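(* Let $\mathfrak{h}_0\in\mathrm{UC}$ and $n\ge 1$, and let $Q=Q(t,x_1,\dots,x_n,r_1,\dots,r_n)$ be the $n\times n$ matrix valued function $Q=\big((\mathbf I-\mathbf K)^{-1}\mathbf K\big)(0,0)$ built from the KPZ fixed point kernel $\mathbf K$ with initial data $\mathfrak h_0$ (all defined in the context), for $t>0$, $x_1<\dots<x_n$ and $r_1,\dots,r_n\in\mathbb R$. Let $\mathcal D_r=\partial_{r_1}+\cdots+\partial_{r_n}$ and $\mathcal D_x=\partial_{x_1}+\cdots+\partial_{x_n}$. Then $Q$ and its derivative $q=\mathcal D_rQ$ solve the matrix Kadomtsev--Petviashvili equation $$\partial_tq+\tfrac12\mathcal D_r(q^2)+\tfrac1{12}\mathcal D_r^3q+\tfrac14\mathcal D_x^2Q+\tfrac12[q,\mathcal D_xQ]=0,\qquad [A,B]=AB-BA .$$ In particular, in the case $n=1$, for the one point distribution function $F(t,x,r)=\mathbb P_{\mathfrak h_0}(\mathfrak h(t,x)\le r)$ of the KPZ fixed point, $\phi=\partial_r^2\log F$ satisfies the scalar KP-II equation $$\partial_t\phi+\tfrac12\partial_r(\phi^2)+\tfrac1{12}\partial_r^3\phi+\tfrac14\partial_r^{-1}\partial_x^2\phi=0,$$ where $\partial_r^{-1}\partial_x^2\phi$ stands for $\partial_x^2\partial_r\log F$.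
   Context: $\mathrm{UC}$ is the set of upper semicontinuous functions $\mathfrak h:\mathbb R\to[-\infty,\infty)$ with $\mathfrak h\not\equiv-\infty$ such that $\mathfrak h(x)\le A+B|x|$ for some $A,B>0$. The KPZ fixed point with initial data $\mathfrak h_0\in\mathrm{UC}$ is the Markov process $\mathfrak h(t,\cdot)$ whose finite dimensional spatial distributions are, for $t>0$, $x_1<\dots<x_n$ and $r_1,\dots,r_n\in\mathbb R$, $$F(t,x_1,\dots,x_n,r_1,\dots,r_n)=\mathbb P_{\mathfrak h_0}\big(\mathfrak h(t,x_1)\le r_1,\dots,\mathfrak h(t,x_n)\le r_n\big)=\det(\mathbf I-\mathbf K),$$ a (non-zero) Fredholm determinant on the $n$-fold direct sum of $L^2(\mathbb R^+)$, where $\mathbf K$ has the $n\times n$ matrix kernel, for $u,v\ge0$, $$\begin{aligned}\mathbf K_{ij}(u,v)=&-e^{(x_j-x_i)\partial^2}(u+r_i,v+r_j)\mathbf 1_{x_i<x_j}\\&+\int p_-(z,ds,db)\,dz\,\mathbf S_{t,-x_i-s}(b,u+r_i)\,\mathbf S_{t,x_j}(z,v+r_j)\\&+\int p_+(z,ds,db)\,dz\,\mathbf S_{t,-x_i}(z,u+r_i)\,\mathbf S_{t,x_j-s}(b,v+r_j)\\&-\int p_-(z,ds_-,db_-)\,p_+(z,ds_+,db_+)\,dz\,\mathbf S_{t,-x_i-s_-}(b_-,u+r_i)\,\mathbf S_{t,x_j-s_+}(b_+,v+r_j),\end{aligned}$$ with integrals over $z\in\mathbb R$, $s,s_\pm\in[0,\infty)$,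 $b,b_\pm\in\mathbb R$. Here: - $e^{a\partial^2}(y,y')=(4\pi a)^{-1/2}e^{-(y-y')^2/(4a)}$ is the heat kernel, $a>0$; - $\mathbf S_{t,x}(z_1,z_2)=\mathbf S_{t,x}(z_1-z_2)$ with $\mathbf S_{t,x}(z)=t^{-1/3}e^{\frac{2x^3}{3t^2}-\frac{zx}{t}}\mathrm{Ai}(-t^{-1/3}z+t^{-4/3}x^2)$, $\mathrm{Ai}$ the Airy function; - with $\mathfrak h_0^{+}(x)=\mathfrak h_0(x)$ and $\mathfrak h_0^-(x)=\mathfrak h_0(-x)$ for $x\ge0$, and $B$ a Brownian motion with diffusion coefficient $2$ (generator $\partial^2$) started at $B(0)=z$, $\tau_{\mathfrak h_0^\pm}=\inf\{s\ge0:B(s)\le\mathfrak h_0^\pm(s)\}$ is the hitting time of the hypograph of $\mathfrak h_0^\pm$, and $p_\pm(z,ds,db)=\mathbb P_z(\tau_{\mathfrak h_0^\pm}\in ds,\,B(\tau_{\mathfrak h_0^\pm})\in db)$. For an operator with matrix kernel $\mathbf A_{ij}(u,v)$, $\mathbf A(0,0)$ denotes the $n\times n$ matrix $(\mathbf A_{ij}(0,0))_{i,j}$ of kernel values at $u=v=0$. For $n=1$ one has $\partial_r\log F=Q$. *)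

(* Defs.v *)
From HB Require Import structures.
From mathcomp Require Import all_boot all_order all_algebra.
From mathcomp Require Import all_classical all_reals all_analysis.
From mathcomp Require Import measurable_realfun.
Set Implicit Arguments.
Unset Strict Implicit.
Unset Printing Implicit Defensive.
Import Order.TTheory GRing.Theory Num.Theory.
Import numFieldNormedType.Exports.

Local Open Scope classical_set_scope.
Local Open Scope ring_scope.

Definition upper_semicontinuous (R : realType) (f : R -> \bar R) : Prop :=
  lower_semicontinuous (fun x => - f x)%E.

Record UC (R : realType) (h : R -> \bar R) : Prop := {
  UC_lt_pinfty : forall x, (h x < +oo)%E;
  UC_usc : upper_semicontinuous h;
  UC_proper : exists x, h x <> -oo%E;
  UC_growth : exists A B : R, [/\ 0 < A, 0 < B &
    forall x, (h x <= (A + B * `|x|)%:E)%E] }.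

(* The integral is only conditionally convergent, hence the explicit limit. *)
Definition airy (R : realType) (x : R) : R :=
  pi^-1 * lim ((fun M : R =>
    \int[lebesgue_measure]_(k in `[0, M]) cos (k ^+ 3 / 3 + x * k)) @ +oo).

Definition heat_kernel (R : realType) (a y y' : R) : R :=
  (4 * pi * a) `^ (- 2^-1) * expR (- (y - y') ^+ 2 / (4 * a)).

Definition kpzS (R : realType) (t x z1 z2 : R) : R :=
  let z := z1 - z2 in
  t `^ (- 3^-1) * expR (2 * x ^+ 3 / (3 * t ^+ 2) - z * x / t) *
  airy (- (t `^ (- 3^-1)) * z + t `^ (- (4 / 3)) * x ^+ 2).

(* Diffusion coefficient 2: the increment over [s, s'] has variance
   2 (s' - s).  The second parameter of normal_prob is a standard deviation.
   The process started at z is z + B. *)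
Record brownian2 (R : realType) (d : measure_display) (W : measurableType d)
    (P : probability W R) (B : R -> W -> R) : Prop := {
  brownian2_measurable : forall s, 0 <= s -> measurable_fun setT (B s);
  brownian2_start : forall w, B 0 w = 0;
  brownian2_continuous :
    forall w, {within `[0, +oo[, continuous (fun s => B s w)};
  brownian2_increments : forall (k : nat) (s : nat -> R) (A : nat -> set R),
    0 <= s 0%N -> (forall i, s i < s i.+1) -> (forall i, measurable (A i)) ->
    P (\bigcap_(i < k) [set w | A i (B (s i.+1) w - B (s i) w)]) =
    (\prod_(i < k) normal_prob 0 (Num.sqrt (2 * (s i.+1 - s i))) (A i))%E }.

Definition hypo_hitting_time (R : realType) (h : R -> \bar R) (b : R -> R)
    : \bar R :=
  ereal_inf [set s%:E | s in [set s | 0 <= s /\ ((b s)%:E <= h s)%E]].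

(* p(z, ds, db), of total mass P_z(tau < oo). *)
Definition hitting_law (R : realType) (d : measure_display)
    (W : measurableType d) (P : probability W R) (B : R -> W -> R)
    (h : R -> \bar R) (z : R) : set (R * R) -> \bar R := fun A =>
  P [set w | let tau := hypo_hitting_time h (fun s => z + B s w) in
             (tau < +oo)%E /\ A (fine tau, z + B (fine tau) w)].

Definition law_integral (R : realType) (p : set (R * R) -> \bar R)
    (g : R -> R -> R) : R :=
  fine (\int[p]_sb (g sb.1 sb.2)%:E)%E.

Definition mxkernel (R : realType) (n : nat) := 'I_n -> 'I_n -> R -> R -> R.

Definition Rplus (R : realType) : set R := `[0, +oo[.

Definition kapply (R : realType) (n : nat) (K : mxkernel R n)
    (f : 'I_n -> R -> R) : 'I_n -> R -> R := fun i u =>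
  \sum_j \int[lebesgue_measure]_(v in @Rplus R) (K i j u v * f j v).

Definition L2plus (R : realType) (n : nat) (f : 'I_n -> R -> R) : Prop :=
  forall i, (f i \_ (@Rplus R)) \in Lfun (@lebesgue_measure R) 2%:E.

Definition aeqplus (R : realType) (n : nat) (f g : 'I_n -> R -> R) : Prop :=
  forall i, ae_eq (@lebesgue_measure R) (@Rplus R) (f i) (g i).

Definition id_sub (R : realType) (n : nat) (K : mxkernel R n)
    (f : 'I_n -> R -> R) : 'I_n -> R -> R := fun i u => f i u - kapply K f i u.

Record id_sub_invertible (R : realType) (n : nat) (K : mxkernel R n) : Prop := {
  id_sub_stable : forall f, L2plus f -> L2plus (id_sub K f);
  id_sub_inj : forall f, L2plus f -> aeqplus (id_sub K f) (fun _ _ => 0) ->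
    aeqplus f (fun _ _ => 0);
  id_sub_surj : forall g, L2plus g ->
    exists2 f, L2plus f & aeqplus (id_sub K f) g }.

(* Rk is the kernel of (I - K)^-1 K: the kernel of an operator on L^2 is only
   determined almost everywhere, and continuity on the closed quadrant selects
   the representative that can be evaluated at (0, 0). *)
Record resolvent_kernel (R : realType) (n : nat) (K Rk : mxkernel R n)
    : Prop := {
  resolvent_invertible : id_sub_invertible K;
  resolvent_continuous : forall i j,
    {within @Rplus R `*` @Rplus R,
      continuous (fun uv : R * R => Rk i j uv.1 uv.2)};
  resolvent_eq : forall f, L2plus f ->
    L2plus (kapply Rk f) /\ aeqplus (id_sub K (kapply Rk f)) (kapply K f) }.

Definition resolvent00 (R : realType) (n : nat) (K : mxkernel R n) : 'M[R]_n :=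
  xget 0 [set M | exists2 Rk, resolvent_kernel K Rk &
                              M = \matrix_(i, j) Rk i j 0 0].

Fixpoint iter_integral (R : realType) (k : nat) (F : seq R -> R) : R :=
  if k is k'.+1 then
    \int[lebesgue_measure]_(u in @Rplus R)
      iter_integral k' (fun s => F (u :: s))
  else F [::].

(* Fredholm's series for det (I - K). The heat kernel entries, strictly above
   the diagonal, are not trace class on L^2(R^+); K is trace class only after a
   conjugation of the form w_i(u) K i j u v / w_j(v), which changes no term of
   this series. *)
Definition fredholm_det (R : realType) (n : nat) (K : mxkernel R n) : R :=
  limn (series (fun k : nat =>
    (-1) ^+ k / (k`!)%:R *
    \sum_(c : {ffun 'I_k -> 'I_n})
      iter_integral k (fun u =>
        \det (\matrix_(a < k, b < k)
                K (c a) (c b) (nth 0 u a) (nth 0 u b))))).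

Definition increasing_row (R : realType) (n : nat) (x : 'rV[R]_n) : Prop :=
  forall i j : 'I_n, (i < j)%N -> x 0 i < x 0 j.

Section kpz.
Context (R : realType) (d : measure_display) (W : measurableType d).
Context (PW : probability W R) (B : R -> W -> R).

Definition kpzK (h0 : R -> \bar R) (n : nat) (t : R) (x r : 'rV[R]_n)
    : mxkernel R n := fun i j u v =>
  let pplus := hitting_law PW B h0 in
  let pminus := hitting_law PW B (fun s => h0 (- s)) in
  let xi := x 0 i in let xj := x 0 j in
  let u' := u + r 0 i in let v' := v + r 0 j in
  - (if xi < xj then heat_kernel (xj - xi) u' v' else 0)
  + \int[lebesgue_measure]_z
      law_integral (pminus z) (fun s b =>
        kpzS t (- xi - s) b u' * kpzS t xj z v')
  + \int[lebesgue_measure]_z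
      law_integral (pplus z) (fun s b =>
        kpzS t (- xi) z u' * kpzS t (xj - s) b v')
  - \int[lebesgue_measure]_z
      law_integral (pminus z) (fun sm bm =>
        law_integral (pplus z) (fun sp bp =>
          kpzS t (- xi - sm) bm u' * kpzS t (xj - sp) bp v')).

Definition kpzF (h0 : R -> \bar R) (n : nat) (t : R) (x r : 'rV[R]_n) : R :=
  fredholm_det (kpzK h0 t x r).

Definition kpzQ (h0 : R -> \bar R) (n : nat) (t : R) (x r : 'rV[R]_n)
    : 'M[R]_n :=
  resolvent00 (kpzK h0 t x r).

Definition history (d' : measure_display) (Om : measurableType d')
    (h : R -> R -> Om -> \bar R) (s : R) : set (set Om) :=
  <<s [set C | exists (u y : R) (A : set (\bar R)),
         [/\ 0 <= u <= s, measurable A & C = h u y @^-1` A]] >>.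

Definition below (d' : measure_display) (Om : measurableType d')
    (h : R -> R -> Om -> \bar R) (n : nat) (t : R) (x r : 'rV[R]_n) : set Om :=
  [set w | forall i, (h t (x 0%R i) w <= (r 0%R i)%:E)%E].

(* The transition probabilities from g over a time t are the laws with
   finite dimensional distributions kpzF g t. *)
Record kpz_fixed_point (d' : measure_display) (Om : measurableType d')
    (P : probability Om R) (h0 : R -> \bar R) (h : R -> R -> Om -> \bar R)
    : Prop := {
  kpz_measurable : forall t x, 0 <= t -> measurable_fun setT (h t x);
  kpz_initial : forall x w, h 0 x w = h0 x;
  kpz_UC : forall t, 0 <= t -> {ae P, forall w, UC (fun x => h t x w)};
  kpz_fdd : forall (n : nat) (t : R) (x r : 'rV[R]_n),
    (0 < n)%N -> 0 < t -> increasing_row x ->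
    P (below h t x r) = (kpzF h0 t x r)%:E;
  kpz_det_neq0 : forall (n : nat) (t : R) (x r : 'rV[R]_n),
    (0 < n)%N -> 0 < t -> increasing_row x -> kpzF h0 t x r != 0;
  kpz_markov : forall (n : nat) (s t : R) (x r : 'rV[R]_n) (E : set Om),
    (0 < n)%N -> 0 <= s < t -> increasing_row x -> history h s E ->
    P (E `&` below h t x r) =
    (\int[P]_(w in E) (kpzF (fun y => h s y w) (t - s) x r)%:E)%E }.

End kpz.

Definition dsum (R : realType) (n : nat) (V : normedModType R)
    (G : 'rV[R]_n -> V) (y : 'rV[R]_n) : V :=
  \sum_i 'D_(delta_mx 0 i) G y.

Definition dsum_exists (R : realType) (n : nat) (V : normedModType R)
    (G : 'rV[R]_n -> V) (y : 'rV[R]_n) : Prop :=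
  forall i, derivable G y (delta_mx 0 i).

Definition commutator (R : realType) (n : nat) (A B : 'M[R]_n) : 'M[R]_n :=
  A *m B - B *m A.

Section matrix_KP.
Context (R : realType) (n : nat).
Context (Q : R -> 'rV[R]_n -> 'rV[R]_n -> 'M[R]_n).

Definition Dr (G : R -> 'rV[R]_n -> 'rV[R]_n -> 'M[R]_n) t x r : 'M[R]_n :=
  dsum (G t x) r.
Definition Dx (G : R -> 'rV[R]_n -> 'rV[R]_n -> 'M[R]_n) t x r : 'M[R]_n :=
  dsum (fun y => G t y r) x.

(* 'D is total, with an arbitrary value where the limit does not exist; the
   existence of the derivatives is therefore part of being a solution. *)
Record matrix_KP_at (t : R) (x r : 'rV[R]_n) : Prop := {
  matrix_KP_derivable_r :
    forall k : nat, (k < 4)%N -> dsum_exists (iter k Dr Q t x) r;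
  matrix_KP_derivable_t : derivable (fun s => Dr Q s x r) t 1;
  matrix_KP_derivable_x :
    forall k : nat, (k < 2)%N -> dsum_exists (fun y => iter k Dx Q t y r) x;
  matrix_KP_eq :
    let q := Dr Q in
    'D_1 (fun s => q s x r) t
    + 2^-1 *: Dr (fun t x r => q t x r *m q t x r) t x r
    + 12^-1 *: Dr (Dr (Dr q)) t x r
    + 4^-1 *: Dx (Dx Q) t x r
    + 2^-1 *: commutator (q t x r) (Dx Q t x r) = 0 }.

End matrix_KP.

Section scalar_KPII.
Context (R : realType) (F : R -> R -> R -> R).

Definition logF t x r : R := ln (F t x r).
Definition phi t x r : R := (logF t x)^`(2)%classic r.

(* The term inv(d_r) d_x^2 phi is d_x^2 d_r log F. *)
Record scalar_KPII_at (t x r : R) : Prop := {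
  scalar_KPII_positive : 0 < F t x r;
  scalar_KPII_derivable_r :
    forall k : nat, (k < 5)%N -> derivable ((logF t x)^`(k)%classic) r 1;
  scalar_KPII_derivable_t : derivable (fun s => phi s x r) t 1;
  scalar_KPII_derivable_x : forall k : nat, (k < 2)%N ->
    derivable ((fun y => (logF t y)^`()%classic r)^`(k)%classic) x 1;
  scalar_KPII_eq :
    (fun s => phi s x r)^`()%classic t
    + 2^-1 * (fun r' => phi t x r' ^+ 2)^`()%classic r
    + 12^-1 * (phi t x)^`(3)%classic r
    + 4^-1 * (fun y => (logF t y)^`()%classic r)^`(2)%classic x = 0 }.

End scalar_KPII.

(* Main.v *)
Require Import Defs.
From HB Require Import structures.
From mathcomp Require Import all_boot all_order all_algebra.
From mathcomp Require Import all_classical all_reals all_analysis.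
From mathcomp Require Import measurable_realfun.
From mathcomp Require Import perm.
From mathcomp Require Import ring lra.
Set Implicit Arguments.
Unset Strict Implicit.
Unset Printing Implicit Defensive.
Import Order.TTheory GRing.Theory Num.Theory.
Import numFieldNormedType.Exports.
Local Open Scope classical_set_scope.
Local Open Scope ring_scope.

(* In S_{t,x}, a derivative in x is a second one in the level, and a derivative
   in t is -1/3 of a third one; the same holds for the heat kernels. Write K_kl
   for the kernel K with k derivatives in its first and l in its second argument,
   and Q_kl = (K_kl + K_k0 (I - K)^-1 K_0l)(0,0). Integration by parts over the
   half-line produces boundary terms at 0, and these factor through the resolvent,
   so that the Q_kl obey a closed hierarchy:
     D_r Q_kl = Q_(k+1)l + Q_k(l+1) - Q_k0 Q_0l,
     D_x Q_kl = Q_k(l+2) - Q_(k+2)l - Q_k1 Q_0l + Q_k0 Q_1l,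
     -3 d_t Q_kl = Q_(k+3)l + Q_k(l+3) - Q_k2 Q_0l + Q_k1 Q_1l - Q_k0 Q_2l.
   As Q = Q_00, the KP equation is an identity between noncommutative polynomials
   in the Q_kl. The analysis behind it consists of contour integrals for S, of
   bounds on exponential moments of Brownian motion up to the hitting time, and of
   Fredholm's theory for kernels conjugated by exponential weights. For n = 1,
   moreover, d_r log F = - tr((I - K)^-1 D_r K) = Q. *)

(** * Real calculus *)

(** The heat kernels do not decay along the diagonal, which bars the matrix kernel from the trace
    class. Multiplying its entries by exponentials whose rates decrease with the row moves the
    problem to a finite measure without changing products, traces or minors. There the elements
    [a Id + f], with [f] bounded, form a ring with a sup norm, in which Fredholm's series, the
    resolvent and Jacobi's formula are elementary. The price comes later: [kpzQ] is defined by
    operators on the unweighted L^2, so the resolvent has to be carried back, with decay off the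
    diagonal and continuity up to the corner.

    All derivatives of the kernel belong to one family [kker] with uniform bounds. Hence along any
    line in [(t, x, r)] the Taylor remainder is quadratic in the sup norm, and such expansions pass
    to products and inverses. Single partial derivatives do not close up on the [Q_kl], because
    their coefficients depend on the row; only their sums over the rows do. The resulting
    derivations run symbolically on noncommutative polynomials, where the equation is decided by
    computation. *)

Section calculus.
Context {R : realType}.
Implicit Types (f g : R -> R) (x a c : R).

Lemma is_deriveD_fun f g x (df dg : R) : is_derive x 1 f df -> is_derive x 1 g dg ->
  is_derive x 1 (fun y => f y + g y) (df + dg).
Proof. by move=> ? ?; exact: is_deriveD. Qed.

Lemma is_deriveB_fun f g x (df dg : R) : is_derive x 1 f df -> is_derive x 1 g dg ->
  is_derive x 1 (fun y => f y - g y) (df - dg).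
Proof. by move=> ? ?; exact: is_deriveB. Qed.

Lemma is_deriveM_fun f g x (df dg : R) : is_derive x 1 f df -> is_derive x 1 g dg ->
  is_derive x 1 (fun y => f y * g y) (df * g x + f x * dg).
Proof.
move=> hf hg; apply: (@is_derive_eq _ _ _ (f * g)) (is_deriveM hf hg) _.
by rewrite [df * _]mulrC addrC; congr (_ + _).
Qed.

Lemma is_deriveZ_fun f x c (df : R) : is_derive x 1 f df ->
  is_derive x 1 (fun y => c * f y) (c * df).
Proof. by move=> hf; exact: (is_deriveZ c hf). Qed.

Lemma is_derive_comp_fun f g x (df dg : R) : is_derive (g x) 1 f df ->
  is_derive x 1 g dg -> is_derive x 1 (fun y => f (g y)) (df * dg).
Proof. by move=> hf hg; exact: is_derive1_comp. Qed.

Lemma is_derive_affine c a x : is_derive x 1 (fun y => c + y * a) a.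
Proof.
have h := is_deriveD_fun (is_derive_cst c x 1) (is_deriveM_fun (is_derive_id x 1) (is_derive_cst a x 1)).
by apply: is_derive_eq h _; rewrite mul1r mulr0 add0r addr0.
Qed.

Lemma is_derive_sum_fun (I : Type) (r : seq I) (h : I -> R -> R) (dh : I -> R) x :
  (forall i, is_derive x 1 (h i) (dh i)) ->
  is_derive x 1 (fun y => \sum_(i <- r) h i y) (\sum_(i <- r) dh i).
Proof.
move=> hh; elim: r => [|i r ih].
  rewrite big_nil (_ : (fun y => _) = cst 0); first exact: is_derive_cst.
  by apply/funext => y; rewrite big_nil.
rewrite big_cons (_ : (fun y => _) = fun y => h i y + \sum_(j <- r) h j y).
  exact: is_deriveD_fun.
by apply/funext => y; rewrite big_cons.
Qed.

Lemma is_derive_continuous_at f x (df : R) : is_derive x 1 f df -> {for x, continuous f}.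
Proof. by move=> [/derivable1_diffP/differentiable_continuous]. Qed.

Lemma is_derive_near f g x (df e : R) : 0 < e ->
  (forall y, `|y - x| < e -> f y = g y) -> is_derive x 1 f df -> is_derive x 1 g df.
Proof.
move=> e0 fg [hf <-].
have nfg : {near x, f =1 g}.
  near=> y; apply: fg; rewrite distrC; near: y.
  by apply/nbhs_ballP; exists e => //= y; rewrite /ball/=.
split; first exact: near_eq_derivable hf.
by rewrite -(near_eq_derive _ nfg).
Unshelve. all: by end_near. Qed.

Lemma lipschitz_derive f (df : R -> R) a (r M : R) :
  (forall x, `|x - a| < r -> is_derive x 1 f (df x) /\ `|df x| <= M) ->
  forall x, `|x - a| < r -> `|f x - f a| <= M * `|x - a|.
Proof.
move=> h x xr; have [->|xa] := eqVneq x a; first by rewrite !subrr normr0 mulr0.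
have main (y z : R) : y < z -> (forall w, y <= w <= z -> `|w - a| < r) ->
    `|f z - f y| <= M * `|z - y|.
  move=> yz hyz.
  have [||c cyz ->] := @MVT _ f df y z yz.
  - by move=> w; rewrite in_itv/= => /andP[yw wz]; have [] := h w (hyz w _);
      rewrite ?(ltW yw) ?(ltW wz).
  - apply: derivable_within_continuous => w; rewrite in_itv/= => wyz.
    by have [[]] := h w (hyz w wyz).
  rewrite normrM ler_wpM2r//; move: cyz; rewrite in_itv/= => /andP[yc cz].
  by have [] := h c (hyz c _); rewrite ?(ltW yc) ?(ltW cz).
case: (ltgtP x a) xa => // [xa _|ax _].
  rewrite distrC [`|x - a|]distrC; apply: main => // w /andP[xw wa].
  rewrite distrC ger0_norm ?subr_ge0//; move: xr; rewrite distrC ger0_norm ?subr_ge0 ?ltW//; lra.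
apply: main => // w /andP[aw wx]; rewrite ger0_norm ?subr_ge0//.
by move: xr; rewrite ger0_norm ?subr_ge0 ?ltW//; lra.
Qed.

(** Two applications of the mean value theorem, the second to [f] minus its linear part. This loses
    the usual factor 1/2, but later only the quadratic order of the remainder matters. *)
Lemma taylor_derive f (df ddf : R -> R) a (r M : R) :
  (forall x, `|x - a| < r -> [/\ is_derive x 1 f (df x), is_derive x 1 df (ddf x)
     & `|ddf x| <= M]) ->
  forall x, `|x - a| < r -> `|f x - f a - (x - a) * df a| <= M * (x - a) ^+ 2.
Proof.
move=> h x xr.
have hd y : `|y - a| < r -> `|df y - df a| <= M * `|y - a|.
  by apply: (@lipschitz_derive df ddf) => z zr; have [] := h z zr.
have M0 : 0 <= M by have [_ _] := h x xr; move=> h3; exact: le_trans (normr_ge0 _) h3.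
pose g y := f y - (y - a) * df a.
have [->|xa] := eqVneq x a; first by rewrite !subrr mul0r expr0n/= mulr0 subrr normr0.
have hg' y : `|y - a| < r -> is_derive y 1 g (df y - df a).
  move=> yr'; have [hf _ _] := h y yr'; rewrite /g; apply: is_deriveB_fun => //.
  have h1 : is_derive y 1 (fun y : R => y - a) 1.
    by have := is_deriveB_fun (is_derive_id y 1) (is_derive_cst a y 1); rewrite subr0.
  by have := is_deriveM_fun h1 (is_derive_cst (df a) y 1); rewrite mulr0 addr0 mul1r.
have main (y z : R) : y < z -> (forall w, y <= w <= z -> `|w - a| <= `|x - a|) ->
    `|g z - g y| <= M * `|x - a| * `|z - y|.
  move=> yz hyz.
  have [||c cyz ->] := @MVT _ g (fun y => df y - df a) y z yz.
  - move=> w; rewrite in_itv/= => /andP[yw wz]; apply: hg'.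
    by apply: le_lt_trans xr; apply: hyz; rewrite ?(ltW yw) ?(ltW wz).
  - apply: derivable_within_continuous => w; rewrite in_itv/= => wyz.
    by have [] := hg' w (le_lt_trans (hyz w wyz) xr).
  rewrite normrM ler_wpM2r//; move: cyz; rewrite in_itv/= => /andP[yc cz].
  have ca : `|c - a| <= `|x - a| by apply: hyz; rewrite ?(ltW yc) ?(ltW cz).
  by apply: le_trans (hd c (le_lt_trans ca xr)) _; rewrite ler_wpM2l.
have -> : f x - f a - (x - a) * df a = g x - g a by rewrite /g subrr mul0r subr0 addrAC.
rewrite -[(x - a) ^+ 2]real_normK ?num_real// expr2 mulrA.
case: (ltgtP x a) xa => // [xa _|ax _].
  rewrite distrC [in leRHS]distrC; apply: (le_trans (main _ _ xa _)) => //.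
    move=> w /andP[xw wa].
    by rewrite !ler0_norm ?subr_le0 ?(ltW xa)//; lra.
  by rewrite distrC.
apply: main => // w /andP[aw wx]; rewrite !ger0_norm ?subr_ge0 ?(ltW ax)//; lra.
Qed.

Lemma is_derive_eps f (df : R) :
  (forall e : R, 0 < e -> exists2 q : R, 0 < q &
    forall s, `|s| < q -> `|f s - f 0 - s * df| <= e * `|s|) ->
  is_derive (0 : R) (1 : R) f df.
Proof.
move=> h; have E : (fun h0 : R => h0^-1 *: (f (h0 *: (1 : R) + 0) - f 0)) @ 0^' --> df.
  apply/cvgrPdist_le => e e0; have [q q0 hq] := h e e0.
  exists q => // s; rewrite /= sub0r normrN => sq s0.
  rewrite [s *: 1]mulr1 addr0 /GRing.scale /=.
  have -> : df - s^-1 * (f s - f 0) = - (s^-1 * (f s - f 0 - s * df)) by field.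
  by rewrite normrN normrM normfV mulrC ler_pdivrMr ?normr_gt0//; exact: hq.
by split; [apply/cvg_ex; exists df|exact/cvg_lim].
Qed.

Lemma is_derive_dist f (df e : R) : is_derive (0 : R) (1 : R) f df -> 0 < e ->
  exists2 q : R, 0 < q & forall s, `|s| < q -> `|f s - f 0 - s * df| <= e * `|s|.
Proof.
move=> [dv <-] e0; have /cvgrPdist_le/(_ e e0)[q q0 hq] := dv.
exists q => // s sq; have [->|s0] := eqVneq s 0.
  by rewrite subrr mul0r subr0 !normr0 mulr0.
have := hq s; rewrite /= sub0r normrN => /(_ sq s0).
rewrite [s *: 1]mulr1 addr0 /GRing.scale /= -/('D_1 f 0); set D := 'D_1 f 0 => h.
have -> : f s - f 0 - s * D = - (s * (D - s^-1 * (f s - f 0))) by field.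
by rewrite normrN normrM mulrC ler_wpM2r.
Qed.

(** One term of the exponential series. It trades the polynomial factors of the contour integrals,
    and the [n ^ n] of Hadamard's bound, for exponentials. *)
Lemma exprn_le_expR (x : R) n : 0 <= x -> x ^+ n <= n`!%:R * expR x.
Proof.
move=> x0; case: n => [|n]; first by rewrite expr0 mul1r -expR0 ler_expR.
have := expR_ge1Dxn n x0; rewrite -ler_pdivrMl ?ltr0n ?fact_gt0// mulrC.
by apply: le_trans; rewrite lerDr.
Qed.

Lemma ler_wpXn2 (x y : R) n : 0 <= x -> x <= y -> x ^+ n <= y ^+ n.
Proof. by move=> x0 xy; rewrite lerXn2r// nnegrE// (le_trans x0). Qed.

End calculus.

Lemma measurable_fun_comp2 d d1 d2 d3 (T : measurableType d) (X : measurableType d1)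
    (Y : measurableType d2) (Z : measurableType d3)
    (f : X -> Y -> Z) (g : T -> X) (h : T -> Y) :
  measurable_fun setT (fun p : X * Y => f p.1 p.2) ->
  measurable_fun setT g -> measurable_fun setT h ->
  measurable_fun setT (fun t => f (g t) (h t)).
Proof.
by move=> mf mg mh; have := measurableT_comp mf (measurable_fun_pair mg mh).
Qed.

(** * Dominated integrals and differentiation under the integral sign *)

Section integrals.
Context d (T : measurableType d) (R : realType) (mu : {measure set T -> \bar R}).
Implicit Types (D : set T) (f g : T -> R).

Lemma integrable_dominated D f g : measurable D -> measurable_fun D f ->
  mu.-integrable D (EFin \o g) -> (forall x, D x -> `|f x| <= g x) ->
  mu.-integrable D (EFin \o f).
Proof.
move=> mD mf ig fg; apply: (le_integrable mD _ _ ig).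
  exact/measurable_EFinP.
by move=> x Dx /=; rewrite lee_fin (le_trans (fg x Dx))// ler_norm.
Qed.

Lemma integrableZ_fun D f (c : R) : measurable D -> mu.-integrable D (EFin \o f) ->
  mu.-integrable D (EFin \o (fun x => c * f x)).
Proof.
by move=> mD jf; rewrite /comp; under eq_fun do rewrite EFinM; exact: integrableZl.
Qed.

Lemma integrableD_fun D f g : measurable D -> mu.-integrable D (EFin \o f) ->
  mu.-integrable D (EFin \o g) -> mu.-integrable D (EFin \o (fun x => f x + g x)).
Proof.
by move=> mD jf jg; rewrite /comp; under eq_fun do rewrite EFinD; exact: integrableD.
Qed.

Lemma integrableB_fun D f g : measurable D -> mu.-integrable D (EFin \o f) ->
  mu.-integrable D (EFin \o g) -> mu.-integrable D (EFin \o (fun x => f x - g x)).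
Proof.
by move=> mD jf jg; rewrite /comp; under eq_fun do rewrite EFinB; exact: integrableB.
Qed.

Lemma normr_Rintegral_le D f g : measurable D -> measurable_fun D f ->
  mu.-integrable D (EFin \o g) -> (forall x, D x -> `|f x| <= g x) ->
  `|\int[mu]_(x in D) f x| <= \int[mu]_(x in D) g x.
Proof.
move=> mD mf ig fg; have jf := integrable_dominated mD mf ig fg.
apply: le_trans (le_normr_Rintegral mD jf) _; apply: le_Rintegral => //.
apply: (@integrable_dominated _ _ g) => //; first exact: measurableT_comp.
by move=> x Dx; rewrite normr_id fg.
Qed.

(** Integrability is asked of [f a] alone: by the mean value theorem [|f x| <= |f a| + r * g], which
    carries it to the whole neighbourhood. *)
Lemma is_derive_Rintegral D (f df : R -> T -> R) (g : T -> R) (a r : R) :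
  measurable D -> 0 < r ->
  (forall x, `|x - a| < r -> measurable_fun D (f x)) ->
  mu.-integrable D (EFin \o f a) ->
  mu.-integrable D (EFin \o g) ->
  (forall x y, `|x - a| < r -> D y -> is_derive x 1 (f ^~ y) (df x y)) ->
  (forall x y, `|x - a| < r -> D y -> `|df x y| <= g y) ->
  is_derive a 1 (fun x => \int[mu]_(y in D) f x y) (\int[mu]_(y in D) df a y).
Proof.
move=> mD r0 mf jfa jg hd dfg.
have xr x : `]a - r, a + r[%classic x -> `|x - a| < r.
  by rewrite /= in_itv/= => /andP[? ?]; rewrite ltr_norml; apply/andP; split; lra.
have aI : `]a - r, a + r[%classic a by rewrite /= in_itv/=; apply/andP; split; lra.
have d1E x y : `|x - a| < r -> D y -> partial1of2 f x y = df x y.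
  by move=> xr' Dy; have [_ <-] := hd x y xr' Dy; rewrite partial1of2E.
have a0 : `|a - a| < r by rewrite subrr normr0.
have jf x : `]a - r, a + r[%classic x -> mu.-integrable D (EFin \o f x).
  move=> /xr xa.
  have jh : mu.-integrable D (EFin \o (fun y => `|f a y| + r * g y)).
    rewrite /comp; under eq_fun do rewrite EFinD EFinM.
    apply: integrableD => //; first exact: (integrable_norm jfa).
    exact: integrableZl.
  apply: (integrable_dominated mD (mf x xa) jh) => y Dy.
  have /= h := @lipschitz_derive _ (f ^~ y) (df ^~ y) a r (g y) _ x xa.
  have {}h : `|f x y - f a y| <= g y * `|x - a|.
    by apply: h => z za; split; [exact: hd|exact: dfg].
  rewrite -lerBlDl (le_trans (lerB_dist _ _))// (le_trans h)// mulrC.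
  by rewrite ler_wpM2r ?(ltW xa)// (le_trans (normr_ge0 _) (dfg a y a0 Dy)).
have df1 x y : `]a - r, a + r[%classic x -> D y -> derivable (f ^~ y) x 1.
  by move=> /xr xa Dy; have [] := hd x y xa Dy.
have jg' : mu.-integrable D (EFin \o (fun y => `|g y|)) by exact: (integrable_norm jg).
have gb x y : `]a - r, a + r[%classic x -> D y -> `|partial1of2 f x y| <= `|g y|.
  by move=> /xr xa Dy; rewrite d1E// (le_trans (dfg x y xa Dy))// ler_norm.
have D1 := derivable_under_integral mD aI jf df1 (fun y => normr_ge0 (g y)) jg' gb.
have D2 := differentiation_under_integral mD aI jf df1 (fun y => normr_ge0 (g y)) jg' gb.
split=> //; rewrite -derive1E D2; apply: eq_Rintegral => y /set_mem Dy.
exact: d1E.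
Qed.

End integrals.

Section exponential_integrals.
Context {R : realType}.
Notation mu := (@lebesgue_measure R).

Let expRN_derive (c x : R) : is_derive x 1 (fun u => - expR (- c * u) / c) (expR (- c * x) * c / c).
Proof.
have h1 : is_derive x 1 (fun u : R => - c * u) (- c).
  by have := is_derive_affine 0 (- c) x; under eq_fun do rewrite add0r mulrC.
have h := is_deriveZ_fun (- c^-1) (is_derive_comp_fun (is_derive_expR (- c * x)) h1).
rewrite (_ : (fun u => _) = (fun y => - c^-1 * expR (- c * y))); last first.
  by apply/funext => u; rewrite !mulNr mulrC.
by apply: is_derive_eq h _; rewrite mulNr mulrN mulrN opprK mulrC.
Qed.

Lemma integral_expRN (c : R) : 0 < c ->
  (\int[mu]_(u in `[0%R, +oo[) (expR (- c * u))%:E = (c^-1)%:E)%E.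
Proof.
move=> c0.
have cF x : {for x, continuous (fun u : R => - expR (- c * u) / c)}.
  exact: is_derive_continuous_at (expRN_derive c x).
rewrite (@ge0_continuous_FTC2y _ _ (fun u => - expR (- c * u) / c) 0 0).
- by rewrite mulr0 expR0 mulNr mul1r -EFinB sub0r opprK.
- by move=> x _; exact: expR_ge0.
- apply: continuous_subspaceT => x.
  apply: continuous_comp; last exact: continuous_expR.
  exact: mulrl_continuous.
- rewrite (_ : (fun u => _) = (fun u => - c^-1 * expR (- c * u))); last first.
    by apply/funext => u; rewrite !mulNr mulrC.
  rewrite -[X in _ --> X](mulr0 (- c^-1)); apply: cvgMr.
  rewrite (_ : (fun x => expR (- c * x)) = (fun x => expR (- (c * x)))); last first.
    by apply/funext => u; rewrite mulNr.
  have h := @cvg_comp _ _ _ (fun x : R => c * x) (fun y : R => expR (- y)) _ _ _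
    (gt0_cvgMry c0 (@cvg_id _ _)) (@cvgr_expR R).
  exact: h.
- by move=> x _; have [] := expRN_derive c x.
- exact/cvg_at_right_filter/cF.
- move=> x _; have [_] := expRN_derive c x; rewrite -derive1E => ->.
  by rewrite mulfK// gt_eqF.
Qed.

Lemma measurable_expRM (c : R) D : measurable_fun D (fun u : R => expR (c * u)).
Proof. by apply: measurableT_comp => //; exact: measurable_funM. Qed.

Lemma integrable_expRN (c : R) : 0 < c ->
  mu.-integrable `[0, +oo[ (EFin \o (fun u => expR (- c * u))).
Proof.
move=> c0; apply/integrableP; split.
  by apply/measurable_EFinP; exact: measurable_expRM.
under eq_integral => u _ do rewrite /= ger0_norm ?expR_ge0//.
by rewrite integral_expRN// ltry.
Qed.

Lemma Rintegral_expRN (c : R) : 0 < c ->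
  \int[mu]_(u in `[0, +oo[) expR (- c * u) = c^-1.
Proof. by move=> c0; rewrite /Rintegral integral_expRN. Qed.

Lemma integrable_expRN_norm (c : R) : 0 < c ->
  mu.-integrable setT (EFin \o (fun u => expR (- c * `|u|))).
Proof.
move=> c0; have mf : measurable_fun setT (fun u : R => expR (- c * `|u|)).
  apply: measurableT_comp => //; apply: measurable_funM => //.
apply/integrableP; split; first exact/measurable_EFinP.
under eq_integral => u _ do rewrite /= ger0_norm ?expR_ge0//.
rewrite ge0_symfun_integralT//.
- rewrite (_ : (\int[mu]_(u in _) _ = \int[mu]_(u in `[0%R, +oo[) (expR (- c * u))%:E)%E).
    by rewrite (integral_expRN c0) -EFinM ltry.
  rewrite (_ : [set x : R | 0 <= x] = `[0, +oo[%classic); last first.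
    by apply/seteqP; split => u /=; rewrite in_itv/= andbT.
  by apply: eq_integral => u; rewrite inE/= in_itv/= andbT => u0; rewrite ger0_norm.
- move=> x; apply: continuous_comp; last exact: continuous_expR.
  apply: continuous_comp; [exact: norm_continuous|exact: mulrl_continuous].
- by move=> u /=; rewrite normrN.
Qed.

End exponential_integrals.

(* A reflexive decision procedure for identities in a noncommutative ring. *)
Inductive nexpr (I : Type) := NVar of I | NZero | NOne | NAdd of nexpr I & nexpr I
  | NOpp of nexpr I | NMul of nexpr I & nexpr I.
Arguments NZero {I}.
Arguments NOne {I}.

Section nring.
Variables (I : eqType) (T : pzRingType) (env : I -> T).

Fixpoint neval (e : nexpr I) : T :=
  match e with
  | NVar n => env n | NZero => 0 | NOne => 1
  | NAdd a b => neval a + neval b | NOpp a => - neval a | NMul a b => neval a * neval b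
  end.

Definition nmono (m : seq I) : T := foldr (fun i acc => env i * acc) 1 m.
Definition nform := seq (seq I * int).
Definition nfeval (l : nform) : T := foldr (fun p acc => nmono p.1 *~ p.2 + acc) 0 l.

Fixpoint ninsert (m : seq I) (c : int) (l : nform) : nform :=
  if l is p :: l' then
    if p.1 == m then (m, p.2 + c) :: l' else p :: ninsert m c l'
  else [:: (m, c)].

Definition nmerge (l1 l2 : nform) := foldr (fun p acc => ninsert p.1 p.2 acc) l2 l1.
Definition nmulmono (m : seq I) (c : int) (l : nform) : nform :=
  map (fun p => (m ++ p.1, c * p.2)) l.
Definition nmulform (l1 l2 : nform) : nform :=
  foldr (fun p acc => nmerge (nmulmono p.1 p.2 l2) acc) [::] l1.

Fixpoint nnorm (e : nexpr I) : nform :=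
  match e with
  | NVar n => [:: ([:: n], 1)] | NZero => [::] | NOne => [:: ([::], 1)]
  | NAdd a b => nmerge (nnorm a) (nnorm b)
  | NOpp a => map (fun p => (p.1, - p.2)) (nnorm a)
  | NMul a b => nmulform (nnorm a) (nnorm b)
  end.

Lemma nfeval_insert m c l : nfeval (ninsert m c l) = nmono m *~ c + nfeval l.
Proof.
elim: l => [|[m' c'] l ih] //=; case: eqP => [->|_] /=.
  by rewrite mulrzDr addrA (addrC (_ *~ c)).
by rewrite ih addrCA.
Qed.

Lemma nfeval_merge l1 l2 : nfeval (nmerge l1 l2) = nfeval l1 + nfeval l2.
Proof.
elim: l1 => [|p l ih] /=; first by rewrite add0r.
by rewrite nfeval_insert ih addrA.
Qed.

Lemma nmono_cat m1 m2 : nmono (m1 ++ m2) = nmono m1 * nmono m2.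
Proof. by elim: m1 => [|i m ih] /=; rewrite ?mul1r// ih mulrA. Qed.

Lemma nfeval_mulmono m c l : nfeval (nmulmono m c l) = (nmono m *~ c) * nfeval l.
Proof.
elim: l => [|p l ih] /=; first by rewrite mulr0.
by rewrite nmono_cat ih mulrDr mulrzA; congr (_ + _); rewrite -mulrzAl -mulrzAr.
Qed.

Lemma nfeval_mulform l1 l2 : nfeval (nmulform l1 l2) = nfeval l1 * nfeval l2.
Proof.
elim: l1 => [|p l ih] /=; first by rewrite mul0r.
by rewrite nfeval_merge ih nfeval_mulmono mulrDl.
Qed.

Lemma nnormE e : nfeval (nnorm e) = neval e.
Proof.
elim: e => [n|||a iha b ihb|a iha|a iha b ihb] //=.
- by rewrite mulr1 addr0.
- by rewrite addr0.
- by rewrite nfeval_merge iha ihb.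
- rewrite -iha; elim: (nnorm a) => [|p l ih] /=; first by rewrite oppr0.
  by rewrite ih mulrNz opprD.
- by rewrite nfeval_mulform iha ihb.
Qed.

(** Monomials that cancel stay in the normal form with coefficient 0, so the test is that every
    coefficient of the difference vanishes. *)
Lemma nring_correct a b :
  all (fun p : seq I * int => p.2 == 0) (nnorm (NAdd a (NOpp b))) -> neval a = neval b.
Proof.
move=> h; apply/eqP; rewrite -subr_eq0 -[neval a - _]/(neval (NAdd a (NOpp b))) -nnormE.
elim: (nnorm _) h => [|p l ih] //= /andP[/eqP -> /ih /eqP ->].
by rewrite mulr0z addr0.
Qed.

End nring.

Ltac nring_find x l :=
  lazymatch l with
  | x :: _ => constr:(O)
  | _ :: ?l' => let n := nring_find x l' in constr:(S n)
  end.
Ltac nring_in x l :=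
  match l with
  | nil => constr:(false)
  | x :: _ => constr:(true)
  | _ :: ?l' => nring_in x l'
  end.
Ltac nring_atoms t l :=
  lazymatch t with
  | (?a + ?b)%R => let l1 := nring_atoms a l in nring_atoms b l1
  | (?a * ?b)%R => let l1 := nring_atoms a l in nring_atoms b l1
  | (- ?a)%R => nring_atoms a l
  | 0%R => l
  | 1%R => l
  | ?x => let b := nring_in x l in
      lazymatch b with true => l | false => constr:(x :: l) end
  end.
Ltac nring_reify t l :=
  lazymatch t with
  | (?a + ?b)%R => let x := nring_reify a l in let y := nring_reify b l in constr:(NAdd x y)
  | (?a * ?b)%R => let x := nring_reify a l in let y := nring_reify b l in constr:(NMul x y)
  | (- ?a)%R => let x := nring_reify a l in constr:(NOpp x)
  | 0%R => constr:(@NZero nat)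
  | 1%R => constr:(@NOne nat)
  | ?x => let n := nring_find x l in constr:(NVar n)
  end.
Ltac nring :=
  lazymatch goal with
  | |- @eq ?T ?a ?b =>
    let l0 := nring_atoms a (@nil T) in
    let l := nring_atoms b l0 in
    let ea := nring_reify a l in
    let eb := nring_reify b l in
    refine (@nring_correct _ _ (nth 0 l) ea eb _); vm_compute; reflexivity
  end.

(** * Contour integrals and the Airy function *)

Section contour.
Context {R : realType}.
Implicit Types (t x y eta xi : R).

(* Real and imaginary parts of [w ^ k exp (- t w^3 / 3 + x w^2 + y w)] at
   [w = eta + i xi]. *)
Definition phase_re t x y eta xi : R :=
  - t * (eta ^+ 3 - 3 * eta * xi ^+ 2) / 3 + x * (eta ^+ 2 - xi ^+ 2) + y * eta.
Definition phase_im t x y eta xi : R :=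
  - t * (3 * eta ^+ 2 * xi - xi ^+ 3) / 3 + 2 * x * eta * xi + y * xi.

Fixpoint cint k t x y eta xi : R * R :=
  if k is k'.+1 then
    let p := cint k' t x y eta xi in (eta * p.1 - xi * p.2, eta * p.2 + xi * p.1)
  else (expR (phase_re t x y eta xi) * cos (phase_im t x y eta xi),
        expR (phase_re t x y eta xi) * sin (phase_im t x y eta xi)).

(** On the vertical line through [eta] the modulus of the integrand is a Gaussian in [xi] of rate
    [x - t * eta]. This is the origin of the condition [0 < x - t * eta] on every abscissa. *)
Lemma phase_re_bound t x y eta xi :
  phase_re t x y eta xi = phase_re t x y eta 0 - (x - t * eta) * xi ^+ 2.
Proof. by rewrite /phase_re; field. Qed.

Lemma cint_bound k t x y eta xi : 0 <= xi ->
  `|(cint k t x y eta xi).1| <= (`|eta| + xi) ^+ k * expR (phase_re t x y eta xi) /\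
  `|(cint k t x y eta xi).2| <= (`|eta| + xi) ^+ k * expR (phase_re t x y eta xi).
Proof.
move=> xi0; elim: k => [|k [h1 h2]] /=.
  rewrite expr0 !mul1r !normrM !(ger0_norm (expR_ge0 _)).
  by rewrite ler_piMr ?expR_ge0 ?cos_max// ler_piMr ?expR_ge0 ?sin_max.
rewrite exprS -mulrA mulrDl; split.
  apply: le_trans (ler_normB _ _) _; rewrite !normrM (ger0_norm xi0).
  by apply: lerD; rewrite ler_wpM2l.
apply: le_trans (ler_normD _ _) _; rewrite !normrM (ger0_norm xi0).
by apply: lerD; rewrite ler_wpM2l.
Qed.

(* [(w ^ k exp (phi w))' = (k w ^ (k - 1) w' + w ^ k phi') exp (phi w)] *)
Lemma is_derive_cint k (t x y eta xi : R -> R) (s dpr dpi de dx : R) :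
  is_derive s 1 (fun u => phase_re (t u) (x u) (y u) (eta u) (xi u)) dpr ->
  is_derive s 1 (fun u => phase_im (t u) (x u) (y u) (eta u) (xi u)) dpi ->
  is_derive s 1 eta de -> is_derive s 1 xi dx ->
  let c j := cint j (t s) (x s) (y s) (eta s) (xi s) in
  is_derive s 1 (fun u => (cint k (t u) (x u) (y u) (eta u) (xi u)).1)
    (k%:R * (de * (c k.-1).1 - dx * (c k.-1).2) + dpr * (c k).1 - dpi * (c k).2) /\
  is_derive s 1 (fun u => (cint k (t u) (x u) (y u) (eta u) (xi u)).2)
    (k%:R * (de * (c k.-1).2 + dx * (c k.-1).1) + dpr * (c k).2 + dpi * (c k).1).
Proof.
move=> hr hi he hx c; elim: k => [|k [ih1 ih2]].
  have he0 := is_derive_comp_fun (is_derive_expR _) hr.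
  have hc := is_derive_comp_fun (is_derive_cos _) hi.
  have hs := is_derive_comp_fun (is_derive_sin _) hi.
  split => /=; [apply: is_derive_eq (is_deriveM_fun he0 hc) _
               |apply: is_derive_eq (is_deriveM_fun he0 hs) _]; ring.
(* The factor [k%:R] vanishes in the only case, [k = 0], in which [k.-1.+1] differs from [k]. *)
have ck : (k%:R * (c k.-1.+1).1 = k%:R * (c k).1 /\ k%:R * (c k.-1.+1).2 = k%:R * (c k).2).
  by case: k {ih1 ih2} => //; rewrite !mul0r.
move: ck; rewrite /= -/(c k.-1) => -[ck1 ck2].
split.
  apply: is_derive_eq (is_deriveB_fun (is_deriveM_fun he ih1) (is_deriveM_fun hx ih2)) _.
  rewrite /= -/(c k) -natr1.
  transitivity (de * (k%:R * (eta s * (c k.-1).1 - xi s * (c k.-1).2)) -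
    dx * (k%:R * (eta s * (c k.-1).2 + xi s * (c k.-1).1)) +
    (de * (c k).1 - dx * (c k).2) + dpr * (eta s * (c k).1 - xi s * (c k).2)
    - dpi * (eta s * (c k).2 + xi s * (c k).1)); first by ring.
  by rewrite ck1 ck2; ring.
apply: is_derive_eq (is_deriveD_fun (is_deriveM_fun he ih2) (is_deriveM_fun hx ih1)) _.
rewrite /= -/(c k) -natr1.
transitivity (de * (k%:R * (eta s * (c k.-1).2 + xi s * (c k.-1).1)) +
    dx * (k%:R * (eta s * (c k.-1).1 - xi s * (c k.-1).2)) +
    (de * (c k).2 + dx * (c k).1) + dpr * (eta s * (c k).2 + xi s * (c k).1)
    + dpi * (eta s * (c k).1 - xi s * (c k).2)); first by ring.
by rewrite ck1 ck2; ring.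
Qed.

Lemma is_derive_cubic (f : R -> R) (s d0 c0 c1 c2 c3 : R) :
  (forall u, f u = c0 + u * c1 + u ^+ 2 * c2 + u ^+ 3 * c3) ->
  d0 = c1 + 2 * s * c2 + 3 * s ^+ 2 * c3 -> is_derive s 1 f d0.
Proof.
move=> fE ->.
have id1 := is_derive_id s (1 : R).
have h2 := is_deriveM_fun id1 id1; have h3 := is_deriveM_fun h2 id1.
have cc c := is_derive_cst (c : R) s (1 : R).
have h := is_deriveD_fun (is_deriveD_fun (is_derive_affine c0 c1 s)
  (is_deriveM_fun h2 (cc c2))) (is_deriveM_fun h3 (cc c3)).
rewrite (_ : f = fun y => c0 + y * c1 + id y * id y * cst c2 y +
  id y * id y * id y * cst c3 y); last first.
  by apply/funext => u; rewrite fE /=; ring.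
by apply: is_derive_eq h _ => /=; ring.
Qed.

(** The phase is linear in [(t, x, y)], so the derivative along a line multiplies the integrand by
    [- a w^3 / 3 + b w^2 + c w], and the index of [cint] counts powers of [w]. This is why a
    derivative in [x] is two derivatives in [y], and one in [t] is -1/3 of three. *)
Lemma is_derive_cint_line k t x y eta xi a b c s :
  let g j := cint j (t + s * a) (x + s * b) (y + s * c) eta xi in
  is_derive s 1 (fun u => (cint k (t + u * a) (x + u * b) (y + u * c) eta xi).1)
    (- a / 3 * (g k.+3).1 + b * (g k.+2).1 + c * (g k.+1).1).
Proof.
move=> g.
have ha : is_derive s 1 (fun u => t + u * a) a by exact: is_derive_affine.
have hb : is_derive s 1 (fun u => x + u * b) b by exact: is_derive_affine.
have hc : is_derive s 1 (fun u => y + u * c) c by exact: is_derive_affine.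
have [||] := @is_derive_cint k (fun u => t + u * a) (fun u => x + u * b)
  (fun u => y + u * c) (cst eta) (cst xi) s (phase_re a b c eta xi)
  (phase_im a b c eta xi) 0 0.
- rewrite /phase_re /=.
  rewrite (_ : (fun u => _) = fun u => phase_re t x y eta xi + u * phase_re a b c eta xi).
    exact: is_derive_affine.
  by apply/funext => u; rewrite /phase_re; ring.
- rewrite (_ : (fun u => _) = fun u => phase_im t x y eta xi + u * phase_im a b c eta xi).
    exact: is_derive_affine.
  by apply/funext => u; rewrite /phase_im /=; ring.
rewrite /= => h _; apply: is_derive_eq h _.
by rewrite /phase_re /phase_im -/(g k); field.
Qed.

(** With [is_derive_cint_xi] this is one of the Cauchy-Riemann equations: both derivatives are the
    real part of [phi' exp phi], where [phi' = - t w^2 + 2 x w + y]. *)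
Lemma is_derive_cint_eta t x y eta xi :
  let g j := cint j t x y eta xi in
  is_derive eta 1 (fun e => (cint 0 t x y e xi).1)
    (- t * (g 2).1 + 2 * x * (g 1).1 + y * (g 0).1).
Proof.
move=> g.
have [||] := @is_derive_cint 0 (cst t) (cst x) (cst y) id (cst xi) eta
  (- t * (eta ^+ 2 - xi ^+ 2) + 2 * x * eta + y)
  (- t * (2 * eta * xi) + 2 * x * xi) 1 0.
- apply: (@is_derive_cubic _ _ _ (- x * xi ^+ 2) (t * xi ^+ 2 + y) (x) (- t / 3)) => [u|]; by rewrite /phase_re /phase_im /=; field.
- apply: (@is_derive_cubic _ _ _ (t * xi ^+ 3 / 3 + y * xi) (2 * x * xi) (- t * xi) (0)) => [u|]; by rewrite /phase_re /phase_im /=; field.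
rewrite /= => h _; apply: is_derive_eq h _.
rewrite /g /=; ring.
Qed.

Lemma is_derive_cint_xi t x y eta xi :
  let g j := cint j t x y eta xi in
  is_derive xi 1 (fun e => (cint 0 t x y eta e).2)
    (- t * (g 2).1 + 2 * x * (g 1).1 + y * (g 0).1).
Proof.
move=> g.
have [||] := @is_derive_cint 0 (cst t) (cst x) (cst y) (cst eta) id xi
  (2 * t * eta * xi - 2 * x * xi)
  (- t * (eta ^+ 2 - xi ^+ 2) + 2 * x * eta + y) 0 1.
- apply: (@is_derive_cubic _ _ _ (- t * eta ^+ 3 / 3 + x * eta ^+ 2 + y * eta) (0) (t * eta - x) (0)) => [u|]; by rewrite /phase_re /phase_im /=; field.
- apply: (@is_derive_cubic _ _ _ (0) (- t * eta ^+ 2 + 2 * x * eta + y) (0) (t / 3)) => [u|]; by rewrite /phase_re /phase_im /=; field.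
rewrite /= => _ h; apply: is_derive_eq h _.
rewrite /g /=; ring.
Qed.

End contour.

Section contour_integral.
Context {R : realType}.
Implicit Types (t x y eta xi : R).
Notation mu := (@lebesgue_measure R).

(** The integral over the upward vertical line through [eta], divided by [2 pi i]: conjugate points
    contribute conjugate values, which leaves a real part over a half-line. *)
Definition contour k t x y eta : R :=
  pi^-1 * \int[mu]_(xi in `[0, +oo[) (cint k t x y eta xi).1.

Lemma measurable_cint d (T : measurableType d) (D : set T) (t x y eta xi : T -> R) k :
  measurable_fun D t -> measurable_fun D x -> measurable_fun D y ->
  measurable_fun D eta -> measurable_fun D xi ->
  measurable_fun D (fun u => (cint k (t u) (x u) (y u) (eta u) (xi u)).1) /\
  measurable_fun D (fun u => (cint k (t u) (x u) (y u) (eta u) (xi u)).2).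
Proof.
move=> mt mx my me mxi; elim: k => [|k [ih1 ih2]] /=.
  have mr : measurable_fun D (fun u => expR (phase_re (t u) (x u) (y u) (eta u) (xi u))).
    apply: measurableT_comp => //; rewrite /phase_re.
    apply: measurable_funD; last exact: measurable_funM.
    apply: measurable_funD; last first.
      by apply: measurable_funM => //; apply: measurable_funB; exact: measurable_funX.
    apply: measurable_funM => //; apply: measurable_funM; first exact: measurable_funN.
    apply: measurable_funB; first exact: measurable_funX.
    by apply: measurable_funM; [exact: measurable_funM|exact: measurable_funX].
  have mi : measurable_fun D (fun u => phase_im (t u) (x u) (y u) (eta u) (xi u)).
    rewrite /phase_im.
    apply: measurable_funD; last exact: measurable_funM.
    apply: measurable_funD; last first.
      by apply: measurable_funM => //; apply: measurable_funM => //; exact: measurable_funM.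
    apply: measurable_funM => //; apply: measurable_funM; first exact: measurable_funN.
    apply: measurable_funB; last exact: measurable_funX.
    apply: measurable_funM => //; apply: measurable_funM => //; exact: measurable_funX.
  have mcos : measurable_fun setT (@cos R) by apply: continuous_measurable_fun; exact: continuous_cos.
  have msin : measurable_fun setT (@sin R) by apply: continuous_measurable_fun; exact: continuous_sin.
  by split; apply: measurable_funM => //; apply: measurableT_comp.
split; first by apply: measurable_funB; exact: measurable_funM.
by apply: measurable_funD; exact: measurable_funM.
Qed.

Lemma measurable_cint_xi D k t x y eta : measurable_fun D (fun xi => (cint k t x y eta xi).1).
Proof. by have [] := @measurable_cint _ _ D (cst t) (cst x) (cst y) (cst eta) id k. Qed.

(** The power of [xi] is absorbed by an exponential, and the Gaussian by [2 xi <= c xi^2 + c^-1].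
    The constant depends on [k] and on the margin [c] only, as domination near a point requires. *)
Lemma cint_dominated k (c : R) : 0 < c -> exists2 C : R, 0 <= C &
  forall t x y eta xi, 0 <= xi -> c <= x - t * eta ->
  `|(cint k t x y eta xi).1| <=
    C * ((1 + `|eta|) ^+ k * expR (phase_re t x y eta 0)) * expR (- 1 * xi).
Proof.
move=> c0; exists (k`!%:R * expR (1 + c^-1)); first by rewrite mulr_ge0 ?expR_ge0.
move=> t x y eta xi xi0 hc; apply: le_trans (cint_bound k t x y eta xi0).1 _.
rewrite phase_re_bound expRD.
have h1 : (`|eta| + xi) ^+ k <= (1 + `|eta|) ^+ k * (k`!%:R * expR (1 + xi)).
  apply: (@le_trans _ _ (((1 + `|eta|) * (1 + xi)) ^+ k)).
    rewrite lerXn2r ?nnegrE ?addr_ge0 ?mulr_ge0 ?addr_ge0//.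
    have : 0 <= `|eta| * xi by rewrite mulr_ge0.
    by have := normr_ge0 eta; lra.
  by rewrite exprMn ler_wpM2l ?exprn_ge0 ?addr_ge0// exprn_le_expR// addr_ge0.
have h2 : expR (1 + xi) * expR (- ((x - t * eta) * xi ^+ 2)) <= expR (1 + c^-1) * expR (- 1 * xi).
  rewrite -!expRD ler_expR.
  have h3 : c * xi ^+ 2 <= (x - t * eta) * xi ^+ 2 by rewrite ler_wpM2r ?sqr_ge0.
  have h4 : 2 * xi <= c * xi ^+ 2 + c^-1.
    rewrite -subr_ge0 (_ : _ - _ = c * (xi - c^-1) ^+ 2); last by field; rewrite gt_eqF.
    by rewrite mulr_ge0 ?sqr_ge0 ?ltW.
  lra.
apply: (@le_trans _ _ ((1 + `|eta|) ^+ k * (k`!%:R * expR (1 + xi)) *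
  (expR (phase_re t x y eta 0) * expR (- ((x - t * eta) * xi ^+ 2))))).
  by rewrite ler_wpM2r// mulr_ge0 ?expR_ge0.
apply: (@le_trans _ _ (((1 + `|eta|) ^+ k * expR (phase_re t x y eta 0) * k`!%:R) *
   (expR (1 + xi) * expR (- ((x - t * eta) * xi ^+ 2))))).
  by rewrite le_eqVlt; apply/orP; left; apply/eqP; ring.
apply: (@le_trans _ _ (((1 + `|eta|) ^+ k * expR (phase_re t x y eta 0) * k`!%:R) *
   (expR (1 + c^-1) * expR (- 1 * xi)))).
  by rewrite ler_wpM2l// !mulr_ge0 ?expR_ge0 ?exprn_ge0 ?addr_ge0.
by rewrite le_eqVlt; apply/orP; left; apply/eqP; ring.
Qed.

Lemma integrable_cint k t x y eta : 0 < x - t * eta ->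
  mu.-integrable `[0, +oo[ (EFin \o (fun xi => (cint k t x y eta xi).1)).
Proof.
move=> h; have [C C0 hC] := cint_dominated k h.
pose g xi := C * ((1 + `|eta|) ^+ k * expR (phase_re t x y eta 0)) * expR (- 1 * xi).
have jg : mu.-integrable `[0, +oo[ (EFin \o g).
  by apply: integrableZ_fun => //; exact: (integrable_expRN ltr01).
apply: (integrable_dominated _ _ jg) => //; first exact: measurable_cint_xi.
by move=> xi /=; rewrite in_itv/= andbT => xi0; exact: hC.
Qed.

Lemma normr_contour k (c : R) : 0 < c -> exists2 C : R, 0 <= C &
  forall t x y eta, c <= x - t * eta ->
  `|contour k t x y eta| <= C * ((1 + `|eta|) ^+ k * expR (phase_re t x y eta 0)).
Proof.
move=> c0; have [C C0 hC] := cint_dominated k c0.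
exists (pi^-1 * C); first by rewrite mulr_ge0// invr_ge0 pi_ge0.
move=> t x y eta hc; rewrite /contour normrM ger0_norm ?invr_ge0 ?pi_ge0//.
rewrite -mulrA ler_wpM2l ?invr_ge0 ?pi_ge0//.
pose g xi := C * ((1 + `|eta|) ^+ k * expR (phase_re t x y eta 0)) * expR (- 1 * xi).
apply: (@le_trans _ _ (\int[mu]_(xi in `[0, +oo[) g xi)).
  apply: normr_Rintegral_le => //; first exact: measurable_cint_xi.
    by apply: integrableZ_fun => //; exact: (integrable_expRN ltr01).
  by move=> xi /=; rewrite in_itv/= andbT => xi0; exact: hC.
rewrite RintegralZl//; last exact: (integrable_expRN ltr01).
by rewrite Rintegral_expRN// invr1 mulr1.
Qed.

Lemma is_derive_contour k t x y eta (a b c : R) : 0 < x - t * eta ->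
  is_derive (0 : R) (1 : R) (fun s => contour k (t + s * a) (x + s * b) (y + s * c) eta)
    (- a / 3 * contour k.+3 t x y eta + b * contour k.+2 t x y eta
     + c * contour k.+1 t x y eta).
Proof.
(* The radius [r] keeps the rate [x - t * eta] above half its value along the segment, with the
   abscissa held fixed. *)
move=> h; pose e := (x - t * eta) / 2; have e0 : 0 < e by rewrite divr_gt0.
pose m : R := `|b - a * eta| + 1; have m0 : 0 < m by rewrite ltr_pwDr.
pose r := e / m; have r0 : 0 < r by rewrite divr_gt0.
have hs s : `|s - 0| < r -> e <= (x + s * b) - (t + s * a) * eta.
  rewrite subr0 => sr.
  have : `|s * (b - a * eta)| <= e.
    rewrite normrM -[e](@mulfVK _ m) ?gt_eqF// -/r.
    by apply: ler_pM => //; [exact: ltW|rewrite /m lerDl].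
  by rewrite ler_norml /e => /andP[? _]; lra.
pose K := expR (phase_re t x y eta 0 + r * `|phase_re a b c eta 0|).
have hK s : `|s - 0| < r ->
    expR (phase_re (t + s * a) (x + s * b) (y + s * c) eta 0) <= K.
  rewrite subr0 => sr; rewrite /K ler_expR.
  rewrite (_ : phase_re _ _ _ _ _ = phase_re t x y eta 0 + s * phase_re a b c eta 0).
    rewrite lerD2l (le_trans (ler_norm _))// normrM ler_wpM2r// ltW//.
  by rewrite /phase_re; ring.
have [C1 C10 hC1] := cint_dominated k.+1 e0.
have [C2 C20 hC2] := cint_dominated k.+2 e0.
have [C3 C30 hC3] := cint_dominated k.+3 e0.
pose A j : R := (1 + `|eta|) ^+ j * K.
have A0 j : 0 <= A j by rewrite mulr_ge0 ?exprn_ge0 ?addr_ge0 ?expR_ge0.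
pose Cg := `|- a / 3| * (C3 * A k.+3) + `|b| * (C2 * A k.+2) + `|c| * (C1 * A k.+1).
pose f s xi := (cint k (t + s * a) (x + s * b) (y + s * c) eta xi).1.
pose df s xi := let g j := cint j (t + s * a) (x + s * b) (y + s * c) eta xi in
  - a / 3 * (g k.+3).1 + b * (g k.+2).1 + c * (g k.+1).1.
have ig : mu.-integrable `[0, +oo[ (EFin \o (fun xi => Cg * expR (- 1 * xi))).
  by apply: integrableZ_fun => //; exact: (integrable_expRN ltr01).
have D : is_derive (0 : R) (1 : R) (fun s => \int[mu]_(xi in `[0, +oo[) f s xi)
    (\int[mu]_(xi in `[0, +oo[) df 0 xi).
  have h0 := @is_derive_Rintegral _ _ R mu `[0, +oo[%classic f df _ 0 r _ r0 _ _ ig.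
  apply: h0 => //.
  - by move=> s _; exact: measurable_cint_xi.
  - by rewrite /f !mul0r !addr0; exact: integrable_cint.
  - by move=> s xi _ _; exact: is_derive_cint_line.
  - move=> s xi sr /=; rewrite in_itv/= andbT => xi0.
    have hj j C : (forall t x y eta xi, 0 <= xi -> e <= x - t * eta ->
       `|(cint j t x y eta xi).1| <=
        C * ((1 + `|eta|) ^+ j * expR (phase_re t x y eta 0)) * expR (- 1 * xi)) -> 0 <= C ->
       `|(cint j (t + s * a) (x + s * b) (y + s * c) eta xi).1| <= C * A j * expR (- 1 * xi).
      move=> hC C0; apply: le_trans (hC _ _ _ _ _ xi0 (hs s sr)) _.
      rewrite ler_wpM2r ?expR_ge0// ler_wpM2l// ler_wpM2l ?exprn_ge0 ?addr_ge0//.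
      exact: hK.
    rewrite /df /Cg 2!mulrDl.
    apply: le_trans (ler_normD _ _) _; apply: lerD; last first.
      by rewrite normrM -mulrA ler_wpM2l// hj.
    apply: le_trans (ler_normD _ _) _; apply: lerD.
      by rewrite normrM -mulrA ler_wpM2l// hj.
    by rewrite normrM -mulrA ler_wpM2l// hj.
have ij j : mu.-integrable `[0, +oo[ (EFin \o (fun xi => (cint j t x y eta xi).1)).
  exact: integrable_cint.
have iz j (v : R) : mu.-integrable `[0, +oo[ (EFin \o (fun xi => v * (cint j t x y eta xi).1)).
  by apply: integrableZ_fun => //; exact: ij.
apply: is_derive_eq (is_deriveZ_fun pi^-1 D) _.
rewrite /df !mul0r !addr0 /contour.
rewrite RintegralD//; last by apply: integrableD_fun => //; exact: iz.
rewrite RintegralD//.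
by rewrite !RintegralZl//; ring.
Qed.

End contour_integral.

Section contour_shift.
Context {R : realType}.
Implicit Types (t x y eta xi M : R).
Notation mu := (@lebesgue_measure R).

Lemma continuous_cint_xi k t x y eta :
  continuous (fun xi => (cint k t x y eta xi).1) /\
  continuous (fun xi => (cint k t x y eta xi).2).
Proof.
elim: k => [|k [ih1 ih2]] /=; last first.
  have ci : continuous (fun xi : R => xi) by move=> z; exact: cvg_id.
  have ce : continuous (fun xi : R => eta) by move=> z; exact: cvg_cst.
  split => z; [apply: cvgB|apply: cvgD]; apply: cvgM.
  - exact: ce.
  - exact: ih1.
  - exact: ci.
  - exact: ih2.
  - exact: ce.
  - exact: ih2.
  - exact: ci.
  - exact: ih1.
have cr : continuous (phase_re t x y eta).
  move=> z; apply: (is_derive_continuous_at (df := 2 * z * (t * eta - x))).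
  apply: (@is_derive_cubic _ _ _ _ (phase_re t x y eta 0) 0 (t * eta - x) 0) => [u|]; last by ring.
  by rewrite /phase_re; field.
have ci : continuous (phase_im t x y eta).
  move=> z; apply: (is_derive_continuous_at
    (df := (- t * eta ^+ 2 + 2 * x * eta + y) + 3 * z ^+ 2 * (t / 3))).
  apply: (@is_derive_cubic _ _ _ _ 0 (- t * eta ^+ 2 + 2 * x * eta + y) 0 (t / 3)) => [u|]; last by ring.
  by rewrite /phase_im; field.
have ce : continuous (fun xi => expR (phase_re t x y eta xi)).
  by move=> z; apply: continuous_comp; [exact: cr|exact: continuous_expR].
have cc : continuous (fun xi => cos (phase_im t x y eta xi)).
  by move=> z; apply: continuous_comp; [exact: ci|exact: continuous_cos].
have cs : continuous (fun xi => sin (phase_im t x y eta xi)).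
  by move=> z; apply: continuous_comp; [exact: ci|exact: continuous_sin].
by split => z; apply: cvgM; [exact: ce|exact: cc|exact: ce|exact: cs].
Qed.

(** Truncation gives a meaning to the abscissa with [x - t * eta = 0], where the integral converges
    only conditionally; the Airy function is defined there. *)
Definition trunc t x y eta M : R := \int[mu]_(xi in `[0, M]) (cint 0 t x y eta xi).1.

Lemma phase_re_le t x y eta xi (E M : R) : `|eta| <= E -> 0 <= xi <= M ->
  phase_re t x y eta xi <=
  `|t| * (E ^+ 3 + 3 * E * M ^+ 2) + `|x| * (E ^+ 2 + M ^+ 2) + `|y| * E.
Proof.
move=> eE /andP[xi0 xiM]; have E0 : 0 <= E by exact: le_trans eE.
have M0 : 0 <= M by exact: le_trans xiM.
have e2 : `|eta| ^+ 2 <= E ^+ 2 by exact: ler_wpXn2.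
have e3 : `|eta| ^+ 3 <= E ^+ 3 by exact: ler_wpXn2.
have m2 : xi ^+ 2 <= M ^+ 2 by exact: ler_wpXn2.
rewrite /phase_re; apply: lerD; last first.
  by apply: le_trans (ler_norm _) _; rewrite normrM ler_wpM2l.
apply: lerD; last first.
  apply: le_trans (ler_norm _) _; rewrite normrM ler_wpM2l//.
  apply: le_trans (ler_normB _ _) _; rewrite !normrX.
  by apply: lerD => //; rewrite ger0_norm.
apply: le_trans (ler_norm _) _; rewrite !normrM normrN -mulrA ler_wpM2l//.
rewrite [`|3^-1|]ger0_norm ?invr_ge0// -[leRHS]mulr1.
apply: ler_pM => //; last by rewrite invf_le1// ler1n.
apply: le_trans (ler_normB _ _) _; rewrite normrX; apply: lerD => //.
rewrite 2!normrM (ger0_norm (sqr_ge0 xi)) (ger0_norm (ler0n R 3)).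
by apply: ler_pM; rewrite ?mulr_ge0 ?sqr_ge0//; rewrite ler_wpM2l.
Qed.

Lemma integrable_cst_itv (a b c : R) : mu.-integrable `[a, b] (EFin \o (fun=> c)).
Proof.
apply: continuous_compact_integrable; first exact: segment_compact.
by apply: continuous_subspaceT => z; exact: cvg_cst.
Qed.

(** Cauchy's theorem on a rectangle, differentiated in the abscissa. The Cauchy-Riemann equation
    turns the integrand into a derivative in [xi]; the lower end contributes nothing, since the
    integrand is real at [xi = 0]. *)
Lemma trunc_derive t x y M eta : 0 < M ->
  is_derive eta 1 (fun e => trunc t x y e M) (cint 0 t x y eta M).2.
Proof.
move=> M0; pose E : R := `|eta| + 1.
pose P := expR (`|t| * (E ^+ 3 + 3 * E * M ^+ 2) + `|x| * (E ^+ 2 + M ^+ 2) + `|y| * E).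
have P0 : 0 <= P by exact: expR_ge0.
have hc j e xi : `|e - eta| < 1 -> 0 <= xi <= M ->
    `|(cint j t x y e xi).1| <= (E + M) ^+ j * P.
  move=> eE /andP[xi0 xiM].
  have eE' : `|e| <= E.
    rewrite -(subrK eta e) (le_trans (ler_normD _ _))// addrC lerD2l; exact: ltW.
  apply: le_trans (cint_bound j t x y e xi0).1 _.
  apply: ler_pM; rewrite ?exprn_ge0 ?addr_ge0 ?expR_ge0//.
    by apply: ler_wpXn2; [rewrite addr_ge0|rewrite lerD].
  by rewrite ler_expR; apply: phase_re_le => //; rewrite xi0.
pose f e xi := (cint 0 t x y e xi).1.
pose df e xi := - t * (cint 2 t x y e xi).1 + 2 * x * (cint 1 t x y e xi).1
  + y * (cint 0 t x y e xi).1.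
pose Cg : R := `|- t| * ((E + M) ^+ 2 * P) + `|2 * x| * ((E + M) ^+ 1 * P) + `|y| * ((E + M) ^+ 0 * P).
have e0 : `|eta - eta| < 1 by rewrite subrr normr0.
have D : is_derive eta 1 (fun e => trunc t x y e M) (\int[mu]_(xi in `[0, M]) df eta xi).
  have h0 := @is_derive_Rintegral _ _ R mu `[0, M]%classic f df _ eta 1 _ ltr01 _ _
    (integrable_cst_itv 0 M Cg).
  apply: h0 => //.
  - by move=> e _; exact: measurable_cint_xi.
  - apply: (integrable_dominated _ _ (integrable_cst_itv 0 M P)) => //; first exact: measurable_cint_xi.
    by move=> xi /=; rewrite in_itv/= => hxi; have := hc 0 eta xi e0 hxi; rewrite expr0 mul1r.
  - by move=> e xi _ _; exact: is_derive_cint_eta.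
  - move=> e xi eE /=; rewrite in_itv/= => hxi; rewrite /df /Cg.
    apply: le_trans (ler_normD _ _) _; apply: lerD; last by rewrite normrM ler_wpM2l// hc.
    apply: le_trans (ler_normD _ _) _; apply: lerD; first by rewrite normrM ler_wpM2l// hc.
    by rewrite normrM ler_wpM2l// hc.
apply: is_derive_eq D _.
have cH z : {for z, continuous (fun xi => (cint 0 t x y eta xi).2)}.
  exact: (continuous_cint_xi 0 t x y eta).2.
rewrite /Rintegral (@continuous_FTC2 _ _ (fun xi => (cint 0 t x y eta xi).2) 0 M)//=.
- have -> : phase_im t x y eta 0 = 0 by rewrite /phase_im; ring.
  by rewrite sin0 mulr0 subr0.
- apply: continuous_subspaceT => z; rewrite /df.
  have cz c k : {for z, continuous (fun xi => c * (cint k t x y eta xi).1)}.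
    by apply: cvgM; [exact: cvg_cst|exact: (continuous_cint_xi k t x y eta).1].
  by apply: cvgD; [apply: cvgD|]; exact: cz.
- split.
  + by move=> z _; have [] := is_derive_cint_xi t x y eta z.
  + exact/cvg_at_right_filter/cH.
  + exact/cvg_at_left_filter/cH.
- move=> z _; have [_] := is_derive_cint_xi t x y eta z.
  by rewrite -derive1E.
Qed.

Lemma expRN_le_inv (v : R) : 0 < v -> expR (- v) <= v^-1.
Proof.
move=> v0; rewrite expRN lef_pV2 ?posrE ?expR_gt0//.
by apply: le_trans (expR_ge1Dx v); rewrite lerDr.
Qed.

(** The upper side of the rectangle has height [M] and an integrand of size
    [expR (- (x - t * eta) * M^2)]. For [0 < t] its integral over the abscissa is of order
    [1 / (t * M^2)], even if the rate vanishes at [eta2]; for [t = 0] the rate is [x] throughout. *)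
Lemma trunc_shift t x y eta1 eta2 : 0 <= t -> eta1 < eta2 -> 0 <= x - t * eta2 ->
  (0 < t) \/ (0 < x) -> exists2 C : R, 0 <= C &
  forall M, 1 <= M -> `|trunc t x y eta2 M - trunc t x y eta1 M| <= C / M.
Proof.
move=> t0 e12 h2 tx; pose E : R := `|eta1| + `|eta2|.
have hE e : eta1 <= e <= eta2 -> `|e| <= E.
  move=> /andP[h1 h3]; rewrite ler_norml; apply/andP; split.
    by apply: le_trans h1; rewrite /E; have := ler_norm (- eta1); rewrite normrN; have := normr_ge0 eta2; lra.
  by apply: le_trans h3 _; rewrite /E; have := ler_norm eta2; have := normr_ge0 eta1; lra.
pose P := expR (`|t| * (E ^+ 3 + 3 * E * 0 ^+ 2) + `|x| * (E ^+ 2 + 0 ^+ 2) + `|y| * E).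
have P0 : 0 <= P by exact: expR_ge0.
have hH e M : 0 <= M -> eta1 <= e <= eta2 ->
    `|(cint 0 t x y e M).2| <= P * expR (- ((x - t * e) * M ^+ 2)).
  move=> M0 he; apply: le_trans (cint_bound 0 t x y e M0).2 _.
  rewrite expr0 mul1r phase_re_bound expRD ler_wpM2r ?expR_ge0// ler_expR.
  by apply: phase_re_le; [exact: hE|rewrite lexx].
(* A mean value inequality against a comparison function [g], so that the bound on the derivative
   may depend on the abscissa instead of being replaced by its supremum. *)
have mono M : 0 < M -> forall g dg : R -> R, (forall e : R, is_derive e (1 : R) g (dg e)) ->
    (forall e, eta1 <= e <= eta2 -> `|(cint 0 t x y e M).2| <= dg e) ->
    `|trunc t x y eta2 M - trunc t x y eta1 M| <= g eta2 - g eta1.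
  move=> M0 g dg hg hdg.
  have main (s : R) : `|s| = 1 -> s * (trunc t x y eta2 M - trunc t x y eta1 M) <= g eta2 - g eta1.
    move=> s1; rewrite -subr_ge0.
    pose F e := g e - s * trunc t x y e M.
    have dF (e : R) : is_derive e (1 : R) F (dg e - s * (cint 0 t x y e M).2).
      by apply: is_deriveB_fun; apply: is_deriveZ_fun; exact: trunc_derive.
    have [|c ce Fc] := @MVT _ F _ eta1 eta2 e12 (fun e _ => dF e).
      by apply: derivable_within_continuous => e _; have [] := dF e.
    have -> : g eta2 - g eta1 - s * (trunc t x y eta2 M - trunc t x y eta1 M) = F eta2 - F eta1.
      by rewrite /F; ring.
    rewrite Fc mulr_ge0 ?subr_ge0 ?(ltW e12)//.
    move: ce; rewrite in_itv/= => /andP[c1 c2].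
    apply: le_trans (ler_norm _) _; rewrite normrM s1 mul1r; apply: hdg.
    by rewrite !ltW.
  rewrite ler_norml; apply/andP; split.
    by have := main (-1); rewrite normrN1 => /(_ erefl); lra.
  by have := main 1; rewrite normr1 => /(_ erefl); lra.
have [t1|t1] := ltP 0 t.
  exists (P / t); first by rewrite divr_ge0.
  move=> M M1; have M0 : 0 < M by exact: lt_le_trans M1.
  have M0' := ltW M0.
  pose g e : R := P * (expR (- ((x - t * e) * M ^+ 2)) / (t * M ^+ 2)).
  have hg (e : R) : is_derive e (1 : R) g (P * expR (- ((x - t * e) * M ^+ 2))).
    have h1 : is_derive e 1 (fun e => - ((x - t * e) * M ^+ 2)) (t * M ^+ 2).
      rewrite (_ : (fun e => _) = fun e => - x * M ^+ 2 + e * (t * M ^+ 2)).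
        exact: is_derive_affine.
      by apply/funext => u; ring.
    have h := is_deriveZ_fun (P / (t * M ^+ 2)) (is_derive_comp_fun (is_derive_expR _) h1).
    rewrite (_ : g = (fun y0 => P / (t * M ^+ 2) * expR (- ((x - t * y0) * M ^+ 2)))).
      apply: is_derive_eq h _; field; rewrite !gt_eqF//.
    by apply/funext => u; rewrite /g; ring.
  apply: le_trans (mono M M0 g _ hg (fun e he => hH e M (ltW M0) he)) _.
  apply: (@le_trans _ _ (g eta2)).
    by rewrite lerBlDr lerDl /g mulr_ge0// divr_ge0 ?expR_ge0// mulr_ge0// sqr_ge0.
  rewrite /g -mulrA ler_wpM2l// -invfM.
  apply: (@le_trans _ _ (1 / (t * M ^+ 2))).
    rewrite ler_wpM2r ?invr_ge0 ?mulr_ge0 ?sqr_ge0//.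
    by rewrite -expR0 ler_expR oppr_le0 mulr_ge0// sqr_ge0.
  rewrite mul1r lef_pV2 ?posrE ?mulr_gt0 ?exprn_gt0// ler_wpM2l//.
  by rewrite expr2 ler_peMl// ltW.
have t00 : t = 0 by apply/eqP; rewrite eq_le t1 t0.
have x0 : 0 < x by case: tx => //; rewrite t00 ltxx.
exists (P / x * (eta2 - eta1)).
  by rewrite mulr_ge0 ?divr_ge0 ?(ltW x0)// subr_ge0 ltW.
move=> M M1; have M0 : 0 < M by exact: lt_le_trans M1.
pose g e : R := 0 + e * (P / x / M).
apply: le_trans (mono M M0 g (fun=> P / x / M) _ _) _.
- by move=> e; exact: is_derive_affine.
- move=> e he; apply: le_trans (hH e M (ltW M0) he) _.
  rewrite -mulrA ler_wpM2l// t00 mul0r subr0 -invfM.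
  apply: le_trans (expRN_le_inv _) _; first by rewrite mulr_gt0// exprn_gt0.
  rewrite lef_pV2 ?posrE ?mulr_gt0 ?exprn_gt0// ler_wpM2l ?(ltW x0)//.
  by rewrite expr2 ler_peMl// ltW.
- by rewrite /g le_eqVlt; apply/orP; left; apply/eqP; ring.
Qed.

Lemma trunc_cvg t x y eta : 0 < x - t * eta -> exists2 C : R, 0 <= C &
  forall M, 1 <= M ->
  `|\int[mu]_(xi in `[0, +oo[) (cint 0 t x y eta xi).1 - trunc t x y eta M| <= C / M.
Proof.
move=> h; have [C0 C00 hC] := cint_dominated 0 h.
pose A := C0 * ((1 + `|eta|) ^+ 0 * expR (phase_re t x y eta 0)).
have A0 : 0 <= A by rewrite mulr_ge0// mulr_ge0 ?expR_ge0 ?exprn_ge0 ?addr_ge0.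
(* One half of [expR (- xi)] is at most [2 / xi <= 2 / M] on the tail, and the other half integrates
   to 2. *)
exists (4 * A); first by rewrite mulr_ge0.
move=> M M1; have M0 : 0 < M by exact: lt_le_trans M1.
have h2 : (0 : R) < 2^-1 by [].
have itvE : `[0, M]%classic = `[0, +oo[%classic `&` `[0, M]%classic :> set R.
  by apply/seteqP; split => z /=; rewrite !in_itv/=; [move=> /andP[-> ->]|move=> []].
rewrite /trunc itvE Rintegral_mkcondr.
have jf := integrable_cint 0 y h.
have jr : mu.-integrable `[0, +oo[ (EFin \o ((fun xi => (cint 0 t x y eta xi).1) \_ `[0, M])).
  apply: (integrable_dominated _ _ (integrable_norm jf)) => //.
    apply/measurable_restrict => //; exact: measurable_cint_xi.
  by move=> xi _; rewrite patchE; case: ifP => _ //=; rewrite normr0.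
rewrite -RintegralB//.
have jg : mu.-integrable `[0, +oo[ (EFin \o (fun u => A * (2 / M) * expR (- 2^-1 * u))).
  by apply: integrableZ_fun => //; exact: integrable_expRN.
apply: le_trans (normr_Rintegral_le _ _ jg _) _ => //.
- apply: measurable_funB; first exact: measurable_cint_xi.
  by apply/measurable_restrict => //; exact: measurable_cint_xi.
- move=> xi /=; rewrite in_itv/= andbT => xi0; rewrite patchE.
  case: ifPn => [_|]; first by rewrite subrr normr0 !mulr_ge0 ?expR_ge0 ?invr_ge0// ltW.
  rewrite notin_setE/= in_itv/= xi0/= => /negP; rewrite -ltNge => Mxi.
  rewrite subr0; apply: le_trans (hC _ _ _ _ _ xi0 (lexx _)) _; rewrite -/A.
  rewrite -mulrA ler_wpM2l//.
  have -> : expR (- 1 * xi) = expR (- (xi / 2)) * expR (- 2^-1 * xi).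
    by rewrite -expRD; congr expR; field.
  rewrite ler_wpM2r ?expR_ge0//; apply: le_trans (expRN_le_inv _) _.
    by rewrite divr_gt0// (lt_trans M0).
  rewrite invf_div; apply: ler_wpM2l => //.
    have X0 : 0 < xi := lt_trans M0 Mxi.
    by rewrite lef_pV2 ?posrE//; exact: ltW.
- rewrite RintegralZl//; last exact: integrable_expRN.
  by rewrite Rintegral_expRN// invrK le_eqVlt; apply/orP; left; apply/eqP; field; rewrite gt_eqF.
Qed.

Lemma eq_of_dist_le_inv (a b C : R) : (forall M, 1 <= M -> `|a - b| <= C / M) -> a = b.
Proof.
move=> h; apply/eqP; rewrite -subr_eq0 -normr_eq0 eq_le normr_ge0 andbT leNgt.
apply/negP => d0; set d := `|a - b| in h d0.
pose M : R := `|C| / d + 1; have M1 : 1 <= M by rewrite lerDr divr_ge0// ltW.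
have := h M M1; rewrite ler_pdivlMr ?(lt_le_trans _ M1)//.
rewrite /M mulrDr mulr1 mulrC divfK ?gt_eqF// => h2.
by have := ler_norm C; lra.
Qed.

(** For [k = 0] both integrals are limits of truncations whose difference is O(1/M). A derivative in
    [y] raises [k] by one, so the equality, known for all [y], is inherited. *)
Lemma contour_shift k t x y eta1 eta2 : 0 <= t -> 0 < x - t * eta1 -> 0 < x - t * eta2 ->
  contour k t x y eta1 = contour k t x y eta2.
Proof.
move=> t0; wlog: eta1 eta2 / eta1 < eta2.
  move=> wh h1 h2; case: (ltgtP eta1 eta2) => [e|e|->//]; first exact: wh.
  by apply/esym; exact: wh.
move=> e12 h1 h2.
have tx : (0 < t) \/ (0 < x).
  have [t1|t1] := ltP 0 t; first by left.
  by right; move: h1; rewrite (_ : t = 0) ?mul0r ?subr0//; apply/eqP; rewrite eq_le t1.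
elim: k y => [|k ih] y.
  rewrite /contour; congr (_ * _).
  have [C1 C10 hC1] := trunc_cvg y h1; have [C2 C20 hC2] := trunc_cvg y h2.
  have [C3 C30 hC3] := trunc_shift y t0 e12 (ltW h2) tx.
  apply: (@eq_of_dist_le_inv _ _ (C1 + C2 + C3)) => M M1.
  rewrite !mulrDl; have := hC1 M M1; have := hC2 M M1; have := hC3 M M1.
  set a := Rintegral _ _ _; set b := Rintegral _ _ _.
  set u := trunc _ _ _ _ _; set v := trunc _ _ _ _ _ => h3 h4 h5.
  have -> : b - a = (b - v) - (a - u) - (u - v) by ring.
  apply: le_trans (ler_normB _ _) _; apply: lerD => //.
  by apply: le_trans (ler_normB _ _) _; apply: lerD.
have d1 := is_derive_contour k y 0 0 1 h1; have d2 := is_derive_contour k y 0 0 1 h2.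
have E : (fun s => contour k (t + s * 0) (x + s * 0) (y + s * 1) eta1) =
  (fun s => contour k (t + s * 0) (x + s * 0) (y + s * 1) eta2).
  by apply/funext => s; rewrite !mulr0 !addr0 ih.
rewrite E in d1; have [_ v1] := d1; have [_ v2] := d2.
by move: v1; rewrite v2 oppr0 !mul0r !add0r !mul1r.
Qed.

End contour_shift.

Section airy_and_heat.
Context {R : realType}.
Implicit Types (t x y eta xi M : R).
Notation mu := (@lebesgue_measure R).

Lemma cvg_of_dist_le_inv (f : R -> R) (l C : R) :
  (forall M, 1 <= M -> `|l - f M| <= C / M) -> f M @[M --> +oo] --> l.
Proof.
move=> h; apply/cvgrPdist_le => e e0; near=> M.
have M1 : 1 <= M by near: M; exact: nbhs_pinfty_ge.
have M0 : 0 < M by exact: lt_le_trans M1.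
apply: le_trans (h M M1) _; rewrite ler_pdivrMr// mulrC -ler_pdivrMr//.
Unshelve. all: by end_near. Qed.

(** Compares the abscissa -1, where the integral converges absolutely, with 0, where the integrand
    is the cosine of the definition of [airy]. *)
Lemma trunc_cvg0 t y : 0 < t -> exists2 C : R, 0 <= C & forall M, 1 <= M ->
  `|pi * contour 0 t 0 y (-1) - trunc t 0 y 0 M| <= C / M.
Proof.
move=> t0; have h1 : 0 < 0 - t * -1 by rewrite mulrN1 opprK add0r.
have h2 : 0 <= 0 - t * 0 :> R by rewrite mulr0 subr0.
have [C1 C10 hC1] := trunc_cvg y h1.
have [C2 C20 hC2] := @trunc_shift _ t 0 y (-1) 0 (ltW t0) (ltrN10 _) h2 (or_introl t0).
exists (C1 + C2); first exact: addr_ge0.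
move=> M M1; rewrite /contour mulrA divff ?gt_eqF ?pi_gt0// mul1r.
rewrite mulrDl; apply: le_trans (lerD (hC1 M M1) (hC2 M M1)).
set a := Rintegral _ _ _.
have -> : a - trunc t 0 y 0 M = (a - trunc t 0 y (-1) M) - (trunc t 0 y 0 M - trunc t 0 y (-1) M).
  by ring.
exact: ler_normB.
Qed.

Lemma airyE y : airy y = contour 0 1 0 y (-1).
Proof.
have [C C0 hC] := trunc_cvg0 y ltr01.
rewrite /airy; have -> : (fun M => \int[mu]_(k in `[0, M]) cos (k ^+ 3 / 3 + y * k)) =
    trunc 1 0 y 0.
  apply/funext => M; apply: eq_Rintegral => xi _ /=.
  have -> : phase_re 1 0 y 0 xi = 0 by rewrite /phase_re; ring.
  by rewrite expR0 mul1r; congr cos; rewrite /phase_im; field.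
have /cvg_lim -> // := cvg_of_dist_le_inv hC.
by rewrite mulrA mulVf ?gt_eqF ?pi_gt0// mul1r.
Qed.

Lemma trunc_scale (c : R) y M : 0 < c -> 0 < M ->
  trunc (c ^+ 3) 0 y 0 M = c^-1 * trunc 1 0 (c^-1 * y) 0 (c * M).
Proof.
move=> c0 M0; pose G v := (cint 0 1 0 (c^-1 * y) 0 v).1.
have dF z : is_derive z (1 : R) (fun z => c * z) c.
  by have := is_derive_affine 0 c z; under eq_fun do rewrite add0r mulrC.
have dE : (fun z : R => c * z)^`()%classic = cst c.
  by apply/funext => z; rewrite derive1E; have [_ ->] := dF z.
have cF z : {for z, continuous (fun z => c * z)} by exact: is_derive_continuous_at (dF z).
have := @integration_by_substitution_increasing R (fun z => c * z) G 0 M (ltW M0).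
rewrite mulr0 dE => h.
have {}h : (\int[mu]_(v in `[0%R, (c * M)%R]) (G v)%:E =
    \int[mu]_(z in `[0%R, M]) ((G (c * z)) * c)%:E)%E.
  apply: h.
  - by move=> u v _ _ uv /=; rewrite ltr_pM2l.
  - by move=> z _; exact: cvg_cst.
  - by apply/cvg_ex; exists c; exact: cvg_cst.
  - by apply/cvg_ex; exists c; exact: cvg_cst.
  - split; first by move=> z _; have [] := dF z.
    + exact/cvg_at_right_filter/cF.
    + exact/cvg_at_left_filter/cF.
  - apply: continuous_subspaceT; exact: (continuous_cint_xi 0 1 0 (c^-1 * y) 0).1.
have -> : trunc 1 0 (c^-1 * y) 0 (c * M) = \int[mu]_(z in `[0, M]) (G (c * z) * c).
  by congr fine; exact: h.
have jG : mu.-integrable `[0, M] (EFin \o (fun z => G (c * z))).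
  apply: continuous_compact_integrable; first exact: segment_compact.
  apply: continuous_subspaceT => z; apply: continuous_comp; first exact: cF.
  exact: (continuous_cint_xi 0 1 0 (c^-1 * y) 0).1.
rewrite RintegralZr// mulrCA mulVf ?gt_eqF// mulr1.
apply: eq_Rintegral => z _; rewrite /G /=; congr (expR _ * cos _).
  by rewrite /phase_re; ring.
by rewrite /phase_im; field; rewrite gt_eqF.
Qed.

Lemma contour_scale (c : R) y : 0 < c -> contour 0 (c ^+ 3) 0 y (-1) = c^-1 * airy (c^-1 * y).
Proof.
move=> c0; rewrite airyE.
have [C1 C10 hC1] := trunc_cvg0 y (exprn_gt0 3 c0).
have [C2 C20 hC2] := trunc_cvg0 (c^-1 * y) ltr01.
apply: (@mulfI _ pi); first by rewrite gt_eqF ?pi_gt0.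
(* [K] makes both truncation levels, [M * K] and [c * (M * K)], at least 1. *)
pose K := 1 + c^-1; have K1 : 1 <= K by rewrite lerDl invr_ge0 ltW.
have K0 : 0 < K by exact: lt_le_trans K1.
have cK : 1 <= c * K by rewrite /K mulrDr mulr1 divff ?gt_eqF// lerDr ltW.
apply: (@eq_of_dist_le_inv _ _ _ (C1 + c^-1 * C2)) => M M1.
have M0 : 0 < M by exact: lt_le_trans M1.
have MK1 : 1 <= M * K by apply: le_trans M1 _; rewrite ler_peMr// ltW.
have cMK1 : 1 <= c * (M * K) by rewrite mulrCA; apply: le_trans M1 _; rewrite ler_peMr// ltW.
have h1 := hC1 _ MK1; have h2 := hC2 _ cMK1.
rewrite trunc_scale ?mulr_gt0// in h1.
have -> : pi * contour 0 (c ^+ 3) 0 y (-1) - pi * (c^-1 * contour 0 1 0 (c^-1 * y) (-1)) =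
  (pi * contour 0 (c ^+ 3) 0 y (-1) - c^-1 * trunc 1 0 (c^-1 * y) 0 (c * (M * K)))
  - c^-1 * (pi * contour 0 1 0 (c^-1 * y) (-1) - trunc 1 0 (c^-1 * y) 0 (c * (M * K))).
  by ring.
apply: le_trans (ler_normB _ _) _; rewrite [leRHS]mulrDl; apply: lerD.
  apply: le_trans h1 _; apply: ler_wpM2l => //; rewrite lef_pV2 ?posrE ?mulr_gt0//.
  by rewrite ler_peMr ?(ltW M0).
rewrite normrM ger0_norm ?invr_ge0 ?(ltW c0)// -mulrA ler_wpM2l ?invr_ge0 ?(ltW c0)//.
apply: le_trans h2 _; rewrite ler_wpM2l// lef_pV2 ?posrE ?mulr_gt0//.
by rewrite mulrCA ler_peMr// ltW.
Qed.

(** The translation of [w] by [x / t] removes the quadratic term of the phase and produces the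
    exponential factor of [kpzS]; the cube root of [t] then rescales the cubic phase to that of the
    Airy function. *)
Lemma kpzSE t x z1 z2 eta : 0 < t -> 0 < x - t * eta ->
  kpzS t x z1 z2 = contour 0 t x (z2 - z1) eta.
Proof.
move=> t0 h; pose y := z2 - z1; rewrite -/y.
pose c := t `^ (3^-1); have c0 : 0 < c by rewrite powR_gt0.
have c3 : c ^+ 3 = t by rewrite -powR_mulrn ?powR_ge0// -powRrM mulVf// powRr1// ltW.
have h0 : 0 < 0 - t * (eta - x / t).
  by rewrite mulrBr mulrCA divff ?gt_eqF// mulr1 sub0r opprB.
have tn0 : t != 0 by rewrite gt_eqF.
pose e := expR (2 * x ^+ 3 / (3 * t ^+ 2) + x * y / t).
have -> : contour 0 t x y eta = e * contour 0 t 0 (y + x ^+ 2 / t) (eta - x / t).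
  rewrite /contour mulrCA; congr (_ * _); rewrite -RintegralZl//; last exact: integrable_cint.
  apply: eq_Rintegral => xi _ /=.
  rewrite /e mulrA -expRD; congr (expR _ * cos _); rewrite /phase_re /phase_im; field; exact: tn0.
rewrite (@contour_shift _ 0 t 0 (y + x ^+ 2 / t) _ (-1))//; last 2 first.
  exact: ltW.
  by rewrite mulrN1 opprK add0r.
rewrite -[in contour _ t]c3 contour_scale// /kpzS.
have -> : t `^ (- 3^-1) = c^-1 by rewrite powRN.
rewrite (_ : z1 - z2 = - y); last by rewrite /y opprB.
rewrite [RHS]mulrCA -[LHS]mulrA; congr (_ * (_ * airy _)).
  by congr expR; field; exact: tn0.
have -> : t `^ (- (4 / 3)) = c^-1 / t.
  rewrite powRN (_ : 4 / 3 = 3^-1 + 1); last by field.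
  by rewrite powRD ?tn0 ?implybT// powRr1 ?(ltW t0)// invfM.
by field; rewrite gt_eqF// gt_eqF.
Qed.

Lemma integral_half_gauss (a : R) : 0 < a ->
  \int[mu]_(xi in `[0, +oo[) expR (- (a * xi ^+ 2)) = Num.sqrt (pi / a) / 2.
Proof.
move=> a0; pose s : R := Num.sqrt (1 / (2 * a)).
have s2 : s ^+ 2 = 1 / (2 * a) by rewrite sqr_sqrtr// divr_ge0 ?mulr_ge0 ?ltW.
have s0 : s != 0 by rewrite gt_eqF// sqrtr_gt0 divr_gt0 ?mulr_gt0.
pose f xi := expR (- (a * xi ^+ 2)).
have cf : continuous f.
  move=> z; apply: continuous_comp; last exact: continuous_expR.
  apply: (is_derive_continuous_at (df := - (2 * z * a))).
  by apply: (@is_derive_cubic _ _ _ _ 0 0 (- a) 0) => [u|]; ring.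
have E : normal_pdf 0 s = fun xi => (Num.sqrt (pi / a))^-1 * f xi.
  apply/funext => xi; rewrite normal_pdfE// /normal_peak /normal_fun s2 subr0 /f.
  congr (_^-1 * expR _); last by rewrite -mulr_natr; field; rewrite gt_eqF.
  by congr Num.sqrt; rewrite -mulr_natr; field; rewrite gt_eqF.
have I1 := @integral_normal_pdf R 0 s.
have p0 : 0 < Num.sqrt (pi / a) by rewrite sqrtr_gt0 divr_gt0 ?pi_gt0.
have If : (\int[mu]_xi (f xi)%:E = (Num.sqrt (pi / a))%:E)%E.
  have : (\int[mu]_xi ((Num.sqrt (pi / a))^-1 * f xi)%:E = 1)%E by have := I1; rewrite E.
  under eq_integral do rewrite EFinM.
  rewrite ge0_integralZl_EFin//.
  - case: (integral _ _ _) => [r| |] //=.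
    + by rewrite -EFinM => -[] h; congr EFin; apply: (mulfI (invr_neq0 (lt0r_neq0 p0))); rewrite h mulVf// gt_eqF.
    + by rewrite mulry gtr0_sg ?invr_gt0// mul1e.
    + by rewrite mulrNy gtr0_sg ?invr_gt0// mul1e.
  - by move=> xi _; rewrite lee_fin expR_ge0.
  - by apply/measurable_EFinP; exact: continuous_measurable_fun.
have Is : (\int[mu]_xi (f xi)%:E = 2%:E * \int[mu]_(xi in `[0%R, +oo[) (f xi)%:E)%E.
  rewrite ge0_symfun_integralT//.
  - by rewrite (_ : [set x : R | 0 <= x] = `[0, +oo[%classic)//; apply/seteqP; split => u /=; rewrite in_itv/= andbT.
  - by move=> xi; exact: expR_ge0.
  - by move=> xi /=; rewrite /f sqrrN.
rewrite If in Is; rewrite /Rintegral -/(f _).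
move: Is; case: (integral _ _ _) => [r| |] //=.
- by rewrite -EFinM => -[] ->; rewrite mulrC mulKf.
- by rewrite mulry gtr0_sg// mul1e.
- by rewrite mulrNy gtr0_sg// mul1e.
Qed.

(** At [t = 0] the phase is quadratic, and on the line through its saddle point [- Y / (2 * a)] the
    integrand is a real Gaussian. The heat kernels thus share the derivative rules of [kpzS]. *)
Lemma heat_kernelE (a y y' : R) eta : 0 < a -> heat_kernel a y y' = contour 0 0 a (y' - y) eta.
Proof.
move=> a0; pose Y := y' - y; rewrite -/Y.
rewrite (@contour_shift _ 0 0 a Y _ (- Y / (2 * a)))//; rewrite ?mul0r ?subr0//.
rewrite /contour (_ : \int[mu]_(_ in _) _ = \int[mu]_(xi in `[0, +oo[)
    (expR (- (Y ^+ 2) / (4 * a)) * expR (- (a * xi ^+ 2)))); last first.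
  apply: eq_Rintegral => xi _ /=.
  have -> : phase_im 0 a Y (- Y / (2 * a)) xi = 0 by rewrite /phase_im; field; rewrite gt_eqF.
  by rewrite cos0 mulr1 -expRD; congr expR; rewrite /phase_re; field; rewrite gt_eqF.
have jf : mu.-integrable `[0, +oo[ (EFin \o (fun xi => expR (- (a * xi ^+ 2)))).
  have /integrable_cint - /(_ 0 0) : 0 < a - 0 * 0 by rewrite mulr0 subr0.
  apply: eq_integrable => // xi _ /=; congr EFin.
  have -> : phase_im 0 a 0 0 xi = 0 by rewrite /phase_im; ring.
  by rewrite cos0 mulr1; congr expR; rewrite /phase_re; ring.
rewrite RintegralZl// integral_half_gauss// /heat_kernel mulrCA [RHS]mulrC; congr (_ * _); last first.
  by rewrite /Y -sqrrN opprB.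
rewrite powRN powR12_sqrt ?mulr_ge0 ?pi_ge0 ?(ltW a0)//.
have p0 := @pi_gt0 R; have a0' := ltW a0; have p0' := ltW p0.
have s0 : 0 < Num.sqrt (4 * pi * a) by rewrite sqrtr_gt0 !mulr_gt0.
apply: (@mulfI _ (Num.sqrt (4 * pi * a))); first by rewrite gt_eqF.
rewrite divff ?gt_eqF// mulrCA (mulrA (Num.sqrt (4 * pi * a))) -sqrtrM ?mulr_ge0//.
rewrite (_ : 4 * pi * a * (pi / a) = (2 * pi) ^+ 2); last by field; rewrite gt_eqF.
have pn : pi != 0 :> R by rewrite gt_eqF.
rewrite sqrtr_sqr ger0_norm; last by rewrite mulr_ge0.
by rewrite (mulrC 2) mulfK ?pnatr_eq0// mulVf.
Qed.

Lemma cubic_bounded (a1 a2 a3 : R) : 0 <= a1 -> 0 <= a2 -> 0 < a3 ->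
  exists K : R, forall m : R, 0 <= m -> a1 * m + a2 * m ^+ 2 - a3 * m ^+ 3 <= K.
Proof.
move=> a10 a20 a30; pose M := (a1 + a2) / a3 + 1.
have M1 : 1 <= M by rewrite lerDr divr_ge0 ?addr_ge0// ltW.
have M0 : 0 <= M by lra.
exists (a1 * M + a2 * M ^+ 2) => m m0; have [mM|Mm] := leP m M.
  have h1 : a1 * m <= a1 * M by rewrite ler_wpM2l.
  have h2 : a2 * m ^+ 2 <= a2 * M ^+ 2 by rewrite ler_wpM2l// ler_wpXn2.
  have h3 : 0 <= a3 * m ^+ 3 by rewrite mulr_ge0 ?exprn_ge0// ltW.
  lra.
have m1 : 1 <= m by lra.
have h0 : 0 <= a1 * M + a2 * M ^+ 2 by rewrite addr_ge0 ?mulr_ge0 ?exprn_ge0.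
have h1 : a1 * m <= a1 * m ^+ 2 by rewrite ler_wpM2l// expr2 ler_peMr.
have h2 : (a1 + a2) * m ^+ 2 <= a3 * m * m ^+ 2.
  rewrite ler_wpM2r ?sqr_ge0// mulrC -ler_pdivrMr//.
  by apply: ltW; apply: le_lt_trans Mm; rewrite /M lerDl.
have h3 : a3 * m * m ^+ 2 = a3 * m ^+ 3 by ring.
by rewrite h3 mulrDl in h2; lra.
Qed.

(* The contour through [- (m + s / t)] makes the cubic term of the phase
   dominate the growth [s (A + B s) / t] allowed by a hypograph below [A + B s]. *)
Lemma contour_hypo_bound (A B t1 t2 X c lam m : R) k : 0 < t1 -> 0 <= t2 -> 0 <= A -> 0 <= B ->
  0 <= X -> 0 <= c -> (1 + X) / t1 <= m ->
  exists2 C : R, 0 <= C & forall t x s p b eta, t1 <= t <= t2 -> `|x| <= X -> 0 <= s ->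
    s * b <= s * (A + B * s) -> - c <= p -> 0 < (- x - s) - t * eta ->
    `|contour k t (- x - s) (p - b) eta| <= C * expR (m * (b - p) - lam * s).
Proof.
move=> t10 t20 A0 B0 X0 c0 hm.
have m0 : 0 <= m by apply: le_trans hm; rewrite divr_ge0 ?addr_ge0// ltW.
have [C1 C10 hC1] := @normr_contour R k 1 ltr01.
have [||| K hK] := @cubic_bounded (k%:R + A + c + `|lam| * t2) (t2 * m + X + B * t2) (2 / 3 * t1).
- by rewrite !addr_ge0// mulr_ge0.
- by rewrite !addr_ge0// mulr_ge0.
- by rewrite mulr_gt0.
exists (C1 * expR K); first by rewrite mulr_ge0 ?expR_ge0.
move=> t x s p b eta /andP[tt1 tt2] xX s0 sb cp h.
have t0 : 0 < t by exact: lt_le_trans tt1.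
have xX' : x <= X by exact: le_trans (ler_norm _) xX.
have xX2 : - x <= X by rewrite -(normrN x) in xX; exact: le_trans (ler_norm _) xX.
have tn0 : t != 0 by rewrite gt_eqF.
pose n := m + s / t.
have st0 : 0 <= s / t by rewrite divr_ge0// ltW.
have n0 : 0 <= n by rewrite addr_ge0.
have nm : m <= n by rewrite lerDl.
have hn : 1 <= (- x - s) - t * (- n).
  rewrite mulrN opprK /n mulrDr (mulrCA t s) divff// mulr1.
  have : t1 * m <= t * m by rewrite ler_wpM2r.
  have : 1 + X <= t1 * m by rewrite mulrC -ler_pdivrMr.
  lra.
rewrite (@contour_shift _ k t _ _ _ (- n))//; [|exact: ltW|exact: lt_le_trans hn].
apply: le_trans (hC1 _ _ _ _ hn) _; rewrite -mulrA ler_wpM2l// -expRD.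
have -> : `|- n| = n by rewrite normrN ger0_norm.
apply: (@le_trans _ _ (expR (k%:R * n + phase_re t (- x - s) (p - b) (- n) 0))).
  rewrite (expRD (k%:R * n)); apply: ler_wpM2r; first exact: expR_ge0.
  rewrite mulrC expRM_natr.
  by apply: ler_wpXn2; [rewrite addr_ge0|exact: expR_ge1Dx].
rewrite ler_expR -lerBlDr; apply: le_trans (hK n n0).
(* Substituted in the quadratic term [- s * n ^+ 2], this turns the cubic coefficient [t / 3] into
   [- 2 / 3 * t], which gives the decay used in [cubic_bounded]. *)
have sE : s = t * (n - m) by rewrite /n; field.
have e1 : phase_re t (- x - s) (p - b) (- n) 0 - m * (b - p) =
    - (2 / 3) * t * n ^+ 3 + t * m * n ^+ 2 - x * n ^+ 2 + (s * b - s * p) / t.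
  by rewrite /phase_re {1}sE /n; field.
have f1 : t1 * n ^+ 3 <= t * n ^+ 3 by rewrite ler_wpM2r ?exprn_ge0.
have f2 : t * m * n ^+ 2 <= t2 * m * n ^+ 2 by rewrite ler_wpM2r ?sqr_ge0// ler_wpM2r.
have f3 : - x * n ^+ 2 <= X * n ^+ 2 by rewrite ler_wpM2r ?sqr_ge0.
have f4 : (s * b - s * p) / t <= (A + c) * n + B * t2 * n ^+ 2.
  have g1 : s * b - s * p <= s * (A + B * s) + s * c.
    by have : s * (- p) <= s * c by [rewrite ler_wpM2l// lerNl]; rewrite mulrN; lra.
  apply: (@le_trans _ _ ((s * (A + B * s) + s * c) / t)).
    by rewrite ler_wpM2r// invr_ge0 ltW.
  have -> : (s * (A + B * s) + s * c) / t = (A + c) * (n - m) + B * t * (n - m) ^+ 2.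
    by rewrite {1 2 3}sE; field.
  have nm0 : 0 <= n - m by rewrite subr_ge0.
  have nmn : n - m <= n by rewrite lerBlDr lerDl.
  apply: lerD; first by rewrite ler_wpM2l// addr_ge0.
  apply: ler_pM; rewrite ?mulr_ge0 ?sqr_ge0 ?(ltW t0)//; first by rewrite ler_wpM2l.
  exact: ler_wpXn2.
have f5 : lam * s <= `|lam| * t2 * n.
  apply: (@le_trans _ _ (`|lam| * s)); first by rewrite ler_wpM2r// ler_norm.
  rewrite -mulrA ler_wpM2l// sE; apply: ler_pM; rewrite ?(ltW t0) ?subr_ge0//.
  by rewrite lerBlDr lerDl.
have -> : k%:R * n + phase_re t (- x - s) (p - b) (- n) 0 - (m * (b - p) - lam * s) =
   k%:R * n + (phase_re t (- x - s) (p - b) (- n) 0 - m * (b - p)) + lam * s by ring.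
rewrite e1; lra.
Qed.

End airy_and_heat.

(** * Fredholm determinants for an abstract integral *)

Section hadamard.
Context {R : realType}.

(** The reflection in the hyperplane orthogonal to [a - c e_0], with [c] the length of [a]; when
    this vector is 0, the identity serves. *)
Lemma householder n (a : 'cV[R]_n.+1) :
  exists H : 'M[R]_n.+1, [/\ H^T *m H = 1%:M, (\det H) ^+ 2 = 1 &
    exists c : R, H *m a = c *: delta_mx ord0 ord0 /\ c ^+ 2 = \sum_i (a i ord0) ^+ 2].
Proof.
pose c : R := Num.sqrt (\sum_i (a i ord0) ^+ 2).
have s0 : 0 <= \sum_i (a i ord0) ^+ 2 by apply: sumr_ge0 => i _; exact: sqr_ge0.
have c2 : c ^+ 2 = \sum_i (a i ord0) ^+ 2 by rewrite /c sqr_sqrtr.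
pose v : 'cV[R]_n.+1 := a - c *: delta_mx ord0 ord0.
pose N := \sum_i (v i ord0) ^+ 2.
have vtv : v^T *m v = N%:M.
  apply/matrixP => i j; rewrite !ord1 !mxE eqxx mulr1n; apply: eq_bigr => k _.
  by rewrite !mxE expr2.
have detT (H : 'M[R]_n.+1) : H^T *m H = 1%:M -> (\det H) ^+ 2 = 1.
  by move=> /(congr1 determinant); rewrite det_mulmx det_tr det1 expr2.
have [N0|N0] := eqVneq N 0.
  exists 1%:M; split; [by rewrite trmx1 mulmx1|by rewrite det1 expr1n|].
  exists c; split=> //; rewrite mul1mx; apply/eqP; rewrite -subr_eq0 -/v; apply/eqP.
  apply/colP => i; rewrite [RHS]mxE; apply/eqP; rewrite -sqrf_eq0; apply/eqP.
  by apply: (@psumr_eq0P _ _ xpredT (fun k => v k ord0 ^+ 2)) => // k _; exact: sqr_ge0.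
pose H : 'M[R]_n.+1 := 1%:M - (2 / N) *: (v *m v^T).
have HT : H^T = H.
  by rewrite /H linearB /= linearZ /= trmx1 trmx_mul trmxK.
have HH : H^T *m H = 1%:M.
  rewrite HT /H mulmxBl !mulmxBr !mul1mx mulmx1 -scalemxAl -scalemxAr scalerA.
  rewrite mulmxA -(mulmxA v) vtv mul_mx_scalar -scalemxAl scalerA.
  rewrite (_ : 2 / N * (2 / N) * N = 2 / N + 2 / N); last by field.
  by rewrite scalerDl opprB addrK subrK.
exists H; split => //; first exact: detT.
exists c; split => //.
have av : v^T *m a = (N / 2)%:M.
  apply/matrixP => i j; rewrite !ord1 !mxE eqxx mulr1n.
  have -> : \sum_k v^T ord0 k * a k ord0 = \sum_k (a k ord0 ^+ 2 - c * (a k ord0 * (k == ord0)%:R)).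
    by apply: eq_bigr => k _; rewrite !mxE eqxx andbT expr2; ring.
  rewrite /N (_ : \sum_i (v i ord0) ^+ 2 = \sum_i (a i ord0 ^+ 2
    - 2 * c * (a i ord0 * (i == ord0)%:R) + c ^+ 2 * (i == ord0)%:R)); last first.
    apply: eq_bigr => k _; rewrite !mxE eqxx andbT; case: (k == ord0) => /=; ring.
  have e0 (f : 'I_n.+1 -> R) : \sum_k f k * (k == ord0)%:R = f ord0.
    rewrite (bigD1 ord0)//= mulr1 big1 ?addr0// => k /negPf ->.
    by rewrite mulr0.
  rewrite big_split /= !big_split /= !sumrN -!mulr_sumr !e0.
  have -> : \sum_i (i == ord0 :> 'I_n.+1)%:R = 1 :> R.
    by have := e0 (fun=> 1); under eq_bigr do rewrite mul1r.
  by rewrite c2; field.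
rewrite /H mulmxBl mul1mx -scalemxAl -mulmxA av mul_mx_scalar scalerA.
rewrite (_ : 2 / N * (N / 2) = 1); last by field.
by rewrite scale1r /v opprB addrC subrK.
Qed.

(** A reflection sends the first column to a multiple of the first basis vector and preserves the
    norms of all columns; expanding along that column leaves a cofactor whose columns are shorter.
    Squares hide the sign of the determinant of the reflection. *)
Lemma hadamard n (A : 'M[R]_n) (b : 'I_n -> R) :
  (forall j, \sum_i (A i j) ^+ 2 <= b j) -> (\det A) ^+ 2 <= \prod_j b j.
Proof.
elim: n A b => [|n ih] A b hb; first by rewrite det_mx00 expr1n big_ord0.
have [H [HH dH [c [Ha c2]]]] := householder (col ord0 A).
pose A' := H *m A.
have -> : (\det A) ^+ 2 = (\det A') ^+ 2 by rewrite det_mulmx exprMn dH mul1r.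
have cA' j : \sum_i (A' i j) ^+ 2 = \sum_i (A i j) ^+ 2.
  have E (M : 'M[R]_n.+1) : \sum_i (M i j) ^+ 2 = (M^T *m M) j j.
    by rewrite mxE; apply: eq_bigr => i _; rewrite mxE expr2.
  by rewrite !E trmx_mul mulmxA -(mulmxA A^T) HH mulmx1.
have A'0 i : A' i ord0 = c * (i == ord0)%:R.
  have : col ord0 A' = c *: delta_mx ord0 ord0 by rewrite -Ha !colE mulmxA.
  by move/colP => /(_ i); rewrite !mxE eqxx andbT.
rewrite (expand_det_col A' ord0) (bigD1 ord0)//= big1 ?addr0; last first.
  by move=> i /negPf i0; rewrite A'0 i0 mulr0 mul0r.
rewrite A'0 eqxx mulr1 exprMn /cofactor addn0 expr0 mul1r c2 [leRHS]big_ord_recl.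
apply: ler_pM; [by apply: sumr_ge0 => i _; exact: sqr_ge0|exact: sqr_ge0| |].
  by apply: le_trans (hb ord0); under eq_bigr do rewrite mxE.
apply: ih => j; apply: le_trans (hb (lift ord0 j)).
rewrite -cA' [leRHS]big_ord_recl; under eq_bigr do rewrite 2!mxE.
by rewrite lerDr sqr_ge0.
Qed.

Lemma det_bound n (A : 'M[R]_n) (M : R) : (forall i j, `|A i j| <= M) ->
  (\det A) ^+ 2 <= (n%:R * M ^+ 2) ^+ n.
Proof.
move=> hM; apply: le_trans (@hadamard _ A (fun=> n%:R * M ^+ 2) _) _; last first.
  by rewrite prodr_const card_ord.
move=> j; apply: (@le_trans _ _ (\sum_(i < n) M ^+ 2)).
  apply: ler_sum => i _; rewrite -real_normK ?num_real//.
  by rewrite lerXn2r ?nnegrE// (le_trans _ (hM i j)).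
by rewrite sumr_const card_ord mulr_natl.
Qed.

(* [n ^ n <= e ^ n n!] and [b ^ n <= e ^ b n!] turn Hadamard's bound into a
   geometric one. *)
Lemma hadamard_geometric (M q : R) : 0 <= M -> 0 < q -> exists2 C : R, 0 <= C &
  forall n, Num.sqrt ((n%:R * M ^+ 2) ^+ n) / n`!%:R <= C * q ^+ n.
Proof.
move=> M0 q0; pose b := expR 1 * M ^+ 2 / q ^+ 2.
have b0 : 0 <= b by apply: divr_ge0; [apply: mulr_ge0; [exact: expR_ge0|exact: sqr_ge0]|exact: sqr_ge0].
exists (Num.sqrt (expR b)); first exact: sqrtr_ge0.
move=> n; have f0 : 0 < n`!%:R :> R by rewrite ltr0n fact_gt0.
rewrite ler_pdivrMr//.
rewrite -[q ^+ n]ger0_norm ?exprn_ge0 ?(ltW q0)// -[n`!%:R]ger0_norm ?(ltW f0)//.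
rewrite -!sqrtr_sqr -!sqrtrM ?expR_ge0 ?mulr_ge0 ?sqr_ge0 ?expR_ge0//.
apply: ler_wsqrtr.
have h1 : n%:R ^+ n <= n`!%:R * expR n%:R :> R by exact: exprn_le_expR.
have h2 : b ^+ n <= n`!%:R * expR b by exact: exprn_le_expR.
have E : (n%:R * M ^+ 2) ^+ n = n%:R ^+ n * (M ^+ 2) ^+ n by rewrite exprMn.
have E2 : expR n%:R * (M ^+ 2) ^+ n = b ^+ n * (q ^+ n) ^+ 2.
  rewrite -[in LHS](mulr_natr 1) mul1r -[n%:R in LHS]mulr1 expRM_natl -!exprMn exprAC -exprMn.
  by congr (_ ^+ _); rewrite /b mulfVK// sqrf_eq0 gt_eqF.
rewrite E; apply: le_trans (ler_wpM2r _ h1) _; first by rewrite exprn_ge0 ?sqr_ge0.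
rewrite -(mulrA n`!%:R) E2.
apply: (@le_trans _ _ (n`!%:R * (n`!%:R * expR b * (q ^+ n) ^+ 2))).
  by rewrite ler_wpM2l ?(ltW f0)// ler_wpM2r ?sqr_ge0.
by rewrite le_eqVlt; apply/orP; left; apply/eqP; ring.
all: by rewrite exprn_ge0 ?(ltW q0).
Qed.

End hadamard.

Section mean.
Context {R : realType}.

Definition bmeas d (X : measurableType d) (f : X -> R) : Prop :=
  measurable_fun setT f /\ exists C, forall x, `|f x| <= C.

(* The properties of integration against a finite measure that Fredholm's
   theory uses, for bounded measurable integrands. *)
Record mean d (X : measurableType d) := Mean {
  mean_fun :> (X -> R) -> R;
  mass : R;
  mass_ge0 : 0 <= mass;
  mean_linear : forall a f g, bmeas f -> bmeas g ->
    mean_fun (fun x => a * f x + g x) = a * mean_fun f + mean_fun g;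
  mean_bound : forall f C, bmeas f -> (forall x, `|f x| <= C) ->
    `|mean_fun f| <= mass * C;
  mean_measurable : forall d' (T : measurableType d') (f : T * X -> R), bmeas f ->
    measurable_fun setT (fun t => mean_fun (fun x => f (t, x)));
  mean_swap : forall f : X * X -> R, bmeas f ->
    mean_fun (fun x => mean_fun (fun y => f (x, y))) =
    mean_fun (fun y => mean_fun (fun x => f (x, y))) }.

Section nest.
Context d (X : measurableType d) (J : mean X).

Fixpoint nest k (F : seq X -> R) : R :=
  if k is k'.+1 then J (fun x => nest k' (fun s => F (x :: s))) else F [::].

(** Joint measurability in the parameter and the first [k] entries of a list, expressed by moving
    these entries one at a time into the parameter space; no sigma-algebra on lists is involved. *)
Fixpoint pmeas k d' (T : measurableType d') d'' (Y : measurableType d'')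
    (F : T -> seq X -> Y) : Prop :=
  if k is k'.+1 then pmeas k' (fun (p : T * X) s => F p.1 (p.2 :: s))
  else measurable_fun setT (fun t => F t [::]).

Lemma pmeas_comp k d1 (T1 : measurableType d1) d2 (T2 : measurableType d2)
    d'' (Y : measurableType d'') (F : T2 -> seq X -> Y) (phi : T1 -> T2) :
  measurable_fun setT phi -> pmeas k F -> pmeas k (fun t => F (phi t)).
Proof.
elim: k d1 T1 d2 T2 F phi => [|k ih] d1 T1 d2 T2 F phi mphi /=.
  by move=> mF; exact: (measurableT_comp mF).
move=> mF; apply: (ih _ _ _ _ _ (fun p : T1 * X => (phi p.1, p.2)) _ mF).
by apply: measurable_fun_pair => //; exact: measurableT_comp.
Qed.

Lemma pmeas_cst k d' (T : measurableType d') d'' (Y : measurableType d'') (f : T -> Y) :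
  measurable_fun setT f -> pmeas k (fun t (s : seq X) => f t).
Proof.
elim: k d' T f => [|k ih] d' T f mf //=.
by apply: (ih _ _ (fun p : T * X => f p.1)); exact: measurableT_comp.
Qed.

(** The entries already moved into the parameter are kept as a list [es] of measurable functions of
    it, which is what the induction generalises over. *)
Lemma pmeas_nth_cat k d' (T : measurableType d') (es : seq (T -> X)) i :
  (forall j, measurable_fun setT (nth (cst point) es j)) ->
  pmeas k (fun t s => nth point (map (@^~ t) es ++ s) i).
Proof.
elim: k d' T es => [|k ih] d' T es mes /=.
  rewrite (_ : (fun t => _) = nth (cst point) es i) //.
  apply/funext => t; rewrite cats0; have [h|h] := ltnP i (size es).
    by rewrite (nth_map (cst point)).
  by rewrite !nth_default ?size_map.
have E (p : T * X) s : [seq f p | f <- rcons [seq (fun p : T * X => f p.1) | f <- es] snd] ++ s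
    = [seq f p.1 | f <- es] ++ p.2 :: s.
  by rewrite map_rcons cat_rcons -map_comp.
have := ih _ (T * X)%type (rcons (map (fun f p => f p.1) es) snd).
have -> : (fun (p : T * X) s => nth point ([seq f p |
    f <- rcons [seq (fun p : T * X => f p.1) | f <- es] snd] ++ s) i) =
    (fun p s => nth point ([seq f p.1 | f <- es] ++ p.2 :: s) i).
  by apply/funext => p; apply/funext => s; rewrite E.
apply => j; rewrite nth_rcons size_map; case: ltnP => h.
  rewrite (nth_map (cst point))//.
  by apply: (measurableT_comp (mes j)); exact: measurable_fst.
by case: eqP => _; [exact: measurable_snd|exact: measurable_cst].
Qed.

Lemma pmeas_nth k d' (T : measurableType d') i :
  pmeas k (fun (t : T) s => nth point s i).
Proof. by apply: (@pmeas_nth_cat k d' T [::]) => j; rewrite nth_nil; exact: measurable_cst. Qed.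

Lemma pmeas_nth_cons k d' (T : measurableType d') (f : T -> X) i :
  measurable_fun setT f -> pmeas k (fun t s => nth point (f t :: s) i).
Proof.
move=> mf; apply: (@pmeas_nth_cat k d' T [:: f]) => -[|j] //=.
by rewrite nth_nil; exact: measurable_cst.
Qed.

Lemma pmeas2 k d' (T : measurableType d') d1 (Y1 : measurableType d1)
    d2 (Y2 : measurableType d2) d3 (Y3 : measurableType d3) (h : Y1 * Y2 -> Y3)
    (F : T -> seq X -> Y1) (G : T -> seq X -> Y2) :
  measurable_fun setT h -> pmeas k F -> pmeas k G ->
  pmeas k (fun t s => h (F t s, G t s)).
Proof.
move=> mh; elim: k d' T F G => [|k ih] d' T F G /= mF mG; last exact: ih.
by apply: (measurableT_comp mh); exact: measurable_fun_pair.
Qed.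

Lemma pmeasD k d' (T : measurableType d') (F G : T -> seq X -> R) :
  pmeas k F -> pmeas k G -> pmeas k (fun t s => F t s + G t s).
Proof.
apply: (pmeas2 (h := fun p : R * R => p.1 + p.2)).
exact: measurable_funD.
Qed.

Lemma pmeasM k d' (T : measurableType d') (F G : T -> seq X -> R) :
  pmeas k F -> pmeas k G -> pmeas k (fun t s => F t s * G t s).
Proof.
apply: (pmeas2 (h := fun p : R * R => p.1 * p.2)).
exact: measurable_funM.
Qed.

Lemma nest_ext k (F G : seq X -> R) :
  (forall s, size s = k -> F s = G s) -> nest k F = nest k G.
Proof.
elim: k F G => [|k ih] F G h /=; first exact: h.
congr (mean_fun J _); apply/funext => x; apply: ih => s sk; apply: h.
by rewrite /= sk.
Qed.

Lemma nest_measurable_bound k d' (T : measurableType d') (F : T -> seq X -> R) (C : R) :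
  pmeas k F -> (forall t s, `|F t s| <= C) ->
  measurable_fun setT (fun t => nest k (F t)) /\
  forall t, `|nest k (F t)| <= mass J ^+ k * C.
Proof.
elim: k d' T F => [|k ih] d' T F /= mF hC.
  by split => // t; rewrite expr0 mul1r.
have [m1 b1] := ih _ _ _ mF (fun p s => hC p.1 (p.2 :: s)).
split.
  apply: (@mean_measurable _ _ J _ T (fun p => nest k (fun s => F p.1 (p.2 :: s)))).
  by split => //; exists (mass J ^+ k * C).
move=> t; rewrite exprS -mulrA; apply: mean_bound; last by move=> x; exact: (b1 (t, x)).
split; last by exists (mass J ^+ k * C) => x; exact: (b1 (t, x)).
exact: (measurableT_comp m1 (measurable_pair1 t)).
Qed.

Lemma nest_bmeas k d' (T : measurableType d') (F : T -> seq X -> R) (C : R) :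
  pmeas k F -> (forall t s, `|F t s| <= C) -> bmeas (fun t => nest k (F t)).
Proof.
move=> mF hC; have [m1 b1] := nest_measurable_bound mF hC.
by split => //; exists (mass J ^+ k * C).
Qed.

Lemma nest_linear k d' (T : measurableType d') (F G : T -> seq X -> R) (a C D : R) t :
  pmeas k F -> (forall t s, `|F t s| <= C) ->
  pmeas k G -> (forall t s, `|G t s| <= D) ->
  nest k (fun s => a * F t s + G t s) = a * nest k (F t) + nest k (G t).
Proof.
elim: k d' T F G t => [|k ih] d' T F G t //= mF hF mG hG.
rewrite -mean_linear.
- congr (mean_fun J _); apply/funext => x.
  exact: (ih _ _ _ _ (t, x) mF (fun p s => hF p.1 (p.2 :: s)) mG (fun p s => hG p.1 (p.2 :: s))).
- have [m1 c1] := nest_bmeas mF (fun p s => hF p.1 (p.2 :: s)).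
  split; first exact: (measurableT_comp m1 (measurable_pair1 t)).
  by move: c1 => [c c1]; exists c => x; exact: (c1 (t, x)).
- have [m1 c1] := nest_bmeas mG (fun p s => hG p.1 (p.2 :: s)).
  split; first exact: (measurableT_comp m1 (measurable_pair1 t)).
  by move: c1 => [c c1]; exists c => x; exact: (c1 (t, x)).
Qed.

Definition delete (b : nat) (s : seq X) := take b s ++ drop b.+1 s.

Lemma nth_delete b s i : nth point (delete b s) i = nth point s (bump b i).
Proof.
rewrite /delete nth_cat size_take /bump; case: (ltnP b (size s)) => bs.
  case: (ltnP i b) => ib /=; first by rewrite nth_take.
  by rewrite nth_drop add1n; congr nth; rewrite addSn subnKC.
rewrite take_oversize// drop_oversize; last exact: ltnW.
case: (ltnP i (size s)) => is_.
  by rewrite leqNgt (leq_trans is_ bs).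
by rewrite nth_nil nth_default// (leq_trans is_) ?leq_addl.
Qed.

(** One [mean_swap] for each of the [b] variables in front. In the row expansion of a minor the
    [b]-th variable becomes the intermediate point of a composition and has to be integrated
    last. *)
Lemma nest_move k b d' (T : measurableType d') (H : T -> X -> seq X -> R) (C : R) t :
  (b <= k)%N -> pmeas k (fun (p : T * X) s => H p.1 p.2 s) ->
  (forall t x s, `|H t x s| <= C) ->
  nest k.+1 (fun s => H t (nth point s b) (delete b s)) =
  J (fun z => nest k (H t z)).
Proof.
elim: b k d' T H t => [|b ih] k d' T H t bk mH hC.
  rewrite [LHS]/=; congr (mean_fun J _); apply/funext => x.
  by apply: nest_ext => s _; rewrite /delete /= drop0.
case: k bk mH => [//|k] bk mH.
have mH' : pmeas k (fun (p : T * X * X) s => H p.1.1 p.2 (p.1.2 :: s)).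
  have mphi : measurable_fun setT (fun p : T * X * X => (p.1.1, p.2, p.1.2)).
    apply: measurable_fun_pair; last by apply: (measurableT_comp measurable_snd measurable_fst).
    by apply: measurable_fun_pair => //; exact: (measurableT_comp measurable_fst measurable_fst).
  exact: (pmeas_comp mphi mH).
transitivity (J (fun x => J (fun z => nest k (fun s => H t z (x :: s))))).
  change (J (fun x => nest k.+1 (fun s => H t (nth point s b) (x :: delete b s))) = 
    J (fun x => J (fun z => nest k (fun s => H t z (x :: s))))).
  congr (mean_fun J _); apply/funext => x.
  exact: (ih k _ _ (fun (p : T * X) z s => H p.1 z (p.2 :: s)) (t, x)).
have [m1 [c c1]] := nest_bmeas mH' (fun p s => hC p.1.1 p.2 (p.1.2 :: s)).
rewrite (@mean_swap _ _ J (fun p => nest k (fun s => H t p.2 (p.1 :: s))))//.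
split; last by exists c => p; exact: (c1 (t, p.1, p.2)).
have mq : measurable_fun setT (fun p : X * X => (t, p.1, p.2)).
  by apply: measurable_fun_pair => //; apply: measurable_fun_pair.
exact: (measurableT_comp m1 mq).
Qed.

End nest.
End mean.

Section fredholm.
Context {R : realType} d (X : measurableType d) (J : @mean R d X).
Implicit Types (A : X -> X -> R) (M : R).

Definition minor A n (p q : nat -> X) : R :=
  \det (\matrix_(i < n, j < n) A (p i) (q j)).

Definition bker A M := measurable_fun setT (fun p : X * X => A p.1 p.2) /\
  forall x y, `|A x y| <= M.

Definition hbound M n : R := Num.sqrt ((n%:R * M ^+ 2) ^+ n).

Lemma minor_bound A M n p q : bker A M -> `|minor A n p q| <= hbound M n.
Proof.
move=> [_ hM]; rewrite -sqrtr_sqr; apply: ler_wsqrtr.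
by apply: det_bound => i j; rewrite mxE.
Qed.

Lemma pmeas_minor A M k d' (T : measurableType d') n (p q : T -> seq X -> nat -> X) :
  bker A M -> (forall i, pmeas k (fun t s => p t s i)) ->
  (forall i, pmeas k (fun t s => q t s i)) ->
  pmeas k (fun t s => minor A n (p t s) (q t s)).
Proof.
move=> [mA _]; elim: k d' T p q => [|k ih] d' T p q /= mp mq; last exact: ih.
rewrite /minor /determinant; apply: measurable_sum => s.
apply: measurable_funM => //; apply: measurable_prod => i _.
under eq_fun do rewrite mxE.
exact: (measurable_fun_comp2 mA).
Qed.

(** Expansion along the row of [x]. In the other terms the row of the deleted point is moved to the
    front; the sign of this cyclic permutation and the sign of the cofactor combine to a minus sign
    for every [b]. *)
Lemma minor_row A n x y (s : seq X) :
  minor A n.+2 (nth point (x :: s)) (nth point (y :: s)) =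
  A x y * minor A n.+1 (nth point s) (nth point s) -
  \sum_(b < n.+1) A x (nth point s b) *
    minor A n.+1 (nth point (nth point s b :: delete b s)) (nth point (y :: delete b s)).
Proof.
rewrite {1}/minor (expand_det_row _ ord0) big_ord_recl; congr (_ + _).
  rewrite mxE /cofactor addn0 expr0 mul1r; congr (_ * \det _).
  by apply/matrixP => i j; rewrite !mxE.
rewrite -sumrN; apply: eq_bigr => b _; rewrite mxE /= -mulrN; congr (_ * _).
rewrite /cofactor; set N := row' _ _.
rewrite (_ : minor _ _ _ _ = \det (row_perm (lift_perm ord0 b 1%g) N)).
  rewrite row_permE det_mulmx det_perm odd_lift_perm odd_perm1 addbF /=.
  by rewrite add0n /bump /= add1n exprS mulN1r mulNr signr_odd.
congr (\det _); apply/matrixP => i j; rewrite !mxE.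
have -> : nth point (y :: s) (lift (lift ord0 b) j) = nth point (y :: delete b s) j.
  have [j'|->] := unliftP ord0 j; last by rewrite /= /bump.
  move=> ->; have -> : nat_of_ord (lift (lift ord0 b) (lift ord0 j')) = (bump b j').+1.
    by rewrite /= /bump /= !add1n ltnS addnS.
  by rewrite (_ : nat_of_ord (lift ord0 j') = j'.+1)//= nth_delete.
congr (A _ _); have [i'|->] := unliftP ord0 i.
  by move=> ->; rewrite lift_perm_lift perm1 /= nth_delete.
by rewrite lift_perm_id.
Qed.

Lemma nest_scale k d' (T : measurableType d') (F : T -> seq X -> R) (a C : R) t :
  pmeas k F -> (forall t s, `|F t s| <= C) ->
  nest J k (fun s => a * F t s) = a * nest J k (F t).
Proof.
move=> mF hF; have := @nest_linear R _ X J k _ T F (fun _ _ => 0) a C 0 t mF hF.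
have m0 : pmeas k (fun (_ : T) (_ : seq X) => 0 : R).
  by apply: (@pmeas_cst _ X k _ T _ R (cst 0)); exact: measurable_cst.
move=> /(_ m0) h.
have n0 : nest J k (fun _ => 0) = 0.
  have [_ /(_ t)] := @nest_measurable_bound R _ X J k _ T _ 0 m0 (fun _ _ => eq_ind_r (fun z => z <= 0) (lexx 0) (@normr0 R R)).
  by rewrite mulr0 normr_le0 => /eqP.
rewrite n0 addr0 in h; rewrite -h; last by move=> *; rewrite normr0.
by apply: nest_ext => s _; rewrite addr0.
Qed.

Lemma nest_sum k (I : Type) (r : seq I) (F : I -> seq X -> R) C :
  (forall i, pmeas k (fun (_ : unit) => F i)) -> (forall i s, `|F i s| <= C) ->
  nest J k (fun s => \sum_(i <- r) F i s) = \sum_(i <- r) nest J k (F i) /\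
  pmeas k (fun (_ : unit) s => \sum_(i <- r) F i s) /\
  exists D, forall s, `|\sum_(i <- r) F i s| <= D.
Proof.
move=> mF hF; elim: r => [|i r [ih [m1 [D hD]]]].
  have m0 : pmeas k (fun (_ : unit) (_ : seq X) => 0 : R).
    by apply: (@pmeas_cst _ X k _ unit _ R (cst 0)); exact: measurable_cst.
  have E : (fun s => \sum_(i <- [::]) F i s) = (fun=> 0) by apply/funext => s; rewrite big_nil.
  split; last split; last by exists 0 => s; rewrite big_nil normr0.
    rewrite big_nil E; have := @nest_scale k _ unit (fun _ _ => 0) 0 0 tt m0.
    by under eq_fun do rewrite mul0r; move=> -> //; rewrite ?mul0r// => *; rewrite normr0.
  by under eq_fun do rewrite E.
have E : (fun s => \sum_(j <- i :: r) F j s) = (fun s => 1 * F i s + \sum_(j <- r) F j s).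
  by apply/funext => s; rewrite big_cons mul1r.
split; last split.
- have h := @nest_linear R _ X J k _ unit (fun=> F i) _ 1 C D tt (mF i) (fun _ => hF i)
    m1 (fun _ => hD).
  by rewrite big_cons E; move: h => /= ->; rewrite mul1r ih.
- rewrite E; apply: (@pmeasD R _ X k _ unit (fun _ s => 1 * F i s)) => //.
  apply: (@pmeasM R _ X k _ unit (fun _ _ => 1)) => //.
  by apply: (@pmeas_cst _ X k _ unit _ R (cst 1)); exact: measurable_cst.
- exists (C + D) => s; rewrite big_cons (le_trans (ler_normD _ _))//.
  by rewrite lerD.
Qed.

(** The coefficients of Fredholm's determinant and of his first minor, without the factors
    [(-1)^k / k!] that [fc] and [fa] restore. *)
Definition dk A k : R := nest J k (fun s => minor A k (nth point s) (nth point s)).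
Definition Nk A k x y : R :=
  nest J k (fun s => minor A k.+1 (nth point (x :: s)) (nth point (y :: s))).

Lemma dk0 A : dk A 0 = 1.
Proof. by rewrite /dk /= /minor det_mx00. Qed.

Lemma Nk0 A x y : Nk A 0 x y = A x y.
Proof. by rewrite /Nk /= /minor det_mx11 mxE. Qed.

Lemma dkS A k : dk A k.+1 = J (fun z => Nk A k z z).
Proof. by []. Qed.

Lemma Nk_pmeas A M k d' (T : measurableType d') (f g : T -> X) : bker A M ->
  measurable_fun setT f -> measurable_fun setT g ->
  pmeas k (fun t s => minor A k.+1 (nth point (f t :: s)) (nth point (g t :: s))).
Proof.
by move=> hA mf mg; apply: (pmeas_minor _ hA) => i; exact: pmeas_nth_cons.
Qed.

Lemma Nk_bker A M k : bker A M -> bker (Nk A k) (mass J ^+ k * hbound M k.+1).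
Proof.
move=> hA.
have mp := @Nk_pmeas A M k _ (X * X)%type fst snd hA measurable_fst measurable_snd.
have [m1 b1] := nest_measurable_bound J mp (fun t s => minor_bound _ _ _ hA).
by split => // x y; exact: (b1 (x, y)).
Qed.

(** The row expansion under the integral. After renaming the integration variables its [k.+1]
    non-leading terms coincide, whence the factor. *)
Lemma NkS A M k x y : bker A M ->
  Nk A k.+1 x y = A x y * dk A k.+1 - k.+1%:R * J (fun z => A x z * Nk A k z y).
Proof.
move=> hA; have [mA bA] := hA.
have M0 : 0 <= M by exact: le_trans (normr_ge0 _) (bA point point).
pose S b (s : seq X) := A x (nth point s b) *
  minor A k.+1 (nth point (nth point s b :: delete b s)) (nth point (y :: delete b s)).
have mS b : pmeas k.+1 (fun (_ : unit) => S b).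
  apply: pmeasM.
    apply: (pmeas2 (h := fun p : X * X => A p.1 p.2) mA (F := fun _ _ => x) (G := fun _ s => nth point s b)).
      exact: (@pmeas_cst _ X _ _ unit _ X (cst x) (measurable_cst x)).
    exact: pmeas_nth.
  have Ed i : (fun (_ : unit) (s : seq X) => nth point (delete b s) i) =
      (fun _ s => nth point s (bump b i)).
    by apply/funext => u; apply/funext => s; rewrite nth_delete.
  apply: (pmeas_minor _ hA) => -[|i].
  - exact: (@pmeas_nth _ X k.+1 _ unit).
  - change (pmeas k.+1 (fun (_ : unit) (s : seq X) => nth point (delete b s) i)).
    by rewrite Ed; exact: (@pmeas_nth _ X k.+1 _ unit).
  - exact: (@pmeas_cst _ X k.+1 _ unit _ X (cst y) (measurable_cst y)).
  - change (pmeas k.+1 (fun (_ : unit) (s : seq X) => nth point (delete b s) i)).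
    by rewrite Ed; exact: (@pmeas_nth _ X k.+1 _ unit).
have bS b s : `|S b s| <= M * hbound M k.+1.
  by rewrite normrM; apply: ler_pM => //; exact: minor_bound.
have [nS [mSS [D hD]]] := @nest_sum k.+1 _ (index_enum 'I_k.+1) (fun b : 'I_k.+1 => S b) _
  (fun b => mS b) (fun b => bS b).
have md : pmeas k.+1 (fun (_ : unit) s => minor A k.+1 (nth point s) (nth point s)).
  by apply: (pmeas_minor _ hA) => i; exact: pmeas_nth.
have mAd : pmeas k.+1 (fun (_ : unit) s => A x y * minor A k.+1 (nth point s) (nth point s)).
  apply: (@pmeasM R _ X k.+1 _ unit (fun _ _ => A x y)) => //.
  by apply: (@pmeas_cst _ X k.+1 _ unit _ R (cst _)); exact: measurable_cst.
have -> : Nk A k.+1 x y = nest J k.+1 (fun s => -1 * (\sum_(b < k.+1) S b s) +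
    A x y * minor A k.+1 (nth point s) (nth point s)).
  by apply: nest_ext => s _; rewrite minor_row mulN1r addrC.
rewrite (@nest_linear R _ X J k.+1 _ unit _ _ (-1) D (M * hbound M k.+1) tt mSS _ mAd); last 2 first.
  by move=> _ s.
  by move=> _ s; rewrite normrM; apply: ler_pM => //; exact: minor_bound.
rewrite (@nest_scale k.+1 _ unit _ (A x y) (hbound M k.+1) tt md); last first.
  by move=> _ s; exact: minor_bound.
rewrite mulN1r addrC nS -/(dk A k.+1); congr (_ - _).
have mN : pmeas k (fun (p : unit * X) s => minor A k.+1 (nth point (p.2 :: s)) (nth point (y :: s))).
  exact: (Nk_pmeas _ hA measurable_snd (measurable_cst y)).
have nb (b : 'I_k.+1) : nest J k.+1 (S b) = J (fun z => A x z * Nk A k z y).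
  transitivity (J (fun z => nest J k (fun s =>
      A x z * minor A k.+1 (nth point (z :: s)) (nth point (y :: s))))).
    apply: (@nest_move R _ X J k b _ unit (fun _ z s =>
      A x z * minor A k.+1 (nth point (z :: s)) (nth point (y :: s))) (M * hbound M k.+1) tt).
    - by rewrite -ltnS.
    - apply: pmeasM => //.
      apply: (pmeas2 (h := fun p : X * X => A p.1 p.2) mA (F := fun _ _ => x) (G := fun p s => p.2)).
        exact: (@pmeas_cst _ X _ _ (unit * X)%type _ X (cst x) (measurable_cst x)).
      exact: (@pmeas_cst _ X _ _ (unit * X)%type _ X snd measurable_snd).
    - by move=> _ z s; rewrite normrM; apply: ler_pM => //; exact: minor_bound.
  congr (mean_fun J _); apply/funext => z.
  exact: (@nest_scale k _ (unit * X)%type _ (A x z) (hbound M k.+1) (tt, z) mN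
    (fun t s => minor_bound _ _ _ hA)).
by rewrite (eq_bigr _ (fun b _ => nb b)) sumr_const card_ord mulr_natl.
Qed.

Definition fc A k : R := (-1) ^+ k / k`!%:R * dk A k.
Definition fa A k x y : R := (-1) ^+ k / k`!%:R * Nk A k x y.

Lemma fc0 A : fc A 0 = 1.
Proof. by rewrite /fc dk0 expr0 fact0 divr1 mulr1. Qed.

Lemma fa0 A x y : fa A 0 x y = A x y.
Proof. by rewrite /fa Nk0 expr0 fact0 divr1 mul1r. Qed.

Lemma bker_section A B M N x y : bker A M -> bker B N ->
  bmeas (fun z => A x z * B z y).
Proof.
move=> [mA hA] [mB hB]; split.
  apply: measurable_funM; first exact: (measurableT_comp mA (pair1_measurable x)).
  exact: (measurableT_comp mB (pair2_measurable y)).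
exists (M * N) => z; rewrite normrM.
by apply: ler_pM.
Qed.

Lemma bker_diag A M : bker A M -> bmeas (fun z => A z z).
Proof.
move=> [mA hA]; split; last by exists M.
exact: (measurable_fun_comp2 mA).
Qed.

Lemma mean_scale (a : R) f : bmeas f -> J (fun x => a * f x) = a * J f.
Proof.
move=> bf; have b0 : bmeas (fun _ : X => 0 : R).
  by split; [exact: measurable_cst|exists 0 => x; rewrite normr0].
have j0 : J (fun _ => 0) = 0.
  have := @mean_bound R _ X J _ 0 b0 (fun=> eq_ind_r (fun z => z <= 0) (lexx 0) (@normr0 R R)).
  by rewrite mulr0 normr_le0 => /eqP.
rewrite -[RHS]addr0 -j0 -mean_linear//.
by congr (mean_fun J _); apply/funext => x; rewrite addr0.
Qed.

(** For the generating series [d] of [fc] and [N] of [fa] in a parameter [lambda], this is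
    [N = d A + lambda A N], read coefficient by coefficient. *)
Lemma faS A M k x y : bker A M ->
  fa A k.+1 x y = fc A k.+1 * A x y + J (fun z => A x z * fa A k z y).
Proof.
move=> hA; rewrite /fa (NkS _ _ _ hA) mulrBr mulrA mulrAC; congr (_ + _).
have -> : (fun z => A x z * ((-1) ^+ k / k`!%:R * Nk A k z y)) =
    fun z => (-1) ^+ k / k`!%:R * (A x z * Nk A k z y).
  by apply/funext => z; rewrite mulrCA.
rewrite mean_scale; last exact: (bker_section _ _ hA (Nk_bker k hA)).
rewrite mulrA -mulNr; congr (_ * _); rewrite factS natrM exprS.
have n0 : k.+1%:R != 0 :> R by rewrite pnatr_eq0.
have f0 : k`!%:R != 0 :> R by rewrite pnatr_eq0 -lt0n fact_gt0.
move: (k.+1%:R) (k`!%:R) n0 f0 => u v n0 f0; by field; rewrite ?n0 ?f0.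
Qed.

Lemma fcS A M k : bker A M -> k.+1%:R * fc A k.+1 = - J (fun z => fa A k z z).
Proof.
move=> hA; rewrite /fc dkS /fa mean_scale; last exact: (bker_diag (Nk_bker k hA)).
rewrite mulrA -mulNr; congr (_ * _); rewrite factS natrM exprS.
have n0 : k.+1%:R != 0 :> R by rewrite pnatr_eq0.
have f0 : k`!%:R != 0 :> R by rewrite pnatr_eq0 -lt0n fact_gt0.
move: (k.+1%:R) (k`!%:R) n0 f0 => u v n0 f0; by field; rewrite ?n0 ?f0.
Qed.

Lemma fredholm_bound M : 0 <= M -> exists2 C : R, 0 <= C &
  forall A, bker A M -> forall k, `|fc A k| <= C * 2^-1 ^+ k /\
    bker (fa A k) (C * 2^-1 ^+ k).
Proof.
(* With this [q] the powers of [mass J * q] are at most [4^-k]; one factor [2^-k] is spent on the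
   [k.+1] that the first minors carry. *)
move=> M0; pose q : R := (4 * (mass J + 1))^-1.
have m0 := mass_ge0 J.
have q0 : 0 < q by rewrite invr_gt0 mulr_gt0 ?ltr_pwDr.
have mq : mass J * q <= 4^-1.
  by rewrite /q invfM mulrCA ler_piMr ?invr_ge0// ler_pdivrMr ?mul1r ?lerDl ?ltr_pwDr.
have [C C0 hC] := hadamard_geometric M0 q0.
have hmq k : (mass J * q) ^+ k <= 4^-1 ^+ k.
  by apply: ler_wpXn2 => //; rewrite mulr_ge0// ltW.
have h42 k : (4^-1 : R) ^+ k <= 2^-1 ^+ k by apply: ler_wpXn2; rewrite ?invr_ge0//; lra.
have h4k k : k.+1%:R * (4^-1 : R) ^+ k <= 2^-1 ^+ k.
  rewrite (_ : 4^-1 = 2^-1 * 2^-1 :> R) ?exprMn; last by rewrite -invfM -natrM.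
  rewrite mulrA ler_piMl ?exprn_ge0 ?invr_ge0//.
  rewrite exprVn -natrX.
  by rewrite ler_pdivrMr ?mul1r ?ltr0n ?expn_gt0// ler_nat ltn_expl.
have fk k : 0 < k`!%:R :> R by rewrite ltr0n fact_gt0.
exists (C + C * q); first by rewrite addr_ge0 ?mulr_ge0// ltW.
move=> A hA k.
have nrm (r : R) : `|(-1) ^+ k / k`!%:R * r| = `|r| / k`!%:R.
  rewrite normrM normrM normrX normrN1 expr1n mul1r ger0_norm ?invr_ge0 ?ltW//.
  by rewrite mulrC.
split.
  rewrite /fc nrm; apply: (@le_trans _ _ (C * 2^-1 ^+ k)); last first.
    by rewrite ler_wpM2r ?exprn_ge0 ?invr_ge0// lerDl mulr_ge0// ltW.
  have mp : pmeas k (fun (_ : unit) s => minor A k (nth point s) (nth point s)).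
    by apply: (pmeas_minor _ hA) => i; exact: pmeas_nth.
  have [_ /(_ tt) b1] := nest_measurable_bound J mp (fun t s => minor_bound _ _ _ hA).
  apply: (@le_trans _ _ (mass J ^+ k * (hbound M k / k`!%:R))).
    by rewrite mulrA ler_wpM2r ?invr_ge0 ?(ltW (fk k)).
  apply: (@le_trans _ _ (mass J ^+ k * (C * q ^+ k))).
    by rewrite ler_wpM2l ?exprn_ge0//; exact: hC.
  rewrite mulrCA -exprMn ler_wpM2l// (le_trans (hmq k))//.
have [mN bN] := Nk_bker k hA.
split; first by apply: measurable_funM => //; exact: measurable_cst.
move=> x y; rewrite /fa nrm; apply: (@le_trans _ _ (C * q * 2^-1 ^+ k)); last first.
  by rewrite ler_wpM2r ?exprn_ge0 ?invr_ge0// lerDr.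
apply: (@le_trans _ _ (mass J ^+ k * (k.+1%:R * (hbound M k.+1 / k.+1`!%:R)))).
  have -> : k.+1%:R * (hbound M k.+1 / k.+1`!%:R) = hbound M k.+1 / k`!%:R.
    have n0 : k.+1%:R != 0 :> R by rewrite pnatr_eq0.
    have f0 : k`!%:R != 0 :> R by rewrite pnatr_eq0 -lt0n fact_gt0.
    rewrite factS natrM; move: (k.+1%:R) (k`!%:R) n0 f0 => u v n0 f0.
    by field; rewrite ?n0 ?f0.
  by rewrite mulrA ler_wpM2r ?invr_ge0 ?(ltW (fk k)).
apply: (@le_trans _ _ (mass J ^+ k * (k.+1%:R * (C * q ^+ k.+1)))).
  by rewrite ler_wpM2l ?exprn_ge0// ler_wpM2l//; exact: hC.
rewrite (_ : _ * _ = C * q * (k.+1%:R * (mass J * q) ^+ k)); last first.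
  by rewrite exprS exprMn; ring.
rewrite ler_wpM2l ?mulr_ge0 ?(ltW q0)// (le_trans _ (h4k k))//.
by rewrite ler_wpM2l.
Qed.

End fredholm.

Section kernel_composition.
Context {R : realType} d (X : measurableType d) (J : @mean R d X).
Implicit Types (f g h : X -> X -> R).

Definition kcomp f g x y : R := J (fun z => f x z * g z y).

Lemma bker_ge0 f (M : R) : bker f M -> 0 <= M.
Proof. by move=> [_ h]; exact: le_trans (normr_ge0 _) (h point point). Qed.

Lemma bker_cst (c : R) : bker (fun _ _ : X => c) `|c|.
Proof. by split=> //; exact: measurable_cst. Qed.

Lemma bkerD f g (M N : R) : bker f M -> bker g N -> bker (fun x y => f x y + g x y) (M + N).
Proof.
move=> [mf hf] [mg hg]; split; first exact: measurable_funD.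
by move=> x y; apply: le_trans (ler_normD _ _) _; apply: lerD.
Qed.

Lemma bkerZ (c : R) f (M : R) : bker f M -> bker (fun x y => c * f x y) (`|c| * M).
Proof.
move=> [mf hf]; split; first by apply: measurable_funM => //; exact: measurable_cst.
by move=> x y; rewrite normrM ler_wpM2l.
Qed.

Lemma bkerN f (M : R) : bker f M -> bker (fun x y => - f x y) M.
Proof.
move=> [mf hf]; split; first exact: measurable_funN.
by move=> x y; rewrite normrN.
Qed.

Lemma bker_kcomp f g (M N : R) : bker f M -> bker g N -> bker (kcomp f g) (mass J * (M * N)).
Proof.
move=> hf hg; have [mf bf] := hf; have [mg bg] := hg; split.
  apply: (@mean_measurable R d X J _ (X * X)%type (fun p => f p.1.1 p.2 * g p.2 p.1.2)).
  split.
    apply: measurable_funM.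
      apply: (measurable_fun_comp2 mf); last exact: measurable_snd.
      exact: (measurableT_comp measurable_fst measurable_fst).
    apply: (measurable_fun_comp2 mg); first exact: measurable_snd.
    exact: (measurableT_comp measurable_snd measurable_fst).
  by exists (M * N) => p; rewrite normrM; apply: ler_pM.
move=> x y; apply: mean_bound; first exact: bker_section hf hg.
by move=> z; rewrite normrM; apply: ler_pM.
Qed.

Lemma meanD (f1 f2 : X -> R) : bmeas f1 -> bmeas f2 ->
  J (fun x => f1 x + f2 x) = J f1 + J f2.
Proof.
move=> b1 b2; rewrite -[J f1]mul1r -mean_linear//.
by congr (mean_fun J _); apply/funext => x; rewrite mul1r.
Qed.

Lemma kcompDl f1 f2 g (M1 M2 N : R) : bker f1 M1 -> bker f2 M2 -> bker g N ->
  kcomp (fun x y => f1 x y + f2 x y) g = fun x y => kcomp f1 g x y + kcomp f2 g x y.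
Proof.
move=> h1 h2 hg; apply/funext => x; apply/funext => y.
rewrite /kcomp -meanD; [|exact: bker_section h1 hg|exact: bker_section h2 hg].
by congr (mean_fun J _); apply/funext => z; rewrite mulrDl.
Qed.

Lemma kcompDr f g1 g2 (M N1 N2 : R) : bker f M -> bker g1 N1 -> bker g2 N2 ->
  kcomp f (fun x y => g1 x y + g2 x y) = fun x y => kcomp f g1 x y + kcomp f g2 x y.
Proof.
move=> hf h1 h2; apply/funext => x; apply/funext => y.
rewrite /kcomp -meanD; [|exact: bker_section hf h1|exact: bker_section hf h2].
by congr (mean_fun J _); apply/funext => z; rewrite mulrDr.
Qed.

Lemma kcompZl (c : R) f g (M N : R) : bker f M -> bker g N ->
  kcomp (fun x y => c * f x y) g = fun x y => c * kcomp f g x y.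
Proof.
move=> hf hg; apply/funext => x; apply/funext => y.
rewrite /kcomp -mean_scale; last exact: bker_section hf hg.
by congr (mean_fun J _); apply/funext => z; rewrite mulrA.
Qed.

Lemma kcompZr (c : R) f g (M N : R) : bker f M -> bker g N ->
  kcomp f (fun x y => c * g x y) = fun x y => c * kcomp f g x y.
Proof.
move=> hf hg; apply/funext => x; apply/funext => y.
rewrite /kcomp -mean_scale; last exact: bker_section hf hg.
by congr (mean_fun J _); apply/funext => z; rewrite mulrCA.
Qed.

Lemma kcompA f g h (M N P : R) : bker f M -> bker g N -> bker h P ->
  kcomp f (kcomp g h) = kcomp (kcomp f g) h.
Proof.
move=> hf hg hh; apply/funext => x; apply/funext => y; rewrite /kcomp.
transitivity (J (fun z => J (fun w => f x z * g z w * h w y))).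
  congr (mean_fun J _); apply/funext => z.
  rewrite -mean_scale; last exact: bker_section hg hh.
  by congr (mean_fun J _); apply/funext => w; rewrite mulrA.
rewrite (@mean_swap R d X J (fun p => f x p.1 * g p.1 p.2 * h p.2 y)); last first.
  have [mf bf] := hf; have [mg bg] := hg; have [mh bh] := hh; split.
    apply: measurable_funM; first apply: measurable_funM => //.
      exact: (measurable_fun_comp2 mf (measurable_cst x) measurable_fst).
    exact: (measurable_fun_comp2 mh measurable_snd (measurable_cst y)).
  exists (M * N * P) => p; rewrite !normrM.
  by apply: ler_pM => //; apply: ler_pM.
congr (mean_fun J _); apply/funext => w /=.
have := @mean_scale R d X J (h w y) (fun z => f x z * g z w) (bker_section x w hf hg).
by rewrite mulrC => <-; congr (mean_fun J _); apply/funext => z; rewrite mulrC.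
Qed.

End kernel_composition.

(** * The ring of multiples of the identity plus bounded kernels, and expansions of its elements *)

Section kernel_ring.
Context {R : realType} d (X : measurableType d) (J : @mean R d X).

(* [UKer a f] stands for [a Id + f]. *)
Record uker_of (J0 : @mean R d X) :=
  UKer { usc : R; ukr : X -> X -> R; ukrP : exists M : R, bker ukr M }.
Arguments UKer {J0} usc {ukr} ukrP.
Local Notation uker := (uker_of J).

HB.instance Definition _ := gen_eqMixin uker.
HB.instance Definition _ := gen_choiceMixin uker.

Lemma uker_eq (u v : uker) : usc u = usc v -> (forall x y, ukr u x y = ukr v x y) -> u = v.
Proof.
case: u v => a f pf [b g pg] /= -> fg.
have E : f = g by apply/funext => x; apply/funext => y.
by move: pf pg; rewrite E => pf pg; congr UKer; exact: Prop_irrelevance.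
Qed.

(** Total, so that families of kernels and their derivatives can be written without proofs of
    boundedness inside the terms. *)
Definition uk_of (f : X -> X -> R) : uker :=
  match pselect (exists M : R, bker f M) with
  | left h => UKer 0 h
  | right _ => UKer 0 (ex_intro _ _ (bker_cst X 0))
  end.

Lemma uk_ofE f (M : R) : bker f M -> usc (uk_of f) = 0 /\ ukr (uk_of f) = f.
Proof. by move=> hf; rewrite /uk_of; case: pselect => // -[]; exists M. Qed.

Definition usca (a : R) : uker := UKer a (ex_intro _ _ (bker_cst X 0)).

Let uzero := usca 0.
Let uone := usca 1.

Program Definition uadd (u v : uker) : uker :=
  @UKer J (usc u + usc v) (fun x y => ukr u x y + ukr v x y) _.
Next Obligation.
move=> [a f [M hM]] [b g [N hN]] /=; exists (M + N); exact: bkerD.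
Qed.

Program Definition uopp (u : uker) : uker := @UKer J (- usc u) (fun x y => - ukr u x y) _.
Next Obligation. move=> [a f [M hM]] /=; exists M; exact: bkerN. Qed.

Program Definition umul (u v : uker) : uker :=
  @UKer J (usc u * usc v) (fun x y =>
    (usc u * ukr v x y + usc v * ukr u x y) + kcomp J (ukr u) (ukr v) x y) _.
Next Obligation.
move=> [a f [M hM]] [b g [N hN]] /=; eexists.
exact: (bkerD (bkerD (bkerZ a hN) (bkerZ b hM)) (bker_kcomp J hM hN)).
Qed.

Let uaddA : associative uadd.
Proof. by move=> u v w; apply: uker_eq => [|x y] /=; rewrite addrA. Qed.
Let uaddC : commutative uadd.
Proof. by move=> u v; apply: uker_eq => [|x y] /=; rewrite addrC. Qed.
Let uadd0 : left_id uzero uadd.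
Proof. by move=> u; apply: uker_eq => [|x y] /=; rewrite add0r. Qed.
Let uaddN : left_inverse uzero uopp uadd.
Proof. by move=> u; apply: uker_eq => [|x y] /=; rewrite addNr. Qed.

HB.instance Definition _ := GRing.isZmodule.Build uker uaddA uaddC uadd0 uaddN.

Let kcomp0l (g : X -> X -> R) (N : R) x y : bker g N -> kcomp J (fun _ _ => 0) g x y = 0.
Proof.
move=> hg; have := @kcompZl R d X J 0 (fun _ _ => 0) g _ _ (bker_cst X 0) hg.
under eq_fun do under eq_fun do rewrite mul0r.
by move=> ->; rewrite mul0r.
Qed.

Let kcomp0r (g : X -> X -> R) (N : R) x y : bker g N -> kcomp J g (fun _ _ => 0) x y = 0.
Proof.
move=> hg; have := @kcompZr R d X J 0 g (fun _ _ => 0) _ _ hg (bker_cst X 0).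
under eq_fun do under eq_fun do rewrite mul0r.
by move=> ->; rewrite mul0r.
Qed.

Let umulA : associative umul.
Proof.
move=> [a f [M hf]] [b g [N hg]] [c h [P hh]]; apply: uker_eq => [|x y] /=; first exact: mulrA.
have fg := bker_kcomp J hf hg; have gh := bker_kcomp J hg hh.
rewrite (kcompDr J hf (bkerD (bkerZ b hh) (bkerZ c hg)) gh).
rewrite (kcompDr J hf (bkerZ b hh) (bkerZ c hg)).
rewrite (kcompZr _ b hf hh) (kcompZr _ c hf hg).
rewrite (kcompDl J (bkerD (bkerZ a hg) (bkerZ b hf)) fg hh).
rewrite (kcompDl J (bkerZ a hg) (bkerZ b hf) hh).
rewrite (kcompZl _ a hg hh) (kcompZl _ b hf hh) (kcompA J hf hg hh).
by ring.
Qed.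

Let umul1 : left_id uone umul.
Proof.
move=> [a f [M hf]]; apply: uker_eq => [|x y] /=; first exact: mul1r.
by rewrite (kcomp0l _ _ hf) mul1r mulr0 !addr0.
Qed.

Let umulr1 : right_id uone umul.
Proof.
move=> [a f [M hf]]; apply: uker_eq => [|x y] /=; first exact: mulr1.
by rewrite (kcomp0r _ _ hf) mul1r mulr0 add0r !addr0.
Qed.

Let umulDl : left_distributive umul uadd.
Proof.
move=> [a f [M hf]] [b g [N hg]] [c h [P hh]]; apply: uker_eq => [|x y] /=; first exact: mulrDl.
by rewrite (kcompDl J hf hg hh); ring.
Qed.

Let umulDr : right_distributive umul uadd.
Proof.
move=> [a f [M hf]] [b g [N hg]] [c h [P hh]]; apply: uker_eq => [|x y] /=; first exact: mulrDr.
by rewrite (kcompDr J hf hg hh); ring.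
Qed.

HB.instance Definition _ :=
  GRing.Zmodule_isPzRing.Build uker umulA umul1 umulr1 umulDl umulDr.

Implicit Types u v w : uker.

Lemma uscD u v : usc (u + v) = usc u + usc v. Proof. by []. Qed.
Lemma uscM u v : usc (u * v) = usc u * usc v. Proof. by []. Qed.
Lemma uscN u : usc (- u) = - usc u. Proof. by []. Qed.
Lemma ukrD u v x y : ukr (u + v) x y = ukr u x y + ukr v x y. Proof. by []. Qed.
Lemma ukrN u x y : ukr (- u) x y = - ukr u x y. Proof. by []. Qed.
Lemma ukrM u v x y : ukr (u * v) x y =
  (usc u * ukr v x y + usc v * ukr u x y) + kcomp J (ukr u) (ukr v) x y.
Proof. by []. Qed.

Lemma usca_comm (a : R) u : usca a * u = u * usca a.
Proof.
case: u => b f [M hf]; apply: uker_eq => [|x y] /=; first exact: mulrC.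
by rewrite (kcomp0l _ _ hf) (kcomp0r _ _ hf) !mulr0 !addr0 add0r.
Qed.

Lemma ukr_uscaM (a : R) u x y : ukr (usca a * u) x y = a * ukr u x y.
Proof.
case: u => b f [M hf] /=; by rewrite (kcomp0l _ _ hf) mulr0 !addr0.
Qed.

Lemma uscaM (a b : R) : usca (a * b) = usca a * usca b.
Proof. by apply: uker_eq => [//|x y]; rewrite ukr_uscaM /= mulr0. Qed.
Lemma uscaD (a b : R) : usca (a + b) = usca a + usca b.
Proof. by apply: uker_eq => [//|x y] /=; rewrite addr0. Qed.
Lemma usca1 : usca 1 = 1. Proof. by []. Qed.
Lemma usca0 : usca 0 = 0. Proof. by []. Qed.
Lemma uscaN (a : R) : usca (- a) = - usca a.
Proof. by apply: uker_eq => [//|x y] /=; rewrite oppr0. Qed.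

(** One constant for the scalar and the kernel: a sup norm, submultiplicative up to the factor
    [2 + mass J]. *)
Definition ubound u (C : R) := `|usc u| <= C /\ forall x y, `|ukr u x y| <= C.

Lemma ubound_ex u : exists2 C : R, 0 <= C & ubound u C.
Proof.
case: u => a f [M hf]; have M0 := bker_ge0 hf; exists (`|a| + M); first by rewrite addr_ge0.
split=> [|x y] /=; first by rewrite lerDl.
by apply: le_trans (hf.2 x y) _; rewrite lerDr.
Qed.

Lemma ubound_ge0 u (C : R) : ubound u C -> 0 <= C.
Proof. by move=> [h _]; exact: le_trans h. Qed.

Lemma ubound_le u (C D : R) : ubound u C -> C <= D -> ubound u D.
Proof. by move=> [h1 h2] CD; split=> [|x y]; [exact: le_trans CD|exact: le_trans (h2 x y) CD]. Qed.

Lemma uboundD u v (C D : R) : ubound u C -> ubound v D -> ubound (u + v) (C + D).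
Proof.
move=> [h1 h2] [h3 h4]; split=> [|x y] /=; apply: le_trans (ler_normD _ _) _; exact: lerD.
Qed.

Lemma uboundN u (C : R) : ubound u C -> ubound (- u) C.
Proof. by move=> [h1 h2]; split=> [|x y] /=; rewrite normrN. Qed.

Lemma uboundB u v (C D : R) : ubound u C -> ubound v D -> ubound (u - v) (C + D).
Proof. by move=> h1 h2; apply: uboundD => //; exact: uboundN. Qed.

Lemma ubound_ukr u (C : R) : ubound u C -> bker (ukr u) C.
Proof. by move=> [_ hC]; have [M [mf _]] := ukrP u; split. Qed.

Lemma uboundM u v (C D : R) : ubound u C -> ubound v D ->
  ubound (u * v) ((2 + mass J) * (C * D)).
Proof.
move=> hu hv; have C0 := ubound_ge0 hu; have D0 := ubound_ge0 hv.
have [_ bk] := bker_kcomp J (ubound_ukr hu) (ubound_ukr hv).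
have CD : 0 <= C * D by rewrite mulr_ge0.
have m0 := mass_ge0 J; have mCD := mulr_ge0 m0 CD.
case: hu hv => h1 h2 [h3 h4]; split=> [|x y].
  rewrite uscM normrM mulrDl; have : `|usc u| * `|usc v| <= C * D by exact: ler_pM.
  lra.
rewrite ukrM mulrDl; apply: le_trans (ler_normD _ _) _; apply: lerD => //.
apply: le_trans (ler_normD _ _) _; rewrite mulrDl !mul1r.
apply: lerD; rewrite normrM; first exact: ler_pM.
by rewrite mulrC; exact: ler_pM.
Qed.

Lemma ubound_usca (a : R) : ubound (usca a) `|a|.
Proof. by split=> [|x y] //=; rewrite normr0. Qed.

Lemma ubound_uscaM (a C : R) u : ubound u C -> ubound (usca a * u) (`|a| * C).
Proof.
move=> [h1 h2]; split=> [|x y].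
  by rewrite uscM normrM ler_wpM2l.
by rewrite ukr_uscaM normrM ler_wpM2l.
Qed.

Lemma ubound_eq0 u : (forall e : R, 0 < e -> ubound u e) -> u = 0.
Proof.
move=> h; apply: uker_eq => [|x y] /=.
  apply/eqP; rewrite -normr_le0; apply/ler_addgt0Pl => e e0; rewrite addr0.
  by have [] := h e e0.
apply/eqP; rewrite -normr_le0; apply/ler_addgt0Pl => e e0; rewrite addr0.
by have [_] := h e e0.
Qed.

(** Differentiability at 0 with a quadratic remainder, uniform in the arguments of the kernel.
    Asking for a quadratic remainder makes products and inverses a matter of algebra; families with
    bounded second derivatives provide it. *)
Definition udiff (u : R -> uker) (u' : uker) := exists C r : R,
  0 < r /\ forall s, `|s| < r -> ubound (u s - u 0 - usca s * u') (C * s ^+ 2).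

Lemma udiff_lip (u : R -> uker) (u' : uker) : udiff u u' -> exists C r : R,
  [/\ 0 < r, 0 <= C & forall s, `|s| < r -> ubound (u s - u 0) (C * `|s|) /\ ubound (u s) C].
Proof.
move=> [C [r [r0 h]]]; have [D D0 hD] := ubound_ex u'; have [E E0 hE] := ubound_ex (u 0).
pose F := `|C| + D; have F0 : 0 <= F by rewrite addr_ge0.
exists (F + E), (Num.min r 1); split; [by rewrite lt_min r0 ltr01|exact: addr_ge0|].
move=> s; rewrite lt_min => /andP[sr s1].
have b : ubound (u s - u 0) (F * `|s|).
  rewrite -(subrK (usca s * u') (u s - u 0)) mulrDl.
  apply: uboundD; last by rewrite mulrC; exact: ubound_uscaM.
  apply: ubound_le (h s sr) _; rewrite -[s ^+ 2]real_normK ?num_real// expr2 mulrA.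
  apply: (@le_trans _ _ (`|C| * `|s| * `|s|)).
    by rewrite !ler_wpM2r// ler_norm.
  by rewrite ler_piMr ?mulr_ge0// ltW.
split; first by apply: ubound_le b _; rewrite ler_wpM2r// lerDl.
rewrite -(subrK (u 0) (u s)); apply: ubound_le (uboundD b hE) _.
by rewrite lerD2r ler_piMr// ltW.
Qed.

Lemma udiff_cst u : udiff (fun=> u) 0.
Proof.
exists 0, 1; split => // s _; rewrite subrr mulr0 subr0 mul0r.
by split=> [|x y] /=; rewrite normr0.
Qed.

Lemma udiffD (u v : R -> uker) u' v' : udiff u u' -> udiff v v' ->
  udiff (fun s => u s + v s) (u' + v').
Proof.
move=> [C [r [r0 h]]] [D [q [q0 k]]]; exists (C + D), (Num.min r q).
split; first by rewrite lt_min r0.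
move=> s; rewrite lt_min => /andP[sr sq]; rewrite mulrDl.
have -> : u s + v s - (u 0 + v 0) - usca s * (u' + v') =
   (u s - u 0 - usca s * u') + (v s - v 0 - usca s * v').
  by rewrite mulrDr !opprD (addrACA (u s)) [LHS]addrACA.
by apply: uboundD; [exact: h|exact: k].
Qed.

Lemma udiffM (u v : R -> uker) u' v' : udiff u u' -> udiff v v' ->
  udiff (fun s => u s * v s) (u' * v 0 + u 0 * v').
Proof.
move=> hu hv; have [Cu [ru [ru0 Cu0 lu]]] := udiff_lip hu.
have [Cv [rv [rv0 Cv0 lv]]] := udiff_lip hv.
case: hu hv => C [r [r0 h]] [D [q [q0 k]]].
have [E E0 hE] := ubound_ex (u 0); have [F F0 hF] := ubound_ex (v 0).
pose m := 2 + mass J; have m0 : 0 <= m by rewrite addr_ge0// mass_ge0.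
exists (m * (C * F) + m * (E * D) + m * (Cu * Cv)), (Num.min (Num.min r q) (Num.min ru rv)).
split; first by rewrite !lt_min r0 q0 ru0.
move=> s; rewrite !lt_min => /andP[/andP[sr sq] /andP[sru srv]].
have -> : u s * v s - u 0 * v 0 - usca s * (u' * v 0 + u 0 * v') =
    (u s - u 0 - usca s * u') * v 0 + u 0 * (v s - v 0 - usca s * v')
    + (u s - u 0) * (v s - v 0).
  have -> : usca s * (u' * v 0 + u 0 * v') = usca s * u' * v 0 + u 0 * (usca s * v').
    by rewrite mulrDr !mulrA (usca_comm s (u 0)).
  rewrite (mulrBl _ (u s - u 0)) (mulrBl (v 0) (u s)) (mulrBr _ (v s - v 0)) (mulrBr _ (v s)).
  rewrite (mulrBl _ (u s)) !(mulrBr _ (v s)).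
  set a := u s * v s; set b := u s * v 0; set p := u 0 * v s - _; set e := u 0 * v 0.
  set x := _ * v 0; set y := u 0 * (_ * _).
  rewrite (addrACA (b - e) (- x) p (- y)) [RHS]addrAC (addrACA (b - e) p) subrr addr0.
  by rewrite opprD; congr (_ + _); rewrite [RHS]addrC addrA subrK.
rewrite [X in ubound _ X]mulrDl [X in ubound _ (X + _)]mulrDl.
apply: uboundD; first apply: uboundD.
- by apply: ubound_le (uboundM (h s sr) hF) _; rewrite -/m le_eqVlt; apply/orP; left; apply/eqP; ring.
- by apply: ubound_le (uboundM hE (k s sq)) _; rewrite -/m le_eqVlt; apply/orP; left; apply/eqP; ring.
- have [l1 _] := lu s sru; have [l2 _] := lv s srv.
  apply: ubound_le (uboundM l1 l2) _; rewrite -/m -[s ^+ 2]real_normK ?num_real//.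
  by rewrite le_eqVlt; apply/orP; left; apply/eqP; ring.
Qed.

(* [rho] is an inverse of [1 - u] at every [s]; its boundedness near [0]
   follows from the resolvent identity. *)
Lemma udiff_inverse (u rho : R -> uker) u' (q : R) : 0 < q -> udiff u u' ->
  (forall s, `|s| < q -> rho s * (1 - u s) = 1 /\ (1 - u s) * rho s = 1) ->
  udiff rho (rho 0 * u' * rho 0).
Proof.
move=> q0 hu hrho; have [Cu [ru [ru0 Cu0 lu]]] := udiff_lip hu.
case: hu => C [r [r0 h]].
have [E E0 hE] := ubound_ex (rho 0).
have h00 : `|0 : R| < q by rewrite normr0.
have id1 s : `|s| < q -> rho s - rho 0 = rho s * (u s - u 0) * rho 0.
  move=> sq; have [e1 e2] := hrho s sq; have [e3 e4] := hrho 0 h00.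
  have -> : u s - u 0 = (1 - u 0) - (1 - u s) by rewrite opprB [RHS]addrC addrA subrK.
  by rewrite mulrBr e1 mulrBl -mulrA e4 mulr1 mul1r.
have id2 s : `|s| < q -> rho s - rho 0 = rho 0 * (u s - u 0) * rho s.
  move=> sq; have [e1 e2] := hrho s sq; have [e3 e4] := hrho 0 h00.
  have -> : u s - u 0 = (1 - u 0) - (1 - u s) by rewrite opprB [RHS]addrC addrA subrK.
  by rewrite mulrBr e3 mulrBl mul1r -mulrA e2 mulr1.
pose m := 2 + mass J; have m0 : 0 <= m by rewrite addr_ge0// mass_ge0.
pose L := m * (m * (E * Cu)) + 1; have L0 : 0 < L by rewrite ltr_wpDl// !mulr_ge0.
have bnd s : `|s| < q -> `|s| < ru -> `|s| < (2 * L)^-1 -> ubound (rho s) (2 * E).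
  move=> sq sru sL; have [N0' N0 hN] := ubound_ex (rho s).
  have [l1 _] := lu s sru.
  (* For small [s] any bound [K] improves to [E + K / 2], because [rho s - rho 0] is
     [rho 0 * (u s - u 0) * rho s]. Iterated from an arbitrary bound, this leaves [2 * E], which no
     longer depends on [s]. *)
  have step K : ubound (rho s) K -> ubound (rho s) (E + K / 2).
    move=> hK; have K0 := ubound_ge0 hK.
    rewrite -(subrK (rho 0) (rho s)) addrC; apply: uboundD => //; rewrite (id2 s sq).
    apply: ubound_le (uboundM (uboundM hE l1) hK) _; rewrite -/m.
    have -> : m * (m * (E * (Cu * `|s|)) * K) = m * (m * (E * Cu)) * `|s| * K by ring.
    rewrite [K / 2]mulrC ler_wpM2r//.
    apply: (@le_trans _ _ (L * (2 * L)^-1)).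
      by apply: ler_pM; rewrite ?mulr_ge0 ?(ltW sL)// /L lerDl.
    by rewrite invfM mulrCA divff ?gt_eqF// mulr1.
  have it n : ubound (rho s) (2 * E + N0' * 2^-1 ^+ n).
    elim: n => [|n ih]; first by apply: ubound_le hN _; rewrite expr0 mulr1 lerDr mulr_ge0.
    by apply: ubound_le (step _ ih) _; rewrite exprS le_eqVlt; apply/orP; left; apply/eqP; field.
  have lim (a : R) : (forall n, a <= 2 * E + N0' * 2^-1 ^+ n) -> a <= 2 * E.
    move=> ha; apply/ler_addgt0Pr => e e0.
    have [n hn] : exists n, N0' * 2^-1 ^+ n <= e.
      have c : (N0' * 2^-1 ^+ n) @[n --> \oo] --> (0 : R).
        by rewrite -[X in _ --> X](mulr0 N0'); apply: cvgMr; apply: cvg_expr; rewrite ger0_norm// invf_lt1// ltr1n.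
      have /cvgrPdist_le/(_ e e0)[n _ hn] := c.
      exists n; have := hn n (leqnn n); rewrite /= sub0r normrN ger0_norm//.
      by rewrite mulr_ge0// exprn_ge0// invr_ge0.
    by apply: le_trans (ha n) _; rewrite lerD2l.
  split=> [|x y]; apply: lim => n; first by have [] := it n.
  by have [_] := it n.
pose A := m * (m * (m * (m * (2 * E * Cu) * E) * Cu) * E) + m * (m * (E * C) * E).
exists A, (Num.min (Num.min q r) (Num.min ru (2 * L)^-1)).
split; first by rewrite !lt_min q0 r0 ru0 invr_gt0 mulr_gt0.
move=> s; rewrite !lt_min => /andP[/andP[sq sr] /andP[sru sL]].
have [l1 _] := lu s sru.
have -> : rho s - rho 0 - usca s * (rho 0 * u' * rho 0) =
   (rho s - rho 0) * (u s - u 0) * rho 0 + rho 0 * (u s - u 0 - usca s * u') * rho 0.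
  have -> : rho 0 * (u s - u 0 - usca s * u') * rho 0 =
      rho 0 * (u s - u 0) * rho 0 - usca s * (rho 0 * u' * rho 0).
    rewrite [rho 0 * (_ - usca _ * _)]mulrBr [LHS]mulrBl; congr (_ - _).
    by rewrite !mulrA usca_comm.
  rewrite {1}(id1 s sq); set P := u s - u 0.
  by rewrite [(rho s - rho 0) * P]mulrBl [(_ - _ * P) * rho 0]mulrBl addrA subrK.
rewrite [X in ubound _ X]mulrDl; apply: uboundD.
  rewrite (id1 s sq).
  apply: ubound_le (uboundM (uboundM (uboundM (uboundM (bnd s sq sru sL) l1) hE) l1) hE) _.
  rewrite -/m -[s ^+ 2]real_normK ?num_real//.
  by rewrite le_eqVlt; apply/orP; left; apply/eqP; ring.
apply: ubound_le (uboundM (uboundM hE (h s sr)) hE) _; rewrite -/m.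
by rewrite le_eqVlt; apply/orP; left; apply/eqP; ring.
Qed.

Lemma is_derive_of_quadratic (f : R -> R) (df C r : R) : 0 < r ->
  (forall s, `|s| < r -> `|f s - f 0 - s * df| <= C * s ^+ 2) ->
  is_derive (0 : R) (1 : R) f df.
Proof.
move=> r0 h; apply: is_derive_eps => e e0.
have C1 : 0 < `|C| + 1 by rewrite ltr_wpDl.
exists (Num.min r (e / (`|C| + 1))); first by rewrite lt_min r0 divr_gt0.
move=> s; rewrite lt_min => /andP[sr se].
apply: le_trans (h s sr) _; rewrite -[s ^+ 2]real_normK ?num_real// expr2 mulrA.
rewrite ler_wpM2r//; apply: (@le_trans _ _ ((`|C| + 1) * `|s|)).
  by rewrite ler_wpM2r// (le_trans (ler_norm C))// lerDl.
by rewrite mulrC -ler_pdivlMr// ltW.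
Qed.

Lemma is_derive_udiff (u : R -> uker) u' (phi : uker -> R) (D : R) :
  (forall v w, phi (v + w) = phi v + phi w) ->
  (forall (a : R) v, phi (usca a * v) = a * phi v) ->
  (forall v (C : R), ubound v C -> `|phi v| <= D * C) ->
  udiff u u' -> is_derive (0 : R) (1 : R) (fun s => phi (u s)) (phi u').
Proof.
move=> pD pZ pB [C [r [r0 h]]].
apply: (@is_derive_of_quadratic _ _ (D * C) r r0) => s sr.
have pN v : phi (- v) = - phi v.
  by have := pZ (-1) v; rewrite uscaN usca1 !mulN1r.
have := pB _ _ (h s sr).
by rewrite !pD !pN pZ mulrA.
Qed.

End kernel_ring.

Section geometric.
Context {R : realType}.

Lemma geometric_tail (a : R^nat) (D : R) n m : (forall i, `|a i| <= D * 2^-1 ^+ i) ->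
  (n <= m)%N -> `|series a m - series a n| <= 2 * D * 2^-1 ^+ n.
Proof.
move=> ha nm; have D0 : 0 <= D by have := ha 0; rewrite expr0 mulr1; exact: le_trans.
have key k : `|series a (n + k)%N - series a n| <= 2 * D * 2^-1 ^+ n * (1 - 2^-1 ^+ k).
  elim: k => [|k ih]; first by rewrite addn0 subrr normr0 expr0 subrr mulr0.
  rewrite addnS seriesSr.
  have -> : series a (n + k)%N + a (n + k)%N - series a n =
    (series a (n + k)%N - series a n) + a (n + k)%N by ring.
  apply: le_trans (ler_normD _ _) _; apply: le_trans (lerD ih (ha _)) _.
  by rewrite exprD exprS le_eqVlt; apply/orP; left; apply/eqP; field.
rewrite -(subnKC nm); apply: le_trans (key _) _.
by rewrite ler_piMr ?mulr_ge0 ?exprn_ge0 ?invr_ge0// lerBlDr lerDl exprn_ge0// invr_ge0.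
Qed.

Lemma geometric_cvg_eps (D e : R) : 0 < e -> exists n, forall m, (n <= m)%N -> D * 2^-1 ^+ m <= e.
Proof.
move=> e0; have c : (`|D| * 2^-1 ^+ n) @[n --> \oo] --> (0 : R).
  rewrite -[X in _ --> X](mulr0 `|D|); apply: cvgMr; apply: cvg_expr.
  by rewrite ger0_norm ?invr_ge0// invf_lt1// ltr1n.
have /cvgrPdist_le/(_ e e0)[n _ hn] := c.
exists n => m nm; have := hn m nm; rewrite /= sub0r normrN ger0_norm.
  by apply: le_trans; rewrite ler_wpM2r ?exprn_ge0 ?invr_ge0// ler_norm.
by rewrite mulr_ge0// exprn_ge0// invr_ge0.
Qed.

Lemma geometric_cvg (a : R^nat) (D : R) : (forall i, `|a i| <= D * 2^-1 ^+ i) ->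
  series a @ \oo --> limn (series a) /\
  forall n, `|limn (series a) - series a n| <= 2 * D * 2^-1 ^+ n.
Proof.
move=> ha; have c : cvgn (series a).
  apply/cauchy_cvgP/cauchy_seriesP => e e0.
  have [N hN] := geometric_cvg_eps (2 * D) (divr_gt0 e0 (ltr0n _ 2)).
  exists (`[N, +oo[%classic, `[N, +oo[%classic) => /=.
    by split; exists N => // n /= Nn; rewrite in_itv/= andbT.
  move=> [n m] /= [+ _]; rewrite in_itv/= andbT => Nn.
  have [nm|nm] := leqP n m; last by rewrite big_geq ?normr0// ltnW.
  have -> : \sum_(n <= k < m) a k = series a m - series a n by rewrite sub_series_geq.
  apply: le_lt_trans (geometric_tail ha nm) _; apply: le_lt_trans (hN n Nn) _.
  by rewrite ltr_pdivrMr// ltr_pMr// ltr1n.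
split => // n.
apply/ler_addgt0Pr => e e0.
have /cvgrPdist_le/(_ e e0)[k _ hk] := c.
have h1 := hk (maxn k n) (leq_maxl _ _).
have h2 := geometric_tail ha (leq_maxr k n).
have -> : limn (series a) - series a n =
  (series a (maxn k n) - series a n) + (limn (series a) - series a (maxn k n)) by ring.
by apply: le_trans (ler_normD _ _) _; apply: lerD.
Qed.

(** Only a finite partial sum is differentiated. The mean value theorem bounds the tail of the
    increments by [|s|] times a geometric tail, uniformly in [s]. *)
Lemma is_derive_series (c c' : nat -> R -> R) (r D : R) : 0 < r ->
  (forall n s, `|s| < r -> is_derive s (1 : R) (c n) (c' n s)) ->
  (forall n s, `|s| < r -> `|c n s| <= D * 2^-1 ^+ n) ->
  (forall n s, `|s| < r -> `|c' n s| <= D * 2^-1 ^+ n) ->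
  is_derive (0 : R) (1 : R) (fun s => limn (series (fun n => c n s)))
    (limn (series (fun n => c' n 0))).
Proof.
move=> r0 dc bc bc'; apply: is_derive_eps => e e0.
have h00 : `|0 : R| < r by rewrite normr0.
have D0 : 0 <= D by have := bc 0%N 0 h00; rewrite expr0 mulr1; exact: le_trans.
have [N hN] := geometric_cvg_eps (2 * D + 2 * D) (divr_gt0 e0 (ltr0n _ 2)).
have {}hN := hN N (leqnn N).
have dS : is_derive (0 : R) (1 : R) (fun s => series (fun n => c n s) N) (series (fun n => c' n 0) N).
  by apply: is_derive_sum_fun => n; exact: dc.
have [q q0 hq] := is_derive_dist dS (divr_gt0 e0 (ltr0n _ 2)).
exists (Num.min q r); first by rewrite lt_min q0.
move=> s; rewrite lt_min => /andP[sq sr].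
have [c1 _] := geometric_cvg (fun n => bc n s sr).
have [c2 _] := geometric_cvg (fun n => bc n 0 h00).
have [_ t3] := geometric_cvg (fun n => bc' n 0 h00).
have ba n : `|c n s - c n 0| <= D * `|s| * 2^-1 ^+ n.
  have h : forall x : R, `|x - 0| < r -> is_derive x (1 : R) (c n) (c' n x) /\ `|c' n x| <= D * 2^-1 ^+ n.
    by move=> x; rewrite subr0 => xr; split; [exact: dc|exact: bc'].
  by have := lipschitz_derive h; rewrite mulrAC => /(_ s); rewrite subr0; apply.
have [c4 t4] := geometric_cvg ba.
have E4 : limn (series (fun n => c n s - c n 0)) =
    limn (series (fun n => c n s)) - limn (series (fun n => c n 0)).
  apply/cvg_lim => //.
  rewrite (_ : series _ = (fun m => series (fun n => c n s) m - series (fun n => c n 0) m)).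
    exact: cvgB.
  by apply/funext => m; rewrite /series /= sumrB.
have E5 : series (fun n => c n s - c n 0) N = series (fun n => c n s) N - series (fun n => c n 0) N.
  by rewrite /series /= sumrB.
rewrite -E4; set L4 := limn _; set L3 := limn _.
have h3 := t3 N; have h4 := t4 N; have h5 := hq s sq; rewrite E5 in h4.
rewrite -/L3 in h3; rewrite -/L4 in h4.
set A := series _ N - series _ N in h4 h5; set B := series _ N in h3 h5.
have -> : L4 - s * L3 = (L4 - A) - s * (L3 - B) + (A - s * B) by ring.
apply: le_trans (ler_normD _ _) _.
have -> : e * `|s| = e / 2 * `|s| + e / 2 * `|s| by field.
apply: lerD; last by rewrite -[A - _]/(_ - _ - _).
apply: le_trans (ler_normB _ _) _; apply: (@le_trans _ _ ((2 * D + 2 * D) * 2^-1 ^+ N * `|s|)); last first.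
  by rewrite ler_wpM2r.
rewrite mulrDl mulrDl; apply: lerD.
  by apply: le_trans h4 _; rewrite le_eqVlt; apply/orP; left; apply/eqP; ring.
by rewrite normrM mulrC ler_wpM2r.
Qed.

End geometric.

Section fredholm_ring.
Context {R : realType} d (X : measurableType d) (J : @mean R d X).
Local Notation U := (uker_of J).
Implicit Types (k u v : U).

(* [Sum_(j <= n) c_(n - j) k ^ j] for the coefficients [c] of the Fredholm
   determinant of [k]. *)
Fixpoint fe k n : U := if n is n'.+1 then usca J (fc J (ukr k) n'.+1) + k * fe k n' else 1.

(** Multiplying the recursion of [fe] by [k] gives that of [fa] in [faS]. *)
Lemma fe_kernel k (M : R) n : usc k = 0 -> bker (ukr k) M ->
  usc (k * fe k n) = 0 /\ ukr (k * fe k n) = fa J (ukr k) n.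
Proof.
move=> k0 hk; elim: n => [|n [ih1 ih2]].
  have -> : k * fe k 0 = k by exact: mulr1.
  by split=> //; apply/funext => x; apply/funext => y; rewrite fa0.
split; first by rewrite uscM k0 mul0r.
apply/funext => x; apply/funext => y.
rewrite [fe k n.+1]/= mulrDr ukrD -usca_comm ukr_uscaM (faS _ _ _ _ hk); congr (_ + _).
by rewrite ukrM k0 mul0r uscM k0 mul0r mul0r addr0 add0r ih2.
Qed.

Lemma fe_comm k n : k * fe k n = fe k n * k.
Proof.
elim: n => [|n ih] /=; first by rewrite mulr1 mul1r.
by rewrite mulrDr mulrDl usca_comm -mulrA ih.
Qed.

Lemma fe_bound (M : R) : 0 <= M -> exists2 D : R, 0 <= D &
  forall k, usc k = 0 -> bker (ukr k) M -> forall n,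
    ubound (fe k n) (D * 2^-1 ^+ n) /\ `|fc J (ukr k) n| <= D * 2^-1 ^+ n.
Proof.
move=> M0; have [C C0 hC] := fredholm_bound J M0.
exists (2 * C + 1); first by rewrite addr_ge0// mulr_ge0.
move=> k k0 hk n; have p0 j : 0 <= (2^-1 : R) ^+ j by rewrite exprn_ge0// invr_ge0.
split; last first.
  apply: le_trans (hC _ hk n).1 _; rewrite ler_wpM2r//; lra.
case: n => [|n] /=.
  split=> [|x y]; rewrite expr0 mulr1 /= ?normr1 ?normr0; lra.
have [h1 _] := hC _ hk n.+1; have [_ [_ h2]] := hC _ hk n.
have [e1 e2] := fe_kernel n k0 hk.
have q0 := p0 n; have Cq : 0 <= C * 2^-1 ^+ n by rewrite mulr_ge0.
have E : (2 * C + 1) * 2^-1 ^+ n.+1 = C * 2^-1 ^+ n + 2^-1 * 2^-1 ^+ n by rewrite exprS; field.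
split=> [|x y].
  rewrite uscD e1 addr0 [usc _]/=; apply: le_trans h1 _; rewrite E exprS.
  have : C * (2^-1 * 2^-1 ^+ n) = 2^-1 * (C * 2^-1 ^+ n) by ring.
  lra.
rewrite ukrD e2 [ukr _ x y]/= add0r; apply: le_trans (h2 x y) _; rewrite E; lra.
Qed.

Definition fdet k : R := limn (series (fc J (ukr k))).

(** The recursion of [fe] makes [(1 - k) * S_n] telescope to the partial sum of [fc] minus [fe k n].
    In the limit the sum of all [fe] is [fdet k] times an inverse of [1 - k]; it is an analogue of
    the adjugate and exists even if [fdet k] is 0. *)
Lemma fredholm_sum (M : R) : 0 <= M -> exists2 D : R, 0 <= D &
  forall k, usc k = 0 -> bker (ukr k) M -> exists S : U,
   [/\ (1 - k) * S = usca J (fdet k), S * (1 - k) = usca J (fdet k) &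
    forall n, ubound (S - \sum_(i < n) fe k i) (2 * D * 2^-1 ^+ n)].
Proof.
move=> M0; have [D D0 hD] := fe_bound M0; exists D => // k k0 hk.
have hb n := (hD k k0 hk n).1; have hc n := (hD k k0 hk n).2.
have [c0 t0] := geometric_cvg (fun i => (hb i).1 : `|usc (fe k i)| <= _).
have cx x y := geometric_cvg (fun i => (hb i).2 x y : `|ukr (fe k i) x y| <= _).
pose f x y := limn (series (fun i => ukr (fe k i) x y)).
have mser n : measurable_fun setT (fun p : X * X => series (fun i => ukr (fe k i) p.1 p.2) n).
  rewrite /series /=; apply: measurable_sum => i.
  by have [_ [m _]] := ukrP (fe k i).
have hf : bker f (2 * D).
  split.
    apply: (measurable_fun_cvg mser) => p _; exact: (cx p.1 p.2).1.
  move=> x y; have := (cx x y).2 0; rewrite /f /series /= big_geq// subr0 expr0 mulr1.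
  by [].
pose S : U := @UKer _ _ _ J (limn (series (fun i => usc (fe k i)))) f (ex_intro _ _ hf).
have sumE n : usc (\sum_(i < n) fe k i) = series (fun i => usc (fe k i)) n /\
    forall x y, ukr (\sum_(i < n) fe k i) x y = series (fun i => ukr (fe k i) x y) n.
  rewrite /series /=; elim: n => [|n [ih1 ih2]].
    by rewrite big_ord0 !big_geq//; split=> // x y; rewrite big_geq.
  split; first by rewrite big_ord_recr big_nat_recr//= ih1.
  by move=> x y; rewrite big_ord_recr big_nat_recr//= ih2.
have hS n : ubound (S - \sum_(i < n) fe k i) (2 * D * 2^-1 ^+ n).
  have [s1 s2] := sumE n; split=> [|x y].
    by rewrite uscD uscN s1; exact: t0.
  by rewrite ukrD ukrN s2; exact: (cx x y).2.
have [cc tc] := geometric_cvg hc.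
have part n : (1 - k) * (\sum_(i < n) fe k i) = usca J (series (fc J (ukr k)) n.+1) - fe k n.
  elim: n => [|n ih].
    by rewrite big_ord0 mulr0 /series /= big_nat1 fc0 subrr.
  rewrite big_ord_recr /= mulrDr ih [series _ n.+2]seriesSr uscaD.
  by set s := usca J _; set c := usca J _; nring.
have part' n : (\sum_(i < n) fe k i) * (1 - k) = (1 - k) * (\sum_(i < n) fe k i).
  rewrite mulrBl mulrBr mul1r mulr1; congr (_ - _).
  by rewrite mulr_suml mulr_sumr; apply: eq_bigr => i _; rewrite fe_comm.
have [E E0 hE] := ubound_ex (1 - k).
pose m := 2 + mass J; have m0 : 0 <= m by rewrite addr_ge0// mass_ge0.
pose B : R := m * (E * (2 * D)) + D + D.
have small (e : R) : 0 < e -> exists n, B * 2^-1 ^+ n <= e.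
  by move=> /(geometric_cvg_eps B)[n hn]; exists n; exact: hn.
have tail n : ubound (usca J (series (fc J (ukr k)) n.+1) - usca J (fdet k)) (D * 2^-1 ^+ n).
  rewrite -uscaN -uscaD; apply: ubound_le (ubound_usca J _) _.
  by rewrite distrC; apply: le_trans (tc n.+1) _; rewrite exprS le_eqVlt; apply/orP; left; apply/eqP; field.
exists S; split=> //; apply/eqP; rewrite -subr_eq0; apply/eqP; apply: ubound_eq0 => e e0.
- have [n hn] := small e e0; apply: ubound_le hn.
  have -> : (1 - k) * S - usca J (fdet k) = (1 - k) * (S - \sum_(i < n) fe k i)
     - fe k n + (usca J (series (fc J (ukr k)) n.+1) - usca J (fdet k)).
    rewrite (mulrBr (1 - k) S) part.
    by set s := usca J _; set c := usca J _; set p := (1 - k) * S; nring.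
  rewrite /B [X in ubound _ X]mulrDl [X in ubound _ (X + _)]mulrDl; apply: uboundD => //; apply: uboundB; last exact: hb.
  by apply: ubound_le (uboundM hE (hS n)) _; rewrite le_eqVlt; apply/orP; left; apply/eqP; rewrite /m; ring.
- have [n hn] := small e e0; apply: ubound_le hn.
  have -> : S * (1 - k) - usca J (fdet k) = (S - \sum_(i < n) fe k i) * (1 - k)
     - fe k n + (usca J (series (fc J (ukr k)) n.+1) - usca J (fdet k)).
    rewrite (mulrBl (1 - k) S) part' part.
    by set s := usca J _; set c := usca J _; set p := S * (1 - k); nring.
  rewrite /B [X in ubound _ X]mulrDl [X in ubound _ (X + _)]mulrDl; apply: uboundD => //; apply: uboundB; last exact: hb.
  by apply: ubound_le (uboundM (hS n) hE) _; rewrite le_eqVlt; apply/orP; left; apply/eqP; rewrite /m; ring.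
Qed.

(** The trace of the kernel part alone: the multiple of the identity, which has no trace, counts as
    0. Cyclicity survives this convention. *)
Definition utr u : R := J (fun z => ukr u z z).

Let ud u : bmeas (fun z => ukr u z z).
Proof. by have [C _ hC] := ubound_ex u; exact: bker_diag (ubound_ukr hC). Qed.

Lemma utrD u v : utr (u + v) = utr u + utr v.
Proof. by rewrite /utr -meanD. Qed.

Lemma utr_usca (a : R) u : utr (usca J a * u) = a * utr u.
Proof.
by rewrite /utr -mean_scale//; congr (mean_fun J _); apply/funext => z; rewrite ukr_uscaM.
Qed.

Lemma utrN u : utr (- u) = - utr u.
Proof. by have := utr_usca (-1) u; rewrite uscaN usca1 !mulN1r. Qed.

Lemma utr0 : utr 0 = 0.
Proof. by have := utr_usca 0 0; rewrite mulr0 mul0r. Qed.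

Lemma utrMC u v : utr (u * v) = utr (v * u).
Proof.
have [C _ hC] := ubound_ex u; have [D _ hD] := ubound_ex v.
have bu := ubound_ukr hC; have bv := ubound_ukr hD.
have bd (a b : R) : bmeas (fun z => a * ukr u z z + b * ukr v z z).
  exact: (bker_diag (bkerD (bkerZ a bu) (bkerZ b bv))).
have E1 : utr (u * v) = J (fun z => usc v * ukr u z z + usc u * ukr v z z) +
    J (fun z => kcomp J (ukr u) (ukr v) z z).
  rewrite -meanD; [|exact: bd|exact: bker_diag (bker_kcomp J bu bv)].
  by congr (mean_fun J _); apply/funext => z; rewrite ukrM; congr (_ + _); rewrite addrC.
have E2 : utr (v * u) = J (fun z => usc v * ukr u z z + usc u * ukr v z z) +
    J (fun z => kcomp J (ukr v) (ukr u) z z).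
  rewrite -meanD; [|exact: bd|exact: bker_diag (bker_kcomp J bv bu)].
  by congr (mean_fun J _); apply/funext => z; rewrite ukrM.
rewrite E1 E2.
congr (_ + _); rewrite /kcomp (@mean_swap R d X J (fun p => ukr u p.1 p.2 * ukr v p.2 p.1)).
  by congr (mean_fun J _); apply/funext => z; congr (mean_fun J _); apply/funext => w; rewrite mulrC.
have [mu_ hu] := bu; have [mv hv] := bv; split.
  apply: measurable_funM => //.
  exact: (measurable_fun_comp2 mv measurable_snd measurable_fst).
by exists (C * D) => p; rewrite normrM; apply: ler_pM.
Qed.

Lemma utr_bound u (C : R) : ubound u C -> `|utr u| <= mass J * C.
Proof. by move=> [_ h]; apply: mean_bound. Qed.

Lemma fc_trace k (M : R) n : usc k = 0 -> bker (ukr k) M ->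
  n.+1%:R * fc J (ukr k) n.+1 = - utr (k * fe k n).
Proof. by move=> k0 hk; rewrite (fcS _ _ hk) /utr (fe_kernel n k0 hk).2. Qed.

(* [Sum_(j < n) e_(n-1-j) (k ^ (m+j) - tr k ^ (m+j))] for [e = fe k]; the
   identity [n e_n = newton n 1] is Newton's. *)
Fixpoint newton k n m : U :=
  if n is n'.+1 then fe k n' * (k ^+ m - usca J (utr (k ^+ m))) + newton k n' m.+1 else 0.

(** The definition adds one power of [k] at a time. This form, a consequence of the recursion of
    [fe], multiplies the shorter sum by [k] instead and is the one on which Newton's identity
    inducts. *)
Lemma newtonS k n m : newton k n.+1 m =
  k ^+ m * fe k n - usca J (utr (k ^+ m * fe k n)) + k * newton k n m.
Proof.
elim: n m => [|n ih] m; first by rewrite /= mulr1 mul1r mulr0.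
have ck : k ^+ m * fe k n = fe k n * k ^+ m.
  elim: m => [|m ih']; first by rewrite expr0 mul1r mulr1.
  by rewrite exprS -mulrA ih' mulrA fe_comm -mulrA.
change (newton k n.+2 m) with
  (fe k n.+1 * (k ^+ m - usca J (utr (k ^+ m))) + newton k n.+1 m.+1).
rewrite ih.
change (newton k n.+1 m) with
  (fe k n * (k ^+ m - usca J (utr (k ^+ m))) + newton k n m.+1).
rewrite [fe k n.+1]/=; set c := fc J _ _; set s := usca J (utr (k ^+ m)).
have -> : utr (k ^+ m * (usca J c + k * fe k n)) = c * utr (k ^+ m) + utr (k ^+ m.+1 * fe k n).
  by rewrite mulrDr utrD -usca_comm utr_usca mulrA -exprSr.
rewrite uscaD uscaM -/s [in RHS]mulrDr -usca_comm (mulrA (k ^+ m)) -exprSr.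
have e1 : k * (fe k n * (k ^+ m - s)) = k ^+ m.+1 * fe k n - s * (k * fe k n).
  by rewrite mulrBr -ck mulrBr (mulrA k) -exprS -usca_comm (mulrA k) -usca_comm -mulrA.
have e2 : (usca J c + k * fe k n) * (k ^+ m - s) = usca J c * k ^+ m + k ^+ m.+1 * fe k n
   - usca J c * s - s * (k * fe k n).
  have sc w : s * w = w * s by exact: usca_comm.
  rewrite mulrBr !mulrDl -(mulrA k) -ck (mulrA k (k ^+ m)) -exprS -(sc (k * fe k n)).
  by set q := usca J c; set w := k * _; set z := k ^+ m.+1 * _; set y := q * _; nring.
rewrite (mulrDr k) e1 e2.
by set a := k ^+ m.+1 * _; set b := usca J c * _; set x := s * (_ * _); set y := k * newton _ _ _;
  set z := usca J (utr _); set w := usca J c * s; nring.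
Qed.

Lemma newtonE k (M : R) n : usc k = 0 -> bker (ukr k) M ->
  newton k n 1 = usca J n%:R * fe k n.
Proof.
move=> k0 hk; elim: n => [|n ih]; first by rewrite usca0 mul0r.
rewrite newtonS ih expr1 -[n.+1%:R]natr1 uscaD usca1.
have -> : utr (k * fe k n) = - (n.+1%:R * fc J (ukr k) n.+1) by rewrite (fc_trace n k0 hk) opprK.
rewrite uscaN uscaM -[n.+1%:R]natr1 uscaD usca1 [fe k n.+1]/=.
rewrite (mulrA k) -(usca_comm n%:R k).
by set a := usca J n%:R; set c := usca J (fc _ _ _); nring.
Qed.

(* The derivatives of [fe k n] and [fc J (ukr k) n] along a direction [k']. *)
Fixpoint dfe k k' n : U * R :=
  if n is n'.+1 then
    let c' := - (utr (k' * fe k n') + utr (k * (dfe k k' n').1)) / n'.+1%:R in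
    (usca J c' + (k' * fe k n' + k * (dfe k k' n').1), c')
  else (0, 0).

(** A direction [k'] need not commute with [k], but under the trace it can be rotated to the front.
    What it then multiplies is a Newton sum, and Newton's identity reduces this sum to [fe k n]. *)
Lemma dfe_trace k (M : R) k' n : usc k = 0 -> bker (ukr k) M ->
  (dfe k k' n.+1).2 = - utr (k' * fe k n).
Proof.
move=> k0 hk; elim/ltn_ind: n => n ih.
have ck i m : k ^+ m * fe k i = fe k i * k ^+ m.
  elim: m => [|m ih']; first by rewrite expr0 mul1r mulr1.
  by rewrite exprS -mulrA ih' mulrA fe_comm -mulrA.
have key j m : (j <= n)%N -> utr (k ^+ m * (dfe k k' j).1) = utr (k' * newton k j m).
  elim: j m => [|j ihj] m jn; first by rewrite /= !mulr0.
  have c'E := ih j jn.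
  change (dfe k k' j.+1).1 with (usca J (dfe k k' j.+1).2 + (k' * fe k j + k * (dfe k k' j).1)).
  rewrite c'E [newton _ _ _]/= !mulrDr !utrD (mulrA (k ^+ m) k) -exprSr ihj ?(ltnW jn)// addrA.
  congr (_ + _); rewrite [utr (k ^+ m * (k' * _))]utrMC -(mulrA k') -usca_comm utr_usca.
  rewrite addrC; congr (_ + _).
  by rewrite mulrN mulrN utrN -usca_comm mulrA -usca_comm -mulrA utr_usca mulNr mulrC.
have := key n 1%N (leqnn n); rewrite expr1 (newtonE n k0 hk) => h.
rewrite /= h mulrA -usca_comm -mulrA utr_usca -natr1.
have n0 : n.+1%:R != 0 :> R by rewrite pnatr_eq0.
by rewrite -natr1 in n0 *; field.
Qed.

Definition qdiff (c : R -> R) (c' : R) := exists C r : R,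
  0 < r /\ forall s, `|s| < r -> `|c s - c 0 - s * c'| <= C * s ^+ 2.

Lemma udiff_usca (c : R -> R) (c' : R) : qdiff c c' -> udiff (fun s => usca J (c s)) (usca J c').
Proof.
move=> [C [r [r0 h]]]; exists C, r; split => // s sr.
rewrite -uscaM -!uscaN -!uscaD.
by split=> [|x y] /=; [exact: h|rewrite normr0; exact: le_trans (normr_ge0 _) (h s sr)].
Qed.

Lemma qdiff_utr (u : R -> U) u' : udiff u u' -> qdiff (fun s => utr (u s)) (utr u').
Proof.
move=> [C [r [r0 h]]]; exists (mass J * C), r; split => // s sr.
rewrite -utr_usca -!utrN -!utrD -mulrA; exact: utr_bound (h s sr).
Qed.

Lemma qdiff_scale (a : R) (c : R -> R) (c' : R) : qdiff c c' -> qdiff (fun s => a * c s) (a * c').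
Proof.
move=> [C [r [r0 h]]]; exists (`|a| * C), r; split => // s sr.
have -> : a * c s - a * c 0 - s * (a * c') = a * (c s - c 0 - s * c') by ring.
by rewrite normrM -mulrA ler_wpM2l// h.
Qed.

Lemma qdiff_near (c e : R -> R) (c' r : R) : 0 < r -> (forall s, `|s| < r -> c s = e s) ->
  qdiff c c' -> qdiff e c'.
Proof.
move=> r0 ce [C [q [q0 h]]]; exists C, (Num.min q r); split; first by rewrite lt_min q0.
move=> s; rewrite lt_min => /andP[sq sr]; rewrite -!ce ?normr0//; exact: h.
Qed.

Lemma udiff_fe (k : R -> U) k' (r M : R) n : 0 < r ->
  (forall s, `|s| < r -> usc (k s) = 0 /\ bker (ukr (k s)) M) -> udiff k k' ->
  udiff (fun s => fe (k s) n) (dfe (k 0) k' n).1 /\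
  qdiff (fun s => fc J (ukr (k s)) n) (dfe (k 0) k' n).2.
Proof.
move=> r0 hk dk; elim: n => [|n [ih1 ih2]].
  split; first exact: udiff_cst.
  by exists 0, 1; split => // s _; rewrite !fc0 subrr mulr0 subr0 normr0 mul0r.
have dkf := udiffM dk ih1.
have q : qdiff (fun s => fc J (ukr (k s)) n.+1) (dfe (k 0) k' n.+1).2.
  have := qdiff_scale (- n.+1%:R^-1) (qdiff_utr dkf).
  rewrite utrD /= mulrC mulrN -mulNr; apply: (qdiff_near r0) => s sr.
  have [k0 hM] := hk s sr; have := fc_trace n k0 hM.
  rewrite mulNr -mulrN => <-; rewrite mulrA mulVf ?mul1r// pnatr_eq0.
split => //; exact: udiffD (udiff_usca q) dkf.
Qed.

Lemma is_derive_qdiff (c : R -> R) (c' : R) : qdiff c c' -> is_derive (0 : R) (1 : R) c c'.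
Proof. by move=> [C [r [r0 h]]]; exact: (is_derive_of_quadratic r0 h). Qed.

(** Jacobi's formula, with [S] in the role of the adjugate: the coefficient of order [n + 1] has
    derivative [- utr (k' * fe k n)], and the geometric bounds allow the series to be differentiated
    term by term. *)
Lemma is_derive_fdet (k k' : R -> U) (r M : R) (S : U) (D : R) : 0 < r ->
  (forall s, `|s| < r -> usc (k s) = 0 /\ bker (ukr (k s)) M) ->
  (forall a, `|a| < r -> udiff (fun s => k (a + s)) (k' a) /\ ubound (k' a) M) ->
  (forall n, ubound (S - \sum_(i < n) fe (k 0) i) (2 * D * 2^-1 ^+ n)) ->
  is_derive (0 : R) (1 : R) (fun s => fdet (k s)) (- utr (k' 0 * S)).
Proof.
move=> r0 hk hk' hS.
have h00 : `|0 : R| < r by rewrite normr0.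
have M0 : 0 <= M := ubound_ge0 (hk' 0 h00).2.
have [E E0 hE] := fe_bound M0.
pose c n s := fc J (ukr (k s)) n.
pose m := 2 + mass J; have m0 : 0 <= m by rewrite addr_ge0// mass_ge0.
pose B := mass J * (m * (M * E)) * 2; have B0 : 0 <= B by rewrite !mulr_ge0 ?mass_ge0.
pose c' n s := if n is n'.+1 then - utr (k' s * fe (k s) n') else 0.
have dc n s : `|s| < r -> is_derive s (1 : R) (c n) (c' n s).
  move=> sr.
  have hks q : `|q| < r - `|s| -> usc (k (s + q)) = 0 /\ bker (ukr (k (s + q))) M.
    by move=> qr; apply: hk; apply: le_lt_trans (ler_normD _ _) _; rewrite addrC -ltrBrDr.
  have r0' : 0 < r - `|s| by rewrite subr_gt0.
  have [_ q] := @udiff_fe (fun q => k (s + q)) (k' s) _ M n r0' hks (hk' s sr).1.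
  have d1 := is_derive_qdiff q.
  have -> : c' n s = (dfe (k (s + 0)) (k' s) n).2.
    case: n {q d1} => [//|n]; have [e1 e2] := hk s sr; rewrite addr0.
    by rewrite (dfe_trace _ _ e1 e2).
  have -> : c n = fun y => fc J (ukr (k (s + (y - s)))) n by apply/funext => y; rewrite addrC subrK.
  have sh : is_derive s (1 : R) (fun y : R => y - s) 1.
    by have := is_deriveB_fun (is_derive_id s (1 : R)) (is_derive_cst s s (1 : R)); rewrite subr0.
  have d2 : is_derive (s - s) (1 : R) (fun q => fc J (ukr (k (s + q))) n) (dfe (k (s + 0)) (k' s) n).2.
    by rewrite subrr.
  by have := @is_derive_comp_fun R (fun q => fc J (ukr (k (s + q))) n) (fun y : R => y - s) s _ _ d2 sh;
    rewrite mulr1.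
have bc n s : `|s| < r -> `|c' n s| <= B * 2^-1 ^+ n.
  move=> sr; case: n => [|n] /=; first by rewrite normr0 mulr_ge0 ?exprn_ge0 ?invr_ge0.
  rewrite normrN; apply: le_trans (utr_bound (uboundM (hk' s sr).2 ((hE _ (hk s sr).1 (hk s sr).2 n).1))) _.
  by rewrite -/m /B exprS le_eqVlt; apply/orP; left; apply/eqP; field.
have bk n s : `|s| < r -> `|c n s| <= E * 2^-1 ^+ n.
  by move=> sr; exact: (hE _ (hk s sr).1 (hk s sr).2 n).2.
have sumc' : limn (series (fun n => c' n 0)) = - utr (k' 0 * S).
  have [cv tv] := geometric_cvg (fun n => bc n 0 h00).
  apply/eqP; rewrite -subr_eq0 -normr_eq0 eq_le normr_ge0 andbT; apply/ler_addgt0Pr => e e0.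
  have serE n : series (fun n => c' n 0) n.+1 = - utr (k' 0 * (\sum_(i < n) fe (k 0) i)).
    rewrite /series /= big_nat_recl//= add0r big_mkord mulr_sumr.
    elim: n => [|n ih]; first by rewrite !big_ord0 utr0 oppr0.
    by rewrite !big_ord_recr /= ih utrD opprD.
  pose B' := B + mass J * (m * (M * (2 * D))).
  have [n hn] := geometric_cvg_eps B' e0; have {}hn := hn n (leqnn n).
  have h1 := tv n.+1; rewrite serE in h1.
  have h2 := utr_bound (uboundM (hk' 0 h00).2 (hS n)).
  rewrite mulrBr utrD utrN in h2.
  set L := limn _ in h1 *; set a := utr (k' 0 * S) in h2 *; set b := utr _ in h1 h2.
  have -> : L - - a = (L - - b) + (a - b) by ring.
  rewrite add0r; apply: le_trans hn; apply: le_trans (ler_normD _ _) _.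
  rewrite /B' mulrDl; apply: lerD.
    by apply: le_trans h1 _; rewrite exprS le_eqVlt; apply/orP; left; apply/eqP; field.
  by apply: le_trans h2 _; rewrite -/m le_eqVlt; apply/orP; left; apply/eqP; ring.
rewrite -sumc'; apply: (@is_derive_series _ c c' r (E + B) r0 dc) => n s sr.
  apply: le_trans (bk n s sr) _; rewrite ler_wpM2r ?exprn_ge0 ?invr_ge0//; lra.
apply: le_trans (bc n s sr) _; rewrite ler_wpM2r ?exprn_ge0 ?invr_ge0//; lra.
Qed.

End fredholm_ring.

(** * Brownian motion and hitting times *)

Section gaussian.
Context {R : realType}.
Local Notation mu := (@lebesgue_measure R).

Lemma ge0_integral_normal_prob (m s : R) (f : R -> \bar R) :
  measurable_fun setT f -> (forall x, (0 <= f x)%E) ->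
  (\int[normal_prob m s]_x f x = \int[mu]_x (f x * (normal_pdf m s x)%:E))%E.
Proof.
move=> mf f0; pose nu := @normal_prob R m s.
have dom : nu `<< mu by exact: normal_prob_dominates.
rewrite -(Radon_Nikodym_SigmaFinite.change_of_variables dom)//.
have hint := Radon_Nikodym_SigmaFinite.f_integrable dom.
apply: ae_eq_integral => //.
- by apply: emeasurable_funM => //; exact: (measurable_int mu).
- by apply: emeasurable_funM => //; apply/measurableT_comp => //; exact: measurable_normal_pdf.
- apply: ae_eqe_mul2l; apply: integral_ae_eq => //=.
  + by apply/measurableT_comp => //; exact: measurable_normal_pdf.
  + by move=> E _ mE; rewrite -Radon_Nikodym_SigmaFinite.f_integral.
Qed.

(** By [th * |x| <= th^2 s^2 + x^2 / (4 s^2)] the integrand is at most a multiple of the normal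
    density of twice the variance; the change of normalisation costs [Num.sqrt 2]. *)
Lemma normal_exp_moment (s th : R) : 0 < s ->
  (\int[normal_prob 0 s]_x (expR (th * `|x|))%:E <= (Num.sqrt 2 * expR (th ^+ 2 * s ^+ 2))%:E)%E.
Proof.
move=> s0; have s1 : s != 0 by rewrite gt_eqF.
have q0 : 0 < Num.sqrt 2 :> R by rewrite sqrtr_gt0.
have qq : Num.sqrt 2 ^+ 2 = 2 :> R by rewrite sqr_sqrtr.
have mexp : measurable_fun setT (fun x : R => (expR (th * `|x|))%:E).
  apply/measurable_EFinP; apply: measurableT_comp; first exact: measurable_expR.
  by apply: measurable_funM => //; exact: normr_measurable.
rewrite ge0_integral_normal_prob => //.
have s21 : s * Num.sqrt 2 != 0 by rewrite mulf_neq0// gt_eqF.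
have <- : (\int[mu]_x ((Num.sqrt 2 * expR (th ^+ 2 * s ^+ 2))%:E * (normal_pdf 0 (s * Num.sqrt 2) x)%:E))%E =
    (Num.sqrt 2 * expR (th ^+ 2 * s ^+ 2))%:E.
  rewrite ge0_integralZl//.
  - by rewrite integral_normal_pdf mule1.
  - by apply/measurable_EFinP; exact: measurable_normal_pdf.
  - by move=> x _; rewrite lee_fin normal_pdf_ge0.
apply: ge0_le_integral => //.
- by move=> x _; rewrite -EFinM lee_fin mulr_ge0 ?expR_ge0 ?normal_pdf_ge0.
- by apply: emeasurable_funM => //; apply/measurable_EFinP; exact: measurable_normal_pdf.
- apply: emeasurable_funM => //; apply/measurable_EFinP; exact: measurable_normal_pdf.
move=> x _; rewrite -!EFinM lee_fin !normal_pdfE// /normal_fun /normal_peak !subr0.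
have -> : Num.sqrt ((s * Num.sqrt 2) ^+ 2 * pi *+ 2) = Num.sqrt 2 * Num.sqrt (s ^+ 2 * pi *+ 2) :> R.
  by rewrite exprMn qq -sqrtrM//; congr Num.sqrt; move: (pi : R) => c; ring.
have -> : Num.sqrt 2 * expR (th ^+ 2 * s ^+ 2) * ((Num.sqrt 2 * Num.sqrt (s ^+ 2 * pi *+ 2))^-1 *
   expR (- x ^+ 2 / ((s * Num.sqrt 2) ^+ 2 *+ 2))) =
   (Num.sqrt (s ^+ 2 * pi *+ 2))^-1 * (expR (th ^+ 2 * s ^+ 2) * expR (- x ^+ 2 / ((s * Num.sqrt 2) ^+ 2 *+ 2))).
  rewrite invfM; set a := expR _; set b := expR _; move: (Num.sqrt (s ^+ 2 * pi *+ 2))^-1 => c.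
  by field; rewrite gt_eqF.
rewrite mulrCA ler_wpM2l ?invr_ge0 ?sqrtr_ge0// -!expRD ler_expR.
have xE : x ^+ 2 = `|x| ^+ 2 by rewrite real_normK// num_real.
rewrite exprMn qq -(mulr_natl (s ^+ 2)) -(mulr_natl (s ^+ 2 * 2)) xE; move: `|x| => a.
have -> : - a ^+ 2 / (2%:R * (s ^+ 2 * 2)) = - a ^+ 2 / (2%:R * s ^+ 2) + (a / (2 * s)) ^+ 2 by field; rewrite s1.
rewrite addrC addrCA lerD2l -subr_ge0.
have -> : th ^+ 2 * s ^+ 2 + (a / (2 * s)) ^+ 2 - th * a = (th * s - a / (2 * s)) ^+ 2 by field; rewrite s1.
exact: sqr_ge0.
Qed.

End gaussian.

Section brownian.
Context {R : realType} d (W : measurableType d) (P : probability W R) (B : R -> W -> R).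
Hypothesis hB : brownian2 P B.

Lemma brownian_exp_moment (s s' th : R) : 0 <= s -> s <= s' ->
  (\int[P]_w (expR (th * `|B s' w - B s w|))%:E <= (2 * expR (th ^+ 2 * (2 * (s' - s))))%:E)%E.
Proof.
move=> s0; rewrite le_eqVlt => /predU1P[<-|ss].
  under eq_integral do rewrite subrr normr0 mulr0 expR0.
  rewrite integral_cst//= probability_setT mule1 subrr !mulr0 expR0 mulr1 lee_fin ler1n//.
have s0' : 0 <= s' by apply: le_trans s0 (ltW ss).
have mX : measurable_fun setT ((fun w => B s' w - B s w) : W -> measurableTypeR R).
  by apply: measurable_funB; apply: (brownian2_measurable hB).
pose X : {mfun W >-> measurableTypeR R} := @mfun_Sub _ _ W (measurableTypeR R) _ (mem_set mX).
pose nu : measure (measurableTypeR R) R := pushforward P X.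
have v0 : 0 < 2 * (s' - s) by rewrite mulr_gt0// subr_gt0.
(* [brownian2_increments] expects an infinite strictly increasing sequence of times, of which only
   the first increment is used. *)
pose u (i : nat) : R := if i is i'.+1 then s' + i'%:R else s.
have law : forall A, measurable A -> A `<=` setT -> nu mX A = normal_prob 0 (Num.sqrt (2 * (s' - s))) A.
  move=> A mA _.
  have := brownian2_increments hB 1 (s := u) (A := fun=> A) s0 _ (fun=> mA).
  rewrite big_ord1 /u /= addr0 => <-.
    rewrite /nu /pushforward /=; congr (P _); apply/seteqP; split=> [w h i|w h] /=.
      by rewrite ltnS leqn0 => /eqP ->; rewrite /= addr0.
    by have := h 0%N; rewrite /= addr0; exact.
  case=> [|i] /=; first by rewrite addr0.
  by rewrite ltrD2l ltr_nat.
have mexp : measurable_fun setT (fun x : R => (expR (th * `|x|))%:E).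
  apply/measurable_EFinP; apply: measurableT_comp; first exact: measurable_expR.
  by apply: measurable_funM => //; exact: normr_measurable.
have -> : (\int[P]_w (expR (th * `|B s' w - B s w|))%:E =
    \int[normal_prob 0 (Num.sqrt (2 * (s' - s)))]_x (expR (th * `|x|))%:E)%E.
  transitivity (\int[nu mX]_x (expR (th * `|x|))%:E)%E; last first.
    exact: (@eq_measure_integral _ _ _ setT (normal_prob 0 (Num.sqrt (2 * (s' - s)))) (nu mX) _ law).
  by rewrite /nu ge0_integral_pushforward// => x _; rewrite lee_fin expR_ge0.
apply: le_trans (normal_exp_moment th _) _; first by rewrite sqrtr_gt0.
rewrite lee_fin (sqr_sqrtr (ltW v0)); apply: ler_wpM2r; first exact: expR_ge0.
by rewrite -[leRHS]ger0_norm// -sqrtr_sqr ler_sqrt// expr2 ler_peMl// ler1n.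
Qed.

(** Level 0 carries the increment from 0 to the integer [j]; level [n + 1] carries the left half of
    the [j]-th dyadic interval of length [2^-n]. *)
Definition chain_start (n j : nat) : R := if n is n'.+1 then j%:R / 2 ^+ n' else 0.
Definition chain_stop (n j : nat) : R := if n is n'.+1 then j%:R / 2 ^+ n' + 2^-1 ^+ n else j%:R.

Lemma chain_start_ge0 n j : 0 <= chain_start n j.
Proof. by case: n => [|n] //=; rewrite divr_ge0// exprn_ge0. Qed.

Lemma chain_start_stop n j : chain_start n j <= chain_stop n j.
Proof. by case: n => [|n] //=; rewrite lerDl exprn_ge0// invr_ge0. Qed.

(* The telescoping step of the dyadic approximations of s, of which the one of
   level n stops at [chain_stop n j] or is trivial. *)
Lemma dyadic_step (b : R -> R) (s : R) n : b 0 = 0 -> 0 <= s ->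
  let t := fun n => (Num.truncn (s * 2 ^+ n))%:R / 2 ^+ n in
  let D := b (t n) - (if n is n'.+1 then b (t n') else 0) in
  D = 0 \/ exists j, D = b (chain_stop n j) - b (chain_start n j) /\ j%:R / 2 ^+ n.-1 <= s.
Proof.
move=> b0 s0 /=; case: n => [|n] /=.
  right; exists (Num.truncn (s * 2 ^+ 0)); rewrite !expr0 divr1 mulr1 b0; split=> //.
  by have /andP[] := truncn_itv s0.
have p0 m : 0 < 2 ^+ m :> R by rewrite exprn_gt0.
have sp m : 0 <= s * 2 ^+ m by rewrite mulr_ge0// ltW.
set k := Num.truncn (s * 2 ^+ n).
have /andP[k1 k2] := truncn_itv (sp n); rewrite -/k in k1 k2.
have ks : k%:R / 2 ^+ n <= s by rewrite ler_pdivrMr.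
have [h|h] := ltP (s * 2 ^+ n.+1) (k.*2.+1)%:R.
  left; have -> : Num.truncn (s * 2 ^+ n.+1) = k.*2.
    apply: truncn_def; rewrite h andbT -muln2 natrM exprS.
    by rewrite (_ : s * (2 * 2 ^+ n) = s * 2 ^+ n * 2) ?ler_wpM2r//; ring.
  rewrite -muln2 natrM exprS; apply/eqP; rewrite subr_eq0; apply/eqP; congr b.
  by field; rewrite gt_eqF.
right; exists k; split=> //; congr (b _ - _).
have -> : Num.truncn (s * 2 ^+ n.+1) = k.*2.+1.
  apply: truncn_def; rewrite h /=; move: k2; rewrite -(ltr_pM2r (p0 1%N)) expr1 -mulrA -exprSr => k2.
  by apply: lt_le_trans k2 _; rewrite -natrM ler_nat muln2 doubleS.
rewrite -[k.*2.+1]addn1 natrD -muln2 natrM mulrDl mul1r exprVn; congr (_ + _).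
by rewrite exprS; field; rewrite gt_eqF.
Qed.

(** The ratio 7/5 lies between two constraints. Against the weights [4^-1 * (3/4)^n] of the chaining
    it must grow, and 7/5 times 3/4 is 21/20; squared against the variance of level [n] it must not,
    and 49/25 times 1/2 is 49/50. The 8 cancels the 1/4 and a further 1/2, and 40 makes
    [(nu + 40) * (1 + n / 20)] exceed [nu + 2 n]. *)
Definition chain_scale (nu : R) (n : nat) : R := 8 * (nu + 40) * (7 / 5) ^+ n.

Lemma chain_scale_weight (nu : R) n : 0 <= nu ->
  nu + n%:R *+ 2 <= chain_scale nu n * (4^-1 * (3 / 4) ^+ n) / 2.
Proof.
move=> nu0.
have -> : chain_scale nu n * (4^-1 * (3 / 4) ^+ n) / 2 = (nu + 40) * (21 / 20) ^+ n.
  rewrite /chain_scale (_ : 21 / 20 = 7 / 5 * (3 / 4) :> R) ?exprMn; last by field.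
  by move: (_ ^+ n) (_ ^+ n) => a b; field.
have h : 1 + n%:R / 20 <= (21 / 20) ^+ n :> R.
  elim: n => [|n ih]; first by rewrite expr0 mul0r addr0.
  rewrite exprS; apply: (@le_trans _ _ (21 / 20 * (1 + n%:R / 20))); last by rewrite ler_wpM2l// divr_ge0.
  have n0 : 0 <= n%:R :> R by [].
  by rewrite -natr1; lra.
apply: (@le_trans _ _ ((nu + 40) * (1 + n%:R / 20))); last by rewrite ler_wpM2l// addr_ge0.
have n0 : 0 <= n%:R :> R by [].
have : 0 <= nu * n%:R by rewrite mulr_ge0.
by rewrite -mulr_natl; lra.
Qed.

(** The weights [w n] sum to 1. If the increment of every level [n] were at most [w n * a / 2], all
    dyadic approximations would stay below [a / 2], against continuity at [s]. So a single increment
    controls [b s]; the condition [1 <= a] pays for the factor [expR (- 2 n)]. *)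
Lemma chaining (nu : R) (b : R -> R) (s : R) : 0 <= nu -> b 0 = 0 -> 0 <= s ->
  {within `[0, +oo[, continuous b} -> 1 <= `|b s| ->
  exists n j, j%:R / 2 ^+ n.-1 <= s /\
    expR (nu * `|b s|) <=
    expR (- (n%:R *+ 2)) * expR (chain_scale nu n * `|b (chain_stop n j) - b (chain_start n j)|).
Proof.
move=> nu0 b0 s0 cb; set a : R := `|b s|; move=> b1.
have a0 : 0 < a by apply: lt_le_trans b1.
pose t n := (Num.truncn (s * 2 ^+ n))%:R / 2 ^+ n : R.
pose D n := b (t n) - (if n is n'.+1 then b (t n') else 0).
pose w n : R := 4^-1 * (3 / 4) ^+ n.
have p0 m : 0 < 2 ^+ m :> R by rewrite exprn_gt0.
have [[n hn]|hD] := pselect (exists n, w n * (a / 2) < `|D n|).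
  have [D0|[j [Dj js]]] := dyadic_step n b0 s0.
    move: hn; rewrite /D D0 normr0 ltNge mulr_ge0// ?mulr_ge0 ?divr_ge0// ?invr_ge0// ?exprn_ge0 ?divr_ge0//.
    exact: ltW.
  exists n, j; split=> //; rewrite -expRD ler_expR -Dj -/(D n).
  have c0 : 0 <= chain_scale nu n by rewrite /chain_scale !mulr_ge0 ?addr_ge0// exprn_ge0// divr_ge0.
  have h1 : chain_scale nu n * (w n * (a / 2)) <= chain_scale nu n * `|D n| by rewrite ler_wpM2l// ltW.
  have h2 := ler_wpM2r (ltW a0) (chain_scale_weight n nu0).
  have h3 : n%:R *+ 2 * 1 <= n%:R *+ 2 * a :> R by rewrite ler_wpM2l// mulrn_wge0.
  have h4 : chain_scale nu n * (w n * (a / 2)) = chain_scale nu n * w n / 2 * a by ring.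
  by move: h1 h2 h3; rewrite h4 /w mulrDl; lra.
exfalso.
have tel N : b (t N) = \sum_(n < N.+1) D n.
  elim: N => [|N ih]; first by rewrite big_ord1 /D subr0.
  by rewrite big_ord_recr /= -ih /D addrC subrK.
have geo N : \sum_(n < N.+1) w n = 1 - (3 / 4) ^+ N.+1.
  elim: N => [|N ih]; first by rewrite big_ord1 /w expr0 expr1; field.
  by rewrite big_ord_recr /= ih /w !exprS; move: (_ ^+ N) => x; field.
have bd N : `|b (t N)| <= a / 2.
  rewrite tel; apply: le_trans (ler_norm_sum _ _ _) _.
  apply: (@le_trans _ _ (\sum_(n < N.+1) w n * (a / 2))).
    by apply: ler_sum => n _; rewrite leNgt; apply/negP => h; apply: hD; exists n.
  rewrite -mulr_suml geo ler_piMl ?divr_ge0 ?ltW// lerBlDr lerDl exprn_ge0//.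
have t0 n : 0 <= t n by rewrite divr_ge0// ltW.
have ct : t n @[n --> \oo] --> s.
  apply/cvgrPdist_le => e e0; have [N hN] := geometric_cvg_eps 1 e0; near=> n.
  have /andP[k1 k2] := truncn_itv (mulr_ge0 s0 (ltW (p0 n))).
  have t1 : t n <= s by rewrite ler_pdivrMr.
  rewrite ger0_norm ?subr_ge0// lerBlDr; apply: (@le_trans _ _ ((Num.truncn (s * 2 ^+ n)).+1%:R / 2 ^+ n)).
    by rewrite ler_pdivlMr// ltW.
  rewrite -natr1 mulrDl addrC lerD2r -exprVn; apply: hN; near: n; exact: nbhs_infty_ge.
have cbt : b (t n) @[n --> \oo] --> b s.
  move: cb => /continuous_within_itvcyP[cr cl].
  have [s00|s00] := eqVneq s 0.
    suff -> : (fun n => b (t n)) = cst (b s) by exact: cvg_cst.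
    by apply/funext => n; rewrite /t s00 mul0r truncn0 mul0r.
  apply: (cvg_comp t b ct); apply: cr; rewrite in_itv /= andbT lt_neqAle eq_sym s00//.
have : a <= a / 2.
  have h : `|b (t n)| @[n --> \oo] --> a by exact: cvg_norm.
  rewrite -[leLHS](cvg_lim _ h)//; apply: limr_le; first by apply: cvgP h.
  exact: nearW.
by rewrite -subr_ge0; lra.
Unshelve. all: by end_near.
Qed.

Definition chain_term (nu lam : R) (n j : nat) (w : W) : R :=
  expR (- (lam * (j%:R / 2 ^+ n.-1))) * (expR (- (n%:R *+ 2)) *
    expR (chain_scale nu n * `|B (chain_stop n j) w - B (chain_start n j) w|)).

(** A sum over all dyadic increments in place of a supremum over all times: its measurability and
    its expectation are obtained term by term. *)
Definition chain_sum (nu lam : R) (w : W) : \bar R :=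
  \big[+%E/0%E]_(0 <= n <oo) \big[+%E/0%E]_(0 <= j <oo) (chain_term nu lam n j w)%:E.

Lemma chain_term_ge0 nu lam n j w : 0 <= chain_term nu lam n j w.
Proof. by rewrite !mulr_ge0// expR_ge0. Qed.

Lemma measurable_chain_term nu lam n j : measurable_fun setT (chain_term nu lam n j).
Proof.
do 2 apply: measurable_funM => //; apply: measurableT_comp; first exact: measurable_expR.
apply: measurable_funM => //; apply: measurableT_comp; first exact: normr_measurable.
apply: measurable_funB; apply: (brownian2_measurable hB); last exact: chain_start_ge0.
exact: le_trans (chain_start_ge0 n j) (chain_start_stop n j).
Qed.

Lemma measurable_chain_sum nu lam : measurable_fun setT (chain_sum nu lam).
Proof.
apply: ge0_emeasurable_sum => [n w _ _|n _].
  by apply: nneseries_ge0 => j _ _; rewrite lee_fin chain_term_ge0.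
apply: ge0_emeasurable_sum => [j w _ _|j _]; first by rewrite lee_fin chain_term_ge0.
by apply/measurable_EFinP; exact: measurable_chain_term.
Qed.

Lemma chain_sum_ge nu lam n j w : ((chain_term nu lam n j w)%:E <= chain_sum nu lam w)%E.
Proof.
have h0 m : (0 <= \big[+%E/0]_(0 <= j <oo) (chain_term nu lam m j w)%:E)%E.
  by apply: nneseries_ge0 => i _ _; rewrite lee_fin chain_term_ge0.
apply: le_trans (@nneseries_lim_ge _ _ xpredT 0 n.+1 _); last by move=> m _ _; exact: h0.
rewrite big_nat_recr//= -[leLHS]add0e; apply: leeD; first by apply: sume_ge0 => m _; exact: h0.
apply: le_trans (@nneseries_lim_ge _ _ xpredT 0 j.+1 _); last by move=> m _ _; rewrite lee_fin chain_term_ge0.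
rewrite big_nat_recr//= -[leLHS]add0e; apply: leeD => //.
by apply: sume_ge0 => m _; rewrite lee_fin chain_term_ge0.
Qed.

Lemma chain_sum_dominates (nu lam : R) w s : 0 <= nu -> 0 <= lam -> 0 <= s ->
  ((expR (nu * `|B s w| - lam * s))%:E <= (expR nu)%:E + chain_sum nu lam w)%E.
Proof.
move=> nu0 l0 s0.
have c0 : (0 <= chain_sum nu lam w)%E by apply: le_trans (chain_sum_ge nu lam 0 0 w); rewrite lee_fin chain_term_ge0.
have [h|h] := leP `|B s w| 1.
  rewrite -[leLHS]adde0; apply: leeD => //; rewrite lee_fin ler_expR lerBlDr.
  by apply: (@le_trans _ _ nu); [rewrite ler_piMr|rewrite lerDl mulr_ge0].
have [n [j [js hn]]] := chaining nu0 (brownian2_start hB w) s0 (@brownian2_continuous _ _ _ _ _ hB w) (ltW h).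
rewrite -[leLHS]add0e; apply: leeD; first by rewrite lee_fin expR_ge0.
apply: le_trans (chain_sum_ge nu lam n j w); rewrite lee_fin addrC expRD.
by apply: ler_pM => //; rewrite ?expR_ge0// ler_expR lerN2 ler_wpM2l.
Qed.

(** At level 0 the variance grows with [j], and this forces the lower bound on [lam]. At the higher
    levels the squared scale times the variance is [2 c^2 (49/50)^n], hence bounded. *)
Lemma integral_chain_term (nu lam : R) n j : 0 <= nu ->
  2 * (8 * (nu + 40)) ^+ 2 + 1 <= lam ->
  (\int[P]_w (chain_term nu lam n j w)%:E <=
   (2 * expR (2 * (8 * (nu + 40)) ^+ 2) * expR (- (n%:R *+ 2)) * expR (- (2 ^+ n.-1)^-1) ^+ j)%:E)%E.
Proof.
move=> nu0; pose c : R := 8 * (nu + 40); rewrite -/c => hl.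
have st := brownian_exp_moment (chain_scale nu n) (chain_start_ge0 n j) (chain_start_stop n j).
under eq_integral do rewrite /chain_term mulrA EFinM.
rewrite ge0_integralZl//; first last.
  apply/measurable_EFinP; apply: measurableT_comp; first exact: measurable_expR.
  apply: measurable_funM => //; apply: measurableT_comp; first exact: normr_measurable.
  apply: measurable_funB; apply: (brownian2_measurable hB); last exact: chain_start_ge0.
  exact: le_trans (chain_start_ge0 n j) (chain_start_stop n j).
apply: (le_trans (lee_pmul _ _ (lexx _) st)) => //.
  by apply: integral_ge0 => w _; rewrite lee_fin expR_ge0.
have [th thE] : exists th, th = chain_scale nu n by exists (chain_scale nu n).
rewrite -EFinM lee_fin -expRM_natl [leLHS]mulrCA -thE -!mulrA ler_wpM2l// -!expRD ler_expR {}thE.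
have j0 : 0 <= j%:R :> R by [].
have c20 : 0 <= c ^+ 2 by exact: sqr_ge0.
case: n {st th} => [|n] /=.
  rewrite /chain_scale -/c !expr0 !mulr1 subr0 invr1 mul0rn oppr0.
  have : 0 <= j%:R * (lam - (2 * c ^+ 2 + 1)) by rewrite mulr_ge0// subr_ge0.
  by lra.
set a := (2 ^+ n)^-1.
have a0 : 0 <= a by rewrite invr_ge0 exprn_ge0.
have -> : chain_scale nu n.+1 * (chain_scale nu n.+1 * (2 * (j%:R * a + 2^-1 ^+ n.+1 - j%:R * a))) = 2 * c ^+ 2 * (49 / 50) ^+ n.+1.
  rewrite mulrA -expr2 addrAC subrr add0r /chain_scale -/c (_ : 49 / 50 = (7 / 5) ^+ 2 * 2^-1 :> R); last by field.
  move: (7 / 5 : R) => q; have e : (q ^+ n.+1) ^+ 2 = (q ^+ 2) ^+ n.+1 by rewrite -!exprM mulnC.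
  rewrite (exprMn _ c) e (exprMn _ (q ^+ 2)).
  by move: ((q ^+ 2) ^+ n.+1) (2^-1 ^+ n.+1) => x y; ring.
have h1 : (49 / 50) ^+ n.+1 <= 1 :> R by rewrite exprn_ile1// ?divr_ge0//; lra.
have h2 : 2 * c ^+ 2 * (49 / 50) ^+ n.+1 <= 2 * c ^+ 2 * 1 by rewrite ler_wpM2l// mulr_ge0.
have h3 : 0 <= (lam - 1) * (j%:R * a) by rewrite mulr_ge0// ?mulr_ge0// subr_ge0; lra.
by lra.
Qed.

Lemma nneseries_le (u : nat -> \bar R) (M : \bar R) : (forall n, 0 <= u n)%E ->
  (forall N, \sum_(0 <= n < N) u n <= M)%E -> (\big[+%E/0%E]_(0 <= n <oo) u n <= M)%E.
Proof.
by move=> u0 h; apply: lime_le; [apply: is_cvg_nneseries => n _ _; exact: u0|exact: nearW].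
Qed.

Lemma integral_chain_sum (nu lam : R) : 0 <= nu -> 2 * (8 * (nu + 40)) ^+ 2 + 1 <= lam ->
  (\int[P]_w chain_sum nu lam w < +oo)%E.
Proof.
move=> nu0 hl; set K : R := 2 * expR (2 * (8 * (nu + 40)) ^+ 2).
have K0 : 0 <= K by rewrite mulr_ge0// expR_ge0.
have tm n j : measurable_fun setT (fun w => (chain_term nu lam n j w)%:E).
  by apply/measurable_EFinP; exact: measurable_chain_term.
have t0 n j w : (0 <= (chain_term nu lam n j w)%:E)%E by rewrite lee_fin chain_term_ge0.
(* The sum over [j] is at most [2 * 2 ^+ n], and [expR (- 2)] is at most 1/3; the levels then form
   twice a geometric series of ratio 2/3. *)
apply: (@le_lt_trans _ _ (6 * K)%:E); last exact: ltry.
rewrite /chain_sum integral_nneseries//; first last.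
- by move=> n w _; apply: nneseries_ge0.
- by move=> n; apply: ge0_emeasurable_sum.
have inner n : (\int[P]_w \big[+%E/0]_(0 <= j <oo) (chain_term nu lam n j w)%:E <= (K * (2 * (2 / 3) ^+ n))%:E)%E.
  rewrite integral_nneseries//; apply: nneseries_le => [j|N]; first exact: integral_ge0.
  set y : R := (2 ^+ n.-1)^-1.
  have y0 : 0 < y by rewrite invr_gt0 exprn_gt0.
  apply: (@le_trans _ _ (\sum_(0 <= j < N) (K * expR (- (n%:R *+ 2)) * expR (- y) ^+ j)%:E)%E).
    by apply: lee_sum => j _; exact: integral_chain_term.
  rewrite sumEFin lee_fin -mulr_sumr -mulrA ler_wpM2l//.
  have s1 : \sum_(0 <= j < N) expR (- y) ^+ j <= 1 + y^-1.
    have e1 : expR (- y) <= (1 + y)^-1 by rewrite expRN lef_pV2 ?posrE ?expR_gt0 ?expR_ge1Dx// addr_gt0.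
    have e2 : (1 - expR (- y))^-1 <= 1 + y^-1.
      rewrite -[leRHS]invrK lef_pV2 ?posrE ?subr_gt0 ?expR_lt1 ?oppr_lt0//; last by rewrite invr_gt0 addr_gt0// invr_gt0.
      have -> : (1 + y^-1)^-1 = 1 - (1 + y)^-1 by field; rewrite !gt_eqF// addr_gt0.
      by rewrite lerD2l lerN2.
    apply: le_trans e2.
    have ne : 1 - expR (- y) != 0 by rewrite gt_eqF// subr_gt0 expR_lt1 oppr_lt0.
    have -> : \sum_(0 <= j < N) expR (- y) ^+ j = (1 - expR (- y) ^+ N) / (1 - expR (- y)).
      elim: N => [|N ih]; first by rewrite big_geq// expr0 subrr mul0r.
      by rewrite big_nat_recr//= ih exprS; move: (_ ^+ N) ne => x ne; field.
    have i0 : 0 <= (1 - expR (- y))^-1 by rewrite invr_ge0 subr_ge0 expR_le1 oppr_le0 ltW.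
    by apply: ler_piMl => //; rewrite lerBlDr lerDl exprn_ge0 ?expR_ge0.
  apply: (@le_trans _ _ (3^-1 ^+ n * (2 * 2 ^+ n))).
    apply: ler_pM; rewrite ?expR_ge0//; first by apply: sumr_ge0 => j _; rewrite exprn_ge0 ?expR_ge0.
      rewrite (_ : - (n%:R *+ 2) = n%:R * (- 2) :> R) ?expRM_natl; last by rewrite mulrN mulr_natr.
      rewrite ler_wpXn2// ?expR_ge0// expRN lef_pV2 ?posrE ?expR_gt0//.
      by apply: le_trans (expR_ge1Dx _); lra.
    apply: le_trans s1 _; rewrite /y invrK.
    have : 2 ^+ n.-1 <= 2 ^+ n :> R by rewrite ler_eXn2l ?leq_pred// ltr1n.
    have : 1 <= 2 ^+ n :> R by rewrite exprn_ege1// ler1n.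
    by lra.
  by rewrite mulrCA -exprMn [3^-1 * 2]mulrC.
apply: nneseries_le => [n|N].
  by apply: integral_ge0 => w _; apply: nneseries_ge0.
apply: (@le_trans _ _ (\sum_(0 <= n < N) (K * (2 * (2 / 3) ^+ n))%:E)%E); first by apply: lee_sum.
rewrite sumEFin lee_fin -mulr_sumr [leRHS]mulrC ler_wpM2l//.
have -> : \sum_(0 <= n < N) 2 * (2 / 3 : R) ^+ n = 6 * (1 - (2 / 3) ^+ N).
  elim: N => [|N ih]; first by rewrite big_geq// expr0 subrr mulr0.
  by rewrite big_nat_recr//= ih exprS; move: (_ ^+ N) => x; field.
by rewrite ler_piMr// lerBlDr lerDl exprn_ge0// divr_ge0.
Qed.

End brownian.

(** * Hitting times of hypographs: attainment, measurability and laws *)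

Section hitting.
Context {R : realType}.

Lemma UC_reflect (h : R -> \bar R) : UC h -> UC (fun s => h (- s)).
Proof.
case=> hlt husc [x hx] [A [C [A0 C0 hg]]]; split=> [y|y a hy||].
- exact: hlt.
- have [V nV hV] := husc (- y) a hy.
  have /nbhs_ballP[e /= e0 be] := nV.
  exists (ball y e) => [|z bz]; first exact: nbhsx_ballx.
  by apply/hV/be; rewrite /ball /= -opprD normrN; exact: bz.
- by exists (- x); rewrite opprK.
- by exists A, C; split=> // y; apply: le_trans (hg _) _; rewrite normrN.
Qed.

Variable h : R -> \bar R.
Local Notation tau b z := (hypo_hitting_time h (fun s => z + b s)%R).
Hypothesis huc : upper_semicontinuous h.

Lemma continuous_on_ge0 (b : R -> R) (t g : R) : {within `[0, +oo[, continuous b} ->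
  0 <= t -> 0 < g ->
  exists2 e : R, 0 < e & forall s, 0 <= s -> `|s - t| < e -> `|b t - b s| < g.
Proof.
move=> cb t0 g0; have : {for t, continuous (b : subspace `[0, +oo[ -> R)} by exact: cb.
move/(_ _ (nbhsx_ballx (b t) _ g0)); rewrite /= => nb.
have t0' : `[0, +oo[%classic t by rewrite /= in_itv /= t0.
move: nb; rewrite /nbhs /= /nbhs_subspace; case: ifP => [_|]; last by rewrite (mem_set t0').
rewrite /within /= => /nbhs_ballP[e2 /= e20 V2]; exists e2 => // s s0 st.
by apply: V2; [rewrite /ball /= distrC|rewrite /= in_itv /= s0].
Qed.

(* Compactness enters through a cluster point, here [t]. *)
Lemma hypograph_limit (b : R -> R) (z t : R) :
  {within `[0, +oo[, continuous b} -> 0 <= t ->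
  (forall e : R, 0 < e -> exists s u : R, [/\ 0 <= s, `|s - t| < e, `|u - t| < e &
    ((z + b s - e)%:E < h u)%E]) ->
  ((z + b t)%:E <= h t)%E.
Proof.
move=> cb t0 hh; rewrite leNgt; apply/negP => ht.
have [a h1 h2] : exists2 a : R, (h t < a%:E)%E & a < z + b t.
  case: (h t) ht => [y||] //= yt; last by exists (z + b t - 1); rewrite ?ltNyr//; lra.
  by exists ((y + (z + b t)) / 2); rewrite ?lte_fin; rewrite lte_fin in yt; lra.
have [V /nbhs_ballP[e1 /= e10 V1] hV] : exists2 V, nbhs t V & forall y, V y -> (h y < a%:E)%E.
  have /huc[V nV hV] : ((- a)%:E < - h t)%E by rewrite EFinN lteN2.
  by exists V => // y /hV; rewrite EFinN lteN2.
pose g := (z + b t - a) / 2; have g0 : 0 < g by rewrite divr_gt0// subr_gt0.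
have [e2 e20 V2] := continuous_on_ge0 cb t0 g0.
pose e := Num.min (Num.min e1 e2) g.
have e0 : 0 < e by rewrite !lt_min e10 e20 g0.
have [s [u [s0 st ut hu]]] := hh e e0.
move: st ut; rewrite /e !lt_min => /andP[/andP[_ st] _] /andP[/andP[ut _] _].
have hb := V2 s s0 st.
have hu' : (h u < a%:E)%E by apply: hV; apply: V1; rewrite /ball /= distrC.
have := lt_trans hu hu'; rewrite lte_fin.
have : e <= g by rewrite /e ge_min lexx orbT.
by move: hb; rewrite /g ltr_norml => /andP[]; lra.
Qed.

(** The hypograph is closed, by upper semicontinuity, and the path is continuous, so the infimum is
    reached. This is what yields the bound [B(tau) <= h(tau)] at the hitting time. *)
Lemma hitting_attained (b : R -> R) (z t : R) : {within `[0, +oo[, continuous b} ->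
  tau b z = t%:E -> 0 <= t /\ ((z + b t)%:E <= h t)%E.
Proof.
move=> cb ht.
have near_t (e : R) : 0 < e -> exists2 s, 0 <= s /\ ((z + b s)%:E <= h s)%E & t <= s < t + e.
  move=> e0; have : (tau b z \is a fin_num)%E by rewrite ht.
  move=> /(lb_ereal_inf_adherent e0)[_ [s [s0 hs] <-]]; rewrite -/(tau b z) ht => se.
  exists s; first by [].
  rewrite -EFinD lte_fin in se; rewrite se andbT -lee_fin -ht.
  by apply: ereal_inf_lbound; exists s.
have t0 : 0 <= t.
  by rewrite -lee_fin -ht; apply: le_ereal_inf_tmp => _ [s [s0 _] <-]; rewrite lee_fin.
split=> //; apply: hypograph_limit => // e e0; have [s [s0 hs] /andP[ts se]] := near_t e e0.
have d : `|s - t| < e by rewrite ger0_norm ?subr_ge0// ltrBlDl.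
by exists s, s; split=> //; apply: lt_le_trans hs; rewrite lte_fin ltrBlDr ltrDl.
Qed.

Lemma hitting_le (b : R -> R) (z s : R) : 0 <= s -> ((z + b s)%:E <= h s)%E ->
  (tau b z <= s%:E)%E.
Proof. by move=> s0 hs; apply: ereal_inf_lbound; exists s. Qed.

(** The path may meet the hypograph at a single irrational time; rational times can see this only
    through a supremum of [h] over a neighbourhood. *)
Definition near_sup (k : nat) (x : R) : \bar R :=
  ereal_sup [set h u | u in [set u | 0 <= u /\ `|u - x| < k.+1%:R^-1]].

(** A countable description of the event that the hitting time is at most [c], from which its
    measurability follows. In one direction rational times approach the hitting time; in the other
    the approximate hits cluster, and the cluster point is a hit by [hypograph_limit]. Rational
    multiples of [c] stay inside the interval from 0 to [c]. *)
Lemma hitting_le_iff (b : R -> R) (z c : R) : {within `[0, +oo[, continuous b} -> 0 <= c ->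
  (tau b z <= c%:E)%E <->
  (forall k : nat, exists q : rat, 0 <= (ratr q : R) <= 1 /\
     ((z + b (c * ratr q) - k.+1%:R^-1)%:E < near_sup k (c * ratr q))%E).
Proof.
move=> cb c0; split=> [hc k|hq].
  have [t ht] : exists t, tau b z = t%:E.
    have : (0 <= tau b z)%E.
      by apply: le_ereal_inf_tmp => _ [s [s0 _] <-]; rewrite lee_fin.
    by move: hc; case: (tau b z) => [t _ _|//|//]; exists t.
  have [t0 htt] := hitting_attained cb ht.
  have tc : t <= c by rewrite -lee_fin -ht.
  have k0 : 0 < k.+1%:R^-1 :> R by rewrite invr_gt0.
  have [e2 e20 V2] := continuous_on_ge0 cb t0 k0.
  pose e := Num.min e2 k.+1%:R^-1; have e0 : 0 < e by rewrite lt_min e20 k0.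
  have [q [q01 hq]] : exists q : rat, 0 <= (ratr q : R) <= 1 /\ `|c * ratr q - t| < e.
    move: t0; rewrite le_eqVlt => /predU1P[<-|t0].
      by exists 0; rewrite rmorph0 lexx ler01 mulr0 subrr normr0.
    have c1 : 0 < c by apply: lt_le_trans tc.
    have : Num.max 0 (t / c - e / c) < t / c by rewrite gt_max !divr_gt0//= ltrBlDr ltrDl divr_gt0.
    move=> /rat_in_itvoo[q]; rewrite in_itv /= gt_max => /andP[/andP[q0 q1] q2]; exists q.
    rewrite (ltW q0) /= (le_trans (ltW q2)) ?ler_pdivrMr ?mul1r//; split=> //.
    rewrite -mulrBl ltr_pdivrMr// mulrC in q1; rewrite ltr_pdivlMr// mulrC in q2.
    by rewrite distrC gtr0_norm ?subr_gt0//; lra.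
  exists q; split=> //; move: hq; rewrite lt_min => /andP[h1 h2].
  have cq : 0 <= c * ratr q by rewrite mulr_ge0//; case/andP: q01.
  have hb := V2 _ cq h1.
  apply: (@lt_le_trans _ _ (h t)); last by apply: ereal_sup_ubound; exists t => //; split=> //; rewrite distrC.
  apply: lt_le_trans htt; rewrite lte_fin; move: hb; rewrite ltr_norml => /andP[].
  by move: (b (c * _)) (k.+1%:R^-1) => x y; lra.
have [q /all_and2[q01 hlt]] := choice hq.
pose s k := c * ratr (q k).
have s0 k : 0 <= s k by rewrite mulr_ge0//; case/andP: (q01 k).
have sc k : s k <= c by rewrite ler_piMr//; case/andP: (q01 k).
have := @segment_compact R 0 c (s @ \oo) _ _.
have FF : ProperFilter (s @ \oo) by exact: fmap_proper_filter.
move=> /(_ FF)[|t [tc cl]].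
  by exists 0%N => // k _; rewrite /= in_itv /= s0 sc.
move: tc; rewrite /= in_itv /= => /andP[t0 tc].
apply: (@le_trans _ _ t%:E); last by rewrite lee_fin.
apply: hitting_le => //; apply: hypograph_limit => // e e0.
have e20 : 0 < e / 2 by rewrite divr_gt0.
have [N hN] : exists N, forall k, (N <= k)%N -> k.+1%:R^-1 <= e / 2.
  exists (Num.truncn (e / 2)^-1) => k Nk; rewrite -[leRHS]invrK lef_pV2 ?posrE ?invr_gt0//.
  by apply: le_trans (ltW (truncnS_gt _)) _; rewrite ler_nat.
have [_ [[k Nk <-] bk]] := cl (s @` [set k | (N <= k)%N]) (ball t (e / 2))
  (ex_intro2 _ _ N I (fun k Nk => ex_intro2 _ _ k Nk erefl)) (nbhsx_ballx t _ e20).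
have /ereal_sup_gt[_ [u [u0 us] <-] hu] := hlt k.
rewrite /ball /= distrC in bk; have kk := hN k Nk.
exists (s k), u; split=> //; first by apply: lt_trans bk _; lra.
  rewrite (_ : u - t = (u - s k) + (s k - t)); last by ring.
  apply: le_lt_trans (ler_normD _ _) _; rewrite (splitr e).
  by rewrite ltrD// (lt_le_trans us).
by apply: le_lt_trans hu; rewrite lee_fin lerD2l lerN2 (le_trans kk)// ler_pdivrMr// ler_peMr ?ler1n// ltW.
Qed.

Context d (W : measurableType d) (P : probability W R) (B : R -> W -> R).
Hypothesis hB : brownian2 P B.

(* The cut-off at 0 makes the process jointly measurable on the whole line. *)
Definition path (s : R) (w : W) : R := B (Num.max s 0) w.

(** A limit, by continuity of the paths, of processes that are constant on dyadic intervals of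
    time. *)
Lemma measurable_path : measurable_fun setT (fun p : R * W => path p.1 p.2).
Proof.
pose t n (s : R) : R := (Num.truncn (s * 2 ^+ n))%:R / 2 ^+ n.
have p0 m : 0 < 2 ^+ m :> R by rewrite exprn_gt0.
apply: (@measurable_fun_cvg _ _ _ _ (fun n p => B (t n p.1) p.2)) => [n|p _].
  move=> _ A mA; rewrite setTI.
  have -> : (fun p : R * W => B (t n p.1) p.2) @^-1` A =
     \bigcup_k ([set s : R | Num.truncn (s * 2 ^+ n) = k] `*` [set w | A (B (k%:R / 2 ^+ n) w)]).
    apply/seteqP; split=> [[s w] /= As|[s w] /= [k _ [/= <- As]]] //.
    by exists (Num.truncn (s * 2 ^+ n)).
  apply: bigcupT_measurable => k; apply: measurableX; last first.
    rewrite -[X in measurable X]setTI; exact: (brownian2_measurable hB).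
  have mle j : measurable [set s : R | (Num.truncn (s * 2 ^+ n) <= j)%N].
    rewrite (_ : [set _ | _] = `]-oo, j.+1%:R / 2 ^+ n[%classic) ?measurable_itv//.
    by apply/seteqP; split=> s /=; rewrite in_itv /= truncn_le_nat ltr_pdivlMr.
  case: k => [|k].
    rewrite (_ : [set _ | _] = [set s : R | (Num.truncn (s * 2 ^+ n) <= 0)%N])//.
    by apply/seteqP; split=> s /=; rewrite leqn0 => /eqP.
  rewrite (_ : [set _ | _] = [set s : R | (Num.truncn (s * 2 ^+ n) <= k.+1)%N] `\` [set s : R | (Num.truncn (s * 2 ^+ n) <= k)%N]).
    exact: measurableD.
  apply/seteqP; split=> s /=; first by move=> ->; rewrite leqnn; split=> //; rewrite ltnn.
  by move=> [h1 /negP]; rewrite -ltnNge => h2; apply/eqP; rewrite eqn_leq h1.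
case: p => s w /=; rewrite /path.
have t0 n : 0 <= t n s by rewrite divr_ge0// ltW.
have s0 : 0 <= Num.max s 0 by rewrite le_max lexx orbT.
apply/cvgrPdist_lt => e e0.
have [q q0 hq] := continuous_on_ge0 (@brownian2_continuous _ _ _ _ _ hB w) s0 e0.
have [N hN] := geometric_cvg_eps 1 (divr_gt0 q0 (ltr0n _ 2)).
near=> n; apply: hq => //.
apply: (@le_lt_trans _ _ (q / 2)); last by rewrite ltr_pdivrMr// ltr_pMr// ltr1n.
apply: (@le_trans _ _ (2^-1 ^+ n)); last by rewrite -[leLHS]mul1r; apply: hN; near: n; exact: nbhs_infty_ge.
have [s00|s00] := leP 0 s; last first.
  have -> : t n s = 0.
    rewrite /t; have /eqP -> : Num.truncn (s * 2 ^+ n) == 0%N.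
      by rewrite -leqn0 truncn_le_nat (lt_trans _ ltr01)// nmulr_rlt0.
    by rewrite mul0r.
  by rewrite subrr normr0 exprn_ge0// invr_ge0.
have /andP[k1 k2] := truncn_itv (mulr_ge0 s00 (ltW (p0 n))).
have t1 : t n s <= s by rewrite ler_pdivrMr.
rewrite distrC ger0_norm ?subr_ge0// lerBlDr; apply: (@le_trans _ _ ((Num.truncn (s * 2 ^+ n)).+1%:R / 2 ^+ n)).
  by rewrite ler_pdivlMr// ltW.
by rewrite -natr1 mulrDl mul1r exprVn addrC.
Unshelve. all: by end_near.
Qed.

Definition hit (p : R * W) : \bar R := tau (fun s => B s p.2) p.1.

Lemma measurable_hit : measurable_fun setT hit.
Proof.
apply: (measurability _ (ErealGenOInfty.measurableE R)) => // _ [_ [c ->] <-].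
rewrite setTI; have [c0|c0] := ltP c 0.
  rewrite (_ : hit @^-1` _ = setT); first exact: measurableT.
  apply/seteqP; split=> // p _; rewrite /= in_itv /= andbT.
  apply: (@lt_le_trans _ _ 0%E); first by rewrite lte_fin.
  by apply: le_ereal_inf_tmp => _ [s [s0 _] <-]; rewrite lee_fin.
have cB w := @brownian2_continuous _ _ _ _ _ hB w.
pose F k (q : rat) : set (R * W) := if 0 <= (ratr q : R) <= 1 then
  [set p | ((p.1 + path (c * ratr q) p.2 - k.+1%:R^-1)%:E < near_sup k (c * ratr q))%E] else set0.
have pE q w : 0 <= (ratr q : R) <= 1 -> path (c * ratr q) w = B (c * ratr q) w.
  by move=> /andP[q0 _]; rewrite /path max_l// mulr_ge0.
have -> : hit @^-1` `]c%:E, +oo[%classic = ~` (\bigcap_k \bigcup_q F k q).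
  apply/seteqP; split=> p /=; rewrite in_itv /= andbT ltNge.
    move=> /negP hit_le hk; apply: hit_le; apply/(hitting_le_iff _ (cB p.2) c0) => k.
    have [q _] := hk k I; rewrite /F; case: ifP => // q01 /= hq.
    by exists q; split=> //; rewrite -pE.
  move=> hk; apply/negP => /(hitting_le_iff _ (cB p.2) c0) all_k; apply: hk => k _.
  by have [q [q01 hq]] := all_k k; exists q => //; rewrite /F q01 /= pE.
apply: measurableC; apply: bigcapT_measurable => k; apply: bigcupT_measurable_rat => q.
rewrite /F; case: ifP => q01; last exact: measurable0.
rewrite -[X in measurable X]setTI; apply: emeasurable_fun_infty_o => //.
apply/measurable_EFinP; apply: measurable_funB => //; apply: measurable_funD => //.
apply: (measurableT_comp (f := path (c * ratr q))) => //.
by apply: (brownian2_measurable hB); rewrite le_max lexx orbT.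
Qed.

(** [fine] returns 0 when the hypograph is never hit, so statements about it are restricted to
    [hit < +oo]. *)
Definition hit_time (p : R * W) : R := fine (hit p).
Definition hit_place (p : R * W) : R := p.1 + path (hit_time p) p.2.

Lemma measurable_hit_time : measurable_fun setT hit_time.
Proof. by apply: measurableT_comp; [exact: fine_measurable|exact: measurable_hit]. Qed.

Lemma measurable_hit_place : measurable_fun setT hit_place.
Proof.
apply: measurable_funD => //.
apply: (measurableT_comp measurable_path (g := fun p => (hit_time p, p.2))).
by apply: measurable_fun_pair => //; exact: measurable_hit_time.
Qed.

Lemma measurable_hit_lty : measurable [set p | (hit p < +oo)%E].
Proof.
rewrite -[X in measurable X]setTI; apply: emeasurable_fun_infty_o => //; exact: measurable_hit.
Qed.

Lemma hit_spec p : (hit p < +oo)%E -> [/\ 0 <= hit_time p, hit p = (hit_time p)%:E,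
  hit_place p = p.1 + B (hit_time p) p.2 & ((hit_place p)%:E <= h (hit_time p))%E].
Proof.
move=> hp.
have h0 : (0 <= hit p)%E by apply: le_ereal_inf_tmp => _ [s [s0 _] <-]; rewrite lee_fin.
have hE : hit p = (hit_time p)%:E by rewrite /hit_time fineK// ge0_fin_numE.
have [t0 ht] := hitting_attained (@brownian2_continuous _ _ _ _ _ hB p.2) hE.
by rewrite /hit_place /path max_l.
Qed.

(** [hitting_law] is a bare set function. On every set it agrees with the image, under time and
    place, of [P] restricted to the event of a hit, and for this image the change of variables is
    available. *)
Lemma law_integralE (z : R) (g : R -> R -> R) :
  measurable_fun setT (fun p : R * R => g p.1 p.2) ->
  P.-integrable [set w | (hit (z, w) < +oo)%E] (fun w => (g (hit_time (z, w)) (hit_place (z, w)))%:E) ->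
  law_integral (hitting_law P B h z) g =
  \int[P]_(w in [set w | (hit (z, w) < +oo)%E]) g (hit_time (z, w)) (hit_place (z, w)).
Proof.
set D := [set w | _] => mg ig.
have mD : measurable D.
  by have := measurable_xsection z measurable_hit_lty; rewrite (_ : xsection _ _ = D)//; apply/seteqP; split=> w;
    rewrite /xsection /= inE.
pose phi (w : W) : R * R := (hit_time (z, w), hit_place (z, w)).
have mphi : measurable_fun setT phi.
  by apply: measurable_fun_pair; apply: measurableT_comp => //;
    [exact: measurable_hit_time|exact: measurable_hit_place].
pose m := [the measure _ _ of mrestr P mD].
have nD : m (~` D) = 0%E by rewrite /m /= /mrestr setICl measure0.
have mC : measurable (~` D) by exact: measurableC.
have mE (f : W -> \bar R) : (\int[m]_(w in D) f w = \int[P]_(w in D) f w)%E.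
  by apply: eq_measure_integral => A mA AD; rewrite /m /= /mrestr setIidl.
have mgp : measurable_fun setT (fun w => (g (phi w).1 (phi w).2)%:E).
  by apply/measurable_EFinP; exact: (measurableT_comp mg mphi).
have im : m.-integrable setT (fun w => (g (phi w).1 (phi w).2)%:E).
  apply/integrableP; split=> //.
  rewrite (@ge0_negligible_integral _ _ _ m setT (~` D))//; first by rewrite setTD setCK mE; case/integrableP: ig.
  by apply: measurableT_comp.
rewrite /law_integral /Rintegral; congr fine.
have -> : hitting_law P B h z = pushforward m phi.
  apply/funext => A; rewrite /hitting_law /pushforward /m /= /mrestr; congr (P _).
  apply/seteqP; split=> w /=.
    move=> [hw hA]; split=> //; rewrite /phi /=.
    by have [_ _ -> _] := @hit_spec (z, w) hw.
  move=> [hA hw]; split=> //; move: hA; rewrite /phi /=.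
  by have [_ _ -> _] := @hit_spec (z, w) hw.
rewrite (integral_pushforward mphi)//; last by apply/measurable_EFinP.
by rewrite preimage_setT (negligible_integral mC measurableT)// setTD setCK mE.
Qed.

End hitting.

Section parameter_integrals.
Context {R : realType} d1 d2 (T1 : measurableType d1) (T2 : measurableType d2).
Variable (mu : {sigma_finite_measure set T2 -> \bar R}).

Lemma measurable_Rintegral_param (f : T1 -> T2 -> R) (D : set T2) : measurable D ->
  measurable_fun setT (fun p : T1 * T2 => f p.1 p.2) ->
  measurable_fun setT (fun x => \int[mu]_(y in D) f x y).
Proof.
move=> mD mf; apply: measurableT_comp; first exact: fine_measurable.
pose F (p : T1 * T2) : \bar R := ((fun y => (f p.1 y)%:E) \_ D) p.2.
have mF : measurable_fun setT F.
  have mDp : measurable (setT `*` D : set (T1 * T2)) by exact: measurableX.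
  have -> : F = (fun p => (f p.1 p.2)%:E) \_ (setT `*` D).
    apply/funext => -[x y]; rewrite /F /patch /=; congr (if _ then _ else _).
    by apply/idP/idP; rewrite !inE /=; [split|case].
  apply/(measurable_restrictT _ mDp)/measurable_EFinP; exact: measurable_funTS.
rewrite (_ : (fun x => _) = fun x => (\int[mu]_y F^\+ (x, y) - \int[mu]_y F^\- (x, y))%E); last first.
  apply/funext => x; transitivity (\int[mu]_y F (x, y))%E; first by rewrite integral_mkcond.
  by rewrite [LHS]integralE; congr (_ - _)%E; apply: eq_integral => y _; rewrite ?funeposE ?funenegE.
apply: emeasurable_funB.
  apply: (measurable_fun_fubini_tonelli_F (m2 := mu) (F^\+)%E) => //; first exact: measurable_funepos.
apply: (measurable_fun_fubini_tonelli_F (m2 := mu) (F^\-)%E) => //; first exact: measurable_funeneg.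
Qed.

End parameter_integrals.

(** * The derivatives of the KPZ kernel *)

Section wave.
Context {R : realType}.
Implicit Types (t x y eta : R).

(* For [t = 0] the abscissa of the contour is [0], division by 0 being 0. *)
Definition wave k t x y : R := contour k t x y ((x - 1) / t).

Lemma waveE k t x y eta : 0 <= t -> 0 < x - t * eta -> contour k t x y eta = wave k t x y.
Proof.
move=> t0 h; apply: contour_shift => //.
have [t00|t00] := eqVneq t 0; first by move: h; rewrite t00 !mul0r.
by rewrite mulrC divfK// opprB addrC subrK.
Qed.

Lemma kpzS_wave t x z1 z2 : 0 < t -> kpzS t x z1 z2 = wave 0 t x (z2 - z1).
Proof.
move=> t0; rewrite /wave -(@kpzSE _ t x z1 z2 ((x - 1) / t))// mulrC divfK ?gt_eqF//.
by rewrite opprB addrC subrK.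
Qed.

Lemma heat_kernel_wave a y y' : 0 < a -> heat_kernel a y y' = wave 0 0 a (y' - y).
Proof. by move=> a0; rewrite -(@waveE 0 0 a _ 0) ?mul0r ?subr0//; exact: heat_kernelE. Qed.

Lemma measurable_wave d (T : measurableType d) k t (x y : T -> R) :
  measurable_fun setT x -> measurable_fun setT y ->
  measurable_fun setT (fun u => wave k t (x u) (y u)).
Proof.
move=> mx my; rewrite /wave /contour; apply: measurable_funM => //.
apply: (@measurable_Rintegral_param _ _ _ _ _ (@lebesgue_measure R)
  (fun u xi => (cint k t (x u) (y u) ((x u - 1) / t) xi).1)); first exact: measurable_itv.
have c1 (f : T -> R) : measurable_fun setT f -> measurable_fun setT (fun p : T * R => f p.1).
  by move=> mf; exact: measurableT_comp.
have [] := @measurable_cint R _ (T * R)%type setT (cst t) (fun p => x p.1) (fun p => y p.1)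
   (fun p => (x p.1 - 1) / t) snd k => //; try exact: c1.
by apply: measurable_funM => //; apply: measurable_funB => //; exact: c1.
Qed.

Lemma is_derive_shift (f : R -> R) (s df : R) :
  is_derive (0 : R) (1 : R) (fun u => f (s + u)) df -> is_derive s (1 : R) f df.
Proof.
move=> h; have -> : f = fun u => (fun u => f (s + u)) (u - s).
  by apply/funext => u; rewrite addrC subrK.
rewrite -[df]mulr1; apply: (@is_derive_comp_fun _ (fun u => f (s + u)) (fun u => u - s)).
  by rewrite subrr.
by have := is_derive_affine (- s) 1 s; under eq_fun do rewrite mulr1 addrC.
Qed.

(** The abscissa of [wave] moves with its parameters. Near a given point it is frozen at the value
    there, which [contour_shift] permits while the rate remains positive. *)
Lemma is_derive_wave k t x y (a b c s : R) :
  0 < t + s * a \/ [/\ t = 0, a = 0 & 0 < x + s * b] ->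
  is_derive s (1 : R) (fun u => wave k (t + u * a) (x + u * b) (y + u * c))
    (- a / 3 * wave k.+3 (t + s * a) (x + s * b) (y + s * c)
     + b * wave k.+2 (t + s * a) (x + s * b) (y + s * c)
     + c * wave k.+1 (t + s * a) (x + s * b) (y + s * c)).
Proof.
move=> h; apply: is_derive_shift.
set t' := t + s * a in h *; set x' := x + s * b in h *; set y' := y + s * c.
pose eta := (x' - 1) / t'.
have pos : 0 <= t' /\ 0 < x' - t' * eta.
  case: h => [h|[t0 a0 x0]].
    by split; [exact: ltW|rewrite /eta mulrC divfK ?gt_eqF// opprB addrC subrK].
  by rewrite /t' t0 a0 mulr0 addr0 mul0r subr0.
have [t'0 d0] := pos; have := is_derive_contour k y' a b c d0.
rewrite !(waveE _ _ t'0 d0); set D := _ + _ + _ => hD.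
have tE u : t + (s + u) * a = t' + u * a by rewrite /t'; ring.
have xE u : x + (s + u) * b = x' + u * b by rewrite /x'; ring.
have yE u : y + (s + u) * c = y' + u * c by rewrite /y'; ring.
under eq_fun do rewrite tE xE yE.
have [e e0 he] : exists2 e : R, 0 < e & forall u, `|u| < e ->
    0 <= t' + u * a /\ 0 < (x' + u * b) - (t' + u * a) * eta.
  pose e1 := (x' - t' * eta) / (`|b - a * eta| + 1).
  have q0 r : 0 < `|r| + 1 :> R by rewrite ltr_wpDl.
  have e10 : 0 < e1 by rewrite divr_gt0.
  have h2 u : `|u| < e1 -> 0 < (x' + u * b) - (t' + u * a) * eta.
    move=> ue; rewrite (_ : _ - _ = (x' - t' * eta) + u * (b - a * eta)); last by ring.
    have : `|u * (b - a * eta)| < x' - t' * eta.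
      rewrite normrM; apply: le_lt_trans (_ : `|u| * (`|b - a * eta| + 1) < _).
        by rewrite ler_wpM2l// lerDl.
      by rewrite -ltr_pdivlMr.
    by rewrite ltr_norml => /andP[]; lra.
  case: h => [h|[t0 a0 x0]]; last first.
    by exists e1 => // u ue; split; [rewrite /t' t0 a0 !mulr0 !addr0|exact: h2].
  pose e2 := t' / (`|a| + 1).
  exists (Num.min e1 e2); first by rewrite lt_min e10 divr_gt0.
  move=> u; rewrite lt_min => /andP[u1 u2]; split; last exact: h2.
  have : `|u * a| < t'.
    rewrite normrM; apply: le_lt_trans (_ : `|u| * (`|a| + 1) < _).
      by rewrite ler_wpM2l// lerDl.
    by rewrite -ltr_pdivlMr.
  by rewrite ltr_norml => /andP[]; lra.
apply: is_derive_near e0 _ hD => u; rewrite subr0 => /he[h1 h2].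
by rewrite (waveE _ _ h1 h2).
Qed.

Lemma wave_hypo_bound (A B t1 t2 X c lam m : R) k : 0 < t1 -> 0 <= t2 -> 0 <= A -> 0 <= B ->
  0 <= X -> 0 <= c -> (1 + X) / t1 <= m ->
  exists2 C : R, 0 <= C & forall t x s p b, t1 <= t <= t2 -> `|x| <= X -> 0 <= s ->
    s * b <= s * (A + B * s) -> - c <= p ->
    `|wave k t (x - s) (p - b)| <= C * expR (m * (b - p) - lam * s).
Proof.
move=> t10 t20 A0 B0 X0 c0 hm.
have [C C0 hC] := contour_hypo_bound lam k t10 t20 A0 B0 X0 c0 hm.
exists C => // t x s p b ht hx s0 sb hp; rewrite -[x in x - s]opprK; apply: hC => //.
  by rewrite normrN.
have t0 : 0 < t by apply: lt_le_trans t10 _; case/andP: ht.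
by rewrite mulrC divfK ?gt_eqF// opprK; lra.
Qed.

(** For [t = 0] every abscissa is admissible, so [- L] can be chosen: exponential decay of any rate,
    in either direction, at the price of the constant. *)
Lemma heat_wave_bound k (x1 x2 L : R) : 0 < x1 ->
  exists2 C : R, 0 <= C & forall x y, x1 <= x <= x2 -> `|wave k 0 x y| <= C * expR (- L * y).
Proof.
move=> x10; have [C C0 hC] := normr_contour k x10.
exists (C * ((1 + `|L|) ^+ k * expR (x2 * L ^+ 2))).
  by rewrite !mulr_ge0 ?expR_ge0// exprn_ge0// addr_ge0.
move=> x y /andP[h1 h2].
have x0 : 0 < x - 0 * (- L) by rewrite mul0r subr0 (lt_le_trans x10).
rewrite -(@waveE _ _ _ _ (- L))//; apply: le_trans (hC 0 x y (- L) _) _.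
  by rewrite mul0r subr0.
rewrite normrN -!mulrA; do 2 (apply: ler_wpM2l; first by rewrite ?exprn_ge0 ?addr_ge0).
rewrite -expRD ler_expR /phase_re sqrrN expr0n mulr0 !subr0 oppr0 mul0r mul0r add0r mulrN [y * L]mulrC mulNr lerD2r.
by rewrite ler_wpM2r// sqr_ge0.
Qed.

End wave.

Section tame.
Context {R : realType} d (W : measurableType d) (P : probability W R) (B : R -> W -> R).
Hypothesis hB : brownian2 P B.

Definition chain_rate (N : nat) : R := 2 * (8 * (N%:R + 40)) ^+ 2 + 1.
(** One null set is discarded for all integers at once. It does not depend on the starting point, so
    the bounds for tame paths hold for every [z]. *)
Definition tame : set W := \bigcap_N [set w | (chain_sum B N%:R (chain_rate N) w < +oo)%E].

Let mchain N : measurable [set w | (chain_sum B N%:R (chain_rate N) w < +oo)%E].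
Proof.
rewrite -[X in measurable X]setTI; apply: emeasurable_fun_infty_o => //.
exact: (measurable_chain_sum hB).
Qed.

Lemma measurable_tame : measurable tame.
Proof. by apply: bigcapT_measurable => N; exact: mchain. Qed.

Let chain0 N w : (0 <= chain_sum B N%:R (chain_rate N) w)%E.
Proof. by apply: le_trans (chain_sum_ge B _ _ 0 0 w); rewrite lee_fin chain_term_ge0. Qed.

Let chain_int N : P.-integrable setT (chain_sum B N%:R (chain_rate N)).
Proof.
apply/integrableP; split; first exact: (measurable_chain_sum hB).
under eq_integral do rewrite gee0_abs//.
exact: (integral_chain_sum hB).
Qed.

Lemma tame_negligible : P (~` tame) = 0%E.
Proof.
apply/negligibleP; first by apply: measurableC; exact: measurable_tame.
rewrite /tame setC_bigcap; apply: negligible_bigcup => N.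
have := integrable_ae measurableT (chain_int N); apply: negligibleS => w /= h1 h2; apply: h1.
by have := h2 I; rewrite ge0_fin_numE.
Qed.

(** An integrable envelope that is uniform in time: any random time, in particular the hitting time,
    may be inserted for [s] without an argument on stopping times. *)
Lemma tame_envelope (nu : R) : exists lam0 : R, exists2 Y : W -> R,
  [/\ measurable_fun setT Y, (forall w, 0 <= Y w) & P.-integrable setT (EFin \o Y)] &
  forall w lam s, tame w -> lam0 <= lam -> 0 <= s -> expR (nu * `|B s w| - lam * s) <= Y w.
Proof.
pose N := (Num.truncn `|nu|).+1; exists (chain_rate N).
exists (fun w => expR N%:R + fine (chain_sum B N%:R (chain_rate N) w)).
  split=> [|w|].
  - apply: measurable_funD => //; apply: measurableT_comp; first exact: fine_measurable.
    exact: (measurable_chain_sum hB).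
  - by rewrite addr_ge0 ?expR_ge0// fine_ge0.
  - apply: integrableD_fun => //.
      exact: finite_measure_integrable_cst.
    apply: le_integrable (chain_int N) => //.
      apply/measurable_EFinP; apply: measurableT_comp; first exact: fine_measurable.
      exact: (measurable_chain_sum hB).
    move=> w _ /=; rewrite [leRHS]gee0_abs// ger0_norm ?fine_ge0//.
    by have := chain0 N w; case: chain_sum => [r|//|//] /=.
move=> w lam s /(_ N I)/= hw hl s0; rewrite -lee_fin EFinD fineK ?ge0_fin_numE//.
have r0 : 0 <= chain_rate N by rewrite /chain_rate addr_ge0// mulr_ge0// sqr_ge0.
apply: le_trans (chain_sum_dominates hB w _ r0 s0); last exact: ler0n.
rewrite lee_fin ler_expR; apply: lerB; last by rewrite ler_wpM2r.
rewrite ler_wpM2r//; apply: le_trans (ler_norm _) _; exact: ltW (truncnS_gt _).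
Qed.

End tame.

Section integral_is.
Context d (T : measurableType d) {R : realType} (mu : {measure set T -> \bar R}) (D : set T).
Hypothesis mD : measurable D.

Definition integral_is (f : T -> R) (v : R) :=
  mu.-integrable D (EFin \o f) /\ \int[mu]_(x in D) f x = v.

Lemma integral_isD f g (v w : R) : integral_is f v -> integral_is g w ->
  integral_is (fun x => f x + g x) (v + w).
Proof.
by move=> [jf <-] [jg <-]; split; [exact: integrableD_fun|rewrite RintegralD].
Qed.

Lemma integral_isZ f (c v : R) : integral_is f v -> integral_is (fun x => c * f x) (c * v).
Proof. by move=> [jf <-]; split; [exact: integrableZ_fun|rewrite RintegralZl]. Qed.

Lemma integral_is_lin3 f g h (a b c u v w : R) :
  integral_is f u -> integral_is g v -> integral_is h w ->
  integral_is (fun x => a * f x + b * g x + c * h x) (a * u + b * v + c * w).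
Proof.
move=> hf hg hh.
exact: (integral_isD (integral_isD (integral_isZ a hf) (integral_isZ b hg)) (integral_isZ c hh)).
Qed.

End integral_is.

Lemma ler_norm_lin3 (R : realDomainType) (a b c f g h F G H : R) :
  `|f| <= F -> `|g| <= G -> `|h| <= H ->
  `|a * f + b * g + c * h| <= `|a| * F + `|b| * G + `|c| * H.
Proof.
move=> hf hg hh; apply: le_trans (ler_normD _ _) _; apply: lerD; last by rewrite normrM ler_wpM2l.
by apply: le_trans (ler_normD _ _) _; apply: lerD; rewrite normrM ler_wpM2l.
Qed.

Section lines.
Context {R : realType}.

(** The amplitudes are bounded uniformly only for [t] in a compact subset of the positive axis. A
    radius of at most 1 lets [line_bound] control the other coordinates. *)
Lemma line_box (t a s0 : R) : 0 < t + s0 * a -> exists2 r : R, 0 < r <= 1 &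
  exists t1 t2 : R, [/\ 0 < t1, 0 <= t2 & forall s, `|s - s0| < r -> t1 <= t + s * a <= t2].
Proof.
set t' := t + s0 * a => t0; have q0 : 0 < `|a| + 1 by rewrite ltr_wpDl.
pose r := Num.min 1 (t' / (2 * (`|a| + 1))).
have r0 : 0 < r by rewrite lt_min ltr01 divr_gt0// mulr_gt0.
exists r; first by rewrite r0 ge_min lexx.
exists (t' / 2), (t' + t' / 2); split=> [||s]; first by rewrite divr_gt0.
  by rewrite addr_ge0 ?divr_ge0// ltW.
rewrite lt_min => /andP[_ hs].
have : `|(s - s0) * a| <= t' / 2.
  rewrite normrM; apply: le_trans (_ : `|s - s0| * (`|a| + 1) <= _).
    by rewrite ler_wpM2l// lerDl.
  rewrite -ler_pdivlMr//; apply: le_trans (ltW hs) _; rewrite invfM mulrA//.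
rewrite (_ : t + s * a = t' + (s - s0) * a); last by rewrite /t'; ring.
by rewrite ler_norml; move: ((s - s0) * a) => y /andP[]; lra.
Qed.

Lemma line_bound (y b s0 s : R) : `|s - s0| <= 1 -> `|y + s * b| <= `|y + s0 * b| + `|b|.
Proof.
move=> hs; rewrite (_ : y + s * b = (y + s0 * b) + (s - s0) * b); last by ring.
by apply: le_trans (ler_normD _ _) _; rewrite lerD2l normrM ler_piMl.
Qed.

End lines.

Section amplitudes.
Context {R : realType}.

(* [k] counts derivatives in the level variable [p]; the derivatives in [y] and
   [t] are those of the Airy semigroup. *)
Record amplitude (M : R -> R -> R) (a : nat -> R -> R -> R -> R -> R) : Prop := {
  amplitude_measurable : forall k t y, measurable_fun setT (fun pz : R * R => a k t y pz.1 pz.2);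
  amplitude_bound : forall k (t1 t2 X c m : R), 0 < t1 -> 0 <= t2 -> 0 <= X -> 0 <= c ->
    0 <= m -> (1 + X) / t1 <= m ->
    exists2 C : R, 0 <= C & forall t y p z, t1 <= t <= t2 -> `|y| <= X -> - c <= p ->
      `|a k t y p z| <= C * expR (- (m * p)) * M m z;
  amplitude_derive : forall k (t y p z da db dc s : R), 0 < t + s * da ->
    is_derive s (1 : R) (fun u => a k (t + u * da) (y + u * db) (p + u * dc) z)
      (- da / 3 * a k.+3 (t + s * da) (y + s * db) (p + s * dc) z
       + db * a k.+2 (t + s * da) (y + s * db) (p + s * dc) z
       + dc * a k.+1 (t + s * da) (y + s * db) (p + s * dc) z) }.

Definition free_amp k t y p z : R := wave k t y (p - z).
Definition free_weight (m z : R) : R := expR (m * z).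

Lemma free_amplitude : amplitude free_weight free_amp.
Proof.
split=> [k t y|k t1 t2 X c m t10 t20 X0 c0 m0 hm|k t y p z da db dc s h].
- by apply: measurable_wave => //; apply: measurable_funB.
- have [C C0 hC] := wave_hypo_bound 0 k t10 t20 (lexx 0) (lexx 0) X0 c0 hm.
  exists C => // t y p z ht hy hp; rewrite /free_amp -[y in wave _ _ y]subr0.
  apply: le_trans (hC t y 0 p z ht hy (lexx 0) _ hp) _; first by rewrite !mul0r.
  by rewrite -mulrA -expRD mulr0 subr0 mulrBr addrC.
- have E u : p + u * dc - z = (p - z) + u * dc by ring.
  by rewrite /free_amp; under eq_fun do rewrite E; rewrite E; apply: is_derive_wave; left.
Qed.

Section pairing.
Variables (M M' : R -> R -> R) (a b : nat -> R -> R -> R -> R -> R).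
Hypothesis ha : amplitude M a.
Hypothesis hb : amplitude M' b.
Hypothesis hMM : forall m z, 0 <= m -> M m z * M' m z <= expR (- m * `|z|).
Notation mu := (@lebesgue_measure R).

Definition pairing k l t y y' p q : R := \int[mu]_z (a k t y p z * b l t y' q z).

Lemma pairing_integrand_bound k l (t1 t2 X c m : R) : 0 < t1 -> 0 <= t2 -> 0 <= X -> 0 <= c ->
  0 <= m -> (1 + X) / t1 <= m ->
  exists2 C : R, 0 <= C & forall t y y' p q z, t1 <= t <= t2 -> `|y| <= X -> `|y'| <= X ->
    - c <= p -> - c <= q ->
    `|a k t y p z * b l t y' q z| <= C * expR (- (m * (p + q))) * expR (- m * `|z|).
Proof.
move=> t10 t20 X0 c0 m0 hm.
have [C C0 hC] := amplitude_bound ha k t10 t20 X0 c0 m0 hm.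
have [C' C'0 hC'] := amplitude_bound hb l t10 t20 X0 c0 m0 hm.
exists (C * C'); first exact: mulr_ge0.
move=> t y y' p q z ht hy hy' hp hq; rewrite normrM.
apply: le_trans (ler_pM _ _ (hC t y p z ht hy hp) (hC' t y' q z ht hy' hq)) _ => //.
rewrite mulrACA [X in X * _](_ : _ = C * C' * expR (- (m * (p + q)))); last first.
  by rewrite mulrDr opprD expRD mulrACA.
by rewrite ler_wpM2l ?hMM// !mulr_ge0// expR_ge0.
Qed.

Let mint k l t y y' p q : measurable_fun setT (fun z => a k t y p z * b l t y' q z).
Proof.
by apply: measurable_funM; [have := amplitude_measurable ha k t y|have := amplitude_measurable hb l t y'];
  move=> h; apply: (measurable_fun_comp2 h).
Qed.

Lemma pairing_integral_is k l t y y' p q : 0 < t ->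
  integral_is mu setT (fun z => a k t y p z * b l t y' q z) (pairing k l t y y' p q).
Proof.
move=> t0; pose X := Num.max `|y| `|y'|; pose c := Num.max `|p| `|q|.
have X0 : 0 <= X by rewrite le_max normr_ge0.
have c0 : 0 <= c by rewrite le_max normr_ge0.
have m0 : 0 < (1 + X) / t by rewrite divr_gt0// ltr_pwDl.
have [C C0 hC] := pairing_integrand_bound k l t0 (ltW t0) X0 c0 (ltW m0) (lexx _).
split=> //; apply: (@integrable_dominated _ _ _ mu setT (fun z => a k t y p z * b l t y' q z)
    (fun z => C * expR (- ((1 + X) / t * (p + q))) * expR (- ((1 + X) / t) * `|z|))) => //.
  exact: mint.
  by apply: (@integrableZ_fun _ _ _ mu setT (fun z => expR (- ((1 + X) / t) * `|z|))) => //; exact: integrable_expRN_norm.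
move=> z _; apply: hC; rewrite ?lexx// ?le_max ?lexx ?orbT//.
  by rewrite lerNl (le_trans (ler_norm _))// normrN le_max lexx.
by rewrite lerNl (le_trans (ler_norm _))// normrN le_max lexx orbT.
Qed.

Lemma pairing_bound k l (t1 t2 X c m : R) : 0 < t1 -> 0 <= t2 -> 0 <= X -> 0 <= c ->
  (1 + X) / t1 <= m ->
  exists2 C : R, 0 <= C & forall t y y' p q, t1 <= t <= t2 -> `|y| <= X -> `|y'| <= X ->
    - c <= p -> - c <= q -> `|pairing k l t y y' p q| <= C * expR (- (m * (p + q))).
Proof.
move=> t10 t20 X0 c0 hm.
have m0 : 0 < m by apply: lt_le_trans hm; rewrite divr_gt0// ltr_pwDl.
have [C C0 hC] := pairing_integrand_bound k l t10 t20 X0 c0 (ltW m0) hm.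
have j := integrable_expRN_norm m0.
exists (C * \int[mu]_z expR (- m * `|z|)).
  by rewrite mulr_ge0// Rintegral_ge0// => z _; rewrite expR_ge0.
move=> t y y' p q ht hy hy' hp hq.
apply: (@le_trans _ _ (\int[mu]_z (C * expR (- (m * (p + q))) * expR (- m * `|z|)))).
  apply: (@normr_Rintegral_le _ _ _ mu setT (fun z => a k t y p z * b l t y' q z)) => //.
    exact: mint.
    exact: (@integrableZ_fun _ _ _ mu setT (fun z => expR (- m * `|z|))).
  by move=> z _; exact: hC.
by rewrite RintegralZl// mulrAC.
Qed.

Lemma measurable_pairing d (T : measurableType d) (p q : T -> R) k l t y y' :
  measurable_fun setT p -> measurable_fun setT q ->
  measurable_fun setT (fun u => pairing k l t y y' (p u) (q u)).
Proof.
move=> mp mq; apply: (@measurable_Rintegral_param _ _ _ _ _ (@lebesgue_measure R)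
  (fun u z => a k t y (p u) z * b l t y' (q u) z)) => //.
apply: measurable_funM.
  apply: (measurable_fun_comp2 (g := fun u : T * R => p u.1) (h := snd) (amplitude_measurable ha k t y)) => //.
  exact: measurableT_comp.
apply: (measurable_fun_comp2 (g := fun u : T * R => q u.1) (h := snd) (amplitude_measurable hb l t y')) => //.
exact: measurableT_comp.
Qed.

Lemma is_derive_pairing k l t y y' p q (dt dy dy' dp dq s : R) : 0 < t + s * dt ->
  let G k l := pairing k l (t + s * dt) (y + s * dy) (y' + s * dy') (p + s * dp) (q + s * dq) in
  is_derive s (1 : R)
    (fun u => pairing k l (t + u * dt) (y + u * dy) (y' + u * dy') (p + u * dp) (q + u * dq))
    (- dt / 3 * G k.+3 l + - dt / 3 * G k l.+3 + dy * G k.+2 l + dy' * G k l.+2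
     + dp * G k.+1 l + dq * G k l.+1).
Proof.
move=> t0 G.
have [r /andP[r0 r1] [t1 [t2 [t10 t20 ht]]]] := line_box t0.
pose X := (`|y + s * dy| + `|dy|) + (`|y' + s * dy'| + `|dy'|).
pose c := (`|p + s * dp| + `|dp|) + (`|q + s * dq| + `|dq|).
have X0 : 0 <= X by rewrite !addr_ge0.
have c0 : 0 <= c by rewrite !addr_ge0.
pose m := (1 + X) / t1; have m0 : 0 < m by rewrite divr_gt0// ltr_pwDl.
have bd k' l' := pairing_integrand_bound k' l' t10 t20 X0 c0 (ltW m0) (lexx _).
pose F k l u z := a k (t + u * dt) (y + u * dy) (p + u * dp) z * b l (t + u * dt) (y' + u * dy') (q + u * dq) z.
pose DF u z := - dt / 3 * F k.+3 l u z + - dt / 3 * F k l.+3 u z + dy * F k.+2 l u z + dy' * F k l.+2 u z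
     + dp * F k.+1 l u z + dq * F k l.+1 u z.
have pos u : `|u - s| < r -> 0 < t + u * dt by move=> /ht/andP[h _]; exact: lt_le_trans h.
have jF k' l' u : `|u - s| < r -> integral_is mu setT (F k' l' u)
    (pairing k' l' (t + u * dt) (y + u * dy) (y' + u * dy') (p + u * dp) (q + u * dq)).
  by move=> /pos h; exact: pairing_integral_is.
have ss : `|s - s| < r by rewrite subrr normr0.
have hDF : integral_is mu setT (DF s) (- dt / 3 * G k.+3 l + - dt / 3 * G k l.+3 + dy * G k.+2 l + dy' * G k l.+2
     + dp * G k.+1 l + dq * G k l.+1).
  have h := integral_isD measurableT
    (integral_is_lin3 measurableT (- dt / 3) (- dt / 3) dy (jF k.+3 l s ss) (jF k l.+3 s ss) (jF k.+2 l s ss))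
    (integral_is_lin3 measurableT dy' dp dq (jF k l.+2 s ss) (jF k.+1 l s ss) (jF k l.+1 s ss)).
  have {h} := h; rewrite -/(G k.+3 l) -/(G k l.+3) -/(G k.+2 l) -/(G k l.+2) -/(G k.+1 l) -/(G k l.+1) !addrA.
  by congr integral_is; apply/funext => z; rewrite /DF !addrA.
rewrite -(hDF.2).
have dom k' l' : exists2 C : R, 0 <= C & forall u z, `|u - s| < r -> `|F k' l' u z| <= C * expR (- m * `|z|).
  have [C C0 hC] := bd k' l'; exists (C * expR (m * c)); first by rewrite mulr_ge0// expR_ge0.
  move=> u z us; have us1 : `|u - s| <= 1 by apply: le_trans (ltW us) r1.
  have lp := line_bound p dp us1; have lq := line_bound q dq us1.
  have ly := line_bound y dy us1; have ly' := line_bound y' dy' us1.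
  apply: le_trans (hC _ _ _ _ _ z (ht u us) _ _ _ _) _.
  - by apply: le_trans ly _; rewrite lerDl addr_ge0.
  - by apply: le_trans ly' _; rewrite lerDr addr_ge0.
  - rewrite lerNl; apply: le_trans (ler_norm _) _; rewrite normrN; apply: le_trans lp _.
    by rewrite lerDl addr_ge0.
  - rewrite lerNl; apply: le_trans (ler_norm _) _; rewrite normrN; apply: le_trans lq _.
    by rewrite lerDr addr_ge0.
  rewrite ler_wpM2r ?expR_ge0// ler_wpM2l// ler_expR -mulrN ler_wpM2l ?(ltW m0)//.
  rewrite opprD; apply: le_trans (_ : `|p + u * dp| + `|q + u * dq| <= _); last exact: lerD.
  by apply: lerD; apply: le_trans (ler_norm _) _; rewrite normrN.
have [C1 C10 h1] := dom k.+3 l; have [C2 C20 h2] := dom k l.+3; have [C3 C30 h3] := dom k.+2 l.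
have [C4 C40 h4] := dom k l.+2; have [C5 C50 h5] := dom k.+1 l; have [C6 C60 h6] := dom k l.+1.
pose K := `|- dt / 3| * C1 + `|- dt / 3| * C2 + `|dy| * C3 + `|dy'| * C4 + `|dp| * C5 + `|dq| * C6.
apply: (@is_derive_Rintegral _ _ _ mu setT (F k l) DF (fun z => K * expR (- m * `|z|)) s r) => //.
- by move=> u _; exact: mint.
- exact: (jF k l s ss).1.
- by apply: (@integrableZ_fun _ _ _ mu setT (fun z => expR (- m * `|z|))) => //; exact: integrable_expRN_norm.
- move=> u z us _; have pu := pos u us.
  have := is_deriveM_fun (amplitude_derive ha k y p z dy dp pu) (amplitude_derive hb l y' q z dy' dq pu).
  by congr is_derive; rewrite /DF /F; ring.
- move=> u z us _; set E := expR _.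
  have -> : K * E = (`|- dt / 3| * (C1 * E) + `|- dt / 3| * (C2 * E) + `|dy| * (C3 * E)) +
     (`|dy'| * (C4 * E) + `|dp| * (C5 * E) + `|dq| * (C6 * E)) by rewrite /K; ring.
  rewrite (_ : DF u z = (- dt / 3 * F k.+3 l u z + - dt / 3 * F k l.+3 u z + dy * F k.+2 l u z) +
    (dy' * F k l.+2 u z + dp * F k.+1 l u z + dq * F k l.+1 u z)); last by rewrite /DF !addrA.
  apply: le_trans (ler_normD _ _) _.
  by apply: lerD; apply: ler_norm_lin3; [exact: h1|exact: h2|exact: h3|exact: h4|exact: h5|exact: h6].
Qed.

End pairing.
End amplitudes.

Section hitting_amplitude.
Context {R : realType} d (W : measurableType d) (P : probability W R) (B : R -> W -> R).
Hypothesis hB : brownian2 P B.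
Variable h : R -> \bar R.
Hypothesis hUC : UC h.

(** The restriction to tame paths turns almost sure bounds into bounds at every point, as domination
    under the integral requires. *)
Definition alive : set (R * W) := [set p | (hit h B p < +oo)%E /\ tame B p.2].
Definition hit_wave k t y p z w : R :=
  \1_alive (z, w) * wave k t (y - hit_time h B (z, w)) (p - hit_place h B (z, w)).
Definition hit_amp k t y p z : R := \int[P]_w hit_wave k t y p z w.
(** At the place of hitting [b = z + B(tau)], the growth [expR (m * b)] gives the first bound
    directly. For the second, [m b = 3 m b - 2 m b], where [b <= A + G * tau] bounds the first term
    and [z] enters the second with the opposite sign. The decay on both sides beats [free_weight]
    and makes the integrals over [z] converge. *)
Definition hit_weight (m z : R) : R := Num.min (expR (m * z)) (expR (- (2 * m * z))).

Let husc := UC_usc hUC.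

Lemma measurable_alive : measurable alive.
Proof.
have -> : alive = [set p | (hit h B p < +oo)%E] `&` (setT `*` tame B).
  by apply/seteqP; split=> -[z w] /= [h1 h2]; split=> //; case: h2.
apply: measurableI; first exact: (measurable_hit_lty husc hB).
by apply: measurableX => //; exact: (measurable_tame hB).
Qed.

Lemma measurable_hit_wave d' (T : measurableType d') k t y (p z : T -> R) (w : T -> W) :
  measurable_fun setT p -> measurable_fun setT z -> measurable_fun setT w ->
  measurable_fun setT (fun u => hit_wave k t y (p u) (z u) (w u)).
Proof.
move=> mp mz mw; have mzw : measurable_fun setT (fun u => (z u, w u)) by exact: measurable_fun_pair.
rewrite /hit_wave; apply: measurable_funM.
  have mi : measurable_fun setT (\1_alive : R * W -> R) by apply: measurable_indic; exact: measurable_alive.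
  exact: (measurableT_comp mi mzw).
apply: measurable_wave; apply: measurable_funB => //.
  exact: (measurableT_comp (measurable_hit_time husc hB) mzw).
exact: (measurableT_comp (measurable_hit_place husc hB) mzw).
Qed.

Lemma measurable_hit_wave_section k t y p z : measurable_fun setT (hit_wave k t y p z).
Proof. exact: measurable_hit_wave. Qed.

Lemma hit_wave_bound k (t1 t2 X c m : R) : 0 < t1 -> 0 <= t2 -> 0 <= X -> 0 <= c ->
  0 <= m -> (1 + X) / t1 <= m ->
  exists C : R, exists2 Y : W -> R,
    [/\ 0 <= C, measurable_fun setT Y, (forall w, 0 <= Y w) & P.-integrable setT (EFin \o Y)] &
    forall t y p z w, t1 <= t <= t2 -> `|y| <= X -> - c <= p ->
      `|hit_wave k t y p z w| <= C * expR (- (m * p)) * hit_weight m z * Y w.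
Proof.
move=> t10 t20 X0 c0 m0 hm.
have [A [G [A0 G0 hg]]] := UC_growth hUC.
have [lam0 [Y [mY Y0 jY] hY]] := tame_envelope hB (2 * m).
(* The summand [3 * m * G] absorbs the growth of the hypograph in [3 m b <= 3 m (A + G * tau)]; the
   rest is left for the envelope of the Brownian path. *)
pose lam := Num.max lam0 0 + 3 * m * G.
have [C C0 hC] := wave_hypo_bound lam k t10 t20 (ltW A0) (ltW G0) X0 c0 hm.
exists (C * expR (3 * m * A)), Y; first by split=> //; rewrite mulr_ge0// expR_ge0.
move=> t y p z w ht hy hp; rewrite /hit_wave normrM.
have wt0 : 0 <= hit_weight m z by rewrite le_min !expR_ge0.
rewrite indicE; case: (boolP ((z, w) \in alive)) => [|_]; last by rewrite normr0 mul0r !mulr_ge0// expR_ge0.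
rewrite inE => -[/= hlt tm]; rewrite normr1 mul1r.
have [tau0 _ bE hb] := hit_spec husc hB hlt.
move: tau0 bE hb; set tau := hit_time _ _ _; set b := hit_place _ _ _ => tau0 bE hb.
have bA : b <= A + G * tau.
  by rewrite -lee_fin; apply: le_trans hb _; apply: le_trans (hg tau) _; rewrite ger0_norm.
apply: le_trans (hC t y tau p b ht hy tau0 _ hp) _; first by rewrite ler_wpM2l.
rewrite mulrBr (_ : m * b - m * p - lam * tau = - (m * p) + (m * b - lam * tau)); last by ring.
rewrite expRD (_ : C * expR (3 * m * A) * expR (- (m * p)) * hit_weight m z * Y w =
  C * (expR (- (m * p)) * (expR (3 * m * A) * hit_weight m z * Y w))); last by ring.
rewrite ler_wpM2l// ler_wpM2l ?expR_ge0// -mulrA [hit_weight _ _ * _]mulrC mulrA.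
have K0 : 0 <= expR (3 * m * A) * Y w by rewrite mulr_ge0// expR_ge0.
rewrite /hit_weight minr_pMr//.
have lm : lam0 <= Num.max lam0 0 by rewrite le_max lexx.
have hYw := hY w (Num.max lam0 0) tau tm lm tau0.
have mG : 0 <= m * G * tau by rewrite !mulr_ge0// ltW.
have mA : 0 <= m * A by rewrite mulr_ge0// ltW.
have nb : 0 <= `|B tau w| by [].
have Bn : B tau w <= `|B tau w| by exact: ler_norm.
have Bn' : - B tau w <= `|B tau w| by rewrite -normrN ler_norm.
have step e : m * b - lam * tau <= 3 * m * A + (2 * m * `|B tau w| - Num.max lam0 0 * tau) + e ->
    expR (m * b - lam * tau) <= expR (3 * m * A) * Y w * expR e.
  move=> he; apply: le_trans (_ : expR (3 * m * A + (2 * m * `|B tau w| - Num.max lam0 0 * tau) + e) <= _).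
    by rewrite ler_expR.
  rewrite (expRD (3 * m * A + _)) (expRD (3 * m * A)).
  by rewrite ler_wpM2r ?expR_ge0// ler_wpM2l ?expR_ge0.
rewrite le_min; apply/andP; split; apply: step; rewrite /lam bE /=.
  have : m * B tau w <= 2 * m * `|B tau w|.
    by rewrite -mulrA mulrCA ler_wpM2l//; lra.
  by move: mG mA; rewrite mulrDl mulrDr; lra.
have h1 : 3 * m * b <= 3 * m * (A + G * tau) by rewrite ler_wpM2l// mulr_ge0.
have h2 : 2 * m * (- B tau w) <= 2 * m * `|B tau w| by rewrite ler_wpM2l// mulr_ge0.
by move: h1; rewrite bE /=; lra.
Qed.

Lemma hit_wave_integrable k t y p z : 0 < t -> P.-integrable setT (EFin \o hit_wave k t y p z).
Proof.
move=> t0; have m0 : 0 <= (1 + `|y|) / t by rewrite divr_ge0// ?ltW// addr_ge0.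
have [C [Y [C0 mY Y0 jY] hY]] := hit_wave_bound k t0 (ltW t0) (normr_ge0 y) (normr_ge0 p) m0 (lexx _).
apply: (@integrable_dominated _ _ _ P setT (hit_wave k t y p z) _ _ _ (integrableZ_fun _ measurableT jY)) => //.
  exact: measurable_hit_wave_section.
by move=> w _; apply: hY => //; rewrite ?lexx// lerNl (le_trans (ler_norm _))// normrN.
Qed.

Lemma hit_amplitude : amplitude hit_weight hit_amp.
Proof.
split=> [k t y|k t1 t2 X c m t10 t20 X0 c0 m0 hm|k t y p z da db dc s t0].
- apply: (@measurable_Rintegral_param _ _ _ _ _ P (fun q : R * R => hit_wave k t y q.1 q.2)) => //.
  by apply: measurable_hit_wave => //; exact: measurableT_comp.
- have [C [Y [C0 mY Y0 jY] hY]] := hit_wave_bound k t10 t20 X0 c0 m0 hm.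
  exists (C * \int[P]_w Y w); first by rewrite mulr_ge0// Rintegral_ge0.
  move=> t y p z ht hy hp.
  apply: (@le_trans _ _ (\int[P]_w (C * expR (- (m * p)) * hit_weight m z * Y w))).
    apply: normr_Rintegral_le => //; first exact: measurable_hit_wave_section.
      exact: (@integrableZ_fun _ _ _ P setT Y).
    by move=> w _; exact: hY.
  by rewrite RintegralZl// le_eqVlt; apply/orP; left; apply/eqP; ring.
have [r /andP[r0 r1] [t1 [t2 [t10 t20 ht]]]] := line_box t0.
pose X := `|y + s * db| + `|db|; pose c := `|p + s * dc| + `|dc|.
have X0 : 0 <= X by rewrite addr_ge0.
have c0 : 0 <= c by rewrite addr_ge0.
pose m := (1 + X) / t1; have m0 : 0 <= m by apply: divr_ge0; [exact: addr_ge0|exact: ltW].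
pose F k u w := hit_wave k (t + u * da) (y + u * db) (p + u * dc) z w.
pose DF u w := - da / 3 * F k.+3 u w + db * F k.+2 u w + dc * F k.+1 u w.
have pos u : `|u - s| < r -> 0 < t + u * da by move=> /ht/andP[hh _]; exact: lt_le_trans hh.
have ss : `|s - s| < r by rewrite subrr normr0.
have jF k' u : `|u - s| < r -> integral_is P setT (F k' u) (hit_amp k' (t + u * da) (y + u * db) (p + u * dc) z).
  by move=> /pos hh; split=> //; exact: hit_wave_integrable.
have hDF := integral_is_lin3 measurableT (- da / 3) db dc (jF k.+3 s ss) (jF k.+2 s ss) (jF k.+1 s ss).
rewrite -(hDF.2).
have dom k' : exists2 Y : W -> R, P.-integrable setT (EFin \o Y) & forall u w, `|u - s| < r -> `|F k' u w| <= Y w.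
  have [C [Y [C0 mY Y0 jY] hY]] := hit_wave_bound k' t10 t20 X0 c0 m0 (lexx _).
  exists (fun w => C * expR (m * c) * hit_weight m z * Y w); first exact: (@integrableZ_fun _ _ _ P setT Y).
  move=> u w us; have us1 : `|u - s| <= 1 by apply: le_trans (ltW us) r1.
  have lp := line_bound p dc us1; have ly := line_bound y db us1.
  apply: le_trans (hY _ _ _ z w (ht u us) ly _) _.
    by rewrite lerNl; apply: le_trans (ler_norm _) _; rewrite normrN.
  rewrite ler_wpM2r// ler_wpM2r ?le_min ?expR_ge0// ler_wpM2l// ler_expR -mulrN ler_wpM2l//.
  by apply: le_trans lp; rewrite -normrN ler_norm.
have [Y1 j1 h1] := dom k.+3; have [Y2 j2 h2] := dom k.+2; have [Y3 j3 h3] := dom k.+1.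
pose Z w := `|- da / 3| * Y1 w + `|db| * Y2 w + `|dc| * Y3 w.
apply: (@is_derive_Rintegral _ _ _ P setT (F k) DF Z s r) => //.
- by move=> u _; exact: measurable_hit_wave_section.
- exact: (jF k s ss).1.
- exact: (integral_is_lin3 measurableT `|- da / 3| `|db| `|dc| (conj j1 erefl) (conj j2 erefl) (conj j3 erefl)).1.
- move=> u w us _; have pu := pos u us; rewrite /DF /F /hit_wave.
  set T := hit_time _ _ _; set b := hit_place _ _ _; set i := \1_alive _.
  have Ey v : y + v * db - T = (y - T) + v * db by ring.
  have Ep v : p + v * dc - b = (p - b) + v * dc by ring.
  under eq_fun do rewrite Ey Ep.
  have := is_deriveZ_fun i (@is_derive_wave _ k t (y - T) (p - b) da db dc u (or_introl pu)).
  by rewrite !Ey !Ep; congr is_derive; ring.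
- move=> u w us _; rewrite /DF /Z.
  by apply: ler_norm_lin3; [exact: h1|exact: h2|exact: h3].
Qed.

Lemma weight_products (m z : R) : 0 <= m ->
  [/\ hit_weight m z * free_weight m z <= expR (- m * `|z|),
      free_weight m z * hit_weight m z <= expR (- m * `|z|) &
      hit_weight m z * hit_weight m z <= expR (- m * `|z|)].
Proof.
move=> m0.
have h1 : hit_weight m z * free_weight m z <= expR (- m * `|z|).
  rewrite /hit_weight /free_weight; have [z0|z0] := leP 0 z.
    apply: (@le_trans _ _ (expR (- (2 * m * z)) * expR (m * z))).
      by rewrite ler_wpM2r ?expR_ge0// ge_min lexx orbT.
    by rewrite -expRD ler_expR ger0_norm//; lra.
  apply: (@le_trans _ _ (expR (m * z) * expR (m * z))).
    by rewrite ler_wpM2r ?expR_ge0// ge_min lexx.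
  have : m * z <= 0 by rewrite mulr_ge0_le0// ltW.
  by rewrite -expRD ler_expR ltr0_norm//; lra.
split=> //; first by rewrite mulrC.
apply: le_trans h1; rewrite ler_wpM2l ?le_min ?expR_ge0//.
by rewrite /hit_weight ge_min lexx.
Qed.

Lemma law_integral_wave k t y p z (c : R) : 0 < t ->
  law_integral (hitting_law P B h z) (fun s b => wave k t (y - s) (p - b) * c) =
  hit_amp k t y p z * c.
Proof.
move=> t0; pose D := [set w | (hit h B (z, w) < +oo)%E].
have mD : measurable D.
  by have := measurable_xsection z (measurable_hit_lty husc hB); rewrite (_ : xsection _ _ = D)//;
    apply/seteqP; split=> w; rewrite /xsection /= inE.
pose f w := wave k t (y - hit_time h B (z, w)) (p - hit_place h B (z, w)) * c.
have mg : measurable_fun setT (fun q : R * R => wave k t (y - q.1) (p - q.2) * c).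
  by apply: measurable_funM => //; apply: measurable_wave; exact: measurable_funB.
have mf : measurable_fun setT f.
  apply: (@measurable_fun_comp2 _ _ _ _ W R R R (fun s b => wave k t (y - s) (p - b) * c)
    (fun w => hit_time h B (z, w)) (fun w => hit_place h B (z, w))) => //.
    by apply: measurableT_comp => //; exact: (measurable_hit_time husc hB).
  by apply: measurableT_comp => //; exact: (measurable_hit_place husc hB).
have jf : P.-integrable D (EFin \o f).
  have [A [G [A0 G0 hg]]] := UC_growth hUC; pose m := (1 + `|y|) / t.
  have m0 : 0 <= m by rewrite divr_ge0// ?ltW// addr_ge0.
  (* With the rate [m * G] the bound [b <= A + G * tau] leaves a constant: for a fixed starting
     point the integrand is bounded on the event of a hit. *)
  have [C C0 hC] := wave_hypo_bound (m * G) k t0 (ltW t0) (ltW A0) (ltW G0) (normr_ge0 y) (normr_ge0 p) (lexx _).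
  apply: (@integrable_dominated _ _ _ P D f (cst (C * expR (m * (A - p)) * `|c|))) => //.
  - exact: measurable_funTS.
  - by apply: (integrableS measurableT) => //; exact: finite_measure_integrable_cst.
  move=> w Dw; have [tau0 _ bE hb] := hit_spec husc hB Dw.
  rewrite /f normrM ler_wpM2r//; move: tau0 bE hb; set tau := hit_time _ _ _; set b := hit_place _ _ _ => tau0 bE hb.
  have bA : b <= A + G * tau.
    by rewrite -lee_fin; apply: le_trans hb _; apply: le_trans (hg tau) _; rewrite ger0_norm.
  have pn : - `|p| <= p by rewrite lerNl (le_trans (ler_norm _))// normrN.
  apply: le_trans (hC t y tau p b _ (lexx _) tau0 _ pn) _; rewrite ?lexx//; first by rewrite ler_wpM2l.
  rewrite ler_wpM2l// ler_expR.
  have : m * b <= m * (A + G * tau) by rewrite ler_wpM2l.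
  by rewrite -/m; lra.
rewrite (law_integralE husc hB (g := fun s b => wave k t (y - s) (p - b) * c))//.
have nt : measurable (~` tame B) by apply: measurableC; exact: (measurable_tame hB).
rewrite /Rintegral (negligible_integral nt mD jf (tame_negligible hB)).
rewrite integral_mkcond -[RHS]RintegralZr//; last exact: hit_wave_integrable.
rewrite /Rintegral; congr fine; apply: eq_integral => w _; rewrite patchE /hit_wave indicE.
have -> : (w \in D `\` ~` tame B) = ((z, w) \in alive).
  by apply/idP/idP; rewrite !inE /= => -[h1 h2]; split=> //; exact: contrapT.
by case: ifP => _; rewrite ?mul1r ?mul0r.
Qed.

End hitting_amplitude.

Lemma linear6 (R : comRingType) (c1 c2 c3 c4 c5 c6 x1 x2 x3 x4 x5 x6 y1 y2 y3 y4 y5 y6 z1 z2 z3 z4 z5 z6 : R) :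
  c1 * x1 + c2 * x2 + c3 * x3 + c4 * x4 + c5 * x5 + c6 * x6
  + (c1 * y1 + c2 * y2 + c3 * y3 + c4 * y4 + c5 * y5 + c6 * y6)
  - (c1 * z1 + c2 * z2 + c3 * z3 + c4 * z4 + c5 * z5 + c6 * z6) =
  c1 * (x1 + y1 - z1) + c2 * (x2 + y2 - z2) + c3 * (x3 + y3 - z3) + c4 * (x4 + y4 - z4)
  + c5 * (x5 + y5 - z5) + c6 * (x6 + y6 - z6).
Proof. by ring. Qed.

Lemma linear6B (R : comRingType) (c1 c2 c3 c4 c5 c6 x1 x2 x3 x4 x5 x6 y1 y2 y3 y4 y5 y6 : R) :
  c1 * x1 + c2 * x2 + - c3 * x3 + c4 * x4 + c5 * x5 + c6 * x6
  - (c1 * y1 + c2 * y2 - c3 * y3 + c4 * y4 + c5 * y5 + c6 * y6) =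
  c1 * (x1 - y1) + c2 * (x2 - y2) - c3 * (x3 - y3) + c4 * (x4 - y4)
  + c5 * (x5 - y5) + c6 * (x6 - y6).
Proof. by ring. Qed.

Section kpz_kernel.
Context {R : realType} d (W : measurableType d) (P : probability W R) (B : R -> W -> R).
Hypothesis hB : brownian2 P B.
Variable h0 : R -> \bar R.
Hypothesis hUC : UC h0.
Notation mu := (@lebesgue_measure R).

Let am := hit_amp P B (fun s => h0 (- s)).
Let ap := hit_amp P B h0.
Let am_ok : amplitude hit_weight am := hit_amplitude hB (UC_reflect hUC).
Let ap_ok : amplitude hit_weight ap := hit_amplitude hB hUC.
Let fr_ok := @free_amplitude R.

(** The part of the KPZ kernel other than the heat kernel. Integrating out the hitting laws reduces
    its three terms to pairings over the common starting point [z]. *)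
Definition path_kernel k l t y y' p q : R :=
  pairing am free_amp k l t y y' p q + pairing free_amp ap k l t y y' p q
  - pairing am ap k l t y y' p q.

Let w1 m z (m0 : 0 <= m) : hit_weight m z * free_weight m z <= expR (- m * `|z|) :> R.
Proof. by have [] := weight_products z m0. Qed.
Let w2 m z (m0 : 0 <= m) : free_weight m z * hit_weight m z <= expR (- m * `|z|) :> R.
Proof. by have [] := weight_products z m0. Qed.
Let w3 m z (m0 : 0 <= m) : hit_weight m z * hit_weight m z <= expR (- m * `|z|) :> R.
Proof. by have [] := weight_products z m0. Qed.

Lemma path_kernel_bound k l (t1 t2 X c m : R) : 0 < t1 -> 0 <= t2 -> 0 <= X -> 0 <= c ->
  (1 + X) / t1 <= m ->
  exists2 C : R, 0 <= C & forall t y y' p q, t1 <= t <= t2 -> `|y| <= X -> `|y'| <= X ->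
    - c <= p -> - c <= q -> `|path_kernel k l t y y' p q| <= C * expR (- (m * (p + q))).
Proof.
move=> t10 t20 X0 c0 hm.
have [C1 C10 h1] := pairing_bound am_ok fr_ok w1 k l t10 t20 X0 c0 hm.
have [C2 C20 h2] := pairing_bound fr_ok ap_ok w2 k l t10 t20 X0 c0 hm.
have [C3 C30 h3] := pairing_bound am_ok ap_ok w3 k l t10 t20 X0 c0 hm.
exists (C1 + C2 + C3); first by rewrite !addr_ge0.
move=> t y y' p q ht hy hy' hp hq; rewrite !mulrDl.
apply: le_trans (ler_normB _ _) _; apply: lerD; last exact: h3.
by apply: le_trans (ler_normD _ _) _; apply: lerD; [exact: h1|exact: h2].
Qed.

Lemma measurable_path_kernel d' (T : measurableType d') (p q : T -> R) k l t y y' :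
  measurable_fun setT p -> measurable_fun setT q ->
  measurable_fun setT (fun u => path_kernel k l t y y' (p u) (q u)).
Proof.
move=> mp mq; have h1 := measurable_pairing am_ok fr_ok k l t y y' mp mq.
have h2 := measurable_pairing fr_ok ap_ok k l t y y' mp mq.
have h3 := measurable_pairing am_ok ap_ok k l t y y' mp mq.
exact: measurable_funB (measurable_funD h1 h2) h3.
Qed.

Lemma is_derive_path_kernel k l t y y' p q (dt dy dy' dp dq s : R) : 0 < t + s * dt ->
  let G k l := path_kernel k l (t + s * dt) (y + s * dy) (y' + s * dy') (p + s * dp) (q + s * dq) in
  is_derive s (1 : R)
    (fun u => path_kernel k l (t + u * dt) (y + u * dy) (y' + u * dy') (p + u * dp) (q + u * dq))
    (- dt / 3 * G k.+3 l + - dt / 3 * G k l.+3 + dy * G k.+2 l + dy' * G k l.+2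
     + dp * G k.+1 l + dq * G k l.+1).
Proof.
move=> t0 G.
have h1 := is_derive_pairing am_ok fr_ok w1 k l y y' p q dy dy' dp dq t0.
have h2 := is_derive_pairing fr_ok ap_ok w2 k l y y' p q dy dy' dp dq t0.
have h3 := is_derive_pairing am_ok ap_ok w3 k l y y' p q dy dy' dp dq t0.
have := is_deriveB_fun (is_deriveD_fun h1 h2) h3.
by congr is_derive; exact: linear6.
Qed.

Section matrix_kernel.
Variable n : nat.
Implicit Types (x r : 'rV[R]_n) (i j : 'I_n).

(* [k] derivatives in the first and [l] in the second argument of the kernel. *)
Definition kker k l t x r i j u v : R :=
  path_kernel k l t (- x 0 i) (x 0 j) (u + r 0 i) (v + r 0 j) -
  (if (i < j)%N then (-1) ^+ k * wave (k + l) 0 (x 0 j - x 0 i) (v + r 0 j - (u + r 0 i)) else 0).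

Lemma kpzKE t x r i j u v : 0 < t -> increasing_row x ->
  kpzK P B h0 t x r i j u v = kker 0 0 t x r i j u v.
Proof.
move=> t0 hx; rewrite /kpzK /kker /path_kernel.
have -> : (if x 0 i < x 0 j then heat_kernel (x 0 j - x 0 i) (u + r 0 i) (v + r 0 j) else 0) =
   (if (i < j)%N then (-1) ^+ 0 * wave (0 + 0) 0 (x 0 j - x 0 i) (v + r 0 j - (u + r 0 i)) else 0).
  case: (ltngtP i j) => ij.
  - by rewrite hx// expr0 mul1r heat_kernel_wave// subr_gt0 hx.
  - by rewrite ltNge le_eqVlt hx// orbT.
  - by rewrite (val_inj ij) ltxx.
set H := (if _ then _ else _).
have -> : \int[mu]_z law_integral (hitting_law P B (fun s => h0 (- s)) z) (fun s b =>
        kpzS t (- x 0 i - s) b (u + r 0 i) * kpzS t (x 0 j) z (v + r 0 j)) =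
    pairing am free_amp 0 0 t (- x 0 i) (x 0 j) (u + r 0 i) (v + r 0 j).
  apply: eq_Rintegral => z _; rewrite -(law_integral_wave hB (UC_reflect hUC))//.
  by congr law_integral; apply/funext => s; apply/funext => b; rewrite !kpzS_wave.
have -> : \int[mu]_z law_integral (hitting_law P B h0 z) (fun s b =>
        kpzS t (- x 0 i) z (u + r 0 i) * kpzS t (x 0 j - s) b (v + r 0 j)) =
    pairing free_amp ap 0 0 t (- x 0 i) (x 0 j) (u + r 0 i) (v + r 0 j).
  apply: eq_Rintegral => z _; rewrite mulrC -(law_integral_wave hB hUC)//.
  by congr law_integral; apply/funext => s; apply/funext => b; rewrite !kpzS_wave// mulrC.
have -> : \int[mu]_z law_integral (hitting_law P B (fun s => h0 (- s)) z) (fun sm bm =>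
        law_integral (hitting_law P B h0 z) (fun sp bp =>
          kpzS t (- x 0 i - sm) bm (u + r 0 i) * kpzS t (x 0 j - sp) bp (v + r 0 j))) =
    pairing am ap 0 0 t (- x 0 i) (x 0 j) (u + r 0 i) (v + r 0 j).
  apply: eq_Rintegral => z _; rewrite -(law_integral_wave hB (UC_reflect hUC))//.
  congr law_integral; apply/funext => s; apply/funext => b.
  rewrite mulrC -(law_integral_wave hB hUC)//.
  by congr law_integral; apply/funext => s'; apply/funext => b'; rewrite !kpzS_wave// mulrC.
by ring.
Qed.

Lemma measurable_kker d' (T : measurableType d') (u v : T -> R) k l t x r i j :
  measurable_fun setT u -> measurable_fun setT v ->
  measurable_fun setT (fun s => kker k l t x r i j (u s) (v s)).
Proof.
move=> mu' mv; apply: measurable_funB.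
  by apply: measurable_path_kernel; exact: measurable_funD.
case: (i < j)%N => //; apply: measurable_funM => //; apply: measurable_wave => //.
by apply: measurable_funB; exact: measurable_funD.
Qed.

Lemma is_derive_kker k l t x r i j u v (dt du dv s : R) (dx dr : 'rV[R]_n) :
  0 < t + s * dt -> (forall i j : 'I_n, (i < j)%N -> x 0 i + s * dx 0 i < x 0 j + s * dx 0 j) ->
  let G k l := kker k l (t + s * dt) (x + s *: dx) (r + s *: dr) i j (u + s * du) (v + s * dv) in
  is_derive s (1 : R)
    (fun a => kker k l (t + a * dt) (x + a *: dx) (r + a *: dr) i j (u + a * du) (v + a * dv))
    (- dt / 3 * G k.+3 l + - dt / 3 * G k l.+3 - dx 0 i * G k.+2 l + dx 0 j * G k l.+2
     + (du + dr 0 i) * G k.+1 l + (dv + dr 0 j) * G k l.+1).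
Proof.
move=> t0 hx G.
have Ex a m : (x + a *: dx) 0 m = x 0 m + a * dx 0 m by rewrite !mxE.
have Er a m : (r + a *: dr) 0 m = r 0 m + a * dr 0 m by rewrite !mxE.
have h1 := is_derive_path_kernel k l (- x 0 i) (x 0 j) (u + r 0 i) (v + r 0 j)
   (- dx 0 i) (dx 0 j) (du + dr 0 i) (dv + dr 0 j) t0.
pose H k l a : R := if (i < j)%N then (-1) ^+ k * wave (k + l) 0 ((x 0 j - x 0 i) + a * (dx 0 j - dx 0 i))
  ((v + r 0 j - (u + r 0 i)) + a * (dv + dr 0 j - (du + dr 0 i))) else 0.
have h2 : is_derive s (1 : R) (H k l) (- dt / 3 * H k.+3 l s + - dt / 3 * H k l.+3 s - dx 0 i * H k.+2 l s + dx 0 j * H k l.+2 s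
     + (du + dr 0 i) * H k.+1 l s + (dv + dr 0 j) * H k l.+1 s).
  rewrite /H; case: ifP => ij; last first.
    rewrite (_ : _ + _ = 0); first exact: is_derive_cst.
    by rewrite !mulr0 oppr0 !addr0.
  have pos : 0 < (x 0 j - x 0 i) + s * (dx 0 j - dx 0 i).
    by have := hx i j ij; lra.
  have := @is_derive_wave _ (k + l) 0 (x 0 j - x 0 i) (v + r 0 j - (u + r 0 i)) 0
    (dx 0 j - dx 0 i) (dv + dr 0 j - (du + dr 0 i)) s (or_intror (And3 erefl erefl pos)).
  move/(is_deriveZ_fun ((-1) ^+ k)); under eq_fun do rewrite mulr0 addr0.
  congr is_derive; rewrite !addSn !addnS !exprS mulr0 addr0 oppr0 mul0r mul0r add0r.
  by move: (wave _ _ _ _) (wave _ _ _ _) (wave _ _ _ _) ((-1) ^+ k) => a b c e; field.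
have GE k' l' a : kker k' l' (t + a * dt) (x + a *: dx) (r + a *: dr) i j (u + a * du) (v + a * dv) =
  path_kernel k' l' (t + a * dt) (- x 0 i + a * - dx 0 i) (x 0 j + a * dx 0 j)
     (u + r 0 i + a * (du + dr 0 i)) (v + r 0 j + a * (dv + dr 0 j)) - H k' l' a.
  rewrite /kker !Ex !Er /H.
  rewrite (_ : - (x 0 i + a * dx 0 i) = - x 0 i + a * - dx 0 i); last by ring.
  rewrite (_ : u + a * du + (r 0 i + a * dr 0 i) = u + r 0 i + a * (du + dr 0 i)); last by ring.
  rewrite (_ : v + a * dv + (r 0 j + a * dr 0 j) = v + r 0 j + a * (dv + dr 0 j)); last by ring.
  rewrite (_ : x 0 j + a * dx 0 j + (- x 0 i + a * - dx 0 i) = x 0 j - x 0 i + a * (dx 0 j - dx 0 i)); last by ring.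
  rewrite (_ : v + r 0 j + a * (dv + dr 0 j) - (u + r 0 i + a * (du + dr 0 i)) =
    v + r 0 j - (u + r 0 i) + a * (dv + dr 0 j - (du + dr 0 i))); last by ring.
  by [].
under eq_fun do rewrite GE.
by have := is_deriveB_fun h1 h2; congr is_derive; rewrite /G !GE; exact: linear6B.
Qed.

Lemma heat_part_bound k l (x1 X c b : R) : 0 < x1 -> 0 <= c -> exists2 C : R, 0 <= C &
  forall x r i j u v, (forall i, `|x 0 i| <= X) -> (forall i, `|r 0 i| <= c) ->
    x1 <= x 0 j - x 0 i ->
    `|(-1) ^+ k * wave (k + l) 0 (x 0 j - x 0 i) (v + r 0 j - (u + r 0 i))| <= C * expR (- b * (v - u)).
Proof.
move=> x10 c0; have [C C0 hC] := @heat_wave_bound _ (k + l) x1 (2 * X) b x10.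
exists (C * expR (2 * `|b| * c)); first by rewrite mulr_ge0// expR_ge0.
move=> x r i j u v hx hr x1x; rewrite normrM normrX normrN1 expr1n mul1r.
apply: le_trans (hC _ _ _) _.
  rewrite x1x /=; have := hx i; have := hx j; rewrite !ler_norml => /andP[_ h1] /andP[h2 _]; lra.
rewrite -mulrA -expRD ler_wpM2l// ler_expR.
rewrite (_ : v + r 0 j - (u + r 0 i) = (v - u) + (r 0 j - r 0 i)); last by ring.
rewrite mulrDr addrC lerD2r; apply: le_trans (ler_norm _) _; rewrite normrM normrN.
rewrite [2 * _]mulrC -mulrA ler_wpM2l//; apply: le_trans (ler_normB _ _) _.
by rewrite mulr_natl mulr2n lerD.
Qed.

Lemma path_part_bound k l (t1 t2 X c m : R) : 0 < t1 -> 0 <= t2 -> 0 <= X -> 0 <= c ->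
  (1 + X) / t1 <= m ->
  exists2 C : R, 0 <= C & forall t x r i j u v, t1 <= t <= t2 -> (forall i, `|x 0 i| <= X) ->
    (forall i, `|r 0 i| <= c) -> 0 <= u -> 0 <= v ->
    `|path_kernel k l t (- x 0 i) (x 0 j) (u + r 0 i) (v + r 0 j)| <= C * expR (- (m * (u + v))).
Proof.
move=> t10 t20 X0 c0 hm; have [C C0 hC] := path_kernel_bound k l t10 t20 X0 c0 hm.
have m0 : 0 <= m by apply: le_trans hm; rewrite divr_ge0// ?addr_ge0// ltW.
exists (C * expR (m * (2 * c))); first by rewrite mulr_ge0// expR_ge0.
move=> t x r i j u v ht hx hr u0 v0.
have rc i' : - c <= r 0 i' by have := hr i'; rewrite ler_norml => /andP[].
apply: le_trans (hC t (- x 0 i) (x 0 j) _ _ ht _ (hx j) _ _) _.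
- by rewrite normrN.
- by have := rc i; lra.
- by have := rc j; lra.
rewrite -mulrA -expRD ler_wpM2l// ler_expR -!mulrN -mulrDr ler_wpM2l//.
by have := rc i; have := rc j; lra.
Qed.

End matrix_kernel.
End kpz_kernel.

(** * The matrix kernel as an element of a ring *)

Section swap.
Context {R : realType} d1 d2 (T1 : measurableType d1) (T2 : measurableType d2).
Variables (m1 : {sigma_finite_measure set T1 -> \bar R}) (m2 : {sigma_finite_measure set T2 -> \bar R}).

Lemma Rintegral_swap (f : T1 -> T2 -> R) (a : T1 -> R) (b : T2 -> R) :
  measurable_fun setT (fun p : T1 * T2 => f p.1 p.2) ->
  m1.-integrable setT (EFin \o a) -> m2.-integrable setT (EFin \o b) ->
  (forall x y, `|f x y| <= a x * b y) ->
  \int[m1]_x \int[m2]_y f x y = \int[m2]_y \int[m1]_x f x y.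
Proof.
move=> mf ja jb hf.
have j2 x : m2.-integrable setT (EFin \o f x).
  apply: (@integrable_dominated _ _ _ m2 setT (f x) (fun y => a x * b y)) => //.
    exact: (measurableT_comp mf (pair1_measurable x)).
  exact: (@integrableZ_fun _ _ _ m2 setT b).
have j1 y : m1.-integrable setT (EFin \o (fun x => f x y)).
  apply: (@integrable_dominated _ _ _ m1 setT (fun x => f x y) (fun x => b y * a x)) => //.
  - exact: (measurableT_comp mf (pair2_measurable y)).
  - exact: (@integrableZ_fun _ _ _ m1 setT a).
  - by move=> x _; rewrite mulrC.
have jp : (m1 \x m2)%E.-integrable setT (fun p : T1 * T2 => (f p.1 p.2)%:E).
  apply/integrable12ltyP; first exact/measurable_EFinP.
  have [ma fa] := integrableP _ _ _ ja; have [mb fb] := integrableP _ _ _ jb.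
  apply: (@le_lt_trans _ _ (\int[m1]_x (`|(a x)%:E| * \int[m2]_y `|(b y)%:E|))%E).
    apply: ge0_le_integral => //.
    - by move=> x _; exact: integral_ge0.
    - apply: (measurable_fun_fubini_tonelli_F (m2 := m2) (fun p : T1 * T2 => `|(f p.1 p.2)%:E|%E)) => //.
      by apply: measurableT_comp => //; exact/measurable_EFinP.
    - by apply: emeasurable_funM => //; exact: measurableT_comp.
    - move=> x _; rewrite -ge0_integralZl//; last exact: measurableT_comp.
      apply: ge0_le_integral => //.
      + by apply: measurableT_comp => //; exact: (measurable_int _ (j2 x)).
      + by apply: emeasurable_funM => //; exact: measurableT_comp.
      + move=> y _; rewrite -EFinM lee_fin /= -normrM; apply: le_trans (hf x y) _; exact: ler_norm.
  rewrite ge0_integralZr//; last 2 first.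
  - exact: measurableT_comp.
  - exact: integral_ge0.
  by apply: lte_mul_pinfty => //; [exact: integral_ge0|rewrite ge0_fin_numE// integral_ge0].
rewrite /Rintegral; congr fine.
have -> : (\int[m1]_x (fine (\int[m2]_y (f x y)%:E))%:E = \int[m1]_x \int[m2]_y (f x y)%:E)%E.
  by apply: eq_integral => x _; rewrite fineK//; exact: (integrable_fin_num measurableT (j2 x)).
rewrite (Fubini jp); apply: eq_integral => y _.
by rewrite fineK//; exact: (integrable_fin_num measurableT (j1 y)).
Qed.

End swap.

Section exponential_mean.
Context {R : realType} (rows : seq nat).
Notation mu := (@lebesgue_measure R).
Notation X := (nat * R)%type.

Definition half_exp (u : R) : R := if 0 <= u then expR (- u) else 0.

Lemma half_exp_ge0 u : 0 <= half_exp u.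
Proof. by rewrite /half_exp; case: ifP => // _; exact: expR_ge0. Qed.

Lemma half_exp_restrict : half_exp = (fun u => expR (- 1 * u)) \_ `[0, +oo[.
Proof.
apply/funext => u; rewrite /half_exp patchE mem_setE in_itv /= andbT mulN1r; by case: ifP.
Qed.

Lemma measurable_half_exp : measurable_fun setT half_exp.
Proof.
rewrite half_exp_restrict; apply/(measurable_restrictT _ (measurable_itv _)).
exact: measurable_expRM.
Qed.

Lemma half_exp_integral_is : integral_is mu setT half_exp 1.
Proof.
split.
  rewrite half_exp_restrict -restrict_EFin.
  have [h _] := @integrable_mkcond _ _ _ mu `[0%R, +oo[%classic
    (EFin \o (fun u : R => expR (- 1 * u))) (measurable_itv _).
  exact: h (integrable_expRN ltr01).
by rewrite half_exp_restrict -Rintegral_mkcond Rintegral_expRN// invr1.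
Qed.

Lemma Rintegral_half_exp (f : R -> R) :
  \int[mu]_u (f u * half_exp u) = \int[mu]_(u in @Rplus R) (f u * expR (- u)).
Proof.
rewrite [RHS]Rintegral_mkcond; apply: eq_Rintegral => u _.
by rewrite half_exp_restrict !patchE; case: ifP => _; rewrite ?mulr0// mulN1r.
Qed.

Lemma integral_is_sum (I : Type) (r : seq I) (F : I -> R -> R) (v : I -> R) :
  (forall i, integral_is mu setT (F i) (v i)) ->
  integral_is mu setT (fun u => \sum_(i <- r) F i u) (\sum_(i <- r) v i).
Proof.
move=> h; elim: r => [|i r ih].
  rewrite big_nil; split; first by under eq_fun do rewrite big_nil; exact: integrable0.
  by rewrite /Rintegral; under eq_integral do rewrite big_nil; rewrite integral0.
by rewrite big_cons; under eq_fun do rewrite big_cons; exact: integral_isD.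
Qed.

Let row_is (f : X -> R) i : bmeas f ->
  integral_is mu setT (fun u => f (i, u) * half_exp u) (\int[mu]_u (f (i, u) * half_exp u)).
Proof.
move=> [mf [C hC]]; have [j _] := half_exp_integral_is; split=> //.
apply: (@integrable_dominated _ _ _ mu setT (fun u => f (i, u) * half_exp u) (fun u => C * half_exp u)) => //.
- apply: measurable_funM; last exact: measurable_half_exp.
  exact: (measurableT_comp mf (pair1_measurable i)).
- exact: (@integrableZ_fun _ _ _ mu setT half_exp).
- by move=> u _; rewrite normrM (ger0_norm (half_exp_ge0 u)) ler_wpM2r// half_exp_ge0.
Qed.

(** A point [(i, u)] is a row and a coordinate of the direct sum, with density [expR (- u)] on the
    half-line. The list [rows] is a parameter so that a single row can be integrated on its own when
    the determinant is expanded over the rows. *)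
Definition row_sum (f : X -> R) : R := \sum_(i <- rows) \int[mu]_u (f (i, u) * half_exp u).

Lemma row_sum_linear a f g : bmeas f -> bmeas g ->
  row_sum (fun x => a * f x + g x) = a * row_sum f + row_sum g.
Proof.
move=> bf bg; rewrite /row_sum mulr_sumr -big_split; apply: eq_bigr => i _ /=.
have := (integral_isD measurableT (integral_isZ measurableT a (row_is i bf)) (row_is i bg)).2.
by move=> <-; apply: eq_Rintegral => u _; ring.
Qed.

Lemma row_sum_bound f (C : R) : bmeas f -> (forall x, `|f x| <= C) -> `|row_sum f| <= (size rows)%:R * C.
Proof.
move=> bf hC; have C0 : 0 <= C by exact: le_trans (normr_ge0 _) (hC (0, 0)).
apply: le_trans (ler_norm_sum _ _ _) _.
apply: le_trans (_ : \sum_(i <- rows) C <= _); last first.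
  by rewrite big_const_seq count_predT iter_addr_0 mulr_natl.
apply: ler_sum => i _; have [j v] := half_exp_integral_is.
rewrite -[leRHS]mulr1 -v -RintegralZl//.
apply: (@normr_Rintegral_le _ _ _ mu setT (fun u => f (i, u) * half_exp u)) => //.
- by have /(measurable_int mu)/measurable_EFinP := (row_is i bf).1.
- exact: (@integrableZ_fun _ _ _ mu setT half_exp).
- by move=> u _; rewrite normrM (ger0_norm (half_exp_ge0 u)) ler_wpM2r// half_exp_ge0.
Qed.

Lemma row_sum_measurable d' (T : measurableType d') (f : T * X -> R) : bmeas f ->
  measurable_fun setT (fun t => row_sum (fun x => f (t, x))).
Proof.
move=> [mf _]; apply: measurable_sum => i.
apply: (@measurable_Rintegral_param _ _ _ _ _ (@lebesgue_measure R)
  (fun t u => f (t, (i, u)) * half_exp u)) => //.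
apply: measurable_funM; last exact: (measurableT_comp measurable_half_exp measurable_snd).
apply: (measurableT_comp mf); apply: measurable_fun_pair => //.
by apply: measurable_fun_pair.
Qed.

Lemma row_sum_swap (f : X * X -> R) : bmeas f ->
  row_sum (fun x => row_sum (fun y => f (x, y))) = row_sum (fun y => row_sum (fun x => f (x, y))).
Proof.
move=> [mf [C hC]]; rewrite /row_sum.
have bs x : bmeas (fun y => f (x, y)).
  by split; [exact: (measurableT_comp mf (pair1_measurable x))|exists C].
have bs' y : bmeas (fun x => f (x, y)).
  by split; [exact: (measurableT_comp mf (pair2_measurable y))|exists C].
have [jh _] := half_exp_integral_is.
have mrow i j : measurable_fun setT (fun p : R * R => f ((i, p.1), (j, p.2)) * half_exp p.2 * half_exp p.1).
  apply: measurable_funM; last exact: (measurableT_comp measurable_half_exp measurable_fst).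
  apply: measurable_funM; last exact: (measurableT_comp measurable_half_exp measurable_snd).
  by apply: (measurableT_comp mf); apply: measurable_fun_pair; apply: measurable_fun_pair.
have bd i j u v : `|f ((i, u), (j, v)) * half_exp v * half_exp u| <= C * half_exp u * half_exp v.
  rewrite !normrM !(ger0_norm (half_exp_ge0 _)) mulrAC ler_wpM2r ?half_exp_ge0//.
  by rewrite ler_wpM2r ?half_exp_ge0.
have inner i j u : \int[mu]_v (f ((i, u), (j, v)) * half_exp v * half_exp u) =
    (\int[mu]_v (f ((i, u), (j, v)) * half_exp v)) * half_exp u.
  by rewrite RintegralZr//; exact: (row_is j (bs (i, u))).1.
have inner' i j v : \int[mu]_u (f ((i, u), (j, v)) * half_exp v * half_exp u) =
    (\int[mu]_u (f ((i, u), (j, v)) * half_exp u)) * half_exp v.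
  rewrite mulrC -(integral_isZ measurableT (half_exp v) (row_is i (bs' (j, v)))).2.
  by apply: eq_Rintegral => u _; rewrite mulrAC mulrC.
have jC : mu.-integrable setT (EFin \o (fun u => C * half_exp u)).
  exact: (@integrableZ_fun _ _ _ mu setT half_exp).
have sw i j : \int[mu]_u ((\int[mu]_v (f ((i, u), (j, v)) * half_exp v)) * half_exp u) =
    \int[mu]_v ((\int[mu]_u (f ((i, u), (j, v)) * half_exp u)) * half_exp v).
  under eq_Rintegral do rewrite -inner; under [RHS]eq_Rintegral do rewrite -inner'.
  exact: (@Rintegral_swap _ _ _ _ _ mu mu (fun u v => f ((i, u), (j, v)) * half_exp v * half_exp u)
    (fun u => C * half_exp u) half_exp (mrow i j) jC jh (bd i j)).
have gb (i : nat) (g : X -> R) : bmeas g -> (forall x, `|g x| <= C) -> `|\int[mu]_u (g (i, u) * half_exp u)| <= C.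
  move=> bg gC; have [_ v1] := half_exp_integral_is; rewrite -[leRHS]mulr1 -v1 -RintegralZl//.
  apply: (@normr_Rintegral_le _ _ _ mu setT (fun u => g (i, u) * half_exp u)) => //.
    by have /(measurable_int mu)/measurable_EFinP := (row_is i bg).1.
  by move=> u _; rewrite normrM (ger0_norm (half_exp_ge0 u)) ler_wpM2r// half_exp_ge0.
have b1 j : bmeas (fun x : X => \int[mu]_v (f (x, (j, v)) * half_exp v)).
  split; last by exists C => x; exact: gb j (fun y => f (x, y)) (bs x) (fun y => hC (x, y)).
  apply: (@measurable_Rintegral_param _ _ _ _ _ (@lebesgue_measure R)
    (fun x v => f (x, (j, v)) * half_exp v)) => //.
  apply: measurable_funM; last exact: (measurableT_comp measurable_half_exp measurable_snd).
  by apply: (measurableT_comp mf); apply: measurable_fun_pair => //; apply: measurable_fun_pair.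
have b2 i : bmeas (fun y : X => \int[mu]_u (f ((i, u), y) * half_exp u)).
  split; last by exists C => y; exact: gb i (fun x => f (x, y)) (bs' y) (fun x => hC (x, y)).
  apply: (@measurable_Rintegral_param _ _ _ _ _ (@lebesgue_measure R)
    (fun y u => f ((i, u), y) * half_exp u)) => //.
  apply: measurable_funM; last exact: (measurableT_comp measurable_half_exp measurable_snd).
  by apply: (measurableT_comp mf); apply: measurable_fun_pair => //; apply: measurable_fun_pair.
transitivity (\sum_(i <- rows) \sum_(j <- rows)
    \int[mu]_u ((\int[mu]_v (f ((i, u), (j, v)) * half_exp v)) * half_exp u)).
  apply: eq_bigr => i _; have := integral_is_sum rows (fun j => row_is i (b1 j)).
  by move=> [_ <-]; apply: eq_Rintegral => u _; rewrite mulr_suml.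
rewrite exchange_big; apply: eq_bigr => j _.
have := integral_is_sum rows (fun i => row_is j (b2 i)).
move=> [_ h]; transitivity (\sum_(i <- rows) \int[mu]_v ((\int[mu]_u (f ((i, u), (j, v)) * half_exp u)) * half_exp v)).
  by apply: eq_bigr => i _; exact: sw.
by rewrite -h; apply: eq_Rintegral => u _; rewrite mulr_suml.
Qed.

Lemma row_sum_mass_ge0 : 0 <= (size rows)%:R :> R. Proof. exact: ler0n. Qed.

Definition row_mean : mean X :=
  Mean row_sum_mass_ge0 row_sum_linear row_sum_bound row_sum_measurable row_sum_swap.

End exponential_mean.

Lemma udiff_uk_of {R : realType} d (X : measurableType d) (J : @mean R d X)
    (f : R -> X -> X -> R) (f' : X -> X -> R) (M M' C q : R) : 0 < q -> 0 <= C ->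
  (forall s, `|s| < q -> bker (f s) M) -> bker f' M' ->
  (forall s a b, `|s| < q -> `|f s a b - f 0 a b - s * f' a b| <= C * s ^+ 2) ->
  udiff (fun s => uk_of J (f s)) (uk_of J f').
Proof.
move=> q0 C0 hf hf' h; exists C, q; split=> // s sq.
have z0 : `|0 : R| < q by rewrite normr0.
have [a0 f0] := uk_ofE J (hf 0 z0); have [a1 f1] := uk_ofE J (hf s sq).
have [a2 f2] := uk_ofE J hf'.
split=> [|a b].
  by rewrite !uscD !uscN uscM a0 a1 a2 mulr0 !subr0 normr0 mulr_ge0// sqr_ge0.
by rewrite !ukrD !ukrN ukr_uscaM f0 f1 f2; exact: h.
Qed.

Section conjugation.
Context {R : realType} (n' : nat).
Notation n := n'.+1.
Notation X := (nat * R)%type.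
Notation J := (@row_mean R (iota 0 n)).
Implicit Types G : 'I_n -> 'I_n -> R -> R -> R.

(** The weights decrease with the row. For [i < j], where the heat kernels sit, steps of 2 ensure
    [col_weight j <= row_weight i]; a heat kernel bounded by [expR (- col_weight j * (v - u))] is
    then bounded after conjugation. *)
Definition row_weight (i : 'I_n) : R := 2 * (n - i)%:R.
Definition col_weight (i : 'I_n) : R := row_weight i + 1.

Lemma row_weight_ge0 i : 0 <= row_weight i. Proof. by rewrite mulr_ge0. Qed.
Lemma col_weight_ge0 i : 0 <= col_weight i. Proof. by rewrite addr_ge0// row_weight_ge0. Qed.

Lemma col_weight_le i : col_weight i <= 2 * n%:R + 1.
Proof. by rewrite lerD2r ler_pM2l// ler_nat leq_subr. Qed.

Lemma col_row_weight (i j : 'I_n) : (i < j)%N -> col_weight j <= row_weight i.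
Proof.
move=> ij; have h : (n - j).+1%:R <= (n - i)%:R :> R by rewrite ler_nat ltn_sub2l.
by rewrite /col_weight /row_weight; move: h; rewrite -natr1; lra.
Qed.

(* The conjugation e^(- a_i u) G_ij(u,v) e^(b_j v), which the weight e^(-v) of
   [row_mean] makes multiplicative since b_j - a_j = 1. *)
Definition conj_kernel G (a b : X) : R :=
  let i : 'I_n := inord a.1 in let j : 'I_n := inord b.1 in
  if (0 <= a.2) && (0 <= b.2)
  then expR (- (row_weight i * a.2)) * G i j a.2 b.2 * expR (col_weight j * b.2) else 0.

Definition decays G (C : R) := forall i j u v, 0 <= u -> 0 <= v ->
  `|G i j u v| <= C * expR (row_weight i * u - col_weight j * v).

Definition mkernel G := forall i j, measurable_fun setT (fun p : R * R => G i j p.1 p.2).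

Let measurable_nat (f : nat -> R) : measurable_fun setT f.
Proof. by move=> _ A _. Qed.

Lemma bker_conj G (C : R) : mkernel G -> 0 <= C -> decays G C -> bker (conj_kernel G) C.
Proof.
move=> mG C0 dG; split; last first.
  move=> a b; rewrite /conj_kernel; case: ifP => [/andP[a0 b0]|_]; last by rewrite normr0.
  set i := inord _; set j := inord _.
  rewrite !normrM !(ger0_norm (expR_ge0 _)).
  apply: le_trans (_ : expR (- (row_weight i * a.2)) * (C * expR (row_weight i * a.2 - col_weight j * b.2)) *
    expR (col_weight j * b.2) <= _).
    by rewrite ler_wpM2r ?expR_ge0// ler_wpM2l ?expR_ge0// dG.
  rewrite mulrCA -!mulrA -!expRD (_ : _ + _ = 0) ?expR0 ?mulr1//; by ring.
pose T (i j : 'I_n) (p : X * X) := ((inord p.1.1 == i :> 'I_n)%:R * (inord p.2.1 == j :> 'I_n)%:R : R) *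
  ((((0 : R) <= p.1.2)%R%:R * ((0 : R) <= p.2.2)%R%:R) *
   (expR (- (row_weight i * p.1.2)) * G i j p.1.2 p.2.2 * expR (col_weight j * p.2.2))).
have -> : (fun p : X * X => conj_kernel G p.1 p.2) = (fun p => \sum_i \sum_j T i j p).
  apply/funext => -[[a u] [b v]]; rewrite /conj_kernel /=.
  rewrite (bigD1 (inord a))//= (bigD1 (inord b))//= /T /= !eqxx !mul1r.
  rewrite !big1 ?addr0 => [|i ia|j jb].
  - by case: (0 <= u); case: (0 <= v); rewrite /= ?mul1r ?mul0r.
  - by apply: big1 => j _; rewrite eq_sym (negPf ia) !mul0r.
  - by rewrite [_ == j]eq_sym (negPf jb) mulr0 !mul0r.
have m11 : measurable_fun setT (fun p : X * X => p.1.1) by apply: measurableT_comp.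
have m12 : measurable_fun setT (fun p : X * X => p.1.2) by apply: measurableT_comp.
have m21 : measurable_fun setT (fun p : X * X => p.2.1) by apply: measurableT_comp.
have m22 : measurable_fun setT (fun p : X * X => p.2.2) by apply: measurableT_comp.
have mpos : measurable_fun setT (fun u : R => ((0 : R) <= u)%R%:R : R).
  rewrite (_ : (fun u : R => _) = \1_(`[0, +oo[%classic : set R)); first exact: measurable_indic.
  by apply/funext => u; rewrite indicE mem_setE in_itv /= andbT.
apply: measurable_sum => i; apply: measurable_sum => j.
apply: measurable_funM.
  apply: measurable_funM.
    exact: (measurableT_comp (measurable_nat (fun a => (inord a == i :> 'I_n)%:R)) m11).
  exact: (measurableT_comp (measurable_nat (fun a => (inord a == j :> 'I_n)%:R)) m21).
apply: measurable_funM.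
  by apply: measurable_funM; [exact: (measurableT_comp mpos m12)|exact: (measurableT_comp mpos m22)].
apply: measurable_funM; last first.
  by apply: measurableT_comp; [exact: measurable_expR|exact: measurable_funM].
apply: measurable_funM.
  by apply: measurableT_comp; [exact: measurable_expR|apply: measurableT_comp => //; exact: measurable_funM].
apply: (@measurable_fun_comp2 _ _ _ _ (X * X)%type R R R (G i j) (fun p => p.1.2) (fun p => p.2.2)) => //.
Qed.

Lemma decaysD G H (C D : R) : decays G C -> decays H D -> decays (fun i j u v => G i j u v + H i j u v) (C + D).
Proof.
move=> hG hH i j u v u0 v0; rewrite mulrDl; apply: le_trans (ler_normD _ _) _.
by apply: lerD; [exact: hG|exact: hH].
Qed.

Lemma decaysM G (c : 'I_n -> 'I_n -> R) (C D : R) : 0 <= C -> (forall i j, `|c i j| <= D) ->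
  decays G C -> decays (fun i j u v => c i j * G i j u v) (D * C).
Proof.
move=> C0 hc hG i j u v u0 v0; rewrite normrM -mulrA; apply: ler_pM => //; exact: hG.
Qed.

Definition kelem G : uker_of J := uk_of J (conj_kernel G).

Lemma kelemE G (C : R) : mkernel G -> 0 <= C -> decays G C ->
  usc (kelem G) = 0 /\ ukr (kelem G) = conj_kernel G.
Proof. by move=> mG C0 dG; exact: uk_ofE (bker_conj mG C0 dG). Qed.

End conjugation.

(** * The KPZ kernels along lines in the parameters *)

Section kernel_lines.
Context {R : realType} d (W : measurableType d) (P : probability W R) (B : R -> W -> R).
Hypothesis hB : brownian2 P B.
Variable h0 : R -> \bar R.
Hypothesis hUC : UC h0.
Variable n' : nat.
Notation n := n'.+1.
Notation K := (@kker R d W P B h0 n).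
Notation J := (@row_mean R (iota 0 n)).
Notation family := (nat -> nat -> 'I_n -> 'I_n -> R -> R -> R).

Lemma mkernel_kker k l t (x r : 'rV[R]_n) : mkernel (K k l t x r).
Proof. by move=> i j; exact: (measurable_kker hB hUC). Qed.

Lemma kker_decays k l (t1 t2 X c x1 : R) : 0 < t1 -> 0 <= t2 -> 0 <= X -> 0 <= c -> 0 < x1 ->
  exists2 C : R, 0 <= C & forall t (x r : 'rV[R]_n), t1 <= t <= t2 -> (forall i, `|x 0 i| <= X) ->
    (forall i, `|r 0 i| <= c) -> (forall i j : 'I_n, (i < j)%N -> x1 <= x 0 j - x 0 i) ->
    decays (K k l t x r) C.
Proof.
(* [m] has to satisfy the condition of the contour bound and to dominate every column weight. *)
move=> t10 t20 X0 c0 x10; pose m : R := Num.max ((1 + X) / t1) (2 * n%:R + 1).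
have hm : (1 + X) / t1 <= m by rewrite le_max lexx.
have hm' : 2 * n%:R + 1 <= m by rewrite le_max lexx orbT.
have [C C0 hC] := path_part_bound hB hUC n k l t10 t20 X0 c0 hm.
(* The decay rate taken for a heat kernel is the weight of its column, hence one constant for each
   [j]; their sum is a common one. *)
have /choice[D hD] : forall j : 'I_n, exists D : R, 0 <= D /\ forall (x r : 'rV[R]_n) i j0 u v,
    (forall i, `|x 0 i| <= X) -> (forall i, `|r 0 i| <= c) -> x1 <= x 0 j0 - x 0 i ->
    `|(-1) ^+ k * wave (k + l) 0 (x 0 j0 - x 0 i) (v + r 0 j0 - (u + r 0 i))| <= D * expR (- col_weight j * (v - u)).
  by move=> j; have [D D0 hD] := @heat_part_bound R n k l x1 X c (col_weight j) x10 c0; exists D.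
have D0 : 0 <= \sum_j D j by apply: sumr_ge0 => j _; case: (hD j).
exists (C + \sum_j D j); first exact: addr_ge0.
move=> t x r ht hx hr gap i j u v u0 v0; rewrite /kker mulrDl.
apply: le_trans (ler_normB _ _) _; apply: lerD.
  apply: le_trans (hC t x r i j u v ht hx hr u0 v0) _; rewrite ler_wpM2l// ler_expR.
  have h1 : col_weight j * v <= m * v by rewrite ler_wpM2r// (le_trans (col_weight_le j)).
  have h2 : 0 <= m * u by rewrite mulr_ge0// (le_trans _ hm')// addr_ge0// mulr_ge0.
  have h3 := mulr_ge0 (row_weight_ge0 (R := R) i) u0; lra.
case: ifP => ij; last by rewrite normr0 mulr_ge0// expR_ge0.
have [Dj0 hDj] := hD j; apply: le_trans (hDj x r i j u v hx hr (gap i j ij)) _.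
apply: ler_pM; rewrite ?expR_ge0//.
  by rewrite (bigD1 j)//= lerDl; apply: sumr_ge0 => j' _; case: (hD j').
have := ler_wpM2r u0 (col_row_weight (R := R) ij).
by rewrite ler_expR mulNr mulrBr; lra.
Qed.

Lemma increasing_gap (x : 'rV[R]_n) : increasing_row x ->
  exists2 x1 : R, 0 < x1 & forall i j : 'I_n, (i < j)%N -> x1 <= x 0 j - x 0 i.
Proof.
(* The sum of all inverse gaps exceeds each of them, so [(1 + S)^-1] is a positive lower bound for
   every gap, also when there is none. *)
move=> hx; pose S : R := \sum_(p : 'I_n * 'I_n | (p.1 < p.2)%N) (x 0 p.2 - x 0 p.1)^-1.
have S0 (Q : pred ('I_n * 'I_n)) : 0 <= \sum_(p : 'I_n * 'I_n | (p.1 < p.2)%N && Q p) (x 0 p.2 - x 0 p.1)^-1.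
  by apply: sumr_ge0 => p /andP[h _]; rewrite invr_ge0 subr_ge0 ltW// hx.
have S0' : 0 <= S by apply: sumr_ge0 => p h; rewrite invr_ge0 subr_ge0 ltW// hx.
exists (1 + S)^-1 => [|i j ij]; first by rewrite invr_gt0 ltr_pwDl.
rewrite -[leRHS]invrK lef_pV2 ?posrE ?invr_gt0 ?subr_gt0 ?hx ?ltr_pwDl//.
by rewrite /S (bigD1 (i, j))//= addrCA lerDl addr_ge0.
Qed.

(* [d_x = d^2] and [d_t = - d^3 / 3] for the functions [S_(t, x)], [d] being the
   derivative in the level. *)
Definition line_derivative (dt : R) (dx dr : 'rV[R]_n) (F : family) : family := fun k l i j u v =>
  - dt / 3 * F k.+3 l i j u v + - dt / 3 * F k l.+3 i j u v - dx 0 i * F k.+2 l i j u v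
  + dx 0 j * F k l.+2 i j u v + dr 0 i * F k.+1 l i j u v + dr 0 j * F k l.+1 i j u v.

Definition uniformly_decays (r : R) (F : R -> family) := forall k l, exists2 C : R, 0 <= C &
  forall s, `|s| < r -> decays (F s k l) C.

Lemma line_derivative_decays dt dx dr r F : uniformly_decays r F ->
  uniformly_decays r (fun s => line_derivative dt dx dr (F s)).
Proof.
move=> hF k l.
have [C1 C10 h1] := hF k.+3 l; have [C2 C20 h2] := hF k l.+3; have [C3 C30 h3] := hF k.+2 l.
have [C4 C40 h4] := hF k l.+2; have [C5 C50 h5] := hF k.+1 l; have [C6 C60 h6] := hF k l.+1.
pose X := \sum_i `|dx 0 i|; pose Y := \sum_i `|dr 0 i|.
have hX i : `|dx 0 i| <= X by rewrite /X (bigD1 i)//= lerDl sumr_ge0.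
have hY i : `|dr 0 i| <= Y by rewrite /Y (bigD1 i)//= lerDl sumr_ge0.
have X0 : 0 <= X by exact: sumr_ge0.
have Y0 : 0 <= Y by exact: sumr_ge0.
exists (`|- dt / 3| * C1 + `|- dt / 3| * C2 + X * C3 + X * C4 + Y * C5 + Y * C6).
  by rewrite !addr_ge0 ?mulr_ge0.
move=> s sr; have cst i j : `|(fun _ _ : 'I_n => - dt / 3) i j| <= `|- dt / 3| by [].
have dX1 (i j : 'I_n) : `|- dx 0 i| <= X by rewrite normrN.
move=> i j u v u0 v0.
have := decaysD (decaysD (decaysD (decaysD (decaysD
   (decaysM C10 cst (h1 s sr)) (decaysM C20 cst (h2 s sr)))
   (decaysM C30 dX1 (h3 s sr))) (decaysM C40 (fun i => hX) (h4 s sr)))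
   (decaysM C50 (fun i (j : 'I_n) => hY i) (h5 s sr))) (decaysM C60 (fun i => hY) (h6 s sr)) i j u0 v0.
by rewrite /line_derivative -[- (dx 0 i * _)]mulNr.
Qed.

Section line.
Variables (t dt : R) (x dx r dr : 'rV[R]_n).
Hypothesis t0 : 0 < t.
Hypothesis hx : increasing_row x.

Definition kline (s : R) : family := fun k l => K k l (t + s * dt) (x + s *: dx) (r + s *: dr).

(** The neighbourhood is chosen from the geometry alone ([t] bounded away from 0, gaps at least
    halved), so one [q] serves all orders of derivatives and only the constants depend on [k] and
    [l]. *)
Lemma line_neighbourhood : exists2 q : R, 0 < q & uniformly_decays q kline /\
  forall s, `|s| < q -> 0 < t + s * dt /\ increasing_row (x + s *: dx).
Proof.
have t0' : 0 < t + 0 * dt by rewrite mul0r addr0.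
have [q1 /andP[q10 q11] [t1 [t2 [t10 t20 ht]]]] := line_box t0'.
have [x1 x10 gap] := increasing_gap hx.
pose X := \sum_i (`|x 0 i| + `|dx 0 i|); pose Y := \sum_i (`|r 0 i| + `|dr 0 i|).
have X0 : 0 <= X by apply: sumr_ge0 => i _; exact: addr_ge0.
have Y0 : 0 <= Y by apply: sumr_ge0 => i _; exact: addr_ge0.
have x20 : 0 < x1 / 2 by rewrite divr_gt0.
pose q2 := x1 / 2 / (2 * X + 1).
have q20 : 0 < q2 by rewrite divr_gt0// ltr_wpDl// mulr_ge0.
have small s : `|s| < q1 -> `|s - 0| <= 1 by rewrite subr0 => sq; apply: le_trans (ltW sq) q11.
have bx s i : `|s| < q1 -> `|(x + s *: dx) 0 i| <= X.
  move=> /small sq; rewrite !mxE; apply: le_trans (line_bound _ _ sq) _; rewrite mul0r addr0.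
  by rewrite /X (bigD1 i)//= lerDl; apply: sumr_ge0 => j _; exact: addr_ge0.
have br s i : `|s| < q1 -> `|(r + s *: dr) 0 i| <= Y.
  move=> /small sq; rewrite !mxE; apply: le_trans (line_bound _ _ sq) _; rewrite mul0r addr0.
  by rewrite /Y (bigD1 i)//= lerDl; apply: sumr_ge0 => j _; exact: addr_ge0.
have gs s (i j : 'I_n) : `|s| < q2 -> (i < j)%N -> x1 / 2 <= (x + s *: dx) 0 j - (x + s *: dx) 0 i.
  move=> sq ij; rewrite !mxE (_ : _ - _ = (x 0 j - x 0 i) + s * (dx 0 j - dx 0 i)); last by ring.
  have : `|s * (dx 0 j - dx 0 i)| <= x1 / 2.
    rewrite normrM; apply: le_trans (_ : `|s| * (2 * X + 1) <= _); last by rewrite -ler_pdivlMr ?ltW// ltr_wpDl// mulr_ge0.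
    rewrite ler_wpM2l//; apply: le_trans (ler_normB _ _) _.
    have dX i' : `|dx 0 i'| <= X.
      rewrite /X (bigD1 i')//=; apply: le_trans (_ : `|x 0 i'| + `|dx 0 i'| <= _); first by rewrite lerDr.
      by rewrite lerDl; apply: sumr_ge0 => j' _; exact: addr_ge0.
    by have := dX i; have := dX j; lra.
  by rewrite ler_norml => /andP[h _]; have := gap i j ij; lra.
exists (Num.min q1 q2); first by rewrite lt_min q10.
split=> [k l|s].
  have [C C0 hC] := kker_decays k l t10 t20 X0 Y0 x20.
  exists C => // s; rewrite lt_min => /andP[s1 s2]; apply: hC => [|i|i|i j].
  - by apply: ht; rewrite subr0.
  - exact: bx.
  - exact: br.
  - exact: gs.
rewrite lt_min => /andP[s1 s2]; split.
  by have /andP[h _] := ht s (eq_ind_r (fun z => `|z| < q1) s1 (subr0 s)); exact: lt_le_trans h.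
by move=> i j ij; rewrite -subr_gt0; apply: lt_le_trans (gs s i j s2 ij).
Qed.

Lemma is_derive_kline k l i j u v s : 0 < t + s * dt -> increasing_row (x + s *: dx) ->
  is_derive s (1 : R) (fun a => kline a k l i j u v) (line_derivative dt dx dr (kline s) k l i j u v).
Proof.
move=> ts xs; have xs' (i' j' : 'I_n) : (i' < j')%N -> x 0 i' + s * dx 0 i' < x 0 j' + s * dx 0 j'.
  by move=> /xs; rewrite !mxE.
have := is_derive_kker hB hUC k l r i j u v 0 0 dr ts xs'.
by rewrite /= !mulr0 !addr0 !add0r; under eq_fun do rewrite !mulr0 !addr0.
Qed.

Lemma is_derive_line_derivative (F : R -> family) (F' : family) (da : R) (xa ra : 'rV[R]_n) k l i j u v s :
  (forall k l, is_derive s (1 : R) (fun a => F a k l i j u v) (F' k l i j u v)) ->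
  is_derive s (1 : R) (fun a => line_derivative da xa ra (F a) k l i j u v)
    (line_derivative da xa ra F' k l i j u v).
Proof.
move=> hF; rewrite /line_derivative.
exact: (is_deriveD_fun (is_deriveD_fun (is_deriveD_fun (is_deriveB_fun (is_deriveD_fun
  (is_deriveZ_fun _ (hF k.+3 l)) (is_deriveZ_fun _ (hF k l.+3)))
  (is_deriveZ_fun _ (hF k.+2 l))) (is_deriveZ_fun _ (hF k l.+2)))
  (is_deriveZ_fun _ (hF k.+1 l))) (is_deriveZ_fun _ (hF k l.+1))).
Qed.

Lemma mkernel_line_derivative (F : family) da xa ra k l : (forall k l, mkernel (F k l)) ->
  mkernel (line_derivative da xa ra F k l).
Proof.
move=> mF i j; rewrite /line_derivative.
apply: measurable_funD; last by apply: measurable_funM => //; exact: mF.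
apply: measurable_funD; last by apply: measurable_funM => //; exact: mF.
apply: measurable_funD; last by apply: measurable_funM => //; exact: mF.
apply: measurable_funB; last by apply: measurable_funM => //; exact: mF.
by apply: measurable_funD; apply: measurable_funM => //; exact: mF.
Qed.

(** The second derivative along the line is again a [line_derivative], of the first one. It obeys
    the same decay, so the quadratic Taylor remainder is uniform after conjugation. *)
Lemma udiff_kline k l : udiff (fun s => kelem (kline s k l)) (kelem (line_derivative dt dx dr (kline 0) k l)).
Proof.
have [q q0 [uq good]] := line_neighbourhood.
have [C C0 hC] := uq k l.
have [C1 C10 hC1] := line_derivative_decays dt dx dr uq k l.
have [C2 C20 hC2] := line_derivative_decays dt dx dr (line_derivative_decays dt dx dr uq) k l.
have mK s k' l' : mkernel (kline s k' l') by exact: mkernel_kker.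
have mD s : mkernel (line_derivative dt dx dr (kline s) k l) by exact: mkernel_line_derivative.
have z0 : `|0 : R| < q by rewrite normr0.
apply: (@udiff_uk_of _ _ _ J (fun s => conj_kernel (kline s k l)) _ C C1 C2 q) => //.
- by move=> s sq; apply: bker_conj => //; exact: hC.
- by apply: bker_conj => //; exact: (hC1 0).
move=> s a b sq; rewrite /conj_kernel.
case: ifP => [/andP[a2 b2]|_]; last by rewrite mulr0 !subr0 normr0 mulr_ge0// sqr_ge0.
set i := inord _; set j := inord _.
have h := @taylor_derive _ (fun s => kline s k l i j a.2 b.2)
  (fun s => line_derivative dt dx dr (kline s) k l i j a.2 b.2)
  (fun s => line_derivative dt dx dr (line_derivative dt dx dr (kline s)) k l i j a.2 b.2) 0 q
  (C2 * expR (row_weight i * a.2 - col_weight j * b.2)).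
have {h} h := h _ s; rewrite !subr0 in h.
have -> : expR (- (row_weight i * a.2)) * kline s k l i j a.2 b.2 * expR (col_weight j * b.2) -
    expR (- (row_weight i * a.2)) * kline 0 k l i j a.2 b.2 * expR (col_weight j * b.2) -
    s * (expR (- (row_weight i * a.2)) * line_derivative dt dx dr (kline 0) k l i j a.2 b.2 * expR (col_weight j * b.2)) =
    (kline s k l i j a.2 b.2 - kline 0 k l i j a.2 b.2 - s * line_derivative dt dx dr (kline 0) k l i j a.2 b.2) *
    (expR (- (row_weight i * a.2)) * expR (col_weight j * b.2)) by ring.
rewrite normrM (@ger0_norm _ (expR _ * _)) ?mulr_ge0 ?expR_ge0//.
apply: le_trans (ler_wpM2r _ (h _ sq)) _; first by rewrite mulr_ge0 ?expR_ge0.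
  move=> y; rewrite subr0 => yq; have [ty xy] := good y yq; split.
  - exact: is_derive_kline.
  - by apply: is_derive_line_derivative => k' l'; exact: is_derive_kline.
  - exact: hC2.
move: (row_weight i * a.2) (col_weight j * b.2) (s ^+ 2) => y z e.
rewrite (_ : C2 * expR (y - z) * e * (expR (- y) * expR z) = C2 * e * (expR (y - z) * (expR (- y) * expR z))); last by ring.
by rewrite -!expRD (_ : y - z + (- y + z) = 0) ?expR0 ?mulr1//; ring.
Qed.

End line.
End kernel_lines.

(** * Fredholm's series of the matrix kernel in terms of the conjugated scalar kernel *)

Section determinant.
Context {R : realType}.
Notation X := (nat * R)%type.
Notation mu := (@lebesgue_measure R).

Lemma mean_sum d (Y : measurableType d) (J : @mean R d Y) (I : Type) (r : seq I) (f : I -> Y -> R) :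
  (forall i, bmeas (f i)) -> J (fun x => \sum_(i <- r) f i x) = \sum_(i <- r) J (f i).
Proof.
move=> bf; elim: r => [|i r ih].
  rewrite big_nil; under eq_fun do rewrite big_nil.
  have b0 : bmeas (fun _ : Y => 0 : R) by split; [exact: measurable_cst|exists 0 => x; rewrite normr0].
  by have := mean_scale J 0 b0; under eq_fun do rewrite mul0r; rewrite mul0r.
rewrite big_cons -ih -[J (f i)]mul1r -mean_linear//.
  by congr (mean_fun J _); apply/funext => x; rewrite big_cons mul1r.
elim: r {ih} => [|j r [m [C hC]]].
  by under eq_fun do rewrite big_nil; split; [exact: measurable_cst|exists 0 => x; rewrite normr0].
have [mj [D hD]] := bf j; split.
  by under eq_fun do rewrite big_cons; exact: measurable_funD.
exists (D + C) => x; rewrite big_cons; apply: le_trans (ler_normD _ _) _; exact: lerD.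
Qed.

Lemma row_mean1 i (f : X -> R) : row_mean [:: i] f = \int[mu]_u (f (i, u) * half_exp u).
Proof. by rewrite /row_mean /= /row_sum big_seq1. Qed.

(** One term of the expansion of [nest] over the choices of rows: the row of each variable is
    prescribed. *)
Fixpoint nest_rows (cs : seq nat) (F : seq X -> R) : R :=
  if cs is i :: cs' then row_mean [:: i] (fun x => nest_rows cs' (fun s => F (x :: s))) else F [::].

Lemma nest_rows_cons i cs (F : seq X -> R) :
  nest_rows (i :: cs) F = row_mean [:: i] (fun x => nest_rows cs (fun s => F (x :: s))).
Proof. by []. Qed.

Lemma nest_rows_measurable cs d (T : measurableType d) (F : T -> seq X -> R) (C : R) :
  pmeas (size cs) F -> (forall t s, `|F t s| <= C) ->
  measurable_fun setT (fun t => nest_rows cs (F t)) /\ forall t, `|nest_rows cs (F t)| <= C.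
Proof.
elim: cs d T F => [|i cs ih] d T F /= mF hC; first by [].
have [m1 b1] := ih _ _ (fun (p : T * X) s => F p.1 (p.2 :: s)) mF (fun _ _ => hC _ _).
split=> [|t].
  apply: (@mean_measurable _ _ _ (row_mean [:: i]) _ T (fun p => nest_rows cs (fun s => F p.1 (p.2 :: s)))).
  by split=> //; exists C.
rewrite -[leRHS]mul1r; apply: (@mean_bound _ _ _ (row_mean [:: i])).
  split; first exact: (measurableT_comp m1 (pair1_measurable t)).
  by exists C => x; exact: (b1 (t, x)).
by move=> x; exact: (b1 (t, x)).
Qed.

Lemma nest_rows_bmeas cs (F : seq X -> R) (C : R) : pmeas (size cs).+1 (fun _ : unit => F) ->
  (forall s, `|F s| <= C) -> bmeas (fun x => nest_rows cs (fun s => F (x :: s))).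
Proof.
move=> mF hC.
have [m1 b1] := nest_rows_measurable (F := fun (p : unit * X) s => F (p.2 :: s)) mF (fun _ _ => hC _).
split; first exact: (measurableT_comp m1 (pair1_measurable tt)).
by exists C => x; exact: (b1 (tt, x)).
Qed.

Lemma pmeas_section k (F : seq X -> R) x : pmeas k.+1 (fun _ : unit => F) ->
  pmeas k (fun (_ : unit) s => F (x :: s)).
Proof.
move=> mF; have m : measurable_fun setT (fun _ : unit => (tt, x)) by exact: measurable_cst.
exact: (@pmeas_comp _ X k _ unit _ (unit * X)%type _ R (fun p s => F (p.2 :: s)) _ m mF).
Qed.

Lemma nest_rowsZ cs (F : seq X -> R) (a C : R) : pmeas (size cs) (fun _ : unit => F) ->
  (forall s, `|F s| <= C) -> nest_rows cs (fun s => a * F s) = a * nest_rows cs F.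
Proof.
elim: cs F => [//|i cs ih] F mF hC.
rewrite !nest_rows_cons -mean_scale; last exact: nest_rows_bmeas mF hC.
congr (mean_fun _ _); apply/funext => x; apply: (ih (fun s => F (x :: s))) => //.
exact: pmeas_section.
Qed.

Fixpoint row_lists (rows : seq nat) k : seq (seq nat) :=
  if k is k'.+1 then [seq i :: cs | i <- rows, cs <- row_lists rows k'] else [:: [::]].

Lemma row_lists_size rows k cs : cs \in row_lists rows k -> size cs = k.
Proof. by elim: k cs => [|k ih] cs /=; [rewrite inE => /eqP ->|case/allpairsP => -[i c] /= [_ /ih <- ->]]. Qed.

Lemma nest_row_lists rows k (F : seq X -> R) (C : R) : pmeas k (fun _ : unit => F) ->
  (forall s, `|F s| <= C) -> nest (row_mean rows) k F = \sum_(cs <- row_lists rows k) nest_rows cs F.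
Proof.
elim: k F => [|k ih] F mF hC; first by rewrite big_seq1.
rewrite [RHS]big_allpairs_dep; change (row_sum rows (fun x => nest (row_mean rows) k (fun s => F (x :: s))) = \sum_(i <- rows) \sum_(cs <- row_lists rows k) nest_rows (i :: cs) F).
rewrite /row_sum; apply: eq_bigr => i _.
(* The condition on the size holds on [row_lists]; with it every summand, for any list [cs], is
   bounded and measurable, as [mean_sum] demands. *)
rewrite -(row_mean1 i (fun x => nest (row_mean rows) k (fun s => F (x :: s)))); transitivity (row_mean [:: i] (fun x => \sum_(cs <- row_lists rows k | size cs == k) nest_rows cs (fun s => F (x :: s)))).
  congr (mean_fun _ _); apply/funext => x; rewrite (ih (fun s => F (x :: s)))//; last exact: pmeas_section.
  rewrite big_seq_cond [RHS]big_seq_cond; apply: eq_bigl => cs.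
  by rewrite andbT; case: (boolP (cs \in _)) => // /row_lists_size ->; rewrite eqxx.
under eq_fun do rewrite big_mkcond; rewrite mean_sum.
  rewrite big_seq [RHS]big_seq; apply: eq_bigr => cs /row_lists_size sk.
  by congr (mean_fun _ _); apply/funext => x; rewrite sk eqxx.
move=> cs; case: eqP => [sk|_].
  by apply: nest_rows_bmeas hC; rewrite sk.
by split; [exact: measurable_cst|exists 0 => x; rewrite normr0].
Qed.

Lemma iter_integral_ext k (F G : seq R -> R) :
  (forall u, size u = k -> all (fun x => 0 <= x) u -> F u = G u) -> iter_integral k F = iter_integral k G.
Proof.
elim: k F G => [|k ih] F G h /=; first exact: h.
apply: eq_Rintegral => u; rewrite mem_setE in_itv /= andbT => u0; apply: ih => s sk s0.
by apply: h; rewrite /= ?sk// u0.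
Qed.

Lemma nest_rows_iter cs (F : seq X -> R) (C : R) : pmeas (size cs) (fun _ : unit => F) ->
  (forall s, `|F s| <= C) ->
  nest_rows cs F = iter_integral (size cs) (fun u => (\prod_(x <- u) expR (- x)) * F (zip cs u)).
Proof.
elim: cs F C => [|i cs ih] F C mF hC; first by rewrite /= big_nil mul1r.
have ms (x : X) : pmeas (size cs) (fun (_ : unit) s => F (x :: s)) := pmeas_section x mF.
rewrite nest_rows_cons row_mean1 Rintegral_half_exp /=; apply: eq_Rintegral => u _.
rewrite mulrC -(nest_rowsZ _ (ms (i, u)) (fun s => hC _)) (ih _ (`|expR (- u)| * C)).
- by apply: iter_integral_ext => s _ _; rewrite big_cons /= mulrCA mulrA.
- have mc : pmeas (size cs) (fun (_ : unit) (_ : seq X) => expR (- u)) by apply: pmeas_cst; exact: measurable_cst.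
  exact: pmeasM mc (ms (i, u)).
- by move=> s; rewrite normrM ler_wpM2l.
Qed.

Lemma sum_row_lists n k (H : seq nat -> R) :
  \sum_(cs <- row_lists (iota 0 n) k) H cs =
  \sum_(c : {ffun 'I_k -> 'I_n}) H [seq val (c a) | a <- enum 'I_k].
Proof.
elim: k H => [|k ih] H.
  rewrite big_seq1 (big_pred1 [ffun a : 'I_0 => match a with Ordinal m i => False_rect _ (Bool.diff_false_true i) end]).
    by rewrite enum_ord0.
  by move=> c; apply/esym/eqP/ffunP => -[].
rewrite big_allpairs_dep; under eq_bigr do rewrite ih.
rewrite -[iota 0 n]val_enum_ord big_map big_enum /=.
rewrite pair_big /=; pose f (p : 'I_n * {ffun 'I_k -> 'I_n}) : {ffun 'I_k.+1 -> 'I_n} :=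
  [ffun a => if unlift ord0 a is Some b then p.2 b else p.1].
pose g (c : {ffun 'I_k.+1 -> 'I_n}) : 'I_n * {ffun 'I_k -> 'I_n} := (c ord0, [ffun b => c (lift ord0 b)]).
rewrite (reindex f) /=; last first.
  exists g => [[i c] _|c _]; rewrite /f /g.
    congr pair; first by rewrite ffunE unlift_none.
    by apply/ffunP => b; rewrite !ffunE liftK.
  apply/ffunP => a; rewrite ffunE /=; case: unliftP => [b|] ->; by rewrite ?ffunE.
apply: eq_bigr => -[i c] _ /=; congr H.
rewrite enum_ordSl /= /f ffunE unlift_none /= -map_comp; congr cons.
by apply: eq_map => b /=; rewrite ffunE liftK.
Qed.

Variable n' : nat.
Notation n := n'.+1.
Notation J := (@row_mean R (iota 0 n)).

(** The weights come out of the determinant as two diagonal matrices. For each variable they leave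
    [expR] of it, since column and row weight differ by 1, and this cancels the density. *)
Lemma conj_kernel_minor (G : 'I_n -> 'I_n -> R -> R -> R) k (c : {ffun 'I_k -> 'I_n}) (u : seq R) :
  size u = k -> all (fun x => 0 <= x) u ->
  let s := zip [seq val (c a) | a <- enum 'I_k] u in
  \prod_(x <- u) expR (- x) * minor (conj_kernel G) k (nth point s) (nth point s) =
  \det (\matrix_(a < k, b < k) G (c a) (c b) (nth 0 u a) (nth 0 u b)).
Proof.
move=> su u0 s; have sE (a : 'I_k) : nth point s a = (val (c a), nth 0 u a).
  rewrite /s (_ : point = (0%N, 0 : R))// nth_zip; last by rewrite size_map size_enum_ord su.
  by rewrite (nth_map a) ?size_enum_ord// nth_ord_enum.
have pos (a : 'I_k) : 0 <= nth 0 u a by apply: (all_nthP 0 u0); rewrite su.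
rewrite /minor; pose A : 'rV[R]_k := \row_a expR (- (row_weight (c a) * nth 0 u a)).
pose D : 'rV[R]_k := \row_a expR (col_weight (c a) * nth 0 u a).
have -> : \matrix_(a < k, b < k) conj_kernel G (nth point s a) (nth point s b) =
   diag_mx A *m (\matrix_(a < k, b < k) G (c a) (c b) (nth 0 u a) (nth 0 u b)) *m diag_mx D.
  apply/matrixP => a b; rewrite mul_mx_diag mul_diag_mx !mxE !sE /conj_kernel /= !pos /=.
  by rewrite !inord_val.
have alg (a b e f : R) : a * b * f = 1 -> a * (b * e * f) = e by move=> h; rewrite -[RHS]mul1r -h; ring.
rewrite !det_mulmx !det_diag (big_nth 0) big_mkord su; apply: alg.
rewrite -!big_split /=; apply: big1 => a _; rewrite !mxE -!expRD.
by rewrite (_ : _ + _ = 0) ?expR0// /col_weight; ring.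
Qed.

Lemma fredholm_det_fdet (G : mxkernel R n) (C : R) : mkernel G -> 0 <= C -> decays G C ->
  fredholm_det G = fdet (kelem G).
Proof.
move=> mG C0 dG; have bG := bker_conj mG C0 dG; have [_ kE] := kelemE mG C0 dG.
rewrite /fredholm_det /fdet kE; congr (limn (series _)); apply/funext => k; rewrite /fc /dk; congr (_ * _).
have mp : pmeas k (fun (_ : unit) (s : seq X) => minor (conj_kernel G) k (nth point s) (nth point s)).
  by apply: (pmeas_minor _ bG) => i; exact: pmeas_nth.
have hb s : `|minor (conj_kernel G) k (nth point s) (nth point s)| <= hbound C k.
  exact: (minor_bound _ _ _ bG).
rewrite (nest_row_lists _ mp hb) sum_row_lists; apply: eq_bigr => c _.
have sz : size [seq val (c a) | a <- enum 'I_k] = k by rewrite size_map size_enum_ord.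
rewrite (@nest_rows_iter _ _ (hbound C k)) ?sz//.
by apply: iter_integral_ext => u su u0; rewrite conj_kernel_minor.
Qed.

End determinant.

(** * The resolvent on square integrable functions *)

Section square_integrable.
Context {R : realType}.
Notation mu := (@lebesgue_measure R).
Implicit Types (f g : R -> R) (h : R -> R -> R) (c u v C : R).

Definition dist_exp c u v : R := expR (- c * `|u - v|).

Lemma dist_exp_ge0 c u v : 0 <= dist_exp c u v. Proof. exact: expR_ge0. Qed.

Lemma dist_expC c u v : dist_exp c u v = dist_exp c v u.
Proof. by rewrite /dist_exp distrC. Qed.

Lemma measurable_dist_exp c : measurable_fun setT (fun p : R * R => dist_exp c p.1 p.2).
Proof.
apply: measurableT_comp => //; apply: measurable_funM => //.
by apply: measurableT_comp => //; exact: measurable_funB.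
Qed.

Lemma integral_dist_exp c : exists2 D : R, 0 <= D & forall u, 0 < c ->
  integral_is mu setT (fun v => dist_exp c v u) D.
Proof.
exists (\int[mu]_v expR (- c * `|v|)).
  by apply: fine_ge0; apply: integral_ge0 => v _; rewrite lee_fin expR_ge0.
move=> u c0; have j := integrable_expRN_norm c0.
have E : (\int[mu]_v (dist_exp c v u)%:E = \int[mu]_v (expR (- c * `|v|))%:E)%E.
  have d (v : R) : is_derive v (1 : R) (fun y => y - u) 1.
    rewrite (_ : (fun y => y - u) = (fun y => - u + y * 1)); first exact: is_derive_affine.
    by apply/funext => y; rewrite mulr1 addrC.
  have dF : (fun y : R => y - u)^`()%classic = cst 1.
    by apply/funext => y; rewrite derive1E; have [_ ->] := d y.
  rewrite [RHS](@increasing_ge0_integration_by_substitutionT _ (fun y => y - u) (fun v => expR (- c * `|v|))).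
  - by apply: eq_integral => v _; rewrite dF /= mulr1.
  - by move=> x y xy; rewrite ltrD2r.
  - by rewrite dF; exact: cst_continuous.
  - by rewrite dF; exact: is_cvg_cst.
  - by rewrite dF; exact: is_cvg_cst.
  - by move=> x; have [] := d x.
  - exact: cvg_addrr_Ny.
  - exact: cvg_addrr.
  - move=> x; apply: continuous_comp; last exact: continuous_expR.
    by apply: continuous_comp; [exact: norm_continuous|exact: mulrl_continuous].
  - by move=> x; exact: expR_ge0.
split; last by rewrite /Rintegral E.
have m : measurable_fun setT (fun v => dist_exp c v u).
  exact: (measurableT_comp (measurable_dist_exp c) (pair2_measurable u)).
apply/integrableP; split; first exact/measurable_EFinP.
under eq_integral => v _ do rewrite /= ger0_norm ?dist_exp_ge0//.
rewrite E; have /integrableP[_] := j.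
by under eq_integral => v _ do rewrite /= ger0_norm ?expR_ge0//.
Qed.

Definition l2 g := measurable_fun setT g /\ mu.-integrable setT (EFin \o (fun v => g v ^+ 2)).

Lemma l2_Lfun g : g \in Lfun mu 2%:E <-> l2 g.
Proof.
split=> [h|[mg jg]].
  by split; [move: h; rewrite inE => /andP[/[!inE]/= mg _]|exact: Lfun2_integrable_sqr].
rewrite inE; apply/andP; split; rewrite inE//= /finite_norm unlock.
have -> : (\int[mu]_x (`|(g x)%:E| `^ 2) = \int[mu]_x (g x ^+ 2)%:E)%E.
  by apply: eq_integral => x _; rewrite abse_EFin poweR_EFin powR_mulrn// real_normK ?num_real.
apply: poweR_lty; have /integrableP[_] := jg.
by under eq_integral => v _ do rewrite /= ger0_norm ?sqr_ge0//.
Qed.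

Let dist_exp_row c u : measurable_fun setT (dist_exp c u).
Proof. exact: (measurableT_comp (measurable_dist_exp c) (pair1_measurable u)). Qed.

Lemma l2_integrable_dist_exp c u g : 0 < c -> l2 g ->
  mu.-integrable setT (EFin \o (fun v => dist_exp c u v * `|g v|)) /\
  mu.-integrable setT (EFin \o (fun v => dist_exp c u v * g v ^+ 2)).
Proof.
move=> c0 [mg jg]; have [D _ hD] := integral_dist_exp c; have [je _] := hD u c0.
have e1 v : dist_exp c u v <= 1 by rewrite -[leRHS]expR0 ler_expR mulNr oppr_le0 mulr_ge0// ltW.
have je' : mu.-integrable setT (EFin \o (dist_exp c u)).
  by apply: eq_integrable je => // v _ /=; rewrite dist_expC.
split.
  apply: (@integrable_dominated _ _ _ mu setT (fun v => dist_exp c u v * `|g v|)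
    (fun v => dist_exp c u v + g v ^+ 2)) => //.
  - apply: measurable_funM; first exact: dist_exp_row.
    exact: (measurableT_comp (@normr_measurable R setT) mg).
  - exact: (@integrableD_fun _ _ _ mu setT (dist_exp c u) (fun v => g v ^+ 2)).
  - move=> v _; rewrite normrM normr_id ger0_norm ?dist_exp_ge0//.
    have h : `|g v| <= 1 + g v ^+ 2.
      rewrite -[g v ^+ 2]real_normK ?num_real//; have := sqr_ge0 (`|g v| - 1); have := sqr_ge0 `|g v|; rewrite sqrrB mulr1 expr1n mulr2n; lra.
    apply: le_trans (ler_wpM2l (dist_exp_ge0 _ _ _) h) _.
    by rewrite mulrDr mulr1 lerD2l -[leRHS]mul1r ler_wpM2r// sqr_ge0.
apply: (@integrable_dominated _ _ _ mu setT (fun v => dist_exp c u v * g v ^+ 2) (fun v => g v ^+ 2)) => //.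
  by apply: measurable_funM; [exact: dist_exp_row|exact: measurable_funX].
move=> v _; rewrite normrM !ger0_norm ?dist_exp_ge0 ?sqr_ge0//.
by rewrite -[leRHS]mul1r ler_wpM2r// sqr_ge0.
Qed.

(* The discriminant of the quadratic form [c |-> int e (|g| - c)^2]. *)
Lemma dist_exp_Cauchy_Schwarz c g : 0 < c -> l2 g -> exists2 D : R, 0 <= D & forall u,
  (\int[mu]_v (dist_exp c u v * `|g v|)) ^+ 2 <= D * \int[mu]_v (dist_exp c u v * g v ^+ 2).
Proof.
move=> c0 hg; have [D D0 hD] := integral_dist_exp c; exists (D + 1); first exact: addr_ge0.
move=> u; have [j1 j2] := l2_integrable_dist_exp u c0 hg.
have [je eD] := hD u c0.
have je' : integral_is mu setT (dist_exp c u) D.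
  split; first by apply: eq_integrable je => // v _ /=; rewrite dist_expC.
  by rewrite -eD; apply: eq_Rintegral => v _; rewrite dist_expC.
set S := \int[mu]_v (dist_exp c u v * `|g v|); set A := \int[mu]_v (dist_exp c u v * g v ^+ 2).
have D1 : 0 < D + 1 by rewrite ltr_wpDl.
pose k := S / (D + 1).
have [_ E] := integral_is_lin3 measurableT 1 (- 2 * k) (k ^+ 2) (conj j2 (erefl A)) (conj j1 (erefl S)) je'.
have : 0 <= 1 * A + - 2 * k * S + k ^+ 2 * D.
  rewrite -E; apply: fine_ge0; apply: integral_ge0 => v _; rewrite lee_fin.
  rewrite (_ : _ + _ = dist_exp c u v * (`|g v| - k) ^+ 2); first by rewrite mulr_ge0 ?sqr_ge0 ?dist_exp_ge0.
  by rewrite sqrrB real_normK ?num_real//; ring.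
have -> : S = k * (D + 1) by rewrite /k divfK// gt_eqF.
move: (sqr_ge0 k) => k2 h.
have {}h : k ^+ 2 * (D + 1) <= A.
  by move: h; rewrite (_ : -2 * k * (k * (D + 1)) = - 2 * (k ^+ 2 * D) - 2 * k ^+ 2); [lra|ring].
rewrite [leLHS](_ : _ = (D + 1) * (k ^+ 2 * (D + 1))); last by ring.
by rewrite ler_wpM2l// ltW.
Qed.

(** A Schur condition: on the unweighted half-line boundedness does not suffice for an operator on
    L^2, while exponential decay off the diagonal does. *)
Definition banded h C := measurable_fun setT (fun p : R * R => h p.1 p.2) /\
  forall u v, `|h u v| <= C * dist_exp 1 u v.

Lemma banded_ge0 h C : banded h C -> 0 <= C.
Proof.
move=> [_ /(_ 0 0)]; rewrite /dist_exp subrr normr0 mulr0 expR0 mulr1; exact: le_trans.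
Qed.

Let mrow h C g u : banded h C -> measurable_fun setT g -> measurable_fun setT (fun v => h u v * g v).
Proof.
by move=> [mh _] mg; apply: measurable_funM => //; exact: (measurableT_comp mh (pair1_measurable u)).
Qed.

Lemma banded_integrable h C u g : banded h C -> l2 g ->
  mu.-integrable setT (EFin \o (fun v => h u v * g v)).
Proof.
move=> hh hg; have [j1 _] := l2_integrable_dist_exp u ltr01 hg.
apply: (@integrable_dominated _ _ _ mu setT (fun v => h u v * g v) (fun v => C * (dist_exp 1 u v * `|g v|))) => //.
- exact: mrow hh hg.1.
- exact: (@integrableZ_fun _ _ _ mu setT (fun v => dist_exp 1 u v * `|g v|)).
- by move=> v _; rewrite normrM mulrA ler_wpM2r// hh.2.
Qed.

(** Schur's test: Cauchy-Schwarz with the weight [dist_exp 1 u], then Fubini to integrate this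
    weight in [u]. *)
Lemma banded_l2 h C g : banded h C -> l2 g -> l2 (fun u => \int[mu]_v (h u v * g v)).
Proof.
move=> hh hg; have C0 := banded_ge0 hh; have [mh bh] := hh; have [mg jg] := hg.
have [D D0 CS] := dist_exp_Cauchy_Schwarz ltr01 hg.
have [E E0 hE] := integral_dist_exp 1.
have mI : measurable_fun setT (fun u => \int[mu]_v (h u v * g v)).
  apply: (@measurable_Rintegral_param _ _ _ _ _ mu (fun u v => h u v * g v)) => //.
  by apply: measurable_funM => //; exact: (measurableT_comp mg measurable_snd).
split=> //.
have mp : measurable_fun setT (fun p : R * R => dist_exp 1 p.1 p.2 * g p.2 ^+ 2).
  apply: measurable_funM; first exact: measurable_dist_exp.
  by apply: measurable_funX; exact: (measurableT_comp mg measurable_snd).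
have jp : (mu \x mu)%E.-integrable setT (fun p : R * R => (dist_exp 1 p.1 p.2 * g p.2 ^+ 2)%:E).
  apply/integrable21ltyP; first exact/measurable_EFinP.
  have inner y : (\int[mu]_x `|(dist_exp 1 x y * g y ^+ 2)%:E| = (g y ^+ 2 * E)%:E)%E.
    have [jy vy] := hE y ltr01.
    transitivity (\int[mu]_x ((g y ^+ 2)%:E * (dist_exp 1 x y)%:E))%E.
      have p0 x : 0 <= dist_exp 1 x y * g y ^+ 2 by apply: mulr_ge0; [exact: dist_exp_ge0|exact: sqr_ge0].
      by apply: eq_integral => x _; rewrite abse_EFin (ger0_norm (p0 x)) -EFinM mulrC.
    rewrite -vy [RHS]EFinM; transitivity ((g y ^+ 2)%:E * \int[mu]_x (dist_exp 1 x y)%:E)%E; first exact: integralZl.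
    congr (_ * _)%E.
    by rewrite fineK//; exact: (integrable_fin_num measurableT jy).
  under eq_integral => y _ do rewrite inner.
  have j := integrableZr measurableT E jg.
  have /integrableP[_] := j; apply: le_lt_trans; rewrite le_eqVlt; apply/orP; left; apply/eqP.
  by apply: eq_integral => x _ /=; rewrite ger0_norm// mulr_ge0// sqr_ge0.
have jF := integrable_fubini_F jp.
have jF' : mu.-integrable setT (EFin \o (fun u => \int[mu]_v (dist_exp 1 u v * g v ^+ 2))).
  apply: eq_integrable jF => // u _; rewrite /fubini_F /= fineK//.
  exact: (integrable_fin_num measurableT (l2_integrable_dist_exp u ltr01 hg).2).
apply: (@integrable_dominated _ _ _ mu setT (fun u => (\int[mu]_v (h u v * g v)) ^+ 2)
  (fun u => C ^+ 2 * D * \int[mu]_v (dist_exp 1 u v * g v ^+ 2))) => //.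
- exact: measurable_funX.
- exact: (@integrableZ_fun _ _ _ mu setT (fun u => \int[mu]_v (dist_exp 1 u v * g v ^+ 2))).
- move=> u _; rewrite normrX -mulrA; apply: le_trans (_ : (C * \int[mu]_v (dist_exp 1 u v * `|g v|)) ^+ 2 <= _).
    have [j1 _] := l2_integrable_dist_exp u ltr01 hg.
    have i0 : 0 <= \int[mu]_v (dist_exp 1 u v * `|g v|).
      by apply: fine_ge0; apply: integral_ge0 => v _; rewrite lee_fin mulr_ge0 ?dist_exp_ge0.
    rewrite lerXn2r ?nnegrE ?mulr_ge0// -RintegralZl//.
    apply: (@normr_Rintegral_le _ _ _ mu setT (fun v => h u v * g v)) => //.
    + exact: mrow hh mg.
    + exact: (@integrableZ_fun _ _ _ mu setT (fun v => dist_exp 1 u v * `|g v|)).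
    + by move=> v _; rewrite normrM mulrA ler_wpM2r// bh.
  by rewrite exprMn ler_wpM2l ?sqr_ge0.
Qed.

(** Half of the decay rate is given up to separate [w] from [v]; Fubini then has a dominating
    function in product form. *)
Lemma dist_exp_triangle u v w : dist_exp 1 u w * dist_exp 1 w v <= dist_exp 2^-1 u w * dist_exp 2^-1 u v.
Proof.
rewrite -!expRD ler_expR; have := ler_distD w u v; have := normr_ge0 (w - v); have := normr_ge0 (u - w); lra.
Qed.

Lemma banded_comp h1 h2 C1 C2 g u : banded h1 C1 -> banded h2 C2 -> l2 g ->
  \int[mu]_w (h1 u w * \int[mu]_v (h2 w v * g v)) = \int[mu]_v ((\int[mu]_w (h1 u w * h2 w v)) * g v).
Proof.
move=> b1 b2 hg; have [m1 k1] := b1; have [m2 k2] := b2; have [mg _] := hg.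
have C10 := banded_ge0 b1; have C20 := banded_ge0 b2.
have h20 : 0 < 2^-1 :> R by rewrite invr_gt0.
have [D D0 hD] := integral_dist_exp 2^-1; have [je _] := hD u h20.
have je' : mu.-integrable setT (EFin \o (dist_exp 2^-1 u)).
  by apply: eq_integrable je => // v _ /=; rewrite dist_expC.
have [j2 _] := l2_integrable_dist_exp u h20 hg.
have bd w v : `|h1 u w * h2 w v| <= C1 * C2 * (dist_exp 2^-1 u w * dist_exp 2^-1 u v).
  rewrite normrM; apply: le_trans (ler_pM _ _ (k1 u w) (k2 w v)) _ => //.
  rewrite [leLHS](_ : _ = C1 * C2 * (dist_exp 1 u w * dist_exp 1 w v)); last by ring.
  by rewrite ler_wpM2l ?mulr_ge0// dist_exp_triangle.
transitivity (\int[mu]_w \int[mu]_v (h1 u w * h2 w v * g v)).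
  apply: eq_Rintegral => w _; rewrite -RintegralZl//; last exact: banded_integrable b2 hg.
  by apply: eq_Rintegral => v _; rewrite mulrA.
rewrite (@Rintegral_swap _ _ _ _ _ mu mu _ (fun w => C1 * C2 * dist_exp 2^-1 u w)
  (fun v => dist_exp 2^-1 u v * `|g v|)).
- apply: eq_Rintegral => v _; rewrite RintegralZr//.
  apply: (@integrable_dominated _ _ _ mu setT (fun w => h1 u w * h2 w v)
    (fun w => C1 * C2 * dist_exp 2^-1 u v * dist_exp 2^-1 u w)) => //.
  + apply: measurable_funM; first exact: (measurableT_comp m1 (pair1_measurable u)).
    exact: (measurableT_comp m2 (pair2_measurable v)).
  + exact: (@integrableZ_fun _ _ _ mu setT (dist_exp 2^-1 u)).
  + by move=> w _; rewrite -!mulrA [dist_exp _ u v * _]mulrC !mulrA -mulrA; exact: bd.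
- apply: measurable_funM; last exact: (measurableT_comp mg measurable_snd).
  apply: measurable_funM => //.
  exact: (measurableT_comp (measurableT_comp m1 (pair1_measurable u)) measurable_fst).
- exact: (@integrableZ_fun _ _ _ mu setT (dist_exp 2^-1 u)).
- exact: j2.
- by move=> w v; rewrite normrM mulrA -[_ * _ * dist_exp _ u v]mulrA ler_wpM2r// bd.
Qed.

Lemma banded_comp_integrable h1 h2 C1 C2 g u : banded h1 C1 -> banded h2 C2 -> l2 g ->
  mu.-integrable setT (EFin \o (fun v => (\int[mu]_w (h1 u w * h2 w v)) * g v)).
Proof.
move=> b1 b2 hg; have [m1 k1] := b1; have [m2 k2] := b2; have [mg _] := hg.
have C10 := banded_ge0 b1; have C20 := banded_ge0 b2.
have h20 : 0 < 2^-1 :> R by rewrite invr_gt0.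
have [D D0 hD] := integral_dist_exp 2^-1; have [je vD] := hD u h20.
have je' : mu.-integrable setT (EFin \o (dist_exp 2^-1 u)).
  by apply: eq_integrable je => // v _ /=; rewrite dist_expC.
have [j2 _] := l2_integrable_dist_exp u h20 hg.
have mh v : measurable_fun setT (fun w => h1 u w * h2 w v).
  apply: measurable_funM; first exact: (measurableT_comp m1 (pair1_measurable u)).
  exact: (measurableT_comp m2 (pair2_measurable v)).
apply: (@integrable_dominated _ _ _ mu setT (fun v => (\int[mu]_w (h1 u w * h2 w v)) * g v)
  (fun v => C1 * C2 * D * (dist_exp 2^-1 u v * `|g v|))) => //.
- apply: measurable_funM => //.
  apply: (@measurable_Rintegral_param _ _ _ _ _ mu (fun v w => h1 u w * h2 w v)) => //.
  apply: measurable_funM; first exact: (measurableT_comp (measurableT_comp m1 (pair1_measurable u)) measurable_snd).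
  exact: (measurable_fun_comp2 m2 measurable_snd measurable_fst).
- exact: (@integrableZ_fun _ _ _ mu setT (fun v => dist_exp 2^-1 u v * `|g v|)).
- move=> v _; rewrite normrM mulrA ler_wpM2r//.
  have -> : C1 * C2 * D * dist_exp 2^-1 u v = \int[mu]_w (C1 * C2 * dist_exp 2^-1 u v * dist_exp 2^-1 u w).
    rewrite RintegralZl// -vD mulrAC; congr (_ * _).
    by apply: eq_Rintegral => w _; rewrite dist_expC.
  apply: (@normr_Rintegral_le _ _ _ mu setT (fun w => h1 u w * h2 w v)); [by []|exact: mh| |].
    exact: (@integrableZ_fun _ _ _ mu setT (dist_exp 2^-1 u)).
  move=> w _; rewrite normrM; apply: le_trans (ler_pM _ _ (k1 u w) (k2 w v)) _ => //.
  rewrite [leLHS](_ : _ = C1 * C2 * (dist_exp 1 u w * dist_exp 1 w v)); last by ring.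
  rewrite -[leRHS]mulrA; apply: ler_wpM2l; first exact: mulr_ge0.
  by rewrite [leRHS]mulrC; exact: dist_exp_triangle.
Qed.

End square_integrable.

Section half_line_operators.
Context {R : realType} (n : nat).
Notation mu := (@lebesgue_measure R).
Implicit Types (K H : mxkernel R n) (f g : 'I_n -> R -> R) (C : R).

Lemma RplusE (u : R) : Rplus u = (0 <= u) :> Prop.
Proof. by rewrite /Rplus /= in_itv /= andbT. Qed.

Lemma measurable_Rplus : measurable (@Rplus R). Proof. exact: measurable_itv. Qed.

Lemma Rintegral_zero : \int[mu]_v (0 : R) = 0.
Proof. by rewrite /Rintegral integral0. Qed.

Lemma cutE (g : R -> R) u : (g \_ (@Rplus R)) u = if 0 <= u then g u else 0.
Proof. by rewrite patchE /Rplus mem_setE in_itv /= andbT. Qed.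

Lemma l2D (f g : R -> R) (a b : R) : l2 f -> l2 g -> l2 (fun u => a * f u + b * g u).
Proof.
move=> [mf jf] [mg jg]; have m : measurable_fun setT (fun u => a * f u + b * g u).
  by apply: measurable_funD; exact: measurable_funM.
split=> //.
apply: (@integrable_dominated _ _ _ mu setT (fun u => (a * f u + b * g u) ^+ 2)
  (fun u => 2 * a ^+ 2 * f u ^+ 2 + 2 * b ^+ 2 * g u ^+ 2)) => //.
- exact: measurable_funX.
- apply: (@integrableD_fun _ _ _ mu setT (fun u => 2 * a ^+ 2 * f u ^+ 2) (fun u => 2 * b ^+ 2 * g u ^+ 2)) => //.
    exact: (@integrableZ_fun _ _ _ mu setT (fun u => f u ^+ 2)).
  exact: (@integrableZ_fun _ _ _ mu setT (fun u => g u ^+ 2)).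
- move=> u _; rewrite ger0_norm ?sqr_ge0//; have := sqr_ge0 (a * f u - b * g u).
  move: (a * f u) (b * g u) (exprMn 2 a (f u)) (exprMn 2 b (g u)) => p q ep eq.
  rewrite -[2 * a ^+ 2 * _]mulrA -[2 * b ^+ 2 * _]mulrA -ep -eq sqrrB sqrrD !mulr2n.
  by move: (p ^+ 2) (q ^+ 2) (p * q) => x y z; lra.
Qed.

Lemma l2_sum (I : Type) (r : seq I) (F : I -> R -> R) : (forall i, l2 (F i)) -> l2 (fun u => \sum_(i <- r) F i u).
Proof.
move=> h; elim: r => [|i r ih].
  under eq_fun do rewrite big_nil; split; first exact: measurable_cst.
  by rewrite (_ : _ \o _ = cst 0%E) ?integrable0//; apply/funext => v /=; rewrite expr0n.
under eq_fun do rewrite big_cons; have := l2D 1 1 (h i) ih.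
by under eq_fun do rewrite !mul1r.
Qed.

Lemma L2plusP f : L2plus f <-> forall i, l2 (f i \_ (@Rplus R)).
Proof. by split=> h i; [apply/l2_Lfun; exact: h|apply/l2_Lfun; exact: h]. Qed.

Definition mxbanded K C := forall i j, measurable_fun setT (fun p : R * R => K i j p.1 p.2) /\
  forall u v, 0 <= u -> 0 <= v -> `|K i j u v| <= C * dist_exp 1 u v.

(** Extension by 0 to the plane, which reduces operators on the half-line to banded ones on the
    whole line. *)
Definition kcut K i j (u v : R) := if (0 <= u) && (0 <= v) then K i j u v else 0.

Lemma banded_kcut K C i j : mxbanded K C -> banded (kcut K i j) C.
Proof.
move=> hK; have [mK bK] := hK i j; have C0 : 0 <= C.
  have := bK 0 0 (lexx 0) (lexx 0); rewrite /dist_exp subrr normr0 mulr0 expR0 mulr1; exact: le_trans.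
split; last first.
  move=> u v; rewrite /kcut; case: ifP => [/andP[u0 v0]|_]; first exact: bK.
  by rewrite normr0 mulr_ge0// dist_exp_ge0.
have -> : (fun p : R * R => kcut K i j p.1 p.2) =
    (fun p : R * R => K i j p.1 p.2) \_ (@Rplus R `*` @Rplus R).
  apply/funext => -[u v]; rewrite patchE /kcut /=.
  case: ifPn => [/andP[u0 v0]|h]; first by rewrite mem_set// /setX /= !RplusE.
  by rewrite memNset// /setX /= !RplusE => -[u0 v0]; rewrite u0 v0 in h.
apply/(measurable_restrictT _ (measurableX measurable_Rplus measurable_Rplus)).
exact: measurable_funS mK.
Qed.

Lemma kapply_cut K f i u : (kapply K f i \_ (@Rplus R)) u =
  \sum_j \int[mu]_v (kcut K i j u v * (f j \_ (@Rplus R)) v).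
Proof.
rewrite cutE; case: ifPn => u0; last first.
  rewrite big1// => j _; transitivity (\int[mu]_v (0 : R)); last exact: Rintegral_zero.
  by apply: eq_Rintegral => v _; rewrite /kcut (negPf u0) mul0r.
apply: eq_bigr => j _; rewrite Rintegral_mkcond; apply: eq_Rintegral => v _.
by rewrite !cutE /kcut u0; case: ifP => _; rewrite ?mulr0.
Qed.

Lemma kapply_ge0 K f i u : 0 <= u -> kapply K f i u =
  \sum_j \int[mu]_v (kcut K i j u v * (f j \_ (@Rplus R)) v).
Proof. by move=> u0; rewrite -kapply_cut cutE u0. Qed.

Lemma kapply_L2 K C f : mxbanded K C -> L2plus f -> L2plus (kapply K f).
Proof.
move=> hK /L2plusP hf; apply/L2plusP => i.
rewrite (_ : _ \_ _ = fun u => \sum_j \int[mu]_v (kcut K i j u v * (f j \_ (@Rplus R)) v)).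
  by apply: l2_sum => j; exact: banded_l2 (banded_kcut i j hK) (hf j).
by apply/funext => u; rewrite kapply_cut.
Qed.

Lemma kapply_linear K C f g (a b : R) i u : mxbanded K C -> L2plus f -> L2plus g -> 0 <= u ->
  kapply K (fun i v => a * f i v + b * g i v) i u = a * kapply K f i u + b * kapply K g i u.
Proof.
move=> hK /L2plusP hf /L2plusP hg u0; rewrite !kapply_ge0// !mulr_sumr -big_split; apply: eq_bigr => j _ /=.
have bK := banded_kcut i j hK; have jf := banded_integrable u bK (hf j); have jg := banded_integrable u bK (hg j).
have [_ <-] := integral_isD measurableT (integral_isZ measurableT a (conj jf erefl))
  (integral_isZ measurableT b (conj jg erefl)).
by apply: eq_Rintegral => v _; rewrite !cutE; case: ifP => _; ring.
Qed.

Lemma L2plus_linear f g (a b : R) : L2plus f -> L2plus g -> L2plus (fun i v => a * f i v + b * g i v).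
Proof.
move=> /L2plusP hf /L2plusP hg; apply/L2plusP => i; have := l2D a b (hf i) (hg i).
congr l2; apply/funext => v; rewrite !cutE; by case: ifP => _; rewrite ?mulr0 ?addr0.
Qed.

Lemma kapply_ext K H f i u : (forall i j u v, 0 <= u -> 0 <= v -> K i j u v = H i j u v) ->
  0 <= u -> kapply K f i u = kapply H f i u.
Proof.
move=> KH u0; rewrite !kapply_ge0//; apply: eq_bigr => j _; apply: eq_Rintegral => v _.
by rewrite /kcut u0 /=; case: ifP => // v0; rewrite KH.
Qed.

Lemma kapply_ae K C f g i u : mxbanded K C -> L2plus f -> L2plus g -> aeqplus f g -> 0 <= u ->
  kapply K f i u = kapply K g i u.
Proof.
move=> hK /L2plusP hf /L2plusP hg fg u0; rewrite !kapply_ge0//; apply: eq_bigr => j _.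
have bK := banded_kcut i j hK; have jf := banded_integrable u bK (hf j); have jg := banded_integrable u bK (hg j).
congr fine; apply: ae_eq_integral => //; [exact: measurable_int jf|exact: measurable_int jg|].
apply: filterS (fg j) => v h _; rewrite !cutE; case: ifP => // v0; rewrite h//.
by rewrite RplusE.
Qed.

Definition mxcomp K H : mxkernel R n := fun i j u v =>
  \sum_l \int[mu]_(w in @Rplus R) (K i l u w * H l j w v).

Lemma kcut_mxcomp K H i j u v : kcut (mxcomp K H) i j u v = \sum_l \int[mu]_w (kcut K i l u w * kcut H l j w v).
Proof.
rewrite {1}/kcut; case: ifPn => [/andP[u0 v0]|h].
  apply: eq_bigr => l _; rewrite Rintegral_mkcond; apply: eq_Rintegral => w _.
  by rewrite cutE /kcut u0 v0 andbT; case: ifP => _; rewrite ?mul0r.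
rewrite big1// => l _; transitivity (\int[mu]_w (0 : R)); last exact: Rintegral_zero.
apply: eq_Rintegral => w _; rewrite /kcut /=; move: h; rewrite negb_and => /orP[] /negPf ->.
  by rewrite mul0r.
by rewrite andbF mulr0.
Qed.

Lemma kapply_comp K H C D f i u : mxbanded K C -> mxbanded H D -> L2plus f -> 0 <= u ->
  kapply K (kapply H f) i u = kapply (mxcomp K H) f i u.
Proof.
move=> hK hH hf u0; have hHf := kapply_L2 hH hf; move/L2plusP : (hf) => lf; move/L2plusP: hHf => lHf.
have bK i j := banded_kcut i j hK; have bH i j := banded_kcut i j hH.
rewrite !kapply_ge0//.
transitivity (\sum_l \sum_j \int[mu]_v ((\int[mu]_w (kcut K i l u w * kcut H l j w v)) * (f j \_ (@Rplus R)) v)).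
  apply: eq_bigr => l _.
  transitivity (\sum_j \int[mu]_w (kcut K i l u w * \int[mu]_v (kcut H l j w v * (f j \_ (@Rplus R)) v))).
    have := integral_is_sum (index_enum 'I_n) (fun j => conj (banded_integrable u (bK i l) (banded_l2 (bH l j) (lf j))) erefl).
    by move=> [_ <-]; apply: eq_Rintegral => w _; rewrite kapply_cut mulr_sumr.
  by apply: eq_bigr => j _; exact: banded_comp (bK i l) (bH l j) (lf j).
rewrite exchange_big; apply: eq_bigr => j _ /=.
have jj l : mu.-integrable setT (EFin \o (fun v => (\int[mu]_w (kcut K i l u w * kcut H l j w v)) * (f j \_ (@Rplus R)) v)).
  exact: banded_comp_integrable (bK i l) (bH l j) (lf j).
have [_ <-] := integral_is_sum (index_enum 'I_n) (fun l => conj (jj l) erefl).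
by apply: eq_Rintegral => v _; rewrite kcut_mxcomp mulr_suml.
Qed.

End half_line_operators.

Section resolvent_kernels.
Context {R : realType} (n : nat).
Notation mu := (@lebesgue_measure R).
Implicit Types (K H : mxkernel R n) (f g : 'I_n -> R -> R) (C : R).

Lemma aeqplus_ge0 f g : (forall i u, 0 <= u -> f i u = g i u) -> aeqplus f g.
Proof. by move=> fg i; apply: aeW => u; rewrite RplusE => /fg. Qed.

Lemma kapplyD K C f g i u : mxbanded K C -> L2plus f -> L2plus g -> 0 <= u ->
  kapply K (fun i v => f i v + g i v) i u = kapply K f i u + kapply K g i u.
Proof.
move=> hK hf hg u0; have := kapply_linear 1 1 i hK hf hg u0; rewrite !mul1r => <-.
by congr kapply; apply/funext => j; apply/funext => v; rewrite !mul1r.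
Qed.

Lemma kapplyB K C f g i u : mxbanded K C -> L2plus f -> L2plus g -> 0 <= u ->
  kapply K (fun i v => f i v - g i v) i u = kapply K f i u - kapply K g i u.
Proof.
move=> hK hf hg u0; have := kapply_linear 1 (-1) i hK hf hg u0; rewrite !mul1r !mulN1r => <-.
by congr kapply; apply/funext => j; apply/funext => v; rewrite mul1r mulN1r.
Qed.

Lemma L2plusD f g : L2plus f -> L2plus g -> L2plus (fun i v => f i v + g i v).
Proof.
move=> hf hg; have := L2plus_linear 1 1 hf hg.
by congr L2plus; apply/funext => j; apply/funext => v; rewrite !mul1r.
Qed.

Lemma L2plusB f g : L2plus f -> L2plus g -> L2plus (fun i v => f i v - g i v).
Proof.
move=> hf hg; have := L2plus_linear 1 (-1) hf hg.
by congr L2plus; apply/funext => j; apply/funext => v; rewrite mul1r mulN1r.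
Qed.

Lemma kapply_kernelB K H C D f i u : mxbanded K C -> mxbanded H D -> L2plus f -> 0 <= u ->
  kapply (fun i j u v => K i j u v - H i j u v) f i u = kapply K f i u - kapply H f i u.
Proof.
move=> hK hH /L2plusP hf u0; rewrite !kapply_ge0// -sumrB; apply: eq_bigr => j _.
have jK := banded_integrable u (banded_kcut i j hK) (hf j).
have jH := banded_integrable u (banded_kcut i j hH) (hf j).
rewrite -RintegralB//; apply: eq_Rintegral => v _; rewrite /kcut; case: ifP => _; last by rewrite mul0r subrr.
by rewrite mulrBl.
Qed.

Section resolvent.
Variables (K H : mxkernel R n) (C D : R).
Hypothesis hK : mxbanded K C.
Hypothesis hH : mxbanded H D.
Hypothesis KH : forall i j u v, 0 <= u -> 0 <= v -> H i j u v = K i j u v + mxcomp K H i j u v.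
Hypothesis HK : forall i j u v, 0 <= u -> 0 <= v -> H i j u v = K i j u v + mxcomp H K i j u v.

Lemma kapply_resolventl f i u : L2plus f -> 0 <= u ->
  kapply K (kapply H f) i u = kapply H f i u - kapply K f i u.
Proof.
move=> hf u0; rewrite (kapply_comp i hK hH hf u0) -(kapply_kernelB i hH hK hf u0).
by apply: kapply_ext => // j l v w v0 w0; rewrite (KH j l v0 w0) addrC addKr.
Qed.

Lemma kapply_resolventr f i u : L2plus f -> 0 <= u ->
  kapply H (kapply K f) i u = kapply H f i u - kapply K f i u.
Proof.
move=> hf u0; rewrite (kapply_comp i hH hK hf u0) -(kapply_kernelB i hH hK hf u0).
by apply: kapply_ext => // j l v w v0 w0; rewrite (HK j l v0 w0) addrC addKr.
Qed.

Lemma id_sub_L2 f : L2plus f -> L2plus (id_sub K f).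
Proof. by move=> hf; apply: L2plusB => //; exact: kapply_L2 hK hf. Qed.

(** On L^2 the inverse of [1 - K] is [1 + H]: the equation [H = K + K H] gives surjectivity, and
    [H = K + H K] gives injectivity. *)
Lemma id_sub_invertible_resolvent : id_sub_invertible K.
Proof.
split; first exact: id_sub_L2.
- move=> f hf f0; have l0 : L2plus (fun (_ : 'I_n) (_ : R) => 0 : R) := ltac:(
    apply/L2plusP => i; have := l2_sum [::] (fun i : 'I_n => (L2plusP f).1 hf i);
    congr l2; apply/funext => v; rewrite big_nil cutE; by case: ifP).
  have Kf0 i u : 0 <= u -> kapply K f i u = 0.
    move=> u0; have := kapply_ae i hH (id_sub_L2 hf) l0 f0 u0.
    rewrite (kapplyB i hH hf (kapply_L2 hK hf) u0) (kapply_resolventr i hf u0) opprB addrC subrK => ->.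
    by apply: big1 => j _; rewrite /Rintegral; under eq_integral do rewrite mulr0; rewrite integral0.
  move=> i; apply: filterS (f0 i) => u h ru; rewrite -(h ru) /id_sub Kf0 ?subr0//.
  by rewrite -RplusE.
- move=> g hg; have hHg := kapply_L2 hH hg; exists (fun i v => g i v + kapply H g i v); first exact: L2plusD.
  apply: aeqplus_ge0 => i u u0; rewrite /id_sub (kapplyD i hK hg hHg u0) (kapply_resolventl i hg u0).
  by rewrite addrCA subrr addr0 addrK.
Qed.

Hypothesis cH : forall i j, {within @Rplus R `*` @Rplus R, continuous (fun uv : R * R => H i j uv.1 uv.2)}.

Lemma resolvent_kernel_of : resolvent_kernel K H.
Proof.
split=> // [|f hf]; first exact: id_sub_invertible_resolvent.
split; first exact: kapply_L2 hH hf.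
by apply: aeqplus_ge0 => i u u0; rewrite /id_sub (kapply_resolventl i hf u0) opprB addrC subrK.
Qed.

Let within_row (F : R * R -> R) u (e : R) : {within @Rplus R `*` @Rplus R, continuous F} -> 0 <= u ->
  {within `[0, e]%classic, continuous (fun v => F (u, v))}.
Proof.
move=> /subspace_continuousP cF u0; apply/subspace_continuousP => v /= ve.
have v0 : 0 <= v by move: ve; rewrite in_itv /= => /andP[].
have q0 : (@Rplus R `*` @Rplus R) (u, v) by split; rewrite /= RplusE.
apply/cvgrPdist_le => a a0; have /cvgrPdist_le/(_ _ a0) := cF (u, v) q0.
rewrite !near_withinE => /nbhs_ballP[r /= r0 hr]; apply/nbhs_ballP; exists r => // w wr we.
apply: (hr (u, w)); first by split => //; exact: ballxx.
by split; rewrite /= RplusE//; move: we; rewrite /= in_itv /= => /andP[].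
Qed.

(** If two continuous resolvent kernels differed at the corner, their difference would keep its sign
    on a small square with side [e]. Applied to the indicator of an interval in column [j], they
    would yield functions that differ on an interval of positive length, against the injectivity of
    [1 - K]. *)
Lemma resolvent_kernel_unique Rk i j : resolvent_kernel K Rk -> Rk i j 0 0 = H i j 0 0.
Proof.
move=> [[_ inj _] cR eqR]; apply/eqP; apply/negP => /negP neq.
pose s := Num.sg (Rk i j 0 0 - H i j 0 0).
pose F (p : R * R) := s * (Rk i j p.1 p.2 - H i j p.1 p.2).
have F0 : 0 < F (0, 0) by rewrite /F /= -normrEsg normr_gt0 subr_eq0.
have cF : {within @Rplus R `*` @Rplus R, continuous F}.
  by move=> p; apply: cvgMr; apply: cvgB; [exact: cR|exact: cH].
have [e e0 he] : exists2 e : R, 0 < e & forall u v, 0 <= u <= e -> 0 <= v <= e -> F (0, 0) / 2 <= F (u, v).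
  have /subspace_continuousP/(_ (0, 0)) := cF.
  have q0 : (@Rplus R `*` @Rplus R) (0, 0) by split; rewrite /= RplusE.
  move=> /(_ q0)/cvgrPdist_le/(_ _ (divr_gt0 F0 (ltr0n R 2))).
  rewrite near_withinE => /nbhs_ballP[r /= r0 hr]; exists (r / 2); first by rewrite divr_gt0.
  move=> u v /andP[u0 ur] /andP[v0 vr]; have h2 : r / 2 < r by rewrite ltr_pdivrMr// ltr_pMr// ltr1n.
  have := hr (u, v); rewrite /ball /= /prod_ball /= /ball /= !sub0r !normrN (ger0_norm u0) (ger0_norm v0).
  move=> /(_ (conj (le_lt_trans ur h2) (le_lt_trans vr h2))).
  have q1 : (@Rplus R `*` @Rplus R) (u, v) by split; rewrite /= RplusE.
  move=> /(_ q1).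
  move=> h; have {h} : F (0, 0) - F (u, v) <= F (0, 0) / 2 by exact: le_trans (ler_norm _) h.
  by clear; move: (F (0, 0)) (F (u, v)) => a b; lra.
pose f : 'I_n -> R -> R := fun l v => if (l == j) && (0 <= v <= e) then 1 else 0.
have lf : L2plus f.
  apply/L2plusP => l; have -> : f l \_ (@Rplus R) = fun v => (l == j)%:R * \1_(`[0, e]%classic) v.
    apply/funext => v; rewrite cutE /f indicE mem_setE in_itv /=.
    by case: eqP => _; case: (0 <= v) => //=; case: (v <= e); rewrite ?mul1r ?mul0r.
  have l1 : l2 (\1_(`[0, e]%classic) : R -> R).
    split; first exact: measurable_indic.
    have -> : (fun v => (\1_(`[0, e]%classic) v : R) ^+ 2) = \1_(`[0, e]%classic).
      by apply/funext => v; rewrite indicE; case: (_ \in _); rewrite ?expr1n ?expr0n.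
    apply: integrable_indic_itv.
  by have := l2D (l == j)%:R 0 l1 l1; under eq_fun do rewrite mul0r addr0.
have mE : measurable (`[0, e]%classic : set R) by exact: measurable_itv.
have me : mu `[0, e]%classic = e%:E by rewrite lebesgue_measure_itv /= lte_fin e0 -EFinB subr0.
have fE M l u : \sum_m \int[mu]_(v in @Rplus R) (M l m u v * f m v) = \int[mu]_(v in `[0, e]) M l j u v.
  rewrite (bigD1 j)//= [X in _ + X]big1 ?addr0; last first.
    move=> m mj; rewrite /Rintegral; under eq_integral do rewrite /f (negPf mj) mulr0.
    by rewrite integral0.
  rewrite [LHS]Rintegral_mkcond [RHS]Rintegral_mkcond; apply: eq_Rintegral => v _.
  rewrite cutE patchE mem_setE in_itv /= /f eqxx /=.
  by case: (0 <= v) => //=; case: (v <= e); rewrite ?mulr1 ?mulr0.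
have [lR eR] := eqR f lf.
have lHf := kapply_L2 hH lf.
have ae0 : aeqplus (fun l v => kapply Rk f l v - kapply H f l v) (fun _ _ => 0).
  apply: inj; first exact: L2plusB.
  move=> l; apply: filterS (eR l) => u h ru; have u0 : 0 <= u by rewrite -RplusE.
  move: (h ru); rewrite /id_sub (kapplyB l hK lR lHf u0) (kapply_resolventl l lf u0).
  by move: (kapply Rk f l u) (kapply K (kapply Rk f) l u) (kapply H f l u) (kapply K f l u) => a b c q; lra.
have pos u : 0 <= u <= e -> 0 < `|kapply Rk f i u - kapply H f i u|.
  move=> ue; have u0 : 0 <= u by case/andP: ue.
  have jR : mu.-integrable `[0, e] (EFin \o (Rk i j u)).
    by apply: continuous_compact_integrable; [exact: segment_compact|exact: (@within_row (fun p => Rk i j p.1 p.2) u e (cR i j) u0)].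
  have jH : mu.-integrable `[0, e] (EFin \o (H i j u)).
    have wH := @within_row (fun p => H i j p.1 p.2) u e (@cH i j) u0.
    by apply: continuous_compact_integrable; [exact: segment_compact|exact: wH].
  have jF : mu.-integrable `[0, e] (EFin \o (fun v => F (u, v))).
    have wF := @within_row F u e cF u0.
    by apply: continuous_compact_integrable; [exact: segment_compact|exact: wF].
  have -> : kapply Rk f i u - kapply H f i u = \int[mu]_(v in `[0, e]) (Rk i j u v - H i j u v).
    by rewrite RintegralB//; congr (_ - _); exact: fE.
  have : 0 < s * \int[mu]_(v in `[0, e]) (Rk i j u v - H i j u v).
    rewrite -RintegralZl//; last exact: (@integrableB_fun _ _ _ mu _ (Rk i j u) (H i j u)).
    apply: lt_le_trans (_ : 0 < \int[mu]_(v in `[0, e]) (F (0, 0) / 2)) _.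
      have -> : \int[mu]_(v in `[0, e]) (F (0, 0) / 2) = F (0, 0) / 2 * e.
        apply: etrans (@Rintegral_cst _ _ R mu _ mE (F (0, 0) / 2)) _; congr (_ * _).
        exact: (congr1 fine me).
      by rewrite mulr_gt0// divr_gt0.
    apply: le_Rintegral => //.
      apply: (@continuous_compact_integrable _ (fun _ => F (0, 0) / 2)); first exact: segment_compact.
      by apply: continuous_subspaceT => x; exact: cvg_cst.
    by move=> v; rewrite /= in_itv /= => ve; exact: he.
  by rewrite normr_gt0; apply: contraTneq => ->; rewrite mulr0 ltxx.
have [N [mN N0 hN]] := ae0 i.
have : (mu `[0%R, e]%classic <= mu N)%E.
  apply: le_measure; rewrite ?inE// => u /= ue; apply: hN => /= h.
  move: ue; rewrite in_itv /= => ue; have := pos u ue.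
  by rewrite h ?normr0 ?ltxx// RplusE; case/andP: ue.
by rewrite N0 me lee_fin leNgt e0.
Qed.

End resolvent.
End resolvent_kernels.

(** * From the conjugated kernels back to the unweighted half-line *)

Section raw_kernels.
Context {R : realType} (n' : nat).
Notation n := n'.+1.
Notation J := (@row_mean R (iota 0 n)).
Notation U := (uker_of J).
Notation mu := (@lebesgue_measure R).

Lemma row_meanE (f : nat * R -> R) :
  J f = \sum_(l < n) \int[mu]_(w in @Rplus R) (f (val l, w) * expR (- w)).
Proof.
transitivity (\sum_(i <- iota 0 n) \int[mu]_u (f (i, u) * half_exp u)); first by [].
rewrite -{1}(subn0 n) -/(index_iota 0 n) big_mkord; apply: eq_bigr => l _.
exact: (Rintegral_half_exp (fun w => f (val l, w))).
Qed.

Definition raw (u : U) : mxkernel R n := fun i j p q =>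
  expR (row_weight i * p) * ukr u (val i, p) (val j, q) * expR (- (col_weight j * q)).

Lemma raw_kelem (G : mxkernel R n) (C : R) i j p q : mkernel G -> 0 <= C -> decays G C ->
  0 <= p -> 0 <= q -> raw (kelem G) i j p q = G i j p q.
Proof.
move=> mG C0 dG p0 q0; rewrite /raw (kelemE mG C0 dG).2 /conj_kernel /= p0 q0 /= !inord_val.
move: (row_weight i * p) (col_weight j * q) (G i j p q) => a b g.
have h1 : expR a * expR (- a) = 1 by rewrite -expRD subrr expR0.
have h2 : expR b * expR (- b) = 1 by rewrite -expRD subrr expR0.
rewrite [LHS](_ : _ = (expR a * expR (- a)) * g * (expR b * expR (- b))); last by ring.
by rewrite h1 h2 mul1r mulr1.
Qed.

Lemma rawM (u w : U) i j p q : usc u = 0 -> usc w = 0 ->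
  raw (u * w) i j p q = mxcomp (raw u) (raw w) i j p q.
Proof.
move=> u0 w0; rewrite /raw ukrM u0 w0 !mul0r !add0r /kcomp row_meanE mulr_sumr mulr_suml.
apply: eq_bigr => l _.
have [D _ hD] := ubound_ex u; have [E _ hE] := ubound_ex w.
have [j1 _] := half_exp_integral_is (R := R).
have j0 : mu.-integrable (@Rplus R) (EFin \o (fun v => ukr u (val i, p) (val l, v) * ukr w (val l, v) (val j, q) * expR (- v))).
  have [mu' bu] := ubound_ukr hD; have [mw bw] := ubound_ukr hE.
  have mk : measurable_fun setT (fun v : R => ((val l, v) : nat * R)) by exact: pair1_measurable.
  have je : mu.-integrable (@Rplus R) (EFin \o (fun v => D * E * expR (- 1 * v))).
    exact: (@integrableZ_fun _ _ _ mu (@Rplus R) (fun v => expR (- 1 * v)) _ (measurable_itv _) (integrable_expRN ltr01)).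
  apply: (@integrable_dominated _ _ _ mu (@Rplus R) _ (fun v => D * E * expR (- 1 * v))) => //.
    exact: measurable_itv.
    apply: measurable_funTS; apply: measurable_funM; last first.
      by apply: measurableT_comp => //; exact: measurable_funN.
    apply: measurable_funM.
      exact: (measurableT_comp (measurableT_comp mu' (pair1_measurable (val i, p))) mk).
    exact: (measurableT_comp (measurableT_comp mw (pair2_measurable (val j, q))) mk).
  move=> v _; rewrite !normrM (ger0_norm (expR_ge0 _)) mulN1r ler_wpM2r ?expR_ge0//.
  exact: ler_pM.
rewrite -RintegralZl//; last exact: measurable_itv.
rewrite -RintegralZr//; last 2 first.
- exact: measurable_itv.
- by apply: (@integrableZ_fun _ _ _ mu (@Rplus R)) => //; exact: measurable_itv.
apply: eq_Rintegral => v _.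
rewrite /col_weight; move: (row_weight i * p) (row_weight j + 1) (row_weight l) => a b c.
have h : expR (- v) = expR (- ((c + 1) * v)) * expR (c * v) by rewrite -expRD; congr expR; ring.
by rewrite h; ring.
Qed.

Lemma mkernel_raw (u : U) : mkernel (raw u).
Proof.
move=> i j; have [D _ hD] := ubound_ex u; have [mu' _] := ubound_ukr hD.
apply: measurable_funM; last first.
  by apply: measurableT_comp => //; apply: measurableT_comp => //; exact: measurable_funM.
apply: measurable_funM; first by apply: measurableT_comp => //; exact: measurable_funM.
have mk l : measurable_fun setT (fun v : R => ((l, v) : nat * R)) by exact: pair1_measurable.
apply: (measurable_fun_comp2 mu'); first exact: (measurableT_comp (mk _) measurable_fst).
exact: (measurableT_comp (mk _) measurable_snd).
Qed.

Lemma raw_decays (u : U) (C : R) : ubound u C -> decays (raw u) C.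
Proof.
move=> [_ hC] i j p q _ _; rewrite /raw !normrM !(ger0_norm (expR_ge0 _)) expRD mulrAC [leRHS]mulrC.
by rewrite ler_wpM2l ?mulr_ge0 ?expR_ge0.
Qed.

(** The rates leave room for one composition with the resolvent. The path part decays faster than
    any row weight grows; the heat part, above the diagonal only, has rate 2, of which 1 is spent on
    the triangle inequality and 1 on the integral. *)
Definition band_bound (G : mxkernel R n) (C : R) := forall i j u v, 0 <= u -> 0 <= v ->
  `|G i j u v| <= C * (expR (- ((2 * n%:R + 1) * (u + v))) + (i < j)%N%:R * dist_exp 2 u v).

Lemma expR_dist_exp (m u v : R) : 1 <= m -> 0 <= u -> 0 <= v -> expR (- (m * (u + v))) <= dist_exp 1 u v.
Proof.
move=> m1 u0 v0; rewrite ler_expR mulN1r lerN2.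
have h : `|u - v| <= u + v by rewrite ler_norml; lra.
by apply: le_trans h _; rewrite ler_peMl// addr_ge0.
Qed.

Lemma dist_exp21 (u v : R) : dist_exp 2 u v <= dist_exp 1 u v.
Proof. by rewrite ler_expR; have := normr_ge0 (u - v); lra. Qed.

Let m1 : 1 <= 2 * n%:R + 1 :> R. Proof. by rewrite lerDr mulr_ge0. Qed.

Lemma band_bound_mxbanded G (C : R) : 0 <= C -> mkernel G -> band_bound G C -> mxbanded G (2 * C).
Proof.
move=> C0 mG hG i j; split=> // u v u0 v0; apply: le_trans (hG i j u v u0 v0) _.
rewrite [leRHS]mulrAC [leRHS]mulrC ler_wpM2l// [leRHS]mulrDl mul1r; apply: lerD; first exact: expR_dist_exp.
by case: (i < j)%N; rewrite ?mul1r ?mul0r ?dist_exp_ge0// dist_exp21.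
Qed.

Lemma row_weight_le (l : 'I_n) : row_weight l <= 2 * n%:R :> R.
Proof. by rewrite ler_pM2l// ler_nat leq_subr. Qed.

Lemma col_weight_ge1 (l : 'I_n) : 1 <= col_weight l :> R.
Proof. by rewrite lerDr row_weight_ge0. Qed.

Lemma path_row_bound (l j : 'I_n) (p q w : R) : 0 <= p -> 0 <= q -> 0 <= w ->
  expR (- ((2 * n%:R + 1) * (p + w))) * expR (row_weight l * w - col_weight j * q) <=
  dist_exp 1 p q * expR (- 1 * w).
Proof.
move=> p0 q0 w0; apply: le_trans (_ : expR (- (1 * (p + q))) * expR (- 1 * w) <= _); last first.
  by rewrite ler_wpM2r ?expR_ge0// expR_dist_exp.
rewrite -!expRD ler_expR.
have h1 := ler_wpM2r w0 (row_weight_le l); have h2 := ler_wpM2r q0 (col_weight_ge1 j).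
have h3 := mulr_ge0 (mulr_ge0 (ler0n R 2) (ler0n R n)) p0.
by move: h1 h2 h3; rewrite mulrDl !mulrDr !mul1r; lra.
Qed.

Lemma heat_row_bound (p q w : R) : dist_exp 2 p w * dist_exp 1 w q <= dist_exp 1 p q * dist_exp 1 p w.
Proof.
rewrite -!expRD ler_expR; have := ler_distD w p q; have := normr_ge0 (p - w); lra.
Qed.

(* The heat kernels are strictly above the diagonal, so the decay of the rows
   [> i] of the resolvent propagates to row [i]. *)
Lemma resolvent_mxbanded G (H : mxkernel R n) (C D : R) : 0 <= C -> mkernel G -> mkernel H -> band_bound G C ->
  decays H D -> (forall i j u v, 0 <= u -> 0 <= v -> H i j u v = G i j u v + mxcomp G H i j u v) ->
  exists E, mxbanded H E.
Proof.
move=> C0 mG mH hG dH hGH.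
have D0 : 0 <= D.
  have := dH ord0 ord0 0 0 (lexx 0) (lexx 0); rewrite !mulr0 subrr expR0 mulr1; exact: le_trans.
have [A A0 hA] := @integral_dist_exp R 1.
suff key k : exists2 E : R, 0 <= E & forall i j : 'I_n, (n - k <= i)%N -> forall u v, 0 <= u -> 0 <= v ->
    `|H i j u v| <= E * dist_exp 1 u v.
  have [E _ hE] := key n; exists E => i j; split=> // u v; apply: hE; by rewrite subnn.
elim: k => [|k [E E0 ih]].
  by exists 0 => // i j; rewrite subn0 leqNgt ltn_ord.
exists (2 * C + \sum_(l < n) (C * D + C * E * A)).
  rewrite addr_ge0 ?mulr_ge0// sumr_ge0// => l _; by rewrite addr_ge0 ?mulr_ge0.
move=> i j ik p q p0 q0; rewrite hGH// mulrDl; apply: le_trans (ler_normD _ _) _; apply: lerD.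
  exact: (band_bound_mxbanded C0 mG hG i j).2.
rewrite mulr_suml; apply: le_trans (ler_norm_sum _ _ _) _; apply: ler_sum => l _.
have [je vA] := hA p ltr01.
have je0 : mu.-integrable (@Rplus R) (EFin \o (fun w => dist_exp 1 w p)).
  by apply: integrableS je => //; exact: measurable_Rplus.
have ee := integrable_expRN (R := R) ltr01.
have v1 : integral_is mu (@Rplus R) (fun w => expR (- 1 * w)) 1.
  by split=> //; rewrite /Rplus Rintegral_expRN// invr1.
have v2 : \int[mu]_(w in @Rplus R) dist_exp 1 w p <= A.
  rewrite -vA Rintegral_mkcond; apply: le_Rintegral => //.
    have [h _] := @integrable_mkcond _ _ _ mu (@Rplus R) (EFin \o (fun w => dist_exp 1 w p)) measurable_Rplus.
    by rewrite restrict_EFin in h; exact: h.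
  by move=> w _; rewrite cutE; case: ifP => // _; exact: dist_exp_ge0.
have [jI vI] : integral_is mu (@Rplus R) (fun w => C * D * dist_exp 1 p q * expR (- 1 * w) + C * E * dist_exp 1 p q * dist_exp 1 w p)
    (C * D * dist_exp 1 p q * 1 + C * E * dist_exp 1 p q * \int[mu]_(w in @Rplus R) dist_exp 1 w p).
  by apply: integral_isD; [exact: measurable_itv|apply: integral_isZ => //; exact: measurable_itv|
    apply: integral_isZ => //; exact: measurable_itv].
apply: le_trans (_ : _ <= C * D * dist_exp 1 p q * 1 + C * E * dist_exp 1 p q * \int[mu]_(w in @Rplus R) dist_exp 1 w p) _; last first.
  rewrite mulr1 mulrDl lerD2l [leRHS]mulrAC ler_wpM2l ?mulr_ge0// dist_exp_ge0//.
rewrite -vI; apply: (@normr_Rintegral_le _ _ _ mu (@Rplus R) (fun w => G i l p w * H l j w q)) => //.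
    exact: measurable_itv.
  apply: measurable_funTS; apply: measurable_funM.
    exact: (measurableT_comp (mG i l) (pair1_measurable p)).
  exact: (measurableT_comp (mH l j) (pair2_measurable q)).
move=> w; rewrite RplusE => w0; rewrite normrM.
apply: le_trans (ler_wpM2r (normr_ge0 _) (hG i l p w p0 w0)) _.
rewrite mulrDr mulrDl; apply: lerD.
  apply: le_trans (ler_wpM2l _ (dH l j w q w0 q0)) _; first by rewrite mulr_ge0// expR_ge0.
  rewrite mulrACA -[leRHS]mulrA ler_wpM2l ?mulr_ge0//; exact: path_row_bound.
case: (boolP (i < l)%N) => il; last by rewrite mul0r mulr0 mul0r !mulr_ge0 ?dist_exp_ge0.
rewrite mul1r; have il' : (n - k <= l)%N.
  by move: ik; rewrite !leq_subLR addSnnS => h; apply: leq_trans h _; rewrite leq_add2l.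
apply: le_trans (ler_wpM2l _ (ih l j il' w q w0 q0)) _; first by rewrite mulr_ge0// dist_exp_ge0.
rewrite mulrACA -[leRHS]mulrA [dist_exp 1 w p]dist_expC ler_wpM2l ?mulr_ge0//; exact: heat_row_bound.
Qed.

End raw_kernels.

Section resolvent_element.
Context {R : realType} (n' : nat).
Notation n := n'.+1.
Notation J := (@row_mean R (iota 0 n)).
Notation U := (uker_of J).

Lemma lipschitz_segment (f df : R -> R) (a b M : R) : a <= b ->
  (forall x, is_derive x (1 : R) f (df x)) -> (forall x, a <= x <= b -> `|df x| <= M) ->
  `|f a - f b| <= M * `|a - b|.
Proof.
move=> ab df' hM; have [->|ne] := eqVneq a b; first by rewrite !subrr normr0 mulr0.
have {ab ne}ab : a < b by rewrite lt_neqAle ne.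
have [|c cab E] := @MVT _ f df a b ab.
  by apply: derivable_within_continuous => x _; have [] := df' x.
rewrite distrC E normrM [`|a - b|]distrC ler_wpM2r// hM//.
by move: cab; rewrite in_itv /= => /andP[ac cb]; rewrite !ltW.
Qed.

Lemma lipschitz_weighted (g g' : R -> R) (a A B p q : R) : 0 <= p -> 0 <= q ->
  (forall u, is_derive u (1 : R) g (g' u)) -> (forall u, 0 <= u -> `|g u| <= A * expR (a * u)) ->
  (forall u, 0 <= u -> `|g' u| <= B * expR (a * u)) ->
  `|expR (- (a * p)) * g p - expR (- (a * q)) * g q| <= (`|a| * A + B) * `|p - q|.
Proof.
move=> p0 q0 dg hg hg'; wlog pq : p q p0 q0 / p <= q.
  move=> h; case: (leP p q) => pq; first exact: h.
  by rewrite distrC [`|p - q|]distrC; apply: h => //; exact: ltW.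
apply: (@lipschitz_segment (fun u => expR (- (a * u)) * g u)
  (fun u => (- a * expR (- (a * u))) * g u + expR (- (a * u)) * g' u)) => // [u|u /andP[pu uq]].
  have he : is_derive u (1 : R) (fun u => expR (- (a * u))) (- a * expR (- (a * u))).
    have h1 : is_derive u (1 : R) (fun u : R => - (a * u)) (- a).
      have := is_derive_affine 0 (- a) u; rewrite (_ : (fun y => 0 + y * - a) = (fun u : R => - (a * u)))//.
      by apply/funext => y; rewrite add0r mulrN mulrC.
    by have := @is_derive_comp_fun _ expR (fun u => - (a * u)) u _ _ (is_derive_expR _) h1; rewrite mulrC.
  exact: is_deriveM_fun he (dg u).
have u0 : 0 <= u by exact: le_trans pu.
have e1 (D x : R) : x <= D * expR (a * u) -> expR (- (a * u)) * x <= D.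
  move=> h; apply: le_trans (ler_wpM2l (expR_ge0 _) h) _.
  by rewrite mulrCA -expRD addNr expR0 mulr1.
apply: le_trans (ler_normD _ _) _; apply: lerD; rewrite !normrM (ger0_norm (expR_ge0 _)).
  by rewrite normrN -mulrA ler_wpM2l// e1// hg.
by rewrite e1// hg'.
Qed.

Section lipschitz.
Variables (G G1 G2 : mxkernel R n) (C C1 C2 : R).
Hypotheses (C0 : 0 <= C) (C10 : 0 <= C1) (C20 : 0 <= C2).
Hypotheses (mG : mkernel G) (dG : decays G C) (dG1 : decays G1 C1) (dG2 : decays G2 C2).
Hypothesis hG1 : forall i j u v, is_derive u (1 : R) (fun a => G i j a v) (G1 i j u v).
Hypothesis hG2 : forall i j u v, is_derive v (1 : R) (fun a => G i j u a) (G2 i j u v).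

Definition row_lipschitz (f : nat * R -> nat * R -> R) (L : R) := forall i p q b, 0 <= p -> 0 <= q ->
  `|f (i, p) b - f (i, q) b| <= L * `|p - q|.

Let N0 : 0 <= 2 * n%:R :> R. Proof. exact: mulr_ge0. Qed.

Lemma conj_kernel_row_lipschitz : row_lipschitz (conj_kernel G) (2 * n%:R * C + C1).
Proof.
move=> i p q [j v] p0 q0; rewrite /conj_kernel /= p0 q0 /=; case: ifPn => v0; last first.
  by rewrite subrr normr0 mulr_ge0// addr_ge0// mulr_ge0.
set i' := inord i; set j' := inord j.
have e0 := expR_ge0 (col_weight j' * v : R).
have h := @lipschitz_weighted (fun u => G i' j' u v * expR (col_weight j' * v))
  (fun u => G1 i' j' u v * expR (col_weight j' * v)) (row_weight i') C C1 p q p0 q0.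
have bnd (H : mxkernel R n) (D u : R) : decays H D -> 0 <= u ->
    `|H i' j' u v * expR (col_weight j' * v)| <= D * expR (row_weight i' * u).
  move=> dH u0; rewrite normrM (ger0_norm e0); apply: le_trans (ler_wpM2r e0 (dH i' j' u v u0 v0)) _.
  by rewrite -mulrA -expRD subrK.
rewrite -[X in `|X - _|]mulrA -[X in `|_ - X|]mulrA; apply: le_trans (h _ _ _) _ => [u|u u0|u u0|].
- have := is_deriveM_fun (hG1 i' j' u v) (is_derive_cst (expR (col_weight j' * v)) u 1).
  by rewrite mulr0 addr0.
- exact: bnd.
- exact: bnd.
rewrite ler_wpM2r// lerD2r ler_wpM2r// ger0_norm ?row_weight_ge0//; exact: row_weight_le.
Qed.

Lemma conj_kernel_col_lipschitz : row_lipschitz (fun a b => conj_kernel G b a) ((2 * n%:R + 1) * C + C2).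
Proof.
move=> j p q [i u] p0 q0; rewrite /conj_kernel /= p0 q0 !andbT; case: ifPn => u0; last first.
  by rewrite subrr normr0 mulr_ge0// addr_ge0// mulr_ge0// addr_ge0.
set i' := inord i; set j' := inord j.
have e0 := expR_ge0 (- (row_weight i' * u) : R).
have h := @lipschitz_weighted (fun v => expR (- (row_weight i' * u)) * G i' j' u v)
  (fun v => expR (- (row_weight i' * u)) * G2 i' j' u v) (- col_weight j') C C2 p q p0 q0.
have bnd (H : mxkernel R n) (D v : R) : decays H D -> 0 <= v ->
    `|expR (- (row_weight i' * u)) * H i' j' u v| <= D * expR (- col_weight j' * v).
  move=> dH v0; rewrite normrM (ger0_norm e0); apply: le_trans (ler_wpM2l e0 (dH i' j' u v u0 v0)) _.
  by rewrite mulrCA -expRD addrA addNr add0r mulNr.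
have sw y v : expR (- (row_weight i' * u)) * y * expR (col_weight j' * v) =
    expR (- (- col_weight j' * v)) * (expR (- (row_weight i' * u)) * y) by rewrite mulNr opprK mulrC.
rewrite !sw; apply: le_trans (h _ _ _) _ => [v|v v0|v v0|].
- exact: is_deriveZ_fun (hG2 i' j' u v).
- exact: bnd.
- exact: bnd.
by rewrite ler_wpM2r// lerD2r ler_wpM2r// normrN ger0_norm ?col_weight_ge0// col_weight_le.
Qed.

Variable rho : U.
Notation k := (kelem G).
Hypotheses (rhok : rho * (1 - k) = 1) (krho : (1 - k) * rho = 1).

Notation T := (rho - 1).

Lemma resolvent_elementl : T = k + k * T.
Proof. by rewrite mulrBr mulr1 addrCA subrr addr0 -[in LHS]krho mulrBl mul1r opprB addrC subrK. Qed.

Lemma resolvent_elementr : T = k + T * k.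
Proof. by rewrite mulrBl mul1r addrCA subrr addr0 -[in LHS]rhok mulrBr mulr1 opprB addrC subrK. Qed.

Let k0 : usc k = 0. Proof. exact: (kelemE mG C0 dG).1. Qed.

Lemma usc_resolvent_element : usc T = 0.
Proof. by rewrite resolvent_elementl uscD uscM k0 mul0r addr0. Qed.

Let T0 := usc_resolvent_element.

(** The equation [T = k + k * T] transfers the Lipschitz bound of [k] in the first argument to [T],
    and [T = k + T * k] does so in the second. *)
Lemma resolvent_element_lipschitz : exists2 L : R, 0 <= L &
  row_lipschitz (ukr T) L /\ row_lipschitz (fun a b => ukr T b a) L.
Proof.
have [D D0 hD] := ubound_ex T; have bT := ubound_ukr hD; have [mT bT'] := bT.
have bk := bker_conj mG C0 dG; have kE := (kelemE mG C0 dG).2.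
pose A := 2 * n%:R * C + C1; pose B := (2 * n%:R + 1) * C + C2.
have A0 : 0 <= A by rewrite addr_ge0// mulr_ge0.
have B0 : 0 <= B by rewrite addr_ge0// mulr_ge0// addr_ge0.
have mJ : 0 <= mass J := mass_ge0 J.
have mean_sub (f g : nat * R -> R) : bmeas f -> bmeas g -> J f - J g = J (fun z => f z - g z).
  move=> bf bg; have := mean_linear J (-1) bg bf; rewrite mulN1r addrC => <-.
  by congr (mean_fun J _); apply/funext => z; rewrite mulN1r addrC.
have E1 a b : ukr T a b = ukr k a b + kcomp J (ukr k) (ukr T) a b.
  by rewrite {1}resolvent_elementl ukrD ukrM k0 T0 !mul0r !add0r.
have E2 a b : ukr T a b = ukr k a b + kcomp J (ukr T) (ukr k) a b.
  by rewrite {1}resolvent_elementr ukrD ukrM k0 T0 !mul0r !add0r.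
have bnd (f g : nat * R -> R) (d : R) : bmeas f -> bmeas g -> (forall z, `|f z - g z| <= d * D) ->
    0 <= d -> `|J f - J g| <= mass J * D * d.
  move=> bf bg fg d0; rewrite mean_sub// -mulrA [D * d]mulrC; apply: mean_bound => //.
  have := (bf, bg) => -[[mf [Cf hf]] [mg [Cg hg]]]; split; first exact: measurable_funB.
  by exists (Cf + Cg) => z; apply: le_trans (ler_normB _ _) _; exact: lerD.
exists (A + B + mass J * D * (A + B)); first exact: addr_ge0 (addr_ge0 A0 B0) (mulr_ge0 (mulr_ge0 mJ D0) (addr_ge0 A0 B0)).
split=> i p q b p0 q0; rewrite ?(E1 (i, _)) ?(E2 _ (i, _)) opprD addrACA.
- have h := @conj_kernel_row_lipschitz i p q _ p0 q0.
  apply: le_trans (ler_normD _ _) _; rewrite mulrDl; apply: lerD.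
    rewrite kE; apply: le_trans (h b) _; by rewrite ler_wpM2r// lerDl.
  apply: le_trans (bnd _ _ (A * `|p - q|) _ _ _ _) _.
  + by rewrite kE; exact: bker_section bk bT.
  + by rewrite kE; exact: bker_section bk bT.
  + by move=> z; rewrite kE -mulrBl normrM; apply: ler_pM => //; exact: h.
  + exact: mulr_ge0.
  + by rewrite mulrA ler_wpM2r// ler_wpM2l ?mulr_ge0// lerDl.
- have h := @conj_kernel_col_lipschitz i p q _ p0 q0.
  apply: le_trans (ler_normD _ _) _; rewrite mulrDl; apply: lerD.
    rewrite kE; apply: le_trans (h b) _; by rewrite ler_wpM2r// lerDr.
  apply: le_trans (bnd _ _ (B * `|p - q|) _ _ _ _) _.
  + by rewrite kE; exact: bker_section bT bk.
  + by rewrite kE; exact: bker_section bT bk.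
  + move=> z; rewrite kE -mulrBr normrM mulrC; apply: ler_pM => //; exact: h.
  + exact: mulr_ge0.
  + by rewrite mulrA ler_wpM2r// ler_wpM2l ?mulr_ge0// lerDr.
Qed.

(** Lipschitz bounds in each argument, uniform in the other one, give joint continuity up to the
    boundary of the quadrant. *)
Lemma raw_resolvent_continuous i j : {within @Rplus R `*` @Rplus R,
  continuous (fun uv : R * R => raw T i j uv.1 uv.2)}.
Proof.
have [L L0 [rL cL]] := resolvent_element_lipschitz.
have cT : {within @Rplus R `*` @Rplus R, continuous (fun p : R * R => ukr T (val i, p.1) (val j, p.2))}.
  apply/subspace_continuousP => -[p q] [/=]; rewrite !RplusE => p0 q0.
  apply/cvgrPdist_le => e e0; rewrite near_withinE; apply/nbhs_ballP.
  exists (e / (2 * L + 1)); first by rewrite /= divr_gt0// ltr_wpDl// mulr_ge0.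
  move=> [p' q'] [/= bp bq] [/=]; rewrite !RplusE => p'0 q'0.
  have -> : from_subspace (@Rplus R `*` @Rplus R) (fun p : R * R => ukr T (val i, p.1) (val j, p.2)) (p, q) -
     from_subspace (@Rplus R `*` @Rplus R) (fun p : R * R => ukr T (val i, p.1) (val j, p.2)) (p', q') =
     (ukr T (val i, p) (val j, q) - ukr T (val i, p') (val j, q)) +
     (ukr T (val i, p') (val j, q) - ukr T (val i, p') (val j, q')) by rewrite addrA subrK.
  apply: le_trans (ler_normD _ _) _.
  apply: le_trans (lerD (rL (val i) p p' (val j, q) p0 p'0) (cL (val j) q q' (val i, p') q0 q'0)) _.
  move: bp bq; rewrite /ball /= => /ltW bp /ltW bq.
  apply: le_trans (lerD (ler_wpM2l L0 bp) (ler_wpM2l L0 bq)) _.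
  rewrite -mulrDl mulrA ler_pdivrMr ?ltr_wpDl ?mulr_ge0// mulrC ler_wpM2l ?ltW//; lra.
have c1 (c : R) : {within @Rplus R `*` @Rplus R, continuous (fun p : R * R => expR (c * p.1))}.
  apply: continuous_subspaceT => p; apply: continuous_comp; last exact: continuous_expR.
  by apply: continuous_comp; [exact: cvg_fst|exact: mulrl_continuous].
have c2 (c : R) : {within @Rplus R `*` @Rplus R, continuous (fun p : R * R => expR (- (c * p.2)))}.
  apply: continuous_subspaceT => p; apply: continuous_comp; last exact: continuous_expR.
  apply: continuous_comp; last exact: opp_continuous.
  by apply: continuous_comp; [exact: cvg_snd|exact: mulrl_continuous].
by move=> p; apply: cvgM; [apply: cvgM; [exact: c1|exact: cT]|exact: c2].
Qed.

Lemma raw_resolvent_kernel (D : R) : 0 <= D -> band_bound G D ->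
  resolvent_kernel G (raw T) /\
  forall Rk i j, resolvent_kernel G Rk -> Rk i j 0 0 = ukr T (val i, 0) (val j, 0).
Proof.
move=> D0 hD; have [E E0 hE] := ubound_ex T.
have rawkE i j p q := @raw_kelem _ _ G C i j p q mG C0 dG.
have rawD (u v : U) i j p q : raw (u + v) i j p q = raw u i j p q + raw v i j p q.
  by rewrite /raw ukrD mulrDr mulrDl.
have l i j p q : 0 <= p -> 0 <= q -> raw T i j p q = G i j p q + mxcomp G (raw T) i j p q.
  move=> p0 q0; rewrite {1}resolvent_elementl rawD rawkE// rawM//; congr (_ + _).
  apply: eq_bigr => m _; apply: eq_Rintegral => w; rewrite inE RplusE => w0.
  by rewrite rawkE.
have r i j p q : 0 <= p -> 0 <= q -> raw T i j p q = G i j p q + mxcomp (raw T) G i j p q.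
  move=> p0 q0; rewrite {1}resolvent_elementr rawD rawkE// rawM//; congr (_ + _).
  apply: eq_bigr => m _; apply: eq_Rintegral => w; rewrite inE RplusE => w0.
  by rewrite rawkE.
have [A hA] := resolvent_mxbanded D0 mG (mkernel_raw _) hD (raw_decays hE) l.
have hG := band_bound_mxbanded D0 mG hD.
split; first exact: resolvent_kernel_of hG hA l r raw_resolvent_continuous.
move=> Rk i j hRk; rewrite (resolvent_kernel_unique hG hA l raw_resolvent_continuous i j hRk).
by rewrite /raw !mulr0 oppr0 expR0 mul1r mulr1.
Qed.

End lipschitz.
End resolvent_element.

Section kpz_resolvent.
Context {R : realType} d (W : measurableType d) (P : probability W R) (B : R -> W -> R).
Hypothesis hB : brownian2 P B.
Variable h0 : R -> \bar R.
Hypothesis hUC : UC h0.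
Variable n' : nat.
Notation n := n'.+1.
Notation K := (@kker R d W P B h0 n).
Notation J := (@row_mean R (iota 0 n)).
Notation U := (uker_of J).
Implicit Types (t : R) (x r : 'rV[R]_n).

Definition kel t x r k l : U := kelem (K k l t x r).

Lemma kker_decays_at k l t x r : 0 < t -> increasing_row x ->
  exists2 C : R, 0 <= C & decays (K k l t x r) C.
Proof.
move=> t0 hx; have [x1 x10 gap] := increasing_gap hx.
have bound (y : 'rV[R]_n) : exists2 Y : R, 0 <= Y & forall i, `|y 0 i| <= Y.
  exists (\sum_i `|y 0 i|); first exact: sumr_ge0.
  by move=> i; rewrite (bigD1 i)//= lerDl sumr_ge0.
have [X X0 hX] := bound x; have [c c0 hc] := bound r.
have [C C0 hC] := @kker_decays R d W P B hB h0 hUC n' k l t t X c x1 t0 (ltW t0) X0 c0 x10.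
by exists C => //; apply: hC => //; rewrite lexx.
Qed.

Lemma kelE t x r k l : 0 < t -> increasing_row x ->
  usc (kel t x r k l) = 0 /\ ukr (kel t x r k l) = conj_kernel (K k l t x r).
Proof.
move=> t0 hx; have [C C0 hC] := kker_decays_at k l r t0 hx.
exact: kelemE (mkernel_kker hB hUC k l t x r) C0 hC.
Qed.

Lemma is_derive_kker_row k l t x r i j u v : 0 < t -> increasing_row x ->
  is_derive u (1 : R) (fun a => K k l t x r i j a v) (K k.+1 l t x r i j u v).
Proof.
move=> t0 hx; have t0' : 0 < t + u * 0 by rewrite mulr0 addr0.
have hx' (i' j' : 'I_n) : (i' < j')%N -> x 0 i' + u * (0 : 'rV[R]_n) 0 i' < x 0 j' + u * (0 : 'rV[R]_n) 0 j'.
  by move=> ij; rewrite !mxE !mulr0 !addr0; exact: hx.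
have := is_derive_kker hB hUC k l r i j 0 v 1 0 0 t0' hx'.
rewrite /= !mxE; under eq_fun do rewrite !scaler0 !mulr0 !addr0 mulr1 add0r.
by rewrite !scaler0 !oppr0 !mulr0 !addr0 !mulr1 !mul0r !add0r ?addr0 ?subr0 ?mul1r ?oppr0 ?addr0 ?add0r.
Qed.

Lemma is_derive_kker_col k l t x r i j u v : 0 < t -> increasing_row x ->
  is_derive v (1 : R) (fun a => K k l t x r i j u a) (K k l.+1 t x r i j u v).
Proof.
move=> t0 hx; have t0' : 0 < t + v * 0 by rewrite mulr0 addr0.
have hx' (i' j' : 'I_n) : (i' < j')%N -> x 0 i' + v * (0 : 'rV[R]_n) 0 i' < x 0 j' + v * (0 : 'rV[R]_n) 0 j'.
  by move=> ij; rewrite !mxE !mulr0 !addr0; exact: hx.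
have := is_derive_kker hB hUC k l r i j u 0 0 1 0 t0' hx'.
rewrite /= !mxE; under eq_fun do rewrite !scaler0 !mulr0 !addr0 mulr1 add0r.
by rewrite !scaler0 !oppr0 !mulr0 !addr0 !mulr1 !mul0r !add0r ?addr0 ?subr0 ?mul1r ?oppr0 ?addr0 ?add0r.
Qed.

Lemma kker_band_bound t x r : 0 < t -> increasing_row x ->
  exists2 C : R, 0 <= C & band_bound (K 0 0 t x r) C.
Proof.
move=> t0 hx; have [x1 x10 gap] := increasing_gap hx.
have bound (y : 'rV[R]_n) : exists2 Y : R, 0 <= Y & forall i, `|y 0 i| <= Y.
  exists (\sum_i `|y 0 i|); first exact: sumr_ge0.
  by move=> i; rewrite (bigD1 i)//= lerDl sumr_ge0.
have [X X0 hX] := bound x; have [c c0 hc] := bound r.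
pose m : R := Num.max ((1 + X) / t) (2 * n%:R + 1).
have hm : (1 + X) / t <= m by rewrite le_max lexx.
have hm' : 2 * n%:R + 1 <= m by rewrite le_max lexx orbT.
have [C C0 hC] := path_part_bound hB hUC n 0 0 t0 (ltW t0) X0 c0 hm.
(* The rates 2 and -2 are used on the two sides of the diagonal; together they bound the heat part
   by [dist_exp 2]. *)
have [D D0 hD] := @heat_part_bound R n 0 0 x1 X c 2 x10 c0.
have [E E0 hE] := @heat_part_bound R n 0 0 x1 X c (-2) x10 c0.
exists (C + (D + E)); first by rewrite !addr_ge0.
move=> i j u v u0 v0; rewrite /kker mulrDr; apply: le_trans (ler_normB _ _) _; apply: lerD.
  apply: le_trans (hC t x r i j u v _ hX hc u0 v0) _; first by rewrite lexx.
  apply: ler_pM; rewrite ?expR_ge0//; first by rewrite lerDl addr_ge0.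
  by rewrite ler_expR lerN2 ler_wpM2r// addr_ge0.
case: ifP => ij; last by rewrite normr0 mul0r mulr0.
rewrite [_%:R * _]mul1r; have h1 := hD x r i j u v hX hc (gap i j ij).
have h2 := hE x r i j u v hX hc (gap i j ij).
have [uv|uv] := leP u v.
  apply: le_trans h1 _; apply: ler_pM; rewrite ?expR_ge0//; first by rewrite addrCA lerDl addr_ge0.
  by rewrite ler_expR distrC ger0_norm// subr_ge0.
apply: le_trans h2 _; apply: ler_pM; rewrite ?expR_ge0//; first by rewrite addrA lerDr addr_ge0.
have vu : 0 <= u - v by rewrite subr_ge0 ltW.
by rewrite /dist_exp ler_expR (ger0_norm vu); lra.
Qed.

Lemma kpzK_kker t x r : 0 < t -> increasing_row x -> kpzK P B h0 t x r = K 0 0 t x r.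
Proof.
move=> t0 hx; apply/funext => i; apply/funext => j; apply/funext => u; apply/funext => v.
exact: kpzKE.
Qed.

Lemma kpzF_fdet t x r : 0 < t -> increasing_row x -> kpzF P B h0 t x r = fdet (kel t x r 0 0).
Proof.
move=> t0 hx; have [C C0 hC] := kker_decays_at 0 0 r t0 hx.
rewrite /kpzF kpzK_kker//; exact: fredholm_det_fdet (mkernel_kker hB hUC 0 0 t x r) C0 hC.
Qed.

Hypothesis det_neq0 : forall t x r, 0 < t -> increasing_row x -> kpzF P B h0 t x r != 0.

Definition rho t x r : U :=
  xget 0 [set v | v * (1 - kel t x r 0 0) = 1 /\ (1 - kel t x r 0 0) * v = 1].

Lemma rhoP t x r : 0 < t -> increasing_row x ->
  rho t x r * (1 - kel t x r 0 0) = 1 /\ (1 - kel t x r 0 0) * rho t x r = 1.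
Proof.
move=> t0 hx; have [C C0 hC] := kker_decays_at 0 0 r t0 hx.
have [k0 kE] := kelE r 0 0 t0 hx.
have bk : bker (ukr (kel t x r 0 0)) C.
  by rewrite kE; exact: bker_conj (mkernel_kker hB hUC 0 0 t x r) C0 hC.
have [D D0 hD] := fredholm_sum J C0; have [S [h1 h2 _]] := hD _ k0 bk.
have f0 : fdet (kel t x r 0 0) != 0 by rewrite -kpzF_fdet// det_neq0.
apply: (@xgetPex _ 0 [set v | v * (1 - kel t x r 0 0) = 1 /\ (1 - kel t x r 0 0) * v = 1]).
exists (usca J (fdet (kel t x r 0 0))^-1 * S); split.
  by rewrite -mulrA h2 -uscaM mulVf ?usca1.
by rewrite mulrA -usca_comm -mulrA h1 -uscaM mulVf ?usca1.
Qed.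

(** At 0 the conjugating weights equal 1, so these are also the values at [(0, 0)] of the
    unconjugated kernel. *)
Definition corner (u : U) : 'M[R]_n := \matrix_(i, j) ukr u (val i, 0) (val j, 0).

(** [kpzQ] selects some continuous resolvent kernel; all of them have the same value at the corner,
    so the selection may be evaluated on the one built from [rho]. *)
Lemma kpz_resolvent t x r : 0 < t -> increasing_row x ->
  (exists Rk, resolvent_kernel (kpzK P B h0 t x r) Rk) /\
  kpzQ P B h0 t x r = corner (rho t x r - 1).
Proof.
move=> t0 hx; have [C C0 hC] := kker_decays_at 0 0 r t0 hx.
have [C1 C10 hC1] := kker_decays_at 1 0 r t0 hx.
have [C2 C20 hC2] := kker_decays_at 0 1 r t0 hx.
have [D D0 hD] := kker_band_bound r t0 hx; have [h1 h2] := rhoP r t0 hx.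
have dr i j u v := is_derive_kker_row 0 0 r i j u v t0 hx.
have dc i j u v := is_derive_kker_col 0 0 r i j u v t0 hx.
have [hR uR] := raw_resolvent_kernel C0 C10 C20 (mkernel_kker hB hUC 0 0 t x r) hC hC1 hC2 dr dc h1 h2 D0 hD.
rewrite /kpzQ kpzK_kker//; split; first by exists (raw (rho t x r - 1)).
rewrite /resolvent00; set A := [set M | _].
have : A (xget 0 A) by apply: xgetPex; exists (\matrix_(i, j) raw (rho t x r - 1) i j 0 0), (raw (rho t x r - 1)).
by move=> [Rk hRk ->]; apply/matrixP => i j; rewrite !mxE; exact: uR.
Qed.

End kpz_resolvent.

(** * The hierarchy of the boundary values *)

(* Derivatives of [dressed k l]: the boundary terms [beta]
   of the integrations by parts in [K_ka K_bl] are dressed by the resolvent. *)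
Section dressing.
Variables (U : pzRingType) (K : nat -> nat -> U) (rho : U) (beta : U -> U -> U).
Hypothesis Krho : (1 - K 0%N 0%N) * rho = 1.
Hypothesis rhoK : rho * (1 - K 0%N 0%N) = 1.
Hypothesis betaDl : forall u v w, beta (u + v) w = beta u w + beta v w.
Hypothesis betaDr : forall u v w, beta u (v + w) = beta u v + beta u w.
Hypothesis betaMl : forall c k a w, c * beta (K k a) w = beta (c * K k a) w.
Hypothesis betaMr : forall c u b l, beta u (K b l) * c = beta u (K b l * c).
Hypothesis ibp : forall k a b l, K k a.+1 * K b l + K k a * K b.+1 l = - beta (K k a) (K b l).

Definition dressed k l := K k l + K k 0%N * rho * K 0%N l.

(** The same expression as [dressed_derivative], which is the product rule for [dressed] with
    [rho' = rho * K' 0 0 * rho]. It is applied here to products of kernels, so that an identity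
    obtained from integration by parts can be dressed as a whole. *)
Definition dress_product (E : nat -> nat -> U) k l :=
  E k l + K k 0%N * rho * E 0%N l + E k 0%N * rho * K 0%N l + K k 0%N * rho * E 0%N 0%N * rho * K 0%N l.

Definition dressed_derivative (K' : nat -> nat -> U) k l :=
  K' k l + K' k 0%N * rho * K 0%N l + K k 0%N * rho * K' 0%N 0%N * rho * K 0%N l + K k 0%N * rho * K' 0%N l.

Let rho1 : rho = 1 + K 0%N 0%N * rho.
Proof. by rewrite -[1 in RHS]Krho mulrBl mul1r subrK. Qed.

Let rho2 : rho = 1 + rho * K 0%N 0.
Proof. by rewrite -[1 in RHS]rhoK mulrBr mulr1 subrK. Qed.

(** By [rho = 1 + K 0 0 * rho] the inner products [K 0 a * K 0 l] are absorbed, and the result is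
    [dressed k a * rho * K 0 l]. *)
Lemma dress_productl a k l : dress_product (fun k l => K k a * K 0%N l) k l =
  K k a * rho * K 0%N l + K k 0%N * rho * K 0%N a * rho * K 0%N l.
Proof.
have h x : x * rho * K 0%N l = x * K 0%N l + x * K 0%N 0%N * rho * K 0%N l by rewrite {1}rho1; nring.
rewrite /dress_product /= (h (K k a)) (h (K k 0%N * rho * K 0%N a)); nring.
Qed.

Lemma dress_productr b k l : dress_product (fun k l => K k 0%N * K b l) k l =
  K k 0%N * rho * K b l + K k 0%N * rho * K b 0%N * rho * K 0%N l.
Proof.
have h x : K k 0%N * rho * x = K k 0%N * x + K k 0%N * rho * K 0%N 0%N * x by rewrite {1}rho2; nring.
have h1 := h (K b l); have h2 := h (K b 0%N * rho * K 0%N l).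
rewrite [RHS](_ : _ = K k 0%N * rho * K b l + K k 0%N * rho * (K b 0%N * rho * K 0%N l)); last by nring.
by rewrite h1 h2 /dress_product /=; nring.
Qed.

Lemma dress_productB E F k l : dress_product (fun k l => E k l - F k l) k l =
  dress_product E k l - dress_product F k l.
Proof. by rewrite /dress_product /=; nring. Qed.

Lemma dress_productD E F k l : dress_product (fun k l => E k l + F k l) k l =
  dress_product E k l + dress_product F k l.
Proof. by rewrite /dress_product /=; nring. Qed.

Lemma dress_productN E k l : dress_product (fun k l => - E k l) k l = - dress_product E k l.
Proof. by rewrite /dress_product /=; nring. Qed.

(** [beta] splits a product at the boundary point; the factors on the left of it dress its first
    argument and those on the right its second. *)
Lemma dress_beta a b k l : dress_product (fun k l => beta (K k a) (K b l)) k l = beta (dressed k a) (dressed b l).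
Proof.
have m u : beta u (K b 0%N) * rho * K 0%N l = beta u (K b 0%N * rho * K 0%N l) by rewrite -mulrA betaMr mulrA.
by rewrite /dress_product /dressed /= !betaDl !betaDr !betaMl !m; nring.
Qed.

Lemma dressed_derivative_r k l : dressed_derivative (fun k l => K k.+1 l + K k l.+1) k l =
  dressed k.+1 l + dressed k l.+1 - beta (dressed k 0) (dressed 0 l).
Proof.
have e : (fun k l => - beta (K k 0%N) (K 0%N l)) = (fun k l => K k 1%N * K 0%N l + K k 0%N * K 1%N l).
  by apply/funext => i; apply/funext => j; rewrite -ibp.
rewrite -dress_beta -dress_productN e dress_productD dress_productl dress_productr.
by rewrite /dressed_derivative /dressed /=; nring.
Qed.

(** Moving two derivatives across the product takes two integrations by parts; their interior terms
    [K k 1 * K 1 l] cancel in the difference. *)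
Lemma dressed_derivative_x k l : dressed_derivative (fun k l => K k l.+2 - K k.+2 l) k l =
  dressed k l.+2 - dressed k.+2 l - beta (dressed k 1) (dressed 0 l) + beta (dressed k 0) (dressed 1 l).
Proof.
have e : (fun k l => beta (K k 0%N) (K 1%N l) - beta (K k 1%N) (K 0%N l)) = (fun k l => K k 2%N * K 0%N l - K k 0%N * K 2%N l).
  apply/funext => i; apply/funext => j; have h1 := ibp i 0 1 j; have h2 := ibp i 1 0 j.
  by rewrite -[beta (K i 0%N) _]opprK -h1 -h2; nring.
have h := congr1 (fun E => dress_product E k l) e.
rewrite /= dress_productB (dress_productB (fun k l => K k 2%N * K 0%N l)) !dress_beta dress_productl dress_productr in h.
rewrite [RHS](_ : _ = dressed k l.+2 - dressed k.+2 l +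
  (beta (dressed k 0) (dressed 1 l) - beta (dressed k 1) (dressed 0 l))); last by nring.
by rewrite h /dressed_derivative /dressed /=; nring.
Qed.

(** Three integrations by parts with alternating signs; the intermediate products cancel in
    pairs. *)
Lemma dressed_derivative_t k l : dressed_derivative (fun k l => K k.+3 l + K k l.+3) k l =
  dressed k.+3 l + dressed k l.+3 - beta (dressed k 2) (dressed 0 l) + beta (dressed k 1) (dressed 1 l)
  - beta (dressed k 0) (dressed 2 l).
Proof.
have e : (fun k l => beta (K k 1%N) (K 1%N l) - beta (K k 2%N) (K 0%N l) - beta (K k 0%N) (K 2%N l)) =
    (fun k l => K k 3%N * K 0%N l + K k 0%N * K 3%N l).
  apply/funext => i; apply/funext => j.
  have h1 := ibp i 0 2 j; have h2 := ibp i 1 1 j; have h3 := ibp i 2 0 j.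
  by rewrite -[beta (K i 1%N) _]opprK -h1 -h2 -h3; nring.
have h := congr1 (fun E => dress_product E k l) e.
rewrite /= !dress_productB (dress_productD (fun k l => K k 3%N * K 0%N l)) !dress_beta dress_productl dress_productr in h.
rewrite [RHS](_ : _ = dressed k.+3 l + dressed k l.+3 +
  (beta (dressed k 1) (dressed 1 l) - beta (dressed k 2) (dressed 0 l) - beta (dressed k 0) (dressed 2 l))); last by nring.
by rewrite h /dressed_derivative /dressed /=; nring.
Qed.

End dressing.

Section boundary_terms.
Context {R : realType}.
Notation mu := (@lebesgue_measure R).

Lemma integral_is_RplusD (f g : R -> R) (v w : R) : integral_is mu (@Rplus R) f v ->
  integral_is mu (@Rplus R) g w -> integral_is mu (@Rplus R) (fun x => f x + g x) (v + w).
Proof. by move=> hf hg; apply: integral_isD => //; exact: measurable_itv. Qed.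

Lemma integral_is_RplusZ (f : R -> R) (c v : R) : integral_is mu (@Rplus R) f v ->
  integral_is mu (@Rplus R) (fun x => c * f x) (c * v).
Proof. by move=> hf; apply: integral_isZ => //; exact: measurable_itv. Qed.

(** Adding [C * expR (- w)] to [f'] makes it nonnegative, so that the fundamental theorem on the
    half-line applies; the correction is integrated explicitly and removed. *)
Lemma integral_derive_decay (f f' : R -> R) (C : R) : (forall w, is_derive w (1 : R) f (f' w)) ->
  continuous f' -> (forall w, 0 <= w -> `|f w| <= C * expR (- w)) ->
  (forall w, 0 <= w -> `|f' w| <= C * expR (- w)) -> integral_is mu (@Rplus R) f' (- f 0).
Proof.
move=> df cf' hf hf'; pose g w := f w - C * expR (- 1 * w); pose g' w := f' w + C * expR (- 1 * w).
have dexp w : is_derive w (1 : R) (fun w => expR (- 1 * w)) (- expR (- 1 * w)).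
  have h1 : is_derive w (1 : R) (fun u : R => - 1 * u) (-1).
    have := is_derive_affine 0 (-1) w; rewrite (_ : (fun y => 0 + y * -1) = (fun u : R => -1 * u))//.
    by apply/funext => y; rewrite add0r mulrC.
  have := @is_derive_comp_fun _ expR (fun u => - 1 * u) w _ _ (is_derive_expR _) h1.
  by rewrite mulrN1.
have dg w : is_derive w (1 : R) g (g' w).
  have := is_deriveB_fun (df w) (is_deriveZ_fun C (dexp w)).
  by rewrite mulrN opprK.
have g0 w : 0 <= w -> 0 <= g' w.
  by move=> w0; have := hf' w w0; rewrite ler_norml /g' mulN1r => /andP[h _]; lra.
have mP : measurable (`[0, +oo[%classic : set R) by exact: measurable_itv.
have cg' : continuous g'.
  move=> w; apply: cvgD; first exact: cf'.
  by apply: cvgMr; apply: is_derive_continuous_at (dexp w).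
have E : (\int[mu]_(w in `[0%R, +oo[) (g' w)%:E = (- g 0)%:E)%E.
  rewrite (@ge0_continuous_FTC2y _ g' g 0 0).
  - by rewrite sub0e.
  - by move=> w w0; exact: g0.
  - exact: continuous_subspaceT.
  - have c0 : (2 * C * expR (- w)) @[w --> +oo] --> (0 : R).
      rewrite -[X in _ --> X](mulr0 (2 * C)); apply: cvgMr; exact: cvgr_expR.
    have bnd w : 0 <= w -> `|g w| <= 2 * C * expR (- w).
      move=> w0; apply: le_trans (ler_normB _ _) _.
      have h := hf w w0; have C0 : 0 <= C * expR (- w) by exact: le_trans (normr_ge0 _) h.
      rewrite mulN1r (ger0_norm C0); lra.
    apply: norm_cvg0; apply: (squeeze_cvgr _ (cvg_cst 0) c0).
    by near=> w; rewrite normr_ge0 /= bnd.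
  - by move=> w _; have [] := dg w.
  - exact/cvg_at_right_filter/(is_derive_continuous_at (dg 0)).
  - by move=> w _; rewrite derive1E; have [_ ->] := dg w.
have je := integrable_expRN (R := R) ltr01.
have jg : integral_is mu (@Rplus R) g' (- g 0).
  split; last by rewrite /Rintegral E.
  apply/integrableP; split; first by apply/measurable_EFinP; apply: measurable_funTS; exact: continuous_measurable_fun.
  rewrite (_ : (\int[mu]_(w in _) _ = \int[mu]_(w in `[0%R, +oo[) (g' w)%:E)%E); first by rewrite E ltry.
  by apply: eq_integral => w; rewrite inE RplusE => w0; rewrite /= ger0_norm// g0.
have v1 : integral_is mu (@Rplus R) (fun w => expR (- 1 * w)) 1.
  by split=> //; rewrite /Rplus Rintegral_expRN// invr1.
have [jf vf] := integral_is_RplusD jg (integral_is_RplusZ (- C) v1).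
have e : (fun w => g' w + - C * expR (- 1 * w)) = f'.
  by apply/funext => w; rewrite /g'; ring.
rewrite e in jf vf; split=> //; rewrite vf /g mulr0 expR0; ring.
Unshelve. all: by end_near. Qed.

Section boundary.
Variable n' : nat.
Notation n := n'.+1.
Notation J := (@row_mean R (iota 0 n)).
Notation U := (uker_of J).
Implicit Types u v w : U.

Definition boundary_kernel u w (x y : nat * R) : R :=
  \sum_(m < n) ukr u x (val m, 0) * ukr w (val m, 0) y.

Definition boundary u w : U := uk_of J (boundary_kernel u w).

Lemma boundaryE u w : usc (boundary u w) = 0 /\ ukr (boundary u w) = boundary_kernel u w.
Proof.
have [C C0 hC] := ubound_ex u; have [D D0 hD] := ubound_ex w.
have [mu' bu] := ubound_ukr hC; have [mw bw] := ubound_ukr hD.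
apply: (@uk_ofE _ _ _ J _ (\sum_(m < n) C * D)); split.
  apply: measurable_sum => m; apply: measurable_funM.
    exact: (measurableT_comp (measurableT_comp mu' (pair2_measurable (val m, 0 : R))) measurable_fst).
  exact: (measurableT_comp (measurableT_comp mw (pair1_measurable (val m, 0 : R))) measurable_snd).
move=> x y; apply: le_trans (ler_norm_sum _ _ _) _; apply: ler_sum => m _.
by rewrite normrM; exact: ler_pM.
Qed.

Lemma boundaryDl u v w : boundary (u + v) w = boundary u w + boundary v w.
Proof.
have [a1 k1] := boundaryE (u + v) w; have [a2 k2] := boundaryE u w; have [a3 k3] := boundaryE v w.
apply: uker_eq => [|x y]; first by rewrite uscD a1 a2 a3 addr0.
rewrite ukrD k1 k2 k3 /boundary_kernel -big_split; apply: eq_bigr => m _ /=.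
by rewrite mulrDl.
Qed.

Lemma boundaryDr u v w : boundary u (v + w) = boundary u v + boundary u w.
Proof.
have [a1 k1] := boundaryE u (v + w); have [a2 k2] := boundaryE u v; have [a3 k3] := boundaryE u w.
apply: uker_eq => [|x y]; first by rewrite uscD a1 a2 a3 addr0.
rewrite ukrD k1 k2 k3 /boundary_kernel -big_split; apply: eq_bigr => m _ /=.
by rewrite mulrDr.
Qed.

(** [boundary] sees kernel parts only. A scalar part of [v] would add a multiple of the kernel of
    [u] to that of [u * v], which the left side does not contain. *)
Lemma boundaryMl u v w : usc v = 0 -> u * boundary v w = boundary (u * v) w.
Proof.
move=> v0; have [a1 k1] := boundaryE (u * v) w; have [a2 k2] := boundaryE v w.
apply: uker_eq => [|x y]; first by rewrite uscM a1 a2 mulr0.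
have [C C0 hC] := ubound_ex u; have [D D0 hD] := ubound_ex v.
have bu := ubound_ukr hC; have bv := ubound_ukr hD.
rewrite ukrM a2 k1 k2 mul0r addr0 /boundary_kernel.
transitivity (usc u * (\sum_(m < n) ukr v x (val m, 0) * ukr w (val m, 0) y) +
    \sum_(m < n) J (fun z => ukr w (val m, 0) y * (ukr u x z * ukr v z (val m, 0)))).
  congr (_ + _); rewrite -mean_sum; last first.
    move=> m; have [mb [E hE]] := bker_section x (val m, 0 : R) bu bv; split.
      by apply: measurable_funM => //; exact: measurable_cst.
    by exists (`|ukr w (val m, 0) y| * E) => z; rewrite normrM ler_wpM2l.
  by congr (mean_fun J _); apply/funext => z; rewrite mulr_sumr; apply: eq_bigr => m _; ring.
have sc (m : 'I_n) : J (fun z => ukr w (val m, 0) y * (ukr u x z * ukr v z (val m, 0))) =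
    ukr w (val m, 0) y * J (fun z => ukr u x z * ukr v z (val m, 0)).
  by rewrite mean_scale//; exact: bker_section bu bv.
rewrite [X in _ + X = _](eq_bigr _ (fun m _ => sc m)) mulr_sumr -big_split; apply: eq_bigr => m _ /=.
by rewrite v0; ring.
Qed.

Lemma boundaryMr u v w : usc v = 0 -> boundary u v * w = boundary u (v * w).
Proof.
move=> v0; have [a1 k1] := boundaryE u (v * w); have [a2 k2] := boundaryE u v.
apply: uker_eq => [|x y]; first by rewrite uscM a1 a2 mul0r.
have [C C0 hC] := ubound_ex w; have [D D0 hD] := ubound_ex v.
have bw := ubound_ukr hC; have bv := ubound_ukr hD.
rewrite ukrM a2 k1 k2 mul0r add0r /boundary_kernel.
transitivity (usc w * (\sum_(m < n) ukr u x (val m, 0) * ukr v (val m, 0) y) +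
    \sum_(m < n) J (fun z => ukr u x (val m, 0) * (ukr v (val m, 0) z * ukr w z y))).
  congr (_ + _); rewrite -mean_sum; last first.
    move=> m; have [mb [E hE]] := bker_section (val m, 0 : R) y bv bw; split.
      by apply: measurable_funM => //; exact: measurable_cst.
    by exists (`|ukr u x (val m, 0)| * E) => z; rewrite normrM ler_wpM2l.
  by congr (mean_fun J _); apply/funext => z; rewrite mulr_suml; apply: eq_bigr => m _; ring.
have sc (m : 'I_n) : J (fun z => ukr u x (val m, 0) * (ukr v (val m, 0) z * ukr w z y)) =
    ukr u x (val m, 0) * J (fun z => ukr v (val m, 0) z * ukr w z y).
  by rewrite mean_scale//; exact: bker_section bv bw.
rewrite [X in _ + X = _](eq_bigr _ (fun m _ => sc m)) mulr_sumr -big_split; apply: eq_bigr => m _ /=.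
by rewrite v0; ring.
Qed.

Lemma corner_boundary u w : corner (boundary u w) = corner u *m corner w.
Proof.
apply/matrixP => i j; rewrite !mxE (boundaryE u w).2; apply: eq_bigr => m _.
by rewrite !mxE.
Qed.

Lemma cornerD u v : corner (u + v) = corner u + corner v.
Proof. by apply/matrixP => i j; rewrite !mxE. Qed.

Lemma cornerN u : corner (- u) = - corner u.
Proof. by apply/matrixP => i j; rewrite !mxE. Qed.

Lemma corner_usca (a : R) u : corner (usca J a * u) = a *: corner u.
Proof. by apply/matrixP => i j; rewrite !mxE ukr_uscaM. Qed.

Lemma decays_mul (F E : mxkernel R n) (c e : R) i m j p z q : decays F c -> decays E e -> 0 <= c -> 0 <= e ->
  0 <= p -> 0 <= z -> 0 <= q ->
  `|F i m p z * E m j z q| <= c * e * expR (row_weight i * p - col_weight j * q) * expR (- z).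
Proof.
move=> hF hE c0 e0 p0 z0 q0; rewrite normrM.
apply: le_trans (ler_pM _ _ (hF i m p z p0 z0) (hE m j z q z0 q0)) _ => //.
rewrite mulrACA -[leRHS]mulrA -!expRD ler_wpM2l ?mulr_ge0// ler_expR.
have -> : col_weight m * z = row_weight m * z + z by rewrite /col_weight mulrDl mul1r.
by clear; move: (row_weight i * p) (col_weight j * q) (row_weight m * z) => a b y; lra.
Qed.

(** At the intermediate point the two conjugating weights cancel against the density of the mean.
    The product in the ring is thus a plain integral over the half-line, and integrating by parts
    differentiates no weight. *)
Lemma boundary_ibp u u' w w' (G G' H H' : mxkernel R n) :
  usc u = 0 -> usc u' = 0 -> usc w = 0 -> usc w' = 0 ->
  ukr u = conj_kernel G -> ukr u' = conj_kernel G' -> ukr w = conj_kernel H -> ukr w' = conj_kernel H' ->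
  (forall i m j p q, 0 <= p -> 0 <= q -> exists a b : R, [/\
    integral_is mu (@Rplus R) (fun z => G' i m p z * H m j z q) a,
    integral_is mu (@Rplus R) (fun z => G i m p z * H' m j z q) b &
    a + b = - (G i m p 0 * H m j 0 q)]) ->
  u' * w + u * w' = - boundary u w.
Proof.
move=> u0 u'0 w0 w'0 uE u'E wE w'E ibp; have [e0 eb] := boundaryE u w.
apply: uker_eq => [|[i p] [j q]].
  by rewrite uscD uscN !uscM e0 u0 u'0 !mul0r addr0 oppr0.
rewrite ukrD ukrN !ukrM eb u0 u'0 w0 w'0 !mul0r !add0r /kcomp !row_meanE /boundary_kernel.
rewrite -big_split -sumrN; apply: eq_bigr => m _ /=; rewrite uE u'E wE w'E.
rewrite /conj_kernel /= lexx !andbT /= inord_val.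
have z1 (F : R -> R) : (forall z, F z = 0) -> \int[mu]_(z in @Rplus R) F z = 0.
  by move=> h; rewrite /Rintegral; under eq_integral do rewrite h; rewrite integral0.
case: ifPn => p0; last first.
  by rewrite mul0r oppr0 !z1 ?addr0// => z; rewrite /= !mul0r.
case: ifPn => q0; last first.
  by rewrite mulr0 oppr0 !z1 ?addr0// => z; rewrite /= andbF mulr0 mul0r.
set i' := inord i; set j' := inord j; set A := row_weight i' * p; set D := col_weight j' * q.
have red (g h z : R) : expR (- A) * g * expR (col_weight m * z) * (expR (- (row_weight m * z)) * h * expR D) * expR (- z) =
    expR (- A) * expR D * (g * h).
  rewrite [LHS](_ : _ = expR (- A) * expR D * (g * h) *
    (expR (col_weight m * z) * expR (- (row_weight m * z)) * expR (- z))); last by ring.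
  by rewrite -!expRD (_ : _ + _ - z = 0) ?expR0 ?mulr1// /col_weight; ring.
have ev (F E : mxkernel R n) (a : R) : integral_is mu (@Rplus R) (fun z => F i' m p z * E m j' z q) a ->
    \int[mu]_(z in @Rplus R)
      ((if 0 <= z then expR (- A) * F i' m p z * expR (col_weight m * z) else 0) *
       (if 0 <= z then expR (- (row_weight m * z)) * E m j' z q * expR D else 0) * expR (- z)) =
    expR (- A) * expR D * a.
  move=> ha; rewrite -(integral_is_RplusZ (expR (- A) * expR D) ha).2.
  by apply: eq_Rintegral => z; rewrite inE RplusE => z0; rewrite z0 red.
have [a [b [ha hb ab]]] := ibp i' m j' p q p0 q0.
transitivity (expR (- A) * expR D * a + expR (- A) * expR D * b); last first.
  by rewrite -mulrDr ab !mulr0 oppr0 expR0; ring.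
congr (_ + _); [rewrite -(ev _ _ _ ha)|rewrite -(ev _ _ _ hb)]; apply: eq_Rintegral => z _;
  by rewrite andbT; case: (0 <= z).
Qed.

End boundary.

Section integration_by_parts.
Context d (W : measurableType d) (P : probability W R) (B : R -> W -> R).
Hypothesis hB : brownian2 P B.
Variable h0 : R -> \bar R.
Hypothesis hUC : UC h0.
Variable n' : nat.
Notation n := n'.+1.
Notation K := (@kker R d W P B h0 n).
Notation J := (@row_mean R (iota 0 n)).

Lemma kel_ibp t (x r : 'rV[R]_n) k a b l : 0 < t -> increasing_row x ->
  kel P B h0 t x r k a.+1 * kel P B h0 t x r b l + kel P B h0 t x r k a * kel P B h0 t x r b.+1 l =
  - boundary (kel P B h0 t x r k a) (kel P B h0 t x r b l).
Proof.
move=> t0 hx; have [a1 k1] := kelE hB hUC r k a t0 hx; have [a2 k2] := kelE hB hUC r k a.+1 t0 hx.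
have [a3 k3] := kelE hB hUC r b l t0 hx; have [a4 k4] := kelE hB hUC r b.+1 l t0 hx.
apply: (boundary_ibp a1 a2 a3 a4 k1 k2 k3 k4) => i m j u v u0 v0.
set A := row_weight i * u; set D := col_weight j * v.
pose G k l u v := K k l t x r i m u v; pose H k l u v := K k l t x r m j u v.
have bd k' l' : exists2 C : R, 0 <= C & decays (K k' l' t x r) C by exact: kker_decays_at.
have [C1 C10 h1] := bd k a; have [C2 C20 h2] := bd b l; have [C3 C30 h3] := bd k a.+1; have [C4 C40 h4] := bd b.+1 l.
pose C := (C3 * C2 + C1 * C4 + C1 * C2) * expR (A - D).
pose f w := G k a u w * H b l w v; pose f' w := G k a.+1 u w * H b l w v + G k a u w * H b.+1 l w v.
have df w : is_derive w (1 : R) f (f' w).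
  exact: is_deriveM_fun (is_derive_kker_col hB hUC k a r i m u w t0 hx) (is_derive_kker_row hB hUC b l r m j w v t0 hx).
have cG k' l' : continuous (G k' l' u).
  by move=> w; exact: is_derive_continuous_at (is_derive_kker_col hB hUC k' l' r i m u w t0 hx).
have cH k' l' : continuous (fun w => H k' l' w v).
  by move=> w; exact: is_derive_continuous_at (is_derive_kker_row hB hUC k' l' r m j w v t0 hx).
have [jf vf] : integral_is mu (@Rplus R) f' (- f 0).
  apply: (@integral_derive_decay f f' C df).
  - by move=> w; apply: cvgD; apply: cvgM; [exact: cG|exact: cH|exact: cG|exact: cH].
  - move=> w w0; apply: le_trans (decays_mul i m j h1 h2 C10 C20 u0 w0 v0) _.
    by rewrite ler_wpM2r ?expR_ge0// ler_wpM2r ?expR_ge0// lerDr addr_ge0// mulr_ge0.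
  - move=> w w0; apply: le_trans (ler_normD _ _) _.
    apply: le_trans (lerD (decays_mul i m j h3 h2 C30 C20 u0 w0 v0) (decays_mul i m j h1 h4 C10 C40 u0 w0 v0)) _.
    by rewrite -2!mulrDl ler_wpM2r ?expR_ge0// ler_wpM2r ?expR_ge0// lerDl mulr_ge0.
have mG k' l' : measurable_fun setT (G k' l' u) by exact: continuous_measurable_fun.
have mH k' l' : measurable_fun setT (fun w => H k' l' w v) by exact: continuous_measurable_fun.
have jp k5 l5 k6 l6 : mu.-integrable (@Rplus R) (EFin \o (fun w => G k5 l5 u w * H k6 l6 w v)).
  have [c c0 hc] := bd k5 l5; have [e e00 he] := bd k6 l6.
  apply: (@integrable_dominated _ _ _ mu (@Rplus R) (fun w => G k5 l5 u w * H k6 l6 w v)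
    (fun w => c * e * expR (A - D) * expR (- 1 * w))).
  - exact: measurable_itv.
  - by apply: measurable_funTS; apply: measurable_funM; [exact: mG|exact: mH].
  - exact: (@integrableZ_fun _ _ _ mu (@Rplus R) (fun w => expR (- 1 * w)) _ (measurable_itv _) (integrable_expRN ltr01)).
  - by move=> w; rewrite RplusE mulN1r => w0; exact: (decays_mul i m j hc he c0 e00 u0 w0 v0).
exists (\int[mu]_(w in @Rplus R) (G k a.+1 u w * H b l w v)), (\int[mu]_(w in @Rplus R) (G k a u w * H b.+1 l w v)).
split; [by split=> //; exact: jp|by split=> //; exact: jp|].
by rewrite -RintegralD//; exact: measurable_itv.
Qed.

End integration_by_parts.
End boundary_terms.

(** * Matrix-valued derivatives and symbolic differentiation of polynomials in the boundary
    values *)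

Section matrix_derivatives.
Context {R : realType}.

Lemma is_derive_mxP (V : normedModType R) (m n : nat) (G : V -> 'M[R]_(m, n)) y v (D : 'M[R]_(m, n)) :
  is_derive y v G D <-> forall i j, is_derive y v (fun z => G z i j) (D i j).
Proof.
split=> [[h1 h2] i j|h].
  have hd := (derivable_mxP G y v).1 h1 i j; split=> //.
  by rewrite -h2 derive_mx// mxE.
have hd : derivable G y v by apply/derivable_mxP => i j; have [] := h i j.
split=> //; rewrite derive_mx//; apply/matrixP => i j; rewrite mxE; by have [_ ->] := h i j.
Qed.

Lemma is_derive_line (V : normedModType R) (g : V -> R) y v (d : R) :
  is_derive (0 : R) (1 : R) (fun s => g (y + s *: v)) d -> is_derive y v g d.
Proof.
have E : (fun h : R => h^-1 *: (((fun s => g (y + s *: v)) \o shift 0) (h *: (1 : R)) - g (y + (0 : R) *: v))) =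
    (fun h : R => h^-1 *: ((g \o shift y) (h *: v) - g y)).
  apply/funext => h; congr (_ *: (g _ - g _)); last by rewrite scale0r addr0.
  by rewrite /= addr0 [_ *: 1]mulr1 addrC.
by move=> [h1 h2]; split; [rewrite /derivable -E|rewrite -h2 /derive -E].
Qed.

Variables (V : normedModType R) (m n' : nat) (v : 'I_m -> V).
Notation n := n'.+1.
Implicit Types (G H : V -> 'M[R]_n) (y : V).

(** One notion for the two kinds of derivatives: for the coordinate directions it is [dsum] together
    with its existence, and for [m = 1] it is the derivative in a real variable. *)
Definition summed_derive G y (D : 'M[R]_n) :=
  (forall i, derivable G y (v i)) /\ \sum_i 'D_(v i) G y = D.

Lemma summed_deriveP G y (D : 'I_m -> 'M[R]_n) : (forall i, is_derive y (v i) G (D i)) ->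
  summed_derive G y (\sum_i D i).
Proof. by move=> h; split=> [i|]; [have [] := h i|apply: eq_bigr => i _; have [_ ->] := h i]. Qed.

Let is_D G y i : derivable G y (v i) -> is_derive y (v i) G ('D_(v i) G y).
Proof. by move=> h; split. Qed.

Lemma summed_deriveD G H y D E : summed_derive G y D -> summed_derive H y E ->
  summed_derive (fun z => G z + H z) y (D + E).
Proof.
move=> [hG <-] [hH <-]; rewrite -big_split; apply: summed_deriveP => i /=.
exact: is_deriveD (is_D (hG i)) (is_D (hH i)).
Qed.

Lemma summed_deriveN G y D : summed_derive G y D -> summed_derive (fun z => - G z) y (- D).
Proof.
by move=> [hG <-]; rewrite -sumrN; apply: summed_deriveP => i; exact: is_deriveN (is_D (hG i)).
Qed.

Lemma summed_derive_cst (A : 'M[R]_n) y : summed_derive (fun=> A) y 0.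
Proof.
have := @summed_deriveP (fun=> A) y (fun=> 0) (fun i => is_derive_cst A y (v i)).
by rewrite big1.
Qed.

Lemma summed_deriveM G H y D E : summed_derive G y D -> summed_derive H y E ->
  summed_derive (fun z => G z * H z) y (D * H y + G y * E).
Proof.
move=> [hG <-] [hH <-]; rewrite mulr_suml mulr_sumr -big_split; apply: summed_deriveP => i /=.
apply/is_derive_mxP => a b.
have dG := (is_derive_mxP _ _ _ _).1 (is_D (hG i)); have dH := (is_derive_mxP _ _ _ _).1 (is_D (hH i)).
rewrite (_ : (fun z => _) = \sum_(c < n) ((fun z => G z a c) * (fun z => H z c b))); last first.
  by apply/funext => z; rewrite mxE fct_sumE; apply: eq_bigr => c _.
have h c : is_derive y (v i) ((fun z => G z a c) * (fun z => H z c b))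
    (G y a c *: 'D_(v i) H y c b + H y c b *: 'D_(v i) G y a c).
  exact: is_deriveM (dG a c) (dH c b).
apply: is_derive_eq (is_derive_sum h) _; rewrite !mxE -big_split; apply: eq_bigr => c _ /=.
by rewrite addrC [_ *: 'D_(v i) G y a c]mulrC.
Qed.

Lemma summed_derive_near G H y D : (\forall z \near y, G z = H z) ->
  summed_derive G y D -> summed_derive H y D.
Proof.
move=> GH [hG <-]; split=> [i|]; first exact: near_eq_derivable GH (hG i).
by apply: eq_bigr => i _; rewrite (near_eq_derive (v i) GH).
Qed.

(** The derivation of the free ring with prescribed values on the variables. As it maps polynomials
    to polynomials, higher derivatives are mere iterations. *)
Fixpoint nderive (I : eqType) (denv : I -> nexpr I) (e : nexpr I) : nexpr I :=
  match e with
  | NVar i => denv i | NZero => NZero | NOne => NZero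
  | NAdd a b => NAdd (nderive denv a) (nderive denv b)
  | NOpp a => NOpp (nderive denv a)
  | NMul a b => NAdd (NMul (nderive denv a) b) (NMul a (nderive denv b))
  end.

(** The factor [c] carries the -1/3 of the time derivative, so that the formal derivations have
    integral coefficients and computation can decide identities. *)
Lemma summed_derive_neval (I : eqType) (env : V -> I -> 'M[R]_n) (denv : I -> nexpr I) y (c : R) :
  (forall i, summed_derive (fun z => env z i) y (c *: neval (env y) (denv i))) ->
  forall e, summed_derive (fun z => neval (env z) e) y (c *: neval (env y) (nderive denv e)).
Proof.
move=> h; elim=> [i|||a iha b ihb|a iha|a iha b ihb] /=.
- exact: h.
- by rewrite scaler0; exact: summed_derive_cst.
- by rewrite scaler0; exact: summed_derive_cst.
- by rewrite scalerDr; exact: summed_deriveD.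
- by rewrite scalerN; exact: summed_deriveN.
- by rewrite scalerDr scalerAl scalerAr; exact: summed_deriveM.
Qed.

End matrix_derivatives.

Section corner_derivatives.
Context {R : realType} d (W : measurableType d) (P : probability W R) (B : R -> W -> R).
Hypothesis hB : brownian2 P B.
Variable h0 : R -> \bar R.
Hypothesis hUC : UC h0.
Variable n' : nat.
Notation n := n'.+1.
Notation K := (@kker R d W P B h0 n).
Notation J := (@row_mean R (iota 0 n)).
Notation U := (uker_of J).
Hypothesis det_neq0 : forall t (x r : 'rV[R]_n), 0 < t -> increasing_row x -> kpzF P B h0 t x r != 0.

Notation kel := (kel P B h0).
Notation rho := (rho P B h0).

Definition kpz_corner (p : nat * nat) t (x r : 'rV[R]_n) : 'M[R]_n :=
  corner (dressed (kel t x r) (rho t x r) p.1 p.2).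

Definition line_kel dt dx dr t x r k l : U := kelem (line_derivative dt dx dr (fun k l => K k l t x r) k l).

(** The expansion is made in the kernel ring, where that of [rho] comes from [udiff_inverse];
    evaluating an entry at the corner is linear and bounded by the sup norm. *)
Lemma is_derive_corner_line t dt (x dx r dr : 'rV[R]_n) p i j : 0 < t -> increasing_row x ->
  is_derive (0 : R) (1 : R) (fun s => kpz_corner p (t + s * dt) (x + s *: dx) (r + s *: dr) i j)
    (corner (dressed_derivative (kel t x r) (rho t x r) (line_kel dt dx dr t x r) p.1 p.2) i j).
Proof.
move=> t0 hx; have [q q0 [_ good]] := line_neighbourhood hB hUC dt dx r dr t0 hx.
pose kl s := kel (t + s * dt) (x + s *: dx) (r + s *: dr).
pose rs s := rho (t + s * dt) (x + s *: dx) (r + s *: dr).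
have e0 : kl 0 = kel t x r by rewrite /kl mul0r !scale0r !addr0.
have r0 : rs 0 = rho t x r by rewrite /rs mul0r !scale0r !addr0.
have dk k l : udiff (fun s => kl s k l) (line_kel dt dx dr t x r k l).
  have := udiff_kline hB hUC dt dx r dr t0 hx k l.
  have -> : kline P B h0 t dt x dx r dr 0 = fun k l => K k l t x r.
    by apply/funext => a; apply/funext => b; rewrite /kline mul0r !scale0r !addr0.
  by [].
have dr' : udiff rs (rs 0 * line_kel dt dx dr t x r 0 0 * rs 0).
  apply: (udiff_inverse q0 (dk 0 0)) => s sq; have [ts xs] := good s sq.
  exact: (rhoP hB hUC det_neq0 _ ts xs).
have := udiffD (dk p.1 p.2) (udiffM (udiffM (dk p.1 0) dr') (dk 0 p.2)).
rewrite e0 r0 => hd.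
have e : line_kel dt dx dr t x r p.1 p.2 + ((line_kel dt dx dr t x r p.1 0 * rho t x r +
    kel t x r p.1 0 * (rho t x r * line_kel dt dx dr t x r 0 0 * rho t x r)) * kel t x r 0 p.2 +
    kel t x r p.1 0 * rho t x r * line_kel dt dx dr t x r 0 p.2) =
   dressed_derivative (kel t x r) (rho t x r) (line_kel dt dx dr t x r) p.1 p.2.
  by rewrite /dressed_derivative; nring.
rewrite e in hd; rewrite mxE.
have -> : (fun s => kpz_corner p (t + s * dt) (x + s *: dx) (r + s *: dr) i j) =
    (fun s => ukr (kl s p.1 p.2 + kl s p.1 0 * rs s * kl s 0 p.2) (val i, 0) (val j, 0)).
  by apply/funext => s; rewrite mxE.
apply: (@is_derive_udiff _ _ _ J _ _ (fun u => ukr u (val i, 0) (val j, 0)) 1 _ _ _ hd) => [//|a v|v C [_ h]].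
  exact: ukr_uscaM.
by rewrite mul1r.
Qed.

Lemma line_kelE dt dx dr t x r k l : 0 < t -> increasing_row x ->
  usc (line_kel dt dx dr t x r k l) = 0 /\
  ukr (line_kel dt dx dr t x r k l) = conj_kernel (line_derivative dt dx dr (fun k l => K k l t x r) k l).
Proof.
move=> t0 hx; have ud : uniformly_decays 1 (fun _ : R => fun k l => K k l t x r).
  by move=> a b; have [C C0 hC] := kker_decays_at hB hUC a b r t0 hx; exists C.
have [C C0 hC] := line_derivative_decays dt dx dr ud k l.
apply: (kelemE _ C0 (hC 0 _)); last by rewrite normr0.
by apply: mkernel_line_derivative => a b; exact: mkernel_kker.
Qed.

Lemma ukr_sum (I : Type) (s : seq I) (u : I -> U) x y : ukr (\sum_(i <- s) u i) x y = \sum_(i <- s) ukr (u i) x y.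
Proof. by elim: s => [|i s ih]; rewrite ?big_nil// !big_cons ukrD ih. Qed.

Lemma usc_sum (I : Type) (s : seq I) (u : I -> U) : usc (\sum_(i <- s) u i) = \sum_(i <- s) usc (u i).
Proof. by elim: s => [|i s ih]; rewrite ?big_nil// !big_cons uscD ih. Qed.

(** The entry [(i, j)] feels a direction through its components [i] and [j]. Once the components of
    all directions add up to the same number in every row, the coefficients no longer depend on
    [(i, j)] and the sum is an element built from the [kel] alone. This is the reason for the
    operators D_r and D_x. *)
Lemma sum_line_kel (I : finType) (dt : I -> R) (dx dr : I -> 'rV[R]_n) (a b c : R) t x r k l :
  0 < t -> increasing_row x -> \sum_i dt i = a -> (forall j, \sum_i dx i 0 j = b) -> (forall j, \sum_i dr i 0 j = c) ->
  \sum_i line_kel (dt i) (dx i) (dr i) t x r k l =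
  usca J (- a / 3) * (kel t x r k.+3 l + kel t x r k l.+3) + usca J b * (kel t x r k l.+2 - kel t x r k.+2 l)
  + usca J c * (kel t x r k.+1 l + kel t x r k l.+1).
Proof.
move=> t0 hx ha hb hc.
have [a1 k1] := kelE hB hUC r k.+3 l t0 hx; have [a2 k2] := kelE hB hUC r k l.+3 t0 hx.
have [a3 k3] := kelE hB hUC r k.+2 l t0 hx; have [a4 k4] := kelE hB hUC r k l.+2 t0 hx.
have [a5 k5] := kelE hB hUC r k.+1 l t0 hx; have [a6 k6] := kelE hB hUC r k l.+1 t0 hx.
have kE i := line_kelE (dt i) (dx i) (dr i) r k l t0 hx.
move: (kel t x r k.+3 l) (kel t x r k l.+3) (kel t x r k.+2 l) (kel t x r k l.+2) (kel t x r k.+1 l) (kel t x r k l.+1)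
  a1 k1 a2 k2 a3 k3 a4 k4 a5 k5 a6 k6 => u1 u2 u3 u4 u5 u6 a1 k1 a2 k2 a3 k3 a4 k4 a5 k5 a6 k6.
apply: uker_eq => [|p q].
  rewrite usc_sum big1 => [|i _]; last by rewrite (kE i).1.
  by rewrite !uscD !uscM !uscD uscN a1 a2 a3 a4 a5 a6 !(subr0, addr0, mulr0).
rewrite ukr_sum !ukrD !ukr_uscaM !ukrD ukrN k1 k2 k3 k4 k5 k6.
under eq_bigr do rewrite (kE _).2.
rewrite /conj_kernel; case: ifP => _; last by rewrite big1// oppr0 !(addr0, mulr0).
set i := inord _; set j := inord _.
rewrite -mulr_suml -mulr_sumr /line_derivative.
transitivity (expR (- (row_weight i * p.2)) * (- a / 3 * K k.+3 l t x r i j p.2 q.2 + - a / 3 * K k l.+3 t x r i j p.2 q.2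
    - b * K k.+2 l t x r i j p.2 q.2 + b * K k l.+2 t x r i j p.2 q.2
    + c * K k.+1 l t x r i j p.2 q.2 + c * K k l.+1 t x r i j p.2 q.2) * expR (col_weight j * q.2)); last by ring.
congr (_ * _ * _).
have e (s : seq I) k1' k2' k3' k4' k5' k6' : \sum_(m <- s) (- dt m / 3 * k1' + - dt m / 3 * k2' - dx m 0 i * k3' +
    dx m 0 j * k4' + dr m 0 i * k5' + dr m 0 j * k6') =
  - (\sum_(m <- s) dt m) / 3 * k1' + - (\sum_(m <- s) dt m) / 3 * k2' - (\sum_(m <- s) dx m 0 i) * k3' +
  (\sum_(m <- s) dx m 0 j) * k4' + (\sum_(m <- s) dr m 0 i) * k5' + (\sum_(m <- s) dr m 0 j) * k6'.
  by elim: s => [|m s ih]; rewrite ?big_nil ?big_cons ?ih; ring.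
by rewrite e ha !hb !hc.
Qed.

Lemma sum_delta_mx (j : 'I_n) : \sum_(i < n) (delta_mx 0 i : 'rV[R]_n) 0 j = 1.
Proof.
rewrite (bigD1 j)//= mxE !eqxx /= big1 ?addr0// => i ij.
by rewrite mxE eqxx /= eq_sym (negPf ij).
Qed.

Lemma dressed_derivative_sum (I : finType) (k : nat -> nat -> U) rh (k' : I -> nat -> nat -> U) a b :
  \sum_i dressed_derivative k rh (k' i) a b = dressed_derivative k rh (fun a b => \sum_i k' i a b) a b.
Proof.
elim: (index_enum I) => [|i s ih].
  by rewrite /dressed_derivative !big_nil; nring.
rewrite big_cons ih /dressed_derivative !big_cons.
by set s1 := \sum_(_ <- s) _; set s2 := \sum_(_ <- s) _; set s3 := \sum_(_ <- s) _; set s4 := \sum_(_ <- s) _; nring.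
Qed.

Lemma corner_sum (I : finType) (u : I -> U) : corner (\sum_i u i) = \sum_i corner (u i).
Proof.
apply: (big_morph (@corner R n')); first exact: cornerD.
by apply/matrixP => i j; rewrite !mxE.
Qed.

End corner_derivatives.

Definition corner_dr (p : nat * nat) : nexpr (nat * nat) := let: (k, l) := p in
  NAdd (NAdd (NVar (k.+1, l)) (NVar (k, l.+1))) (NOpp (NMul (NVar (k, 0%N)) (NVar (0%N, l)))).

Definition corner_dx (p : nat * nat) : nexpr (nat * nat) := let: (k, l) := p in
  NAdd (NAdd (NAdd (NVar (k, l.+2)) (NOpp (NVar (k.+2, l)))) (NOpp (NMul (NVar (k, 1%N)) (NVar (0%N, l)))))
    (NMul (NVar (k, 0%N)) (NVar (1%N, l))).

(* [-3] times the derivative in [t], which keeps the coefficients integral *)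
Definition corner_dt (p : nat * nat) : nexpr (nat * nat) := let: (k, l) := p in
  NAdd (NAdd (NAdd (NAdd (NVar (k.+3, l)) (NVar (k, l.+3))) (NOpp (NMul (NVar (k, 2%N)) (NVar (0%N, l)))))
    (NMul (NVar (k, 1%N)) (NVar (1%N, l)))) (NOpp (NMul (NVar (k, 0%N)) (NVar (2%N, l)))).

Section corner_dressing.
Context {R : realType}.
Variable n' : nat.
Notation n := n'.+1.
Notation J := (@row_mean R (iota 0 n)).
Notation U := (uker_of J).
Variables (K : nat -> nat -> U) (rho : U).
Hypotheses (K_usc : forall k l, usc (K k l) = 0) (h1 : (1 - K 0 0) * rho = 1) (h2 : rho * (1 - K 0 0) = 1).
Hypothesis ibp : forall k a b l, K k a.+1 * K b l + K k a * K b.+1 l = - boundary (K k a) (K b l).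

Let bMl c k a w : c * boundary (K k a) w = boundary (c * K k a) w.
Proof. exact: boundaryMl. Qed.
Let bMr c u b l : boundary u (K b l) * c = boundary u (K b l * c).
Proof. exact: boundaryMr. Qed.
Let Q (p : nat * nat) : 'M[R]_n := corner (dressed K rho p.1 p.2).

Lemma corner_dressed_derivative_r k l :
  corner (dressed_derivative K rho (fun k l => K k.+1 l + K k l.+1) k l) = neval Q (corner_dr (k, l)).
Proof.
rewrite (dressed_derivative_r h1 h2 (@boundaryDl _ _) (@boundaryDr _ _) bMl bMr ibp).
by rewrite /Q; move: (dressed K rho) => D; rewrite !(cornerD, cornerN) corner_boundary.
Qed.

Lemma corner_dressed_derivative_x k l :
  corner (dressed_derivative K rho (fun k l => K k l.+2 - K k.+2 l) k l) = neval Q (corner_dx (k, l)).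
Proof.
rewrite (dressed_derivative_x h1 h2 (@boundaryDl _ _) (@boundaryDr _ _) bMl bMr ibp).
by rewrite /Q; move: (dressed K rho) => D; rewrite !(cornerD, cornerN) !corner_boundary.
Qed.

Lemma corner_dressed_derivative_t k l :
  corner (dressed_derivative K rho (fun k l => K k.+3 l + K k l.+3) k l) = neval Q (corner_dt (k, l)).
Proof.
rewrite (dressed_derivative_t h1 h2 (@boundaryDl _ _) (@boundaryDr _ _) bMl bMr ibp).
by rewrite /Q; move: (dressed K rho) => D; rewrite !(cornerD, cornerN) !corner_boundary.
Qed.

Let dressed_derivative_usca (a : R) E k l :
  dressed_derivative K rho (fun k l => usca J a * E k l) k l = usca J a * dressed_derivative K rho E k l.
Proof. by rewrite /dressed_derivative !mulrDr !mulrA -!(usca_comm a (K k 0%N * rho)) !mulrA. Qed.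

Lemma corner_dressed_derivative (a b c : R) k l :
  corner (dressed_derivative K rho (fun k l => usca J a * (K k.+3 l + K k l.+3)
    + usca J b * (K k l.+2 - K k.+2 l) + usca J c * (K k.+1 l + K k l.+1)) k l) =
  a *: neval Q (corner_dt (k, l)) + b *: neval Q (corner_dx (k, l)) + c *: neval Q (corner_dr (k, l)).
Proof.
rewrite -corner_dressed_derivative_t -corner_dressed_derivative_x -corner_dressed_derivative_r.
by rewrite -!corner_usca -!cornerD -!dressed_derivative_usca; congr corner; rewrite /dressed_derivative; nring.
Qed.

End corner_dressing.

Section matrix_KP_equation.
Context {R : realType} d (W : measurableType d) (P : probability W R) (B : R -> W -> R).
Hypothesis hB : brownian2 P B.
Variable h0 : R -> \bar R.
Hypothesis hUC : UC h0.
Variable n' : nat.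
Notation n := n'.+1.
Notation J := (@row_mean R (iota 0 n)).
Hypothesis det_neq0 : forall t (x r : 'rV[R]_n), 0 < t -> increasing_row x -> kpzF P B h0 t x r != 0.
Notation kel := (kel P B h0).
Notation rho := (rho P B h0).
Notation kpz_corner := (@kpz_corner R d W P B h0 n').

Definition kpz_poly (e : nexpr (nat * nat)) t (x r : 'rV[R]_n) : 'M[R]_n :=
  neval (fun p => kpz_corner p t x r) e.

Section at_good_point.
Variables (t : R) (x r : 'rV[R]_n).
Hypotheses (t0 : 0 < t) (hx : increasing_row x).

Lemma corner_dressed_derivative_kel (a b c : R) p :
  corner (dressed_derivative (kel t x r) (rho t x r) (fun k l =>
    usca J a * (kel t x r k.+3 l + kel t x r k l.+3) + usca J b * (kel t x r k l.+2 - kel t x r k.+2 l)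
    + usca J c * (kel t x r k.+1 l + kel t x r k l.+1)) p.1 p.2) =
  a *: kpz_poly (corner_dt p) t x r + b *: kpz_poly (corner_dx p) t x r + c *: kpz_poly (corner_dr p) t x r.
Proof.
have [h2 h1] := rhoP hB hUC det_neq0 r t0 hx.
have h3 k l : usc (kel t x r k l) = 0 by have [] := kelE hB hUC r k l t0 hx.
have h4 k a' b' l := kel_ibp hB hUC r k a' b' l t0 hx.
rewrite /kpz_poly [in RHS](surjective_pairing p) /kpz_corner; move: (kel t x r) (rho t x r) h1 h2 h3 h4 => K1 rho1 h1 h2 h3 h4.
exact: corner_dressed_derivative.
Qed.

(** The function [G] need only follow a line in [(t, x, r)] along each direction; the same statement
    thus serves D_r, D_x and the time derivative, as well as functions of real variables when [n] is
    1. *)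
Lemma summed_derive_kpz_corner (V : normedModType R) m (v : 'I_m -> V) (G : V -> 'M[R]_n) y
  (dt : 'I_m -> R) (dx dr : 'I_m -> 'rV[R]_n) (a b c : R) p :
  (forall i s, G (y + s *: v i) = kpz_corner p (t + s * dt i) (x + s *: dx i) (r + s *: dr i)) ->
  \sum_i dt i = a -> (forall j, \sum_i dx i 0 j = b) -> (forall j, \sum_i dr i 0 j = c) ->
  summed_derive v G y ((- a / 3) *: kpz_poly (corner_dt p) t x r +
    b *: kpz_poly (corner_dx p) t x r + c *: kpz_poly (corner_dr p) t x r).
Proof.
move=> hG ha hb hc; rewrite -corner_dressed_derivative_kel.
have e k l := sum_line_kel hB hUC r k l t0 hx ha hb hc.
rewrite (_ : (fun k l => _) = fun k l => \sum_i line_kel P B h0 (dt i) (dx i) (dr i) t x r k l); last first.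
  by apply/funext => k; apply/funext => l; rewrite e.
rewrite -dressed_derivative_sum corner_sum; apply: summed_deriveP => i.
apply/is_derive_mxP => i' j'; apply: is_derive_line.
rewrite (_ : (fun s => _) = fun s => kpz_corner p (t + s * dt i) (x + s *: dx i) (r + s *: dr i) i' j'); last first.
  by apply/funext => s; rewrite hG.
exact: is_derive_corner_line.
Qed.

Lemma summed_derive_kpz_poly_r e :
  summed_derive (fun i : 'I_n => delta_mx 0 i : 'rV[R]_n) (kpz_poly e t x) r
    (1 *: kpz_poly (nderive corner_dr e) t x r).
Proof.
apply: summed_derive_neval => p.
have := @summed_derive_kpz_corner _ n (fun i => delta_mx 0 i : 'rV[R]_n) (kpz_corner p t x) r (fun=> 0) (fun=> 0)
  (fun i => delta_mx 0 i) 0 0 1 p.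
have -> : - 0 / 3 = 0 :> R by rewrite oppr0 mul0r.
rewrite !scale0r !add0r; apply => [i s||j|j]; last exact: sum_delta_mx.
- by rewrite mulr0 scaler0 !addr0.
- by rewrite big1.
- by rewrite big1// => i _; rewrite mxE.
Qed.

Lemma summed_derive_kpz_poly_x e :
  summed_derive (fun i : 'I_n => delta_mx 0 i : 'rV[R]_n) (fun y => kpz_poly e t y r) x
    (1 *: kpz_poly (nderive corner_dx e) t x r).
Proof.
apply: summed_derive_neval => p.
have := @summed_derive_kpz_corner _ n (fun i => delta_mx 0 i : 'rV[R]_n) (fun y => kpz_corner p t y r) x (fun=> 0)
  (fun i => delta_mx 0 i) (fun=> 0) 0 1 0 p.
have -> : - 0 / 3 = 0 :> R by rewrite oppr0 mul0r.
rewrite !scale0r !add0r addr0; apply => [i s||j|j]; last by rewrite big1// => i _; rewrite mxE.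
- by rewrite mulr0 scaler0 !addr0.
- by rewrite big1.
- exact: sum_delta_mx.
Qed.

Lemma summed_derive_kpz_poly_t e :
  summed_derive (fun _ : 'I_1 => 1 : R) (fun s => kpz_poly e s x r) t
    ((- 1 / 3) *: kpz_poly (nderive corner_dt e) t x r).
Proof.
apply: summed_derive_neval => p.
have := @summed_derive_kpz_corner _ 1 (fun=> 1 : R) (fun s => kpz_corner p s x r) t (fun=> 1) (fun=> 0) (fun=> 0) 1 0 0 p.
rewrite !scale0r !addr0; apply => [i s||j|j]; [|by rewrite big_ord1|by rewrite big1// => i _; rewrite mxE..].
by rewrite !scaler0 !addr0.
Qed.

End at_good_point.

Lemma near_increasing_row (x : 'rV[R]_n) : increasing_row x -> \forall y \near x, increasing_row y.
Proof.
move=> hx.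
have h (ij : 'I_n * 'I_n) : \forall y \near x, (ij.1 < ij.2)%N -> (y : 'rV[R]_n) 0 ij.1 < y 0 ij.2.
  case: (ltnP ij.1 ij.2) => hij; last by near=> y.
  have c : (fun y : 'rV[R]_n => y 0 ij.2 - y 0 ij.1) @ x --> x 0 ij.2 - x 0 ij.1.
    have h (j : 'I_n) : (fun y : 'rV[R]_n => y 0 j) @ x --> x 0 j := @coord_continuous R _ _ 0 j x.
    exact: cvgB (h _) (h _).
  have x0 : 0 < x 0 ij.2 - x 0 ij.1 by rewrite subr_gt0 hx.
  have h1 := cvgr_gt _ c _ x0; near=> y => _; rewrite -subr_gt0; near: y; exact: h1.
have h1 := filter_forall _ h; near=> y; have hy : forall ij : 'I_n * 'I_n, (ij.1 < ij.2)%N -> (y : 'rV[R]_n) 0 ij.1 < y 0 ij.2.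
  by near: y; exact: h1.
by move=> i j; exact: (hy (i, j)).
Unshelve. all: by end_near. Qed.

Section derivatives_of_poly.
Variables (G : R -> 'rV[R]_n -> 'rV[R]_n -> 'M[R]_n) (e : nexpr (nat * nat)).
Hypothesis hG : forall t x r, 0 < t -> increasing_row x -> G t x r = kpz_poly e t x r.
Variables (t : R) (x r : 'rV[R]_n).
Hypotheses (t0 : 0 < t) (hx : increasing_row x).

Lemma Dr_poly : dsum_exists (G t x) r /\ Dr G t x r = kpz_poly (nderive corner_dr e) t x r.
Proof.
have := summed_derive_kpz_poly_r r t0 hx e; rewrite scale1r; apply: summed_derive_near.
by near=> y; rewrite hG.
Unshelve. all: by end_near. Qed.

Lemma Dx_poly : dsum_exists (fun y => G t y r) x /\ Dx G t x r = kpz_poly (nderive corner_dx e) t x r.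
Proof.
have := summed_derive_kpz_poly_x r t0 hx e; rewrite scale1r; apply: summed_derive_near.
by have := near_increasing_row hx; apply: filterS => y hy; rewrite hG.
Qed.

Lemma Dt_poly : derivable (fun s => G s x r) t 1 /\
  'D_1 (fun s => G s x r) t = (- 1 / 3) *: kpz_poly (nderive corner_dt e) t x r.
Proof.
have [] : summed_derive (fun _ : 'I_1 => 1 : R) (fun s => G s x r) t ((- 1 / 3) *: kpz_poly (nderive corner_dt e) t x r).
  have := summed_derive_kpz_poly_t r t0 hx e; apply: summed_derive_near.
  by have := lt_nbhsr t0; apply: filterS => s hs; rewrite hG.
by move=> /(_ ord0) h; rewrite big_ord1.
Qed.

End derivatives_of_poly.

Let dr e := nderive corner_dr e.
Let dx e := nderive corner_dx e.
Let dt e := nderive corner_dt e.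

(** Inserting [rho = 1 + K * rho] and [rho = 1 + rho * K] turns [rho - 1] into [K + K * rho * K],
    which is [dressed 0 0]. *)
Lemma kpzQ_poly t (x r : 'rV[R]_n) : 0 < t -> increasing_row x ->
  kpzQ P B h0 t x r = kpz_poly (NVar (0, 0)%N) t x r.
Proof.
move=> t0 hx; have [h2 h1] := rhoP hB hUC det_neq0 r t0 hx.
have [_ ->] := kpz_resolvent hB hUC det_neq0 r t0 hx.
rewrite /kpz_poly /= /kpz_corner /=; move: (kel t x r) (rho t x r) h1 h2 => K1 rho1 h1 h2.
congr corner; rewrite /dressed.
have e1 : rho1 = 1 + K1 0%N 0%N * rho1 by rewrite -[1 in RHS]h1 mulrBl mul1r subrK.
have e2 : rho1 = 1 + rho1 * K1 0%N 0%N by rewrite -[1 in RHS]h2 mulrBr mulr1 subrK.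
by rewrite {1}e1 {1}e2; nring.
Qed.

(** The matrix KP equation multiplied by 12, with the factor -1/3 of [corner_dt] turned into -4. It
    holds for any values of the variables in any ring, as an identity of expanded noncommutative
    polynomials. *)
Lemma matrix_KP_poly (T : pzRingType) (env : nat * nat -> T) :
  let E e := neval env e in let Q := NVar (0, 0)%N in let q := dr Q in
  - (E (dt q) *+ 4) + E (dr (NMul q q)) *+ 6 + E (dr (dr (dr q))) + E (dx (dx Q)) *+ 3 +
    (E q * E (dx Q) - E (dx Q) * E q) *+ 6 = 0.
Proof.
move=> E Q q.
(* The syntax has no numerals, so integer multiples are written as iterated sums. *)
pose tm k (e : nexpr (nat * nat)) := iter k (NAdd e) NZero.
have tmE k e : E (tm k e) = E e *+ k by elim: k => [|k ih] //=; rewrite mulrS -ih.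
pose c := NAdd (NAdd (NAdd (NAdd (NOpp (tm 4 (dt q))) (tm 6 (dr (NMul q q)))) (dr (dr (dr q)))) (tm 3 (dx (dx Q))))
  (tm 6 (NAdd (NMul q (dx Q)) (NOpp (NMul (dx Q) q))))%N.
have : E c = E NZero by apply: nring_correct; vm_compute.
by rewrite -[E q * _ - _]/(E (NAdd (NMul q (dx Q)) (NOpp (NMul (dx Q) q)))) -!tmE.
Qed.

Lemma kpzQ_matrix_KP t (x r : 'rV[R]_n) : 0 < t -> increasing_row x ->
  matrix_KP_at (@kpzQ R d W P B h0 n) t x r.
Proof.
move=> t0 hx; pose Q := NVar (0, 0)%N; pose q := dr Q.
have hQ := kpzQ_poly.
have hr k t' x' r' : 0 < t' -> increasing_row x' ->
    iter k (@Dr R n) (@kpzQ R d W P B h0 n) t' x' r' = kpz_poly (iter k dr Q) t' x' r'.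
  elim: k t' x' r' => [|k ih] t' x' r' t0' hx'; first exact: hQ.
  exact: (Dr_poly ih r' t0' hx').2.
have hX k t' x' r' : 0 < t' -> increasing_row x' ->
    iter k (@Dx R n) (@kpzQ R d W P B h0 n) t' x' r' = kpz_poly (iter k dx Q) t' x' r'.
  elim: k t' x' r' => [|k ih] t' x' r' t0' hx'; first exact: hQ.
  exact: (Dx_poly ih r' t0' hx').2.
split.
- by move=> k _; exact: (Dr_poly (hr k) r t0 hx).1.
- exact: (Dt_poly (hr 1%N) r t0 hx).1.
- by move=> k _; exact: (Dx_poly (hX k) r t0 hx).1.
have hq t' x' r' : 0 < t' -> increasing_row x' -> Dr (@kpzQ R d W P B h0 n) t' x' r' = kpz_poly q t' x' r' := hr 1%N t' x' r'.
have hqq t' x' r' : 0 < t' -> increasing_row x' -> Dr (@kpzQ R d W P B h0 n) t' x' r' *m Dr (@kpzQ R d W P B h0 n) t' x' r' =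
    kpz_poly (NMul q q) t' x' r'.
  by move=> t0' hx'; rewrite hq.
have h4 : Dr (Dr (Dr (Dr (@kpzQ R d W P B h0 n)))) t x r = kpz_poly (dr (dr (dr q))) t x r := hr 4%N t x r t0 hx.
have h2 : Dx (Dx (@kpzQ R d W P B h0 n)) t x r = kpz_poly (dx (dx Q)) t x r := hX 2%N t x r t0 hx.
have h1 : Dx (@kpzQ R d W P B h0 n) t x r = kpz_poly (dx Q) t x r := hX 1%N t x r t0 hx.
move=> q'; rewrite {}/q' (Dt_poly hq r t0 hx).2 (Dr_poly hqq r t0 hx).2 h4 h2 /commutator hq// h1.
have h : - (kpz_poly (dt q) t x r *+ 4) + kpz_poly (dr (NMul q q)) t x r *+ 6 + kpz_poly (dr (dr (dr q))) t x r +
  kpz_poly (dx (dx Q)) t x r *+ 3 + (kpz_poly q t x r * kpz_poly (dx Q) t x r - kpz_poly (dx Q) t x r * kpz_poly q t x r) *+ 6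
  = 0 := matrix_KP_poly _.
rewrite -!/(dt _) -!/(dr _); move: h; move: (kpz_poly (dt q) t x r) (kpz_poly (dr (NMul q q)) t x r) (kpz_poly (dr (dr (dr q))) t x r) (kpz_poly (dx (dx Q)) t x r)
  (kpz_poly q t x r) (kpz_poly (dx Q) t x r) => a b c e f g h.
apply: (@scalerI _ _ (12 : R)); first by rewrite pnatr_eq0.
rewrite scaler0 -[RHS]h !scalerDr !scalerA.
have -> : 12 * (- 1 / 3) = - 4 :> R by lra.
have -> : 12 / 2 = 6 :> R by lra.
have -> : 12 / 12 = 1 :> R by lra.
have -> : 12 / 4 = 3 :> R by lra.
by rewrite scale1r scaleNr !scaler_nat mulrnDl.
Qed.

End matrix_KP_equation.

(** * The logarithmic derivative of the determinant *)

Section log_determinant.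
Context {R : realType} d (W : measurableType d) (P : probability W R) (B : R -> W -> R).
Hypothesis hB : brownian2 P B.
Variable h0 : R -> \bar R.
Hypothesis hUC : UC h0.
Variable n' : nat.
Notation n := n'.+1.
Notation K := (@kker R d W P B h0 n).
Notation J := (@row_mean R (iota 0 n)).
Notation U := (uker_of J).
Notation mu := (@lebesgue_measure R).
Hypothesis det_neq0 : forall t (x r : 'rV[R]_n), 0 < t -> increasing_row x -> kpzF P B h0 t x r != 0.
Notation kel := (kel P B h0).
Notation rho := (rho P B h0).

Lemma utr_boundary (u w : U) : usc u = 0 -> usc w = 0 -> utr (boundary u w) = \tr (corner (w * u)).
Proof.
move=> u0 w0; rewrite /utr (boundaryE u w).2 /boundary_kernel.
have [C C0 hC] := ubound_ex u; have [D D0 hD] := ubound_ex w.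
rewrite (_ : (fun z => _) = fun z => \sum_(m < n) ukr w (val m, 0) z * ukr u z (val m, 0)); last first.
  by apply/funext => z; apply: eq_bigr => m _; rewrite mulrC.
rewrite mean_sum; last by move=> m; exact: bker_section (ubound_ukr hD) (ubound_ukr hC).
by apply: eq_bigr => m _; rewrite mxE ukrM u0 w0 !mul0r !add0r.
Qed.

(** On the diagonal [K_10 + K_01] is the derivative of [w -> K w w], so its integral over the
    half-line is minus the value at 0. *)
Lemma utr_kel_shift t (x r : 'rV[R]_n) : 0 < t -> increasing_row x ->
  utr (kel t x r 1 0 + kel t x r 0 1) = - \tr (corner (kel t x r 0 0)).
Proof.
move=> t0 hx; have [a0 k0] := kelE hB hUC r 0 0 t0 hx.
have [a1 k1] := kelE hB hUC r 1 0 t0 hx; have [a2 k2] := kelE hB hUC r 0 1 t0 hx.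
rewrite /utr row_meanE /mxtrace -sumrN; apply: eq_bigr => m _.
rewrite mxE k0 /conj_kernel /= lexx /= inord_val !mulr0 oppr0 expR0 mul1r mulr1.
have [C C0 hC] := kker_decays_at hB hUC 0 0 r t0 hx.
have [C1 C10 hC1] := kker_decays_at hB hUC 1 0 r t0 hx.
have [C2 C20 hC2] := kker_decays_at hB hUC 0 1 r t0 hx.
pose f k l w := K k l t x r m m w w.
have df k l w : is_derive w (1 : R) (f k l) (f k.+1 l w + f k l.+1 w).
  have t0' : 0 < t + w * 0 by rewrite mulr0 addr0.
  have hx' (i j : 'I_n) : (i < j)%N -> x 0 i + w * (0 : 'rV[R]_n) 0 i < x 0 j + w * (0 : 'rV[R]_n) 0 j.
    by move=> ij; rewrite !mxE !mulr0 !addr0; exact: hx.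
  have := is_derive_kker hB hUC k l r m m 0 0 1 1 0 t0' hx'.
  rewrite /= !mxE; under eq_fun do rewrite !scaler0 !mulr0 !addr0 mulr1 add0r.
  by rewrite !scaler0 !oppr0 !mulr0 !addr0 !mulr1 !mul0r !add0r ?addr0 ?subr0 ?mul1r ?oppr0 ?addr0 ?add0r.
have cf k l : continuous (f k l) by move=> w; exact: is_derive_continuous_at (df k l w).
have dec (w : R) : row_weight m * w - col_weight m * w = - w by rewrite /col_weight mulrDl mul1r opprD addrA subrr sub0r.
have [_ <-] : integral_is mu (@Rplus R) (fun w => f 1%N 0%N w + f 0%N 1%N w) (- f 0%N 0%N 0).
  apply: (@integral_derive_decay _ (f 0%N 0%N) _ (C + (C1 + C2)) (df 0%N 0%N)).
  - by move=> w; apply: cvgD; exact: cf.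
  - move=> w w0; have := hC m m w w w0 w0; rewrite dec => h; apply: le_trans h _.
    by rewrite ler_wpM2r ?expR_ge0// lerDl addr_ge0.
  - move=> w w0; have h1 := hC1 m m w w w0 w0; have h2 := hC2 m m w w w0 w0; rewrite !dec in h1 h2.
    apply: le_trans (ler_normD _ _) _; apply: le_trans (lerD h1 h2) _.
    by rewrite -mulrDl ler_wpM2r ?expR_ge0// lerDr.
apply: eq_Rintegral => w; rewrite inE RplusE => w0.
rewrite k1 k2 /conj_kernel /= w0 /= inord_val.
have e : expR (- (row_weight m * w)) * expR (col_weight m * w) * expR (- w) = 1.
  by rewrite -!expRD -[X in _ = X]expR0 /col_weight; congr expR; ring.
by rewrite /f -[RHS]mulr1 -e; ring.
Qed.

(** Write [rho = 1 + K * rho]. The term without [rho] is [utr_kel_shift]. In the other, [rho]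
    commutes with [K], and cyclicity brings the product to the form [K_01 * K + K * K_10], whose
    integration by parts leaves a boundary term with trace that of [K * rho * K] at the corner. *)
Lemma utr_resolvent t (x r : 'rV[R]_n) : 0 < t -> increasing_row x ->
  - utr ((kel t x r 1 0 + kel t x r 0 1) * rho t x r) = \tr (kpzQ P B h0 t x r).
Proof.
move=> t0 hx; have [h2 h1] := rhoP hB hUC det_neq0 r t0 hx.
have ib := kel_ibp hB hUC r 0 0 0 0 t0 hx; have tk := utr_kel_shift r t0 hx.
have [_ ->] := kpz_resolvent hB hUC det_neq0 r t0 hx.
have [a0 _] := kelE hB hUC r 0 0 t0 hx; move: ib tk.
move: (kel t x r 1 0) (kel t x r 0 1) (kel t x r 0 0) (rho t x r) a0 h1 h2 => k1 k2 k0 rh a0 h1 h2 ib tk.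
have e1 : rh = 1 + k0 * rh by rewrite -[1 in RHS]h1 mulrBl mul1r subrK.
have e2 : rh = 1 + rh * k0 by rewrite -[1 in RHS]h2 mulrBr mulr1 subrK.
have e3 : rh * k0 = k0 * rh by apply: (addrI 1); rewrite -e1 -e2.
have -> : (k1 + k2) * rh = (k1 + k2) + (k1 * k0 * rh + k2 * k0 * rh) by rewrite {1}e1; nring.
rewrite !utrD -utrD tk.
have -> : utr (k1 * k0 * rh) = utr (k0 * k1 * rh) by rewrite -(mulrA k1) -e3 mulrA utrMC mulrA.
rewrite -utrD -mulrDl [X in utr (X * _)]addrC ib mulNr utrN boundaryMr//.
rewrite utr_boundary ?uscM ?a0 ?mul0r// opprD !opprK -raddfD/= -cornerD; congr (\tr (corner _)).
transitivity (k0 * rh); first by rewrite [in RHS]e2; nring.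
by rewrite [X in _ = X - 1]e1; nring.
Qed.

Let utr_scaler (c : R) (u v : U) : utr (u * (usca J c * v)) = c * utr (u * v).
Proof. by rewrite mulrA -usca_comm -mulrA utr_usca. Qed.

(** Jacobi's formula, where the adjugate [S] is [fdet] times [rho] because [1 - k] is invertible;
    moving all levels by the same amount differentiates the kernel to [K_10 + K_01]. *)
Lemma is_derive_kpzF t (x r : 'rV[R]_n) : 0 < t -> increasing_row x ->
  is_derive (0 : R) (1 : R) (fun s => kpzF P B h0 t x (r + s *: const_mx 1))
    (kpzF P B h0 t x r * \tr (kpzQ P B h0 t x r)).
Proof.
move=> t0 hx; pose e : 'rV[R]_n := const_mx 1.
have [q q0 [uq good]] := line_neighbourhood hB hUC 0 0 r e t0 hx.
have [C C0 hC] := uq 0%N 0%N; have [D D0 hD] := line_derivative_decays 0 0 e uq 0 0.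
have kl s : kline P B h0 t 0 x 0 r e s = fun k l => K k l t x (r + s *: e).
  by apply/funext => a; apply/funext => b; rewrite /kline mulr0 scaler0 !addr0.
pose M := C + D.
have CM : C <= M by rewrite lerDl.
have DM : D <= M by rewrite lerDr.
pose k s : U := kel t x (r + s *: e) 0 0.
pose k' s : U := kelem (line_derivative 0 0 e (fun k l => K k l t x (r + s *: e)) 0 0).
have hk s : `|s| < q -> usc (k s) = 0 /\ bker (ukr (k s)) M.
  move=> sq; have := hC s sq; rewrite kl => h.
  have [-> ->] := kelE hB hUC (r + s *: e) 0 0 t0 hx; split=> //.
  have [m b] := bker_conj (mkernel_kker hB hUC 0 0 t x _) C0 h.
  by split=> // a b'; exact: le_trans (b a b') CM.
have hk' a : `|a| < q -> udiff (fun s => k (a + s)) (k' a) /\ ubound (k' a) M.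
  move=> aq; split.
    have := udiff_kline hB hUC 0 0 (r + a *: e) e t0 hx 0 0.
    rewrite (_ : kline P B h0 t 0 x 0 (r + a *: e) e 0 = fun k l => K k l t x (r + a *: e)); last first.
      by apply/funext => k1; apply/funext => l1; rewrite /kline mulr0 !scaler0 scale0r !addr0.
    have E : (fun s => k (a + s)) = fun s => kelem (kline P B h0 t 0 x 0 (r + a *: e) e s 0 0).
      by apply/funext => s; rewrite /k /kline mulr0 scaler0 !addr0 scalerDl addrA.
    by move=> h; exact: (@eq_ind_r _ _ (fun f => udiff f (k' a)) h _ E).
  have := hD a aq; rewrite kl => h.
  have mK k1 l1 : mkernel (K k1 l1 t x (r + a *: e)) by exact: mkernel_kker.
  have ml := mkernel_line_derivative 0 0 e 0 0 mK.
  have [z kE] := kelemE ml D0 h; split; first by rewrite z normr0 (le_trans C0).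
  by move=> p p'; rewrite kE; apply: le_trans ((bker_conj ml D0 h).2 p p') DM.
have M0 : 0 <= M by exact: le_trans C0 CM.
have [N N0 hN] := fredholm_sum J M0.
have [z0 b0] := hk 0 ltac:(by rewrite normr0).
have [S [s1 _ s3]] := hN _ z0 b0.
have := is_derive_fdet q0 hk hk' s3.
have r0 : r + 0 *: e = r by rewrite scale0r addr0.
have k0 : k 0 = kel t x r 0 0 by rewrite /k r0.
have [h2 h1] := rhoP hB hUC det_neq0 r t0 hx.
have -> : S = usca J (fdet (kel t x r 0 0)) * rho t x r.
  by rewrite usca_comm -k0 -s1 mulrA k0 h2 mul1r.
have -> : k' 0 = kel t x r 1 0 + kel t x r 0 1.
  have [p1 u1] := kelE hB hUC r 1 0 t0 hx; have [p2 u2] := kelE hB hUC r 0 1 t0 hx.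
  have := hD 0 ltac:(by rewrite normr0); rewrite kl r0 => h.
  have mK k1 l1 : mkernel (K k1 l1 t x r) by exact: mkernel_kker.
  have [z kE] := kelemE (mkernel_line_derivative 0 0 e 0 0 mK) D0 h.
  rewrite /k' r0; apply: uker_eq => [|a b]; first by rewrite uscD z p1 p2 addr0.
  rewrite ukrD kE u1 u2 /conj_kernel; case: ifP => _; last by rewrite addr0.
  by rewrite /line_derivative !mxE oppr0 !mul0r !mul1r !(subr0, addr0, add0r) mulrDr mulrDl.
have -> : - utr ((kel t x r 1 0 + kel t x r 0 1) * (usca J (fdet (kel t x r 0 0)) * rho t x r)) =
    kpzF P B h0 t x r * \tr (kpzQ P B h0 t x r).
  rewrite -utr_resolvent// kpzF_fdet//; move: (kel t x r 1 0) (kel t x r 0 1) (fdet _) (rho t x r) => a b c v.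
  by rewrite utr_scaler mulrN.
have E : (fun s => kpzF P B h0 t x (r + s *: e)) = fun s => fdet (k s) by apply/funext => s; rewrite kpzF_fdet.
move=> h; exact: (@eq_ind_r _ _ (fun f => is_derive (0 : R) (1 : R) f _) h _ E).
Qed.

End log_determinant.

(** * The one point function *)

Section scalar_KPII.
Context {R : realType} d (W : measurableType d) (P : probability W R) (B : R -> W -> R).
Hypothesis hB : brownian2 P B.
Variable h0 : R -> \bar R.
Hypothesis hUC : UC h0.
Hypothesis det_neq0 : forall t (x r : 'rV[R]_1), 0 < t -> increasing_row x -> kpzF P B h0 t x r != 0.
Notation row1 := (const_mx : R -> 'rV[R]_1).

Lemma increasing_row1 (x : 'rV[R]_1) : increasing_row x.
Proof. by move=> i j; rewrite !ord1 ltnn. Qed.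

Let row1E (a s : R) : row1 (a + s *: (1 : R)) = row1 a + s *: row1 1.
Proof. by apply/matrixP => i j; rewrite !mxE. Qed.

Definition kpz_poly1 e (t x r : R) : R := kpz_poly P B h0 e t (row1 x) (row1 r) 0 0.

Let is_derive_entry (G : R -> 'M[R]_1) y D : summed_derive (fun _ : 'I_1 => 1 : R) G y D ->
  is_derive y (1 : R) (fun z => G z 0 0) (D 0 0).
Proof.
move=> [h <-]; rewrite big_ord1; apply: (is_derive_mxP _ _ _ _).1.
by split => //; exact: (h ord0).
Qed.

Let kpz_poly1M a b (t x r : R) : kpz_poly1 (NMul a b) t x r = kpz_poly1 a t x r * kpz_poly1 b t x r.
Proof.
have e : kpz_poly P B h0 (NMul a b) t (row1 x) (row1 r) =
    kpz_poly P B h0 a t (row1 x) (row1 r) *m kpz_poly P B h0 b t (row1 x) (row1 r) by [].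
rewrite /kpz_poly1 e; move: (kpz_poly _ _ _ a _ _ _) (kpz_poly _ _ _ b _ _ _) => f g.
by rewrite mxE big_ord1.
Qed.

Lemma is_derive_kpz_poly1_t e (t x r : R) : 0 < t ->
  is_derive t (1 : R) (fun s => kpz_poly1 e s x r) ((- 1 / 3) * kpz_poly1 (nderive corner_dt e) t x r).
Proof.
move=> t0; have := is_derive_entry (summed_derive_kpz_poly_t hB hUC det_neq0 (row1 r) t0 (@increasing_row1 (row1 x)) e).
by rewrite mxE.
Qed.

Lemma is_derive_kpz_poly1_x e (t x r : R) : 0 < t ->
  is_derive x (1 : R) (fun y => kpz_poly1 e t y r) (kpz_poly1 (nderive corner_dx e) t x r).
Proof.
move=> t0.
have h : summed_derive (fun _ : 'I_1 => 1 : R) (fun y => kpz_poly P B h0 e t (row1 y) (row1 r)) x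
    (1 *: kpz_poly P B h0 (nderive corner_dx e) t (row1 x) (row1 r)).
  apply: summed_derive_neval => p.
  have := @summed_derive_kpz_corner R d W P B hB h0 hUC 0 det_neq0 t (row1 x) (row1 r) t0 (@increasing_row1 _) _ 1
    (fun=> 1 : R) (fun y => kpz_corner P B h0 p t (row1 y) (row1 r)) x (fun=> 0) (fun=> row1 1) (fun=> 0) 0 1 0 p.
  have -> : - 0 / 3 = 0 :> R by rewrite oppr0 mul0r.
  rewrite !scale0r !add0r addr0; apply => [i s||j|j].
  - by rewrite row1E mulr0 scaler0 !addr0.
  - by rewrite big_ord1.
  - by rewrite big_ord1 mxE.
  - by rewrite big_ord1 mxE.
by have := is_derive_entry h; rewrite scale1r.
Qed.

Lemma is_derive_kpz_poly1_r e (t x r : R) : 0 < t ->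
  is_derive r (1 : R) (kpz_poly1 e t x) (kpz_poly1 (nderive corner_dr e) t x r).
Proof.
move=> t0.
have h : summed_derive (fun _ : 'I_1 => 1 : R) (fun y => kpz_poly P B h0 e t (row1 x) (row1 y)) r
    (1 *: kpz_poly P B h0 (nderive corner_dr e) t (row1 x) (row1 r)).
  apply: summed_derive_neval => p.
  have := @summed_derive_kpz_corner R d W P B hB h0 hUC 0 det_neq0 t (row1 x) (row1 r) t0 (@increasing_row1 _) _ 1
    (fun=> 1 : R) (fun y => kpz_corner P B h0 p t (row1 x) (row1 y)) r (fun=> 0) (fun=> 0) (fun=> row1 1) 0 0 1 p.
  have -> : - 0 / 3 = 0 :> R by rewrite oppr0 mul0r.
  rewrite !scale0r !add0r; apply => [i s||j|j].
  - by rewrite row1E mulr0 scaler0 !addr0.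
  - by rewrite big_ord1.
  - by rewrite big_ord1 mxE.
  - by rewrite big_ord1 mxE.
by have := is_derive_entry h; rewrite scale1r.
Qed.

Variable F : R -> R -> R -> R.
Hypothesis F_kpzF : forall t x r : R, 0 < t -> F t x r = kpzF P B h0 t (row1 x) (row1 r).
Hypothesis F_ge0 : forall t x r, 0 <= F t x r.

Let Q : nexpr (nat * nat) := NVar (0, 0)%N.
Let dr := @nderive (nat * nat)%type corner_dr.
Let dx := @nderive (nat * nat)%type corner_dx.
Let dt := @nderive (nat * nat)%type corner_dt.

(** A nonnegative value that is a nonzero determinant is positive, and so the logarithm is
    differentiable there. *)
Let F_gt0 t x r : 0 < t -> 0 < F t x r.
Proof. by move=> t0; rewrite lt_def F_ge0 andbT F_kpzF// det_neq0//; exact: increasing_row1. Qed.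

Lemma is_derive_logF t x r : 0 < t -> is_derive r (1 : R) (logF F t x) (kpz_poly1 Q t x r).
Proof.
move=> t0; have dF : is_derive r (1 : R) (F t x) (F t x r * kpz_poly1 Q t x r).
  apply: is_derive_line.
  have := is_derive_kpzF hB hUC det_neq0 (row1 r) t0 (@increasing_row1 (row1 x)).
  rewrite -F_kpzF// (kpzQ_poly hB hUC det_neq0)//; last exact: increasing_row1.
  rewrite /mxtrace big_ord1.
  have E : (fun s => F t x (r + s *: (1 : R))) = fun s => kpzF P B h0 t (row1 x) (row1 r + s *: row1 1).
    by apply/funext => s; rewrite (F_kpzF _ _ t0) row1E.
  move=> h; exact: (@eq_ind_r _ _ (fun f => is_derive (0 : R) (1 : R) f _) h _ E).
have := is_derive_comp_fun (is_derive1_ln (F_gt0 x r t0)) dF.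
by rewrite mulrA mulVf ?mul1r// gt_eqF// F_gt0.
Qed.

Lemma iter_derive_logF k t x : 0 < t -> (logF F t x)^`(k.+1)%classic = kpz_poly1 (iter k dr Q) t x.
Proof.
move=> t0; elim: k => [|k ih]; apply/funext => r.
  by rewrite derive1n1 derive1E; have [_ ->] := is_derive_logF x r t0.
by rewrite derive1nS ih derive1E; have [_ ->] := is_derive_kpz_poly1_r (iter k dr Q) x r t0.
Qed.

Lemma kpz_scalar_KPII t x r : 0 < t -> scalar_KPII_at F t x r.
Proof.
move=> t0.
have phiE s : 0 < s -> phi F s x = kpz_poly1 (dr Q) s x by exact: (@iter_derive_logF 1).
have phi_near : \forall s \near t, phi F s x r = kpz_poly1 (dr Q) s x r.
  by have := lt_nbhsr t0; apply: filterS => s s0; rewrite phiE.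
have dphi : is_derive t (1 : R) (fun s => phi F s x r) ((- 1 / 3) * kpz_poly1 (dt (dr Q)) t x r).
  have [h <-] := is_derive_kpz_poly1_t (dr Q) x r t0.
  have phi_near' : \forall s \near t, kpz_poly1 (dr Q) s x r = phi F s x r by apply: filterS phi_near => s ->.
  split; first exact: near_eq_derivable phi_near' h.
  by rewrite (near_eq_derive _ phi_near').
have dlog : (fun y => (logF F t y)^`()%classic r) = fun y => kpz_poly1 Q t y r.
  by apply/funext => y; rewrite -derive1n1 (iter_derive_logF 0).
have dxn k : (fun y => kpz_poly1 Q t y r)^`(k)%classic = fun y => kpz_poly1 (iter k dx Q) t y r.
  elim: k => [//|k ih]; apply/funext => y; rewrite derive1nS ih derive1E.
  by have [_ ->] := is_derive_kpz_poly1_x (iter k dx Q) y r t0.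
split.
- exact: F_gt0.
- case=> [|k] _; first by have [] := is_derive_logF x r t0.
  by rewrite iter_derive_logF//; have [] := is_derive_kpz_poly1_r (iter k dr Q) x r t0.
- by have [] := dphi.
- move=> k _; rewrite dlog dxn; by have [] := is_derive_kpz_poly1_x (iter k dx Q) x r t0.
have sq : (fun r' => phi F t x r' ^+ 2) = kpz_poly1 (NMul (dr Q) (dr Q)) t x.
  by apply/funext => r'; rewrite (phiE t t0) kpz_poly1M expr2.
have d3 : (phi F t x)^`(3)%classic r = kpz_poly1 (dr (dr (dr (dr Q)))) t x r.
  have -> : (phi F t x)^`(3)%classic = (logF F t x)^`(5)%classic by [].
  by rewrite iter_derive_logF.
rewrite sq d3 dlog dxn !derive1E; have [_ ->] := dphi.
have [_ ->] := is_derive_kpz_poly1_r (NMul (dr Q) (dr Q)) x r t0.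
have h : - (kpz_poly P B h0 (dt (dr Q)) t (row1 x) (row1 r) *+ 4) +
  kpz_poly P B h0 (dr (NMul (dr Q) (dr Q))) t (row1 x) (row1 r) *+ 6 +
  kpz_poly P B h0 (dr (dr (dr (dr Q)))) t (row1 x) (row1 r) +
  kpz_poly P B h0 (dx (dx Q)) t (row1 x) (row1 r) *+ 3 +
  (kpz_poly P B h0 (dr Q) t (row1 x) (row1 r) * kpz_poly P B h0 (dx Q) t (row1 x) (row1 r) -
   kpz_poly P B h0 (dx Q) t (row1 x) (row1 r) * kpz_poly P B h0 (dr Q) t (row1 x) (row1 r)) *+ 6 = 0 := matrix_KP_poly _.
move/(congr1 (fun A : 'M[R]_1 => A 0 0)): h.
rewrite /kpz_poly1 -/(dr _); move: (kpz_poly _ _ _ (dt (dr Q)) _ _ _) (kpz_poly _ _ _ (dr (NMul _ _)) _ _ _)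
  (kpz_poly _ _ _ (dr (dr (dr (dr Q)))) _ _ _) (kpz_poly _ _ _ (dx (dx Q)) _ _ _) => a b c e.
move: (kpz_poly _ _ _ (dr Q) _ _ _) (kpz_poly _ _ _ (dx Q) _ _ _) => f g.
(* Matrices of size 1 commute, so the commutator drops out of the matrix equation. *)
have fg : f * g = g * f by apply/matrixP => i j; rewrite !ord1 !mxE !big_ord1 mulrC.
rewrite fg subrr mul0rn addr0 !(mxE, mulmxnE).
move: (a 0 0) (b 0 0) (c 0 0) (e 0 0) => a0 b0 c0 e0 h; lra.
Qed.

End scalar_KPII.

Theorem theorem1p1 (R : realType)
    (d : measure_display) (W : measurableType d) (PW : probability W R)
    (B : R -> W -> R) (hB : brownian2 PW B)
    (h0 : R -> \bar R) (hUC : UC h0)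
    (d' : measure_display) (Om : measurableType d') (P : probability Om R)
    (h : R -> R -> Om -> \bar R) (hh : kpz_fixed_point PW B P h0 h)
    (n : nat) (hn : (0 < n)%N) :
  (forall (t : R) (x r : 'rV[R]_n), 0 < t -> increasing_row x ->
     (exists Rk, resolvent_kernel (kpzK PW B h0 t x r) Rk) /\
     matrix_KP_at (@kpzQ R d W PW B h0 n) t x r) /\
  (forall t x r : R, 0 < t ->
     scalar_KPII_at
       (fun t x r => fine (P [set w | (h t x w <= r%:E)%E])) t x r).
Proof.
split.
  case: n hn => [//|n'] hn t x r t0 hx.
  have det0 t' (x' r' : 'rV[R]_n'.+1) : 0 < t' -> increasing_row x' -> kpzF PW B h0 t' x' r' != 0.
    exact: (kpz_det_neq0 hh).
  by split; [have [] := kpz_resolvent hB hUC det0 r t0 hx|exact: kpzQ_matrix_KP].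
move=> t x r t0.
have det0 t' (x' r' : 'rV[R]_1) : 0 < t' -> increasing_row x' -> kpzF PW B h0 t' x' r' != 0.
  exact: (kpz_det_neq0 hh).
apply: (kpz_scalar_KPII hB hUC det0) => // [t' x' r' t0'|t' x' r'].
  have := kpz_fdd hh (const_mx r' : 'rV[R]_1) (isT : (0 < 1)%N) t0' (@increasing_row1 R (const_mx x')).
  rewrite (_ : below h t' _ _ = [set w | (h t' x' w <= r'%:E)%E]); first by move=> ->.
  by apply/seteqP; split=> w /=; [move=> /(_ 0)|move=> hw i]; rewrite !mxE.
exact: fine_ge0.
Qed.
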